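(* Assume that $x_{10},\dots,x_{N0}$ are mutually independent with common mean $\bar x_0$, that $\max_{1\le i\le N}\mathbb E\|x_{i0}\|^2<C_0$ with $C_0$ independent of $N$, that $\{x_{i0}\}$ and $\{W_i\}$ are independent of each other, and that $Q\ge0$. Then Problem (P1), i.e. $\inf_{u}J^{\rm F}_{\rm soc}(u)$ over all $u=(u_1,\dots,u_N)$ with $u_i\in L^2_{\mathcal F_t}(0,T;\mathbb R^r)$, has an optimal control $$\check u_i=-R^{-1}B^T(Px_i+Kx^{(N)}+s),\qquad i=1,\dots,N,$$ where $P,K:[0,T]\to\mathbb R^{n\times n}$ and $s:[0,T]\to\mathbb R^n$ are determined by $$\begin{aligned} \rho P&=\dot P+A^TP+PA-PBR^{-1}B^TP+Q,\quad P(T)=0,\\ \rho K&=\dot K+(A+G)^TK+K(A+G)-PBR^{-1}B^TK-KBR^{-1}B^TP\\ &\quad+G^TP+PG-KBR^{-1}B^TK-Q_\Gamma,\quad K(T)=0,\\ \rho s&=\dot s+[A+G-BR^{-1}B^T(P+K)]^Ts+(P+K)f-\bar\eta,\quad s(T)=0. \end{aligned}$$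
   Context: $N$ is the number of agents, $T>0$ a finite horizon, $\rho>0$ a discount constant. $A,G,\Gamma,Q\in\mathbb R^{n\times n}$, $B\in\mathbb R^{n\times r}$, $R\in\mathbb R^{r\times r}$, $\eta\in\mathbb R^n$ are constant, with $Q,R$ symmetric and $R>0$; $f,\sigma:[0,\infty)\to\mathbb R^n$ are continuous with $\int_0^\infty e^{-\rho t}(\|f\|^2+\|\sigma\|^2)dt<\infty$. $W_1,\dots,W_N$ are independent one-dimensional Brownian motions. Agent $i$ has state $x_i\in\mathbb R^n$ and control $u_i\in\mathbb R^r$ with $$dx_i=[Ax_i+Bu_i+Gx^{(N)}+f]dt+\sigma dW_i,\quad x_i(0)=x_{i0},\quad x^{(N)}=\tfrac1N\sum_{j=1}^Nx_j.$$ $\mathcal F_t=\sigma\big(\bigcup_{i=1}^N\mathcal F^i_t\big)$ with $\mathcal F^i_t=\sigma(x_{i0},W_i(s),0\le s\le t)$, and $L^2_{\mathcal F_t}(0,T;\mathbb R^k)$ is the space of $\mathcal F_t$-adapted $\mathbb R^k$-valued processes $z$ with $\mathbb E\int_0^T\|z(t)\|^2dt<\infty$. Costs (with $\|z\|_M^2=z^TMz$): $J^{\rm F}_i(u)=\mathbb E\int_0^Te^{-\rho t}\{\|x_i-\Gamma x^{(N)}-\eta\|_Q^2+\|u_i\|_R^2\}dt$ and $J^{\rm F}_{\rm soc}(u)=\sum_{i=1}^NJ^{\rm F}_i(u)$. Notation: $Q_\Gamma=\Gamma^TQ+Q\Gamma-\Gamma^TQ\Gamma$, $\bar\eta=Q\eta-\Gamma^TQ\eta$.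 $Q\ge 0$ means positive semidefinite. *)

(* Defs.v *)
From HB Require Import structures.
From mathcomp Require Import all_boot all_order all_algebra.
From mathcomp Require Import all_classical all_reals all_analysis.

Set Implicit Arguments.
Unset Strict Implicit.
Unset Printing Implicit Defensive.

Import Order.TTheory GRing.Theory Num.Theory.
Import numFieldNormedType.Exports.

Local Open Scope classical_set_scope.
Local Open Scope ring_scope.

Section Quadratic.
Context {R : realType} {n : nat}.

Definition quad (M : 'M[R]_n) (z : 'cV[R]_n) : R := (z^T *m M *m z) 0 0.

(* Squared Euclidean norm; the norm `|z| of the library on matrices is the
   maximum norm. *)
Definition sqnorm (z : 'cV[R]_n) : R := \sum_(k < n) z k 0 ^+ 2.

Definition sym_mx (M : 'M[R]_n) : Prop := M^T = M.

Definition pos_semidef (M : 'M[R]_n) : Prop := forall z, 0 <= quad M z.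

Definition pos_def (M : 'M[R]_n) : Prop := forall z, z != 0 -> 0 < quad M z.

End Quadratic.

Section Probability.
Context {R : realType} {d : measure_display} {Omega : measurableType d}.
Variable Pr : probability Omega R.

(* The sigma-algebra generated by the real variables X i, for i in D. *)
Definition sigma_of (I : Type) (D : set I) (X : I -> Omega -> R) :
    set (set Omega) :=
  <<s \bigcup_(i in D) preimage_set_system setT (X i) measurable >>.

Definition sigma_vec (n : nat) (X : Omega -> 'cV[R]_n) : set (set Omega) :=
  sigma_of setT (fun k w => X w k 0).

Definition measurable_vec (n : nat) (X : Omega -> 'cV[R]_n) : Prop :=
  forall k, measurable_fun setT (fun w => X w k 0).

Definition independent2 (F G : set (set Omega)) : Prop :=
  forall A B, F A -> G B -> Pr (A `&` B) = (Pr A * Pr B)%E.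

(* Mutual independence of finitely many sigma-algebras. Subfamilies need no
   separate mention: take E i = setT for the indices left out. *)
Definition mutually_independent (N : nat) (F : 'I_N -> set (set Omega)) :
    Prop :=
  forall E : 'I_N -> set Omega, (forall i, F i (E i)) ->
    Pr (\bigcap_(i in [set: 'I_N]) E i) = (\prod_(i < N) Pr (E i))%E.

(* Standard one-dimensional Brownian motion on [0, +oo[; the values of W at
   negative times are irrelevant. The second parameter of [normal_prob] is the
   standard deviation. *)
Record brownian_motion (W : R -> Omega -> R) : Prop := BrownianMotion {
  brownian_measurable : forall t : R, 0 <= t -> measurable_fun setT (W t) ;
  brownian_start : \forall w \ae Pr, W 0 w = 0 ;
  brownian_normal : forall s t : R, 0 <= s -> s < t ->
    forall S : set R, measurable S ->
      Pr ((fun w => W t w - W s w) @^-1` S)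
      = normal_prob 0 (Num.sqrt (t - s)) S ;
  brownian_indep : forall s t : R, 0 <= s -> s < t ->
    independent2 (sigma_of `[0, s] W)
      (sigma_of setT (fun (_ : unit) w => W t w - W s w)) ;
  brownian_continuous : \forall w \ae Pr,
    {within `[0, +oo[, continuous (fun t => W t w)} }.

End Probability.

(* The stochastic integral of a deterministic square-integrable integrand, as
   the L^2-limit of the elementary integrals of step functions that approximate
   the integrand in L^2(0, T). *)
Section StochasticIntegral.
Context {R : realType} {d : measure_display} {Omega : measurableType d}.
Variables (Pr : probability Omega R) (n : nat) (T : R).

(* The step function equal to [step_val k] on
   ]step_time k, step_time k.+1], k < step_size. *)
Record step_fun : Type := StepFun {
  step_size : nat ;
  step_time : nat -> R ;
  step_val : nat -> 'cV[R]_n ;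
  step_time_ge0 : 0 <= step_time 0%N ;
  step_time_mono : forall k, step_time k <= step_time k.+1 ;
  step_time_leT : step_time step_size <= T }.

Definition step_eval (phi : step_fun) (t : R) : 'cV[R]_n :=
  \sum_(k < step_size phi)
    (\1_(`]step_time phi k, step_time phi k.+1]%classic) t : R)
      *: step_val phi k.

Definition step_integral (phi : step_fun) (W : R -> Omega -> R) (t : R)
    (w : Omega) : 'cV[R]_n :=
  \sum_(k < step_size phi)
    (W (Num.min t (step_time phi k.+1)) w - W (Num.min t (step_time phi k)) w)
      *: step_val phi k.

(* M t = \int_0^t sigma dW for t in [0, T]; this determines each M t only up to
   a null set. *)
Definition ito_integral (sigma : R -> 'cV[R]_n) (W : R -> Omega -> R)
    (M : R -> Omega -> 'cV[R]_n) : Prop :=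
  (forall t : R, 0 <= t <= T -> measurable_vec (M t)) /\
  exists phi : nat -> step_fun,
    ((fun m => \int[lebesgue_measure]_(t in `[0%R, T])
        (sqnorm (step_eval (phi m) t - sigma t))%:E)%E @ \oo --> 0%E) /\
    forall t : R, 0 <= t <= T ->
      (fun m => \int[Pr]_w
        (sqnorm (step_integral (phi m) W t w - M t w))%:E)%E @ \oo --> 0%E.

End StochasticIntegral.

Section Processes.
Context {R : realType} {d : measure_display} {Omega : measurableType d}.
Variables (Pr : probability Omega R) (T : R).

Definition jointly_measurable (k : nat) (z : R -> Omega -> 'cV[R]_k) : Prop :=
  forall j, measurable_fun ((`[0, T] : set R) `*` [set: Omega])
    (fun p : measurableTypeR R * Omega => z p.1 p.2 j 0).

(* F^i_t; no null sets are added. *)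
Definition agent_filtration (n : nat) (x0 : Omega -> 'cV[R]_n)
    (W : R -> Omega -> R) (t : R) : set (set Omega) :=
  <<s sigma_vec x0 `|` sigma_of `[0, t] W >>.

Definition filtration (n N : nat) (x0 : 'I_N -> Omega -> 'cV[R]_n)
    (W : 'I_N -> R -> Omega -> R) (t : R) : set (set Omega) :=
  <<s \bigcup_(i in [set: 'I_N]) agent_filtration (x0 i) (W i) t >>.

Definition adapted (F : R -> set (set Omega)) (k : nat)
    (z : R -> Omega -> 'cV[R]_k) : Prop :=
  forall t : R, 0 <= t <= T -> sigma_vec (z t) `<=` F t.

(* L^2_F(0, T; R^k). Joint measurability is what gives the double integral
   below its meaning. *)
Definition L2_adapted (F : R -> set (set Omega)) (k : nat)
    (z : R -> Omega -> 'cV[R]_k) : Prop :=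
  [/\ jointly_measurable z, adapted F z &
    (\int[Pr]_w \int[lebesgue_measure]_(t in `[0%R, T]) (sqnorm (z t w))%:E
      < +oo)%E].

End Processes.

Section Model.
Context {R : realType} {d : measure_display} {Omega : measurableType d}.
Variables (Pr : probability Omega R) (n r : nat) (T rho : R).
Variables (A : 'M[R]_n) (B : 'M[R]_(n, r)) (G Gamma Q : 'M[R]_n).
Variables (Rc : 'M[R]_r) (eta : 'cV[R]_n) (f sigma : R -> 'cV[R]_n).
Variable N : nat.
Variables (x0 : 'I_N -> Omega -> 'cV[R]_n) (W : 'I_N -> R -> Omega -> R).

Definition average (x : 'I_N -> R -> Omega -> 'cV[R]_n) (t : R) (w : Omega) :
    'cV[R]_n :=
  N%:R^-1 *: \sum_(j < N) x j t w.

Definition drift (u : 'I_N -> R -> Omega -> 'cV[R]_r)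
    (x : 'I_N -> R -> Omega -> 'cV[R]_n) (i : 'I_N) (t : R) (w : Omega) :
    'cV[R]_n :=
  A *m x i t w + B *m u i t w + G *m average x t w + f t.

(* x solves, on [0, T] and with continuous paths,
     dx_i = [A x_i + B u_i + G x^(N) + f] dt + sigma dW_i,  x_i(0) = x0_i.
   For an admissible u this determines x up to indistinguishability, and x is
   then adapted to the filtration completed by the null sets. *)
Definition is_state (u : 'I_N -> R -> Omega -> 'cV[R]_r)
    (x : 'I_N -> R -> Omega -> 'cV[R]_n) : Prop :=
  forall i : 'I_N,
    [/\ jointly_measurable T (x i),
        \forall w \ae Pr, {within `[0, T], continuous (fun t => x i t w)} &
        exists2 M : R -> Omega -> 'cV[R]_n,
          ito_integral Pr T sigma (W i) M &
          \forall w \ae Pr, forall t : R, 0 <= t <= T ->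
            x i t w = x0 i w
              + \col_k (\int[lebesgue_measure]_(s in `[0, t])
                          drift u x i s w k 0)
              + M t w].

Definition admissible (u : 'I_N -> R -> Omega -> 'cV[R]_r) : Prop :=
  forall i, L2_adapted Pr T (filtration x0 W) (u i).

(* The costs, with the state x written as an explicit argument. The integrands
   are nonnegative when Q and Rc are positive semidefinite, so the
   extended-real integrals are meaningful without integrability assumptions. *)
Definition agent_cost (x : 'I_N -> R -> Omega -> 'cV[R]_n)
    (u : 'I_N -> R -> Omega -> 'cV[R]_r) (i : 'I_N) : \bar R :=
  (\int[Pr]_w \int[lebesgue_measure]_(t in `[0%R, T])
     (expR (- rho * t) *
        (quad Q (x i t w - Gamma *m average x t w - eta)
         + quad Rc (u i t w)))%:E)%E.

Definition social_cost (x : 'I_N -> R -> Omega -> 'cV[R]_n)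
    (u : 'I_N -> R -> Omega -> 'cV[R]_r) : \bar R :=
  (\sum_(i < N) agent_cost x u i)%E.

Definition optimal_control (u : 'I_N -> R -> Omega -> 'cV[R]_r) : Prop :=
  [/\ admissible u, exists x, is_state u x &
    forall x u' x', is_state u x -> admissible u' -> is_state u' x' ->
      (social_cost x u <= social_cost x' u')%E].

Definition Q_Gamma : 'M[R]_n :=
  Gamma^T *m Q + Q *m Gamma - Gamma^T *m Q *m Gamma.

Definition eta_bar : 'cV[R]_n := Q *m eta - Gamma^T *m Q *m eta.

(* A differential equation on [0, T] is read as: continuity on [0, T] and the
   equation at the interior times. *)
Definition P_equation (P : R -> 'M[R]_n) : Prop :=
  [/\ {within `[0, T], continuous P}, P T = 0 &
    forall t : R, 0 < t < T -> derivable P t 1 /\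
      rho *: P t = derive1 P t + A^T *m P t + P t *m A
        - P t *m B *m invmx Rc *m B^T *m P t + Q].

Definition K_equation (P K : R -> 'M[R]_n) : Prop :=
  [/\ {within `[0, T], continuous K}, K T = 0 &
    forall t : R, 0 < t < T -> derivable K t 1 /\
      rho *: K t = derive1 K t + (A + G)^T *m K t + K t *m (A + G)
        - P t *m B *m invmx Rc *m B^T *m K t
        - K t *m B *m invmx Rc *m B^T *m P t
        + G^T *m P t + P t *m G
        - K t *m B *m invmx Rc *m B^T *m K t - Q_Gamma].

Definition s_equation (P K : R -> 'M[R]_n) (s : R -> 'cV[R]_n) : Prop :=
  [/\ {within `[0, T], continuous s}, s T = 0 &
    forall t : R, 0 < t < T -> derivable s t 1 /\
      rho *: s t = derive1 s t
        + (A + G - B *m invmx Rc *m B^T *m (P t + K t))^T *m s t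
        + (P t + K t) *m f t - eta_bar].

Definition riccati_system (P K : R -> 'M[R]_n) (s : R -> 'cV[R]_n) : Prop :=
  [/\ P_equation P, K_equation P K & s_equation P K s].

Definition feedback (P K : R -> 'M[R]_n) (s : R -> 'cV[R]_n)
    (x : 'I_N -> R -> Omega -> 'cV[R]_n) (i : 'I_N) (t : R) (w : Omega) :
    'cV[R]_r :=
  - (invmx Rc *m B^T *m (P t *m x i t w + K t *m average x t w + s t)).

End Model.

(* Main.v *)
Require Import Defs.
From HB Require Import structures.
From mathcomp Require Import all_boot all_order all_algebra.
From mathcomp Require Import all_classical all_reals all_analysis.
From mathcomp Require Import perm ring lra measurable_realfun.

(** Two admissible states differ by a process delta that solves a linear equation
    without noise, driven by the difference v of the controls. Since the cost is
    convex, the feedback is optimal as soon as the first variation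
      E int_0^T e^(- rho t) sum_i
        (<Q (x_i - Gamma x^(N) - eta), delta_i - Gamma delta^(N)> + <R u_i, v_i>) dt
    vanishes. The Riccati system says precisely that, with the costate
    p_i = P x_i + K x^(N) + s, the integrand is minus the formal derivative of
    sum_i <e^(- rho t) p_i, delta_i>, the noise being left out of dx_i; and
    p_i(T) = 0 = delta_i(0). Write x_i = Y_i + M_i with M_i = int sigma dW_i. The
    part of the costate that depends on Y is differentiable, so its contribution
    integrates to 0 along every path. The part linear in M has a deterministic
    coefficient w, and E [w M_j . d delta_i] may be replaced by
    E [w M_j(T) . d delta_i] because the increments of M_j are orthogonal to the
    past; then M_j(T) is a constant in time, and parts apply again.

    P is obtained from a linear Hamiltonian system, whose fundamental matrix stays
    invertible because Q >= 0; P + K solves a Riccati equation of the same kind,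
    with weight (I - Gamma)^T Q (I - Gamma). The same fundamental matrices solve the
    closed loop explicitly, the average and the deviations from it being decoupled. *)

Set Implicit Arguments.
Unset Strict Implicit.
Unset Printing Implicit Defensive.

Import Order.TTheory GRing.Theory Num.Theory.
Import numFieldNormedType.Exports.

Local Open Scope classical_set_scope.
Local Open Scope ring_scope.

(** * Differential equations for matrix functions *)

(** No Ito formula is used. Two states carry the same noise, so their difference has no quadratic
    variation, and the exact second-order expansion of the cost leaves only a linear term to
    control; completing the square with the Riccati matrices would bring in the quadratic variation
    of the states. The obstacle is measurability: the filtrations contain no null sets, whereas
    stochastic integrals and states are determined only up to null sets. For existence, the feedback
    must be adapted at every sample point, so limits and time integrals are replaced by upper limits
    of adapted expressions that agree with them along continuous paths. For comparison, a competing
    state cannot be treated as adapted; only its control can. That the difference of two states is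
    orthogonal to later increments of the noise is therefore derived from a linear equation for
    covariances, by Gronwall. Continuous paths of the stochastic integral come from a maximal
    inequality at dyadic times, which makes suitable step integrals converge uniformly in time
    almost surely. *)

Lemma cvg_sumr {R : realType} (T : Type) (F : set_system T) {FF : Filter F}
    (I : finType) (u : I -> T -> R) (l : I -> R) :
  (forall i, u i x @[x --> F] --> l i) ->
  (\sum_i u i x) @[x --> F] --> \sum_i l i.
Proof.
move=> ul; elim: (index_enum I) => [|i r IH].
  rewrite big_nil; under eq_fun do rewrite big_nil; exact: cvg_cst.
by rewrite big_cons; under eq_fun do rewrite big_cons; exact: cvgD.
Qed.

Section MatrixDerivative.
Context {R : realType}.

(** Entrywise, so that the rules for products and transposes reduce to scalar sums; [mx_is_deriveE]
    and [mx_is_derive1] pass to and from the derivative in the space of matrices, in which the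
    differential equations are stated. *)
Definition mx_is_derive {m p : nat} (F : R -> 'M[R]_(m, p)) (t : R)
    (D : 'M[R]_(m, p)) : Prop :=
  forall i j, is_derive t 1 (fun u => F u i j) (D i j).

Lemma mx_is_deriveE m p (F : R -> 'M[R]_(m, p)) t D :
  mx_is_derive F t D -> derivable F t 1 /\ derive1 F t = D.
Proof.
move=> FD; have dF : derivable F t 1.
  by apply/derivable_mxP => i j; apply: (@ex_derive _ _ _ _ _ _ _ (FD i j)).
split => //; rewrite derive1E derive_mx //; apply/matrixP => i j; rewrite mxE.
exact: (@derive_val _ _ _ _ _ _ _ (FD i j)).
Qed.

Lemma mx_is_derive1 m p (F : R -> 'M[R]_(m, p)) t :
  derivable F t 1 -> mx_is_derive F t (derive1 F t).
Proof.
move=> dF i j; rewrite derive1E derive_mx // mxE; apply/derivableP.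
by move/derivable_mxP : dF.
Qed.

Lemma mx_is_derive_eq m p (F : R -> 'M[R]_(m, p)) t D D' :
  mx_is_derive F t D -> D = D' -> mx_is_derive F t D'.
Proof. by move=> + <-. Qed.

Lemma mx_is_derive_cst m p (M : 'M[R]_(m, p)) t : mx_is_derive (fun=> M) t 0.
Proof. by move=> i j; rewrite mxE; exact: is_derive_cst. Qed.

Lemma mx_is_deriveD m p (F G : R -> 'M[R]_(m, p)) t F' G' :
  mx_is_derive F t F' -> mx_is_derive G t G' ->
  mx_is_derive (fun u => F u + G u) t (F' + G').
Proof.
move=> dF dG i j; rewrite mxE.
rewrite [X in is_derive _ _ X](_ : _ = (fun u => F u i j) + (fun u => G u i j)).
  exact: is_deriveD.
by apply/funext => u; rewrite mxE.
Qed.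

Lemma mx_is_deriveN m p (F : R -> 'M[R]_(m, p)) t F' :
  mx_is_derive F t F' -> mx_is_derive (fun u => - F u) t (- F').
Proof.
move=> dF i j; rewrite mxE.
rewrite [X in is_derive _ _ X](_ : _ = - (fun u => F u i j)).
  exact: is_deriveN.
by apply/funext => u; rewrite mxE.
Qed.

Lemma mx_is_deriveB m p (F G : R -> 'M[R]_(m, p)) t F' G' :
  mx_is_derive F t F' -> mx_is_derive G t G' ->
  mx_is_derive (fun u => F u - G u) t (F' - G').
Proof. by move=> dF dG; apply: mx_is_deriveD => //; exact: mx_is_deriveN. Qed.

Lemma mx_is_deriveZ m p (g : R -> R) (F : R -> 'M[R]_(m, p)) (t g' : R) F' :
  is_derive t 1 g g' -> mx_is_derive F t F' ->
  mx_is_derive (fun u => g u *: F u) t (g t *: F' + g' *: F t).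
Proof.
move=> dg dF i j; rewrite !mxE.
rewrite [X in is_derive _ _ X](_ : _ = g * (fun u => F u i j)).
  apply: is_derive_eq (is_deriveM dg (dF i j)) _; rewrite /GRing.scale /=.
  by ring.
by apply/funext => u; rewrite mxE.
Qed.

Lemma mx_is_deriveM m p q (F : R -> 'M[R]_(m, p)) (G : R -> 'M[R]_(p, q)) t
    F' G' : mx_is_derive F t F' -> mx_is_derive G t G' ->
  mx_is_derive (fun u => F u *m G u) t (F' *m G t + F t *m G').
Proof.
move=> dF dG i j; rewrite !mxE -big_split /=.
rewrite [X in is_derive _ _ X](_ : _ =
    \sum_(k < p) ((fun u => F u i k) * (fun u => G u k j))).
  apply: is_derive_eq (is_derive_sum (fun k => is_deriveM (dF i k) (dG k j))) _.
  apply: eq_bigr => k _; rewrite /GRing.scale /=.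
  by ring.
by apply/funext => u; rewrite mxE fct_sumE.
Qed.

Lemma mx_is_deriveMr m p q (F : R -> 'M[R]_(m, p)) (M : 'M[R]_(p, q)) t F' :
  mx_is_derive F t F' -> mx_is_derive (fun u => F u *m M) t (F' *m M).
Proof.
move=> dF; apply: mx_is_derive_eq (mx_is_deriveM dF (mx_is_derive_cst M t)) _.
by rewrite mulmx0 addr0.
Qed.

Lemma mx_is_derive_tr m p (F : R -> 'M[R]_(m, p)) t F' :
  mx_is_derive F t F' -> mx_is_derive (fun u => (F u)^T) t F'^T.
Proof.
move=> dF i j; rewrite mxE.
rewrite [X in is_derive _ _ X](_ : _ = (fun u => F u j i)); first exact: dF.
by apply/funext => u; rewrite mxE.
Qed.

Lemma mx_is_derive_continuous m p (F : R -> 'M[R]_(m, p)) t F' :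
  mx_is_derive F t F' -> {for t, continuous F}.
Proof.
move=> /mx_is_deriveE[dF _].
by apply: differentiable_continuous; exact/derivable1_diffP.
Qed.

(** The exponential series is taken entry by entry, as scalar power series, so that it can be
    differentiated term by term. *)
Lemma mx_exp_exists m (H : 'M[R]_m) :
  exists E : R -> 'M[R]_m, E 0 = 1%:M /\ forall t, mx_is_derive E t (H *m E t).
Proof.
(* Coefficients of the entries of L exp(tH). The left factor [L] makes the family closed under
   formal differentiation, which replaces [L] by [L *m H] ([dc]); linearity in [L] then leads back
   to the case of the identity. *)
pose c (L : 'M[R]_m) i j (k : nat) : R := (L *m H ^+ k) i j / k`!%:R.
(* A bound for all row sums of absolute values, whence |(H^k) i j| <= b^k and comparison with the
   series of exp(b |x|). *)
pose b := \sum_i \sum_j `|H i j|.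
have b0 : 0 <= b by rewrite sumr_ge0// => i _; exact: sumr_ge0.
have Hk k : forall i j, `|(H ^+ k) i j| <= b ^+ k.
  elim: k => [i j|k IH i j].
    by rewrite !expr0 mxE; case: eqP => _; rewrite ?normr1 ?normr0.
  rewrite exprS mxE (le_trans (ler_norm_sum _ _ _))//.
  apply: (@le_trans _ _ (\sum_l `|H i l| * b ^+ k)).
    by apply: ler_sum => l _; rewrite normrM ler_wpM2l.
  rewrite -mulr_suml exprS ler_wpM2r ?exprn_ge0// /b.
  by rewrite [leRHS](bigD1 i) //= lerDl sumr_ge0// => l _; exact: sumr_ge0.
have cE L i j x : pseries (c L i j) x =
    (fun n => \sum_l L i l * pseries (c 1%:M l j) x n).
  apply/funext => n; rewrite /pseries /series /=.
  under [RHS]eq_bigr do rewrite mulr_sumr.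
  rewrite [RHS]exchange_big /=; apply: eq_bigr => k _.
  rewrite /c mxE !mulr_suml; apply: eq_bigr => l _.
  by rewrite mul1mx !mulrA.
have c1 i j x : cvgn (pseries (c 1%:M i j) x).
  apply: normed_cvg; apply: (@series_le_cvg _ _ (exp_coeff (b * `|x|))) => //.
  - by move=> k /=.
  - by move=> k; rewrite exp_coeff_ge0// mulr_ge0.
  - move=> k /=; rewrite /c /exp_coeff /= mul1mx !normrM normfV normr_nat.
    by rewrite normrX exprMn mulrAC ler_wpM2r ?invr_ge0 ?ler0n// ler_wpM2r ?exprn_ge0.
  - exact: is_cvg_series_exp_coeff.
have lin L i j x : pseries (c L i j) x @ \oo -->
    \sum_l L i l * limn (pseries (c 1%:M l j) x).
  rewrite cE; apply: cvg_sumr => l.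
  by apply: cvgM; [exact: cvg_cst|exact: c1].
have dc L i j : pseries_diffs (c L i j) = c (L *m H) i j.
  apply/funext => k; rewrite /pseries_diffs /c exprS.
  by rewrite factS natrM invfM mulrCA mulVKf// -mulmxA.
exists (fun t => \matrix_(i, j) limn (pseries (c 1%:M i j) t)); split.
  apply/matrixP => i j; rewrite !mxE.
  apply: cvg_lim => //; rewrite -(cvg_shiftn 1) /=.
  rewrite (_ : (fun _ => _) = cst (i == j)%:R); first exact: cvg_cst.
  apply/funext => n; rewrite /pseries /series /= addn1.
  rewrite big_nat_recl//= big1 ?addr0; last by move=> k _; rewrite expr0n mulr0.
  by rewrite expr0 mulr1 /c fact0 divr1 expr0 mulmx1 mxE.
move=> t i j; rewrite mxE.
rewrite [X in is_derive _ _ X](_ : _ = fun x => limn (pseries (c 1%:M i j) x));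
  last by apply/funext => u; rewrite mxE.
have cc L i' j' x : cvgn (pseries (c L i' j') x).
  by apply/cvg_ex; eexists; exact: lin.
(* Termwise differentiation asks for convergence of the series and of its first two formal
   derivatives at a radius beyond |t|; here they converge everywhere. *)
have := @pseries_snd_diffs R (c 1%:M i j) (`|t| + 1) t.
rewrite !dc mul1mx => /(_ (cc _ _ _ _) (cc _ _ _ _) (cc _ _ _ _)).
rewrite [limn (pseries (c H i j) t)](cvg_lim _ (lin H i j t))//.
have -> : \sum_l H i l * (\matrix_(i0, j0) limn (pseries (c 1%:M i0 j0) t)) l j
   = \sum_l H i l * limn (pseries (c 1%:M l j) t).
  by apply: eq_bigr => l _; rewrite mxE.
by apply; rewrite ltr_normr ltrDl ltr01.
Qed.
End MatrixDerivative.

Section Gronwall.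
Context {R : realType}.

Lemma is_derive_near_eq (F G : R -> R) (t : R) (D : R) :
  (\forall u \near t, F u = G u) -> is_derive t 1 F D -> is_derive t 1 G D.
Proof. by move=> FG; exact: near_eq_is_derive. Qed.

Lemma is_derive_sumr (I : finType) (F : I -> R -> R) (D : I -> R) (t : R) :
  (forall i, is_derive t 1 (F i) (D i)) ->
  is_derive t 1 (fun u => \sum_i F i u) (\sum_i D i).
Proof.
move=> FD; elim: (index_enum I) => [|i r IH].
  rewrite big_nil; under eq_fun do rewrite big_nil; exact: is_derive_cst.
by rewrite big_cons; under eq_fun do rewrite big_cons; exact: is_deriveD.
Qed.

Lemma sum_normr_sqr_le (I : finType) (z : I -> R) :
  (\sum_i `|z i|) ^+ 2 <= #|I|%:R * \sum_i z i ^+ 2.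
Proof.
have -> : (\sum_i `|z i|) ^+ 2 = \sum_i \sum_j `|z i| * `|z j|.
  by rewrite expr2 mulr_suml; apply: eq_bigr => i _; rewrite mulr_sumr.
have -> : #|I|%:R * (\sum_i z i ^+ 2) =
    \sum_i \sum_j ((z i ^+ 2 + z j ^+ 2) / 2).
  under [RHS]eq_bigr => i _
    do rewrite -mulr_suml big_split /= sumr_const -(mulr_natl (z i ^+ 2)).
  rewrite -mulr_suml big_split /= sumr_const -(mulr_natl (\sum_j _)) -mulr_sumr.
  by lra.
apply: ler_sum => i _; apply: ler_sum => j _.
rewrite ler_pdivlMr// -(real_normK (num_real (z i))) -(real_normK (num_real (z j))).
by rewrite -subr_ge0; have := sqr_ge0 (`|z i| - `|z j|); nra.
Qed.

(** With phi the sum of squares, |phi'| <= C phi, so exp(-Ct) phi is nonincreasing and exp(Ct) phi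
    nondecreasing. A zero at the left end propagates by the former, one at the right end by the
    latter. *)
Lemma gronwall_zero (I : finType) (z zd : I -> R -> R) (a b L : R) :
  0 <= L ->
  (forall i, {within `[a, b], continuous (z i)}) ->
  (forall t, a < t < b -> forall i, is_derive t 1 (z i) (zd i t)) ->
  (forall t, a < t < b -> forall i, `|zd i t| <= L * \sum_j `|z j t|) ->
  (forall i, z i a = 0) \/ (forall i, z i b = 0) ->
  forall t, a <= t <= b -> forall i, z i t = 0.
Proof.
move=> L0 cz dz bz z0 t /andP[at_ tb] i.
pose phi u := \sum_j z j u ^+ 2.
pose phid u := \sum_j (2 * (z j u * zd j u)).
(* The cardinal comes from Cauchy-Schwarz, in the form of [sum_normr_sqr_le]. *)
pose C := 2 * L * #|I|%:R.
have phi0 u : 0 <= phi u by apply: sumr_ge0 => j _; exact: sqr_ge0.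
have dphi u : a < u < b -> is_derive u 1 phi (phid u).
  move=> uab; apply: is_derive_sumr => j; have dj := dz u uab j.
  apply: is_derive_eq (is_deriveX 2 dj) _.
  by rewrite /GRing.scale /=; ring.
have bphi u : a < u < b -> `|phid u| <= C * phi u.
  move=> uab; rewrite (le_trans (ler_norm_sum _ _ _))//.
  apply: (@le_trans _ _ (\sum_j 2 * (`|z j u| * (L * \sum_k `|z k u|)))).
    apply: ler_sum => j _; rewrite !normrM ger0_norm// ler_wpM2l// ler_wpM2l//.
    exact: bz.
  rewrite -mulr_sumr -mulr_suml.
  have := sum_normr_sqr_le (z ^~ u); rewrite -/(phi u) /C.
  set s := \sum_i _; move=> h.
  have -> : 2 * (s * (L * s)) = (2 * L) * s ^+ 2 by ring.
  by rewrite -[leRHS]mulrA ler_wpM2l// mulr_ge0.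
have cphi : {within `[a, b], continuous phi}.
  move=> x; apply: cvg_sumr => j; rewrite (_ : (fun _ => _) = z j \* z j).
    by rewrite expr2; apply: cvgM; exact: cz.
  by apply/funext => v; rewrite expr2.
have dpsi (e u : R) : a < u < b ->
    is_derive u 1 (fun v => expR (e * v) * phi v)
      (expR (e * u) * (e * phi u + phid u)).
  move=> uab; have dp := dphi u uab.
  have dl : is_derive u 1 (fun v : R => e * v) e.
    rewrite (_ : (fun _ => _) = e \*: id)//.
    by apply: is_derive_eq; rewrite /GRing.scale /= mulr1.
  have de : is_derive u 1 (fun v => expR (e * v)) (expR (e * u) * e).
    exact: is_derive1_comp.
  apply: is_derive_eq (is_deriveM de dp) _.
  by rewrite /GRing.scale /=; ring.
have cpsi (e : R) : {within `[a, b], continuous (fun v => expR (e * v) * phi v)}.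
  move=> x; apply: cvgM; last exact: cphi.
  apply: continuous_subspaceT => y; apply: continuous_comp.
    by apply: cvgM; [exact: cvg_cst|exact: cvg_id].
  exact: continuous_expR.
suff : phi t <= 0.
  move=> ph; have : phi t = 0 by apply/eqP; rewrite eq_le ph phi0.
  move/eqP; rewrite psumr_eq0; last by move=> j _; exact: sqr_ge0.
  by move=> /allP/(_ i (mem_index_enum i)); rewrite sqrf_eq0 => /eqP.
have expR_mul_le0 (e x y : R) : y = 0 -> expR (e * t) * phi t <= expR x * y ->
    phi t <= 0.
  by move=> ->; rewrite mulr0 pmulr_rle0 ?expR_gt0.
have dpsiE (e x : R) : a < x < b ->
    derive1 (fun v => expR (e * v) * phi v) x = expR (e * x) * (e * phi x + phid x).
  by move=> xab; rewrite derive1E; have [_ ->] := dpsi e x xab.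
have dpsi1 (e x : R) : x \in `]a, b[ -> derivable (fun v => expR (e * v) * phi v) x 1.
  by rewrite in_itv/= => xab; have [] := dpsi e x xab.
case: z0 => z0.
- apply: (expR_mul_le0 (- C) (- C * a) (phi a)).
    by apply: big1 => j _; rewrite z0 expr0n.
  refine (ler0_derive1_nincr (dpsi1 (- C)) _ (cpsi (- C)) (lexx a) at_ tb) => x.
  rewrite in_itv/= => xab; rewrite dpsiE// pmulr_rle0 ?expR_gt0// mulNr addrC.
  by rewrite subr_le0; have := bphi _ xab; rewrite ler_norml => /andP[].
- apply: (expR_mul_le0 C (C * b) (phi b)).
    by apply: big1 => j _; rewrite z0 expr0n.
  refine (ger0_derive1_ndecr (dpsi1 C) _ (cpsi C) at_ tb (lexx b)) => x.
  rewrite in_itv/= => xab; rewrite dpsiE// pmulr_rge0 ?expR_gt0// addrC.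
  by rewrite -lerBlDr sub0r; have := bphi _ xab; rewrite ler_norml => /andP[].
Qed.

(** Along y + c z with z = S y the form equals 2 c |z|^2 + c^2 quad S z, which is negative for small
    c < 0 unless z = 0. *)
Lemma psd_kernel n (S : 'M[R]_n) (y : 'cV[R]_n) :
  sym_mx S -> pos_semidef S -> quad S y = 0 -> S *m y = 0.
Proof.
move=> symS psdS qy; set z := S *m y.
pose q := (z^T *m z) 0 0; pose p := quad S z.
have q0 : 0 <= q.
  by rewrite /q mxE sumr_ge0// => k _; rewrite mxE -expr2 sqr_ge0.
have yS : y^T *m S = z^T by rewrite /z trmx_mul symS.
have E c : quad S (y + c *: z) = c * (2 * q) + c ^+ 2 * p.
  have -> : quad S (y + c *: z) = ((y^T + c *: z^T) *m S *m (y + c *: z)) 0 0.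
    rewrite /quad (_ : (y + c *: z)^T = y^T + c *: z^T)//.
    by apply/matrixP => i j; rewrite !mxE.
  rewrite !mulmxDl !mulmxDr -!scalemxAl -!scalemxAr.
  have mxD (M1 M2 : 'M[R]_1) : (M1 + M2) 0 0 = M1 0 0 + M2 0 0 by rewrite mxE.
  have mxZ (a : R) (M1 : 'M[R]_1) : (a *: M1) 0 0 = a * M1 0 0 by rewrite mxE.
  rewrite !(mxD, mxZ) -[(y^T *m S *m y) 0 0]/(quad S y) qy yS.
  rewrite -(mulmxA z^T S y) -/z -/q -[(z^T *m S *m z) 0 0]/p.
  by rewrite expr2; ring.
have p0 : 0 <= p by exact: psdS.
have {}q0 : q = 0.
  apply/eqP; rewrite eq_le q0 andbT leNgt; apply/negP => q1.
  (* The minimiser -q / p is undefined for p = 0, hence p + 1; the value becomes (q / (p + 1))^2 (p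
     - 2 (p + 1)) < 0. *)
  have := psdS (y + (- (q / (p + 1))) *: z); rewrite E leNgt => /negP; apply.
  have p1 : 0 < p + 1 by lra.
  rewrite (_ : _ + _ = (q / (p + 1)) ^+ 2 * (p - 2 * (p + 1))); last first.
    by field; rewrite gt_eqF.
  by rewrite pmulr_rlt0; [lra|rewrite exprn_gt0// divr_gt0].
apply/matrixP => k l; rewrite ord1 [RHS]mxE.
move: q0; rewrite /q mxE => /eqP; rewrite psumr_eq0; last first.
  by move=> m _; rewrite mxE -expr2 sqr_ge0.
move=> /allP/(_ k (mem_index_enum k)); rewrite mxE -expr2 sqrf_eq0.
by move/eqP.
Qed.

Lemma gronwall_zero_mx m p (D : R -> 'M[R]_(m, p)) (M1 : R -> 'M[R]_m)
    (M2 : R -> 'M[R]_p) (a b L : R) :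
  0 <= L ->
  {within `[a, b], continuous D} ->
  (forall t, a < t < b -> mx_is_derive D t (M1 t *m D t + D t *m M2 t)) ->
  (forall t, a < t < b -> forall i j, `|M1 t i j| <= L) ->
  (forall t, a < t < b -> forall i j, `|M2 t i j| <= L) ->
  D a = 0 \/ D b = 0 ->
  forall t, a <= t <= b -> D t = 0.
Proof.
move=> L0 cD dD bM1 bM2 D0 t tab; apply/matrixP => i j; rewrite mxE.
pose z (k : 'I_m * 'I_p) u := D u k.1 k.2.
suff : forall t, a <= t <= b -> forall k, z k t = 0 by move=> /(_ t tab (i, j)).
apply: (@gronwall_zero _ z
    (fun k u => (M1 u *m D u + D u *m M2 u) k.1 k.2) a b (L + L)).
- by rewrite addr_ge0.
- move=> k x; apply: (cvg_comp D (fun M : 'M[R]_(m, p) => M k.1 k.2)).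
    exact: cD.
  exact: coord_continuous.
- by move=> u uab k; exact: dD.
- move=> u uab k; rewrite mxE (le_trans (ler_normD _ _))// mulrDl lerD//.
    rewrite mxE (le_trans (ler_norm_sum _ _ _))//.
    apply: (@le_trans _ _ (\sum_l L * `|D u l k.2|)).
      by apply: ler_sum => l _; rewrite normrM ler_wpM2r// bM1.
    rewrite -mulr_sumr ler_wpM2l// -(pair_bigA _ (fun l q => `|D u l q|)) /=.
    by apply: ler_sum => l _; rewrite [leRHS](bigD1 k.2)//= lerDl sumr_ge0.
  rewrite mxE (le_trans (ler_norm_sum _ _ _))//.
  apply: (@le_trans _ _ (\sum_l L * `|D u k.1 l|)).
    by apply: ler_sum => l _; rewrite normrM mulrC ler_wpM2r// bM2.
  rewrite -mulr_sumr ler_wpM2l// -(pair_bigA _ (fun l q => `|D u l q|)) /=.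
  by rewrite [leRHS](bigD1 k.1)//= lerDl sumr_ge0// => l _; exact: sumr_ge0.
- by case: D0 => D0; [left|right] => k; rewrite /z D0 mxE.
Qed.
End Gronwall.

(** * The Riccati system *)

(* Reduces an additive identity between matrices to one between their entries,
   the products being treated as atoms. *)
Ltac mx_atoms :=
  repeat match goal with
  | |- context [@mulmx ?R ?m ?n ?p ?A ?B] =>
      move: (@mulmx R m n p A B) => ?
  | |- context [@trmx ?R ?m ?n ?A] => move: (@trmx R m n A) => ?
  end.
Ltac mx_abel_at := mx_atoms; rewrite !mxE; ring.
Ltac mx_abel := mx_atoms; apply/matrixP => ? ?; rewrite !mxE; ring.

Section Riccati.
Context {R : realType}.

Lemma trmxD m p (M N : 'M[R]_(m, p)) : (M + N)^T = M^T + N^T.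
Proof. exact: linearD. Qed.

Lemma trmxN m p (M : 'M[R]_(m, p)) : (- M)^T = - M^T.
Proof. exact: linearN. Qed.

Lemma trmxB m p (M N : 'M[R]_(m, p)) : (M - N)^T = M^T - N^T.
Proof. exact: linearB. Qed.

Lemma derivable_cvg (f : R -> R) (t : R) :
  derivable f t 1 -> f u @[u --> t] --> f t.
Proof. by move=> /derivable1_diffP/differentiable_continuous. Qed.

(** A nonincreasing function with equal end values is constant in between. *)
Lemma ge0_derive_const (phi phid : R -> R) (a b : R) :
  a < b -> (forall t : R, is_derive t 1 phi (phid t)) ->
  (forall t, a < t < b -> phid t <= 0) -> phi a = phi b ->
  forall t, a < t < b -> phid t = 0.
Proof.
move=> ab dphi phid0 eab t tab.
have cphi : {within `[a, b], continuous phi}.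
  apply: continuous_subspaceT => x; apply: differentiable_continuous.
  by apply/derivable1_diffP; have [] := dphi x.
have mono x y : a <= x -> x <= y -> y <= b -> phi y <= phi x.
  move=> ax xy yb; refine (ler0_derive1_nincr _ _ cphi ax xy yb) => u.
    by have [] := dphi u.
  by rewrite in_itv/= => /phid0; rewrite derive1E; have [_ ->] := dphi u.
have cst x : a <= x <= b -> phi x = phi a.
  move=> /andP[ax xb]; apply/eqP; rewrite eq_le mono//= eab.
  by rewrite -eab {1}eab mono.
have d0 : is_derive t 1 phi 0.
  apply: is_derive_near_eq (is_derive_cst (phi a) t (1 : R)).
  have : \forall u \near t, u \in `]a, b[ by apply: near_in_itvoo; rewrite in_itv.
  apply: filterS => u; rewrite in_itv/= => /andP[au ub].
  by rewrite /cst /= cst// (ltW au) (ltW ub).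
by have [_ <-] := dphi t; have [_ ->] := d0.
Qed.

Lemma det0_kernel n (M : 'M[R]_n) : \det M = 0 ->
  exists2 v : 'cV[R]_n, v != 0 & M *m v = 0.
Proof.
rewrite -det_tr => /eqP/det0P[v v0 vM]; exists v^T.
  by apply: contra v0 => /eqP/(congr1 trmx); rewrite trmxK trmx0 => ->.
by apply: trmx_inj; rewrite trmx_mul trmxK trmx0.
Qed.

Lemma is_derive_prodr (I : finType) (F : I -> R -> R) (t : R) :
  (forall i, derivable (F i) t 1) -> derivable (fun u => \prod_i F i u) t 1.
Proof.
move=> dF; elim: (index_enum I) => [|i r IH].
  rewrite (_ : (fun _ => _) = cst 1); first exact: derivable_cst.
  by apply/funext => u; rewrite big_nil.
rewrite (_ : (fun _ => _) = F i \* (fun u => \prod_(j <- r) F j u)).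
  exact: (derivableM (dF i) IH).
by apply/funext => u; rewrite big_cons.
Qed.

Lemma derivable_det n (F : R -> 'M[R]_n) t :
  derivable F t 1 -> derivable (fun u => \det (F u)) t 1.
Proof.
move=> /derivable_mxP dF; rewrite /determinant.
pose G (s : 'S_n) u := (-1) ^+ s * \prod_i F u i (s i).
suff : is_derive t 1 (fun u => \sum_s G s u) (\sum_s derive1 (G s) t) by case.
apply: is_derive_sumr => s; rewrite derive1E; apply: derivableP.
apply: derivableM; first exact: derivable_cst.
exact: is_derive_prodr.
Qed.

Lemma derivable_adj n (F : R -> 'M[R]_n) t :
  derivable F t 1 -> derivable (fun u => \adj (F u)) t 1.
Proof.
move=> dF; apply/derivable_mxP => i j.
rewrite (_ : (fun _ => _) = fun u => (-1) ^+ (j + i) * \det (row' j (col' i (F u)))).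
  apply: derivableM; first exact: derivable_cst.
  apply: derivable_det; apply/derivable_mxP => k l.
  rewrite (_ : (fun _ => _) = (fun u => F u (lift j k) (lift i l))).
    by move/derivable_mxP : dF.
  by apply/funext => u; rewrite !mxE.
by apply/funext => u; rewrite !mxE.
Qed.

(** Differentiating F V = 1 gives the formula once V is known to be differentiable, which the
    cofactor formula supplies where this is applied. *)
Lemma mx_is_derive_inv n (F V : R -> 'M[R]_n) t F' :
  mx_is_derive F t F' ->
  (\forall u \near t, F u *m V u = 1%:M) -> derivable V t 1 ->
  mx_is_derive V t (- (V t *m F' *m V t)).
Proof.
move=> dF FV /mx_is_derive1 dV.
apply: (mx_is_derive_eq dV).
have d0 : F' *m V t + F t *m derive1 V t = 0.
  apply/matrixP => i j; have := mx_is_deriveM dF dV i j.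
  have : is_derive t 1 (fun u => (F u *m V u) i j) 0.
    apply: is_derive_near_eq (is_derive_cst ((1%:M : 'M[R]_n) i j) t (1 : R)).
    by apply: filterS FV => u ->.
  move=> [_ d1] [_ d2]; by rewrite -d2 d1 mxE.
have FV1 := nbhs_singleton FV; have VF1 := mulmx1C FV1.
have := congr1 (mulmx (V t)) d0; rewrite mulmxDr !mulmxA VF1 mul1mx mulmx0.
by move/eqP; rewrite addrC addr_eq0 => /eqP.
Qed.

(** The Hamiltonian system takes the value (1, 0) at [T], so that Y X^-1 is the Riccati solution
    with terminal value 0. The derivative of the inverse [V] is two-sided even at [T], so the
    equation for Y X^-1 holds up to and including [T]. *)
Lemma riccati_fundamental n (a S Q : 'M[R]_n) (T : R) :
  sym_mx S -> pos_semidef S -> sym_mx Q -> pos_semidef Q ->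
  exists X Y V : R -> 'M[R]_n,
    [/\ forall t, mx_is_derive X t (a *m X t - S *m Y t),
        forall t, mx_is_derive Y t (- (Q *m X t) - a^T *m Y t),
        X T = 1%:M /\ Y T = 0,
        forall t, (X t)^T *m Y t = (Y t)^T *m X t &
        forall t, t <= T -> [/\ V t *m X t = 1%:M, X t *m V t = 1%:M &
          mx_is_derive V t (- (V t *m (a *m X t - S *m Y t) *m V t))]].
Proof.
move=> symS psdS symQ psdQ.
have [E [E0 dE]] := mx_exp_exists (block_mx a (- S) (- Q) (- a^T)).
pose Z t := E (t - T) *m col_mx (1%:M : 'M[R]_n) (0 : 'M[R]_n).
pose X t := usubmx (Z t); pose Y t := dsubmx (Z t).
have dZ t : mx_is_derive Z t (block_mx a (- S) (- Q) (- a^T) *m Z t).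
  rewrite /Z mulmxA; apply: mx_is_deriveMr => i j.
  have h : is_derive t 1 (fun u : R => u - T) 1.
    rewrite -[X in is_derive _ _ _ X]subr0.
    exact: is_deriveB.
  have := @is_derive1_comp _ (fun u => E u i j) (fun u => u - T) t _ _ (dE _ i j) h.
  by rewrite mulr1.
have Zsplit t : Z t = col_mx (X t) (Y t) by rewrite vsubmxK.
have dZE t : block_mx a (- S) (- Q) (- a^T) *m Z t =
    col_mx (a *m X t - S *m Y t) (- (Q *m X t) - a^T *m Y t).
  by rewrite Zsplit mul_block_col !mulNmx.
have dX t : mx_is_derive X t (a *m X t - S *m Y t).
  move=> i j; have := dZ t (lshift n i) j; rewrite dZE col_mxEu.
  by under eq_fun do rewrite Zsplit col_mxEu.
have dY t : mx_is_derive Y t (- (Q *m X t) - a^T *m Y t).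
  move=> i j; have := dZ t (rshift n i) j; rewrite dZE col_mxEd.
  by under eq_fun do rewrite Zsplit col_mxEd.
have ZT : Z T = col_mx 1%:M 0 by rewrite /Z subrr E0 mul1mx.
have XT : X T = 1%:M by rewrite /X ZT col_mxKu.
have YT : Y T = 0 by rewrite /Y ZT col_mxKd.
(* The difference of the two sides has derivative 0, [S] and [Q] being symmetric, and vanishes at
   [T] with [Y]. This makes Y X^-1 symmetric. *)
have XYs t : (X t)^T *m Y t = (Y t)^T *m X t.
  pose D t := (X t)^T *m Y t - (Y t)^T *m X t.
  have dD u : mx_is_derive D u 0.
    apply: mx_is_derive_eq.
      apply: mx_is_deriveB; apply: mx_is_deriveM.
      - apply: mx_is_derive_tr; exact: dX.
      - exact: dY.
      - apply: mx_is_derive_tr; exact: dY.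
      - exact: dX.
    rewrite !(trmxB, trmxN, trmx_mul) trmxK symS symQ.
    rewrite !(mulmxBl, mulmxBr, mulmxDl, mulmxDr, mulNmx, mulmxN) !mulmxA.
    by mx_abel.
  apply/eqP; rewrite -subr_eq0 -/(D t); apply/eqP/matrixP => i j.
  rewrite (_ : D t i j = D T i j).
    by rewrite /D XT YT trmx1 trmx0 mul1mx mul0mx subrr.
  apply: (@is_derive_0_is_cst R (fun u => D u i j)) => u.
  by have := dD u i j; rewrite mxE.
(* If X(t) v = 0, the pairing of Xv and Yv vanishes at t and at T, while its derivative is -(quad S
   (Yv) + quad Q (Xv)) <= 0. Hence S Y v = 0 in between, X v solves x' = a x from x(t) = 0, and v =
   X(T) v = 0. *)
have Xu t : t <= T -> \det (X t) != 0.
  move=> tT; apply/negP => /eqP/det0_kernel[v v0 Xv].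
  have {tT}tT : t < T.
    rewrite lt_neqAle tT andbT; apply: contra v0 => /eqP teqT.
    by move: Xv; rewrite teqT XT mul1mx => ->.
  pose x u := X u *m v; pose y u := Y u *m v.
  pose phi u := ((x u)^T *m y u) 0 0.
  have dx u : mx_is_derive x u (a *m x u - S *m y u).
    have := mx_is_deriveMr v (dX u); rewrite mulmxBl -!mulmxA; exact.
  have dy u : mx_is_derive y u (- (Q *m x u) - a^T *m y u).
    have := mx_is_deriveMr v (dY u); rewrite mulmxBl mulNmx -!mulmxA; exact.
  have dphi (u : R) : is_derive u 1 phi (- (quad S (y u) + quad Q (x u))).
    apply: is_derive_eq (mx_is_deriveM (mx_is_derive_tr (dx u)) (dy u) 0 0) _.
    rewrite trmxB !trmx_mul symS mulmxBl mulmxBr mulmxN !mulmxA.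
    by rewrite /quad /x /y !trmx_mul !mulmxA; mx_abel_at.
  have := ge0_derive_const tT dphi.
  have phi_t : phi t = 0 by rewrite /phi /x Xv trmx0 mul0mx mxE.
  have phi_T : phi T = 0 by rewrite /phi /y YT mul0mx mulmx0 mxE.
  have Sge u : 0 <= quad S (y u) by exact: psdS.
  have Qge u : 0 <= quad Q (x u) by exact: psdQ.
  rewrite phi_t phi_T => /(_ (fun u _ => _) erefl) h.
  have {}h u : t < u < T -> S *m y u = 0.
    move=> utT; apply: psd_kernel => //.
    have : - (quad S (y u) + quad Q (x u)) = 0.
      by apply: h utT => w; rewrite oppr_le0; exact: addr_ge0.
    by have := Sge u; have := Qge u; lra.
  have : x T = 0.
    apply: (@gronwall_zero_mx R _ _ x (fun=> a) (fun=> 0) t T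
      (\sum_i \sum_j `|a i j|)) => //.
    - by rewrite sumr_ge0// => i _; exact: sumr_ge0.
    - apply: continuous_subspaceT => u; exact: mx_is_derive_continuous (dx u).
    - by move=> u utT; apply: mx_is_derive_eq (dx u) _; rewrite h// mulmx0 subr0 addr0.
    - move=> u _ i j; rewrite (bigD1 i)//= (bigD1 j)//= -addrA lerDl.
      by rewrite addr_ge0// ?sumr_ge0// => k _; exact: sumr_ge0.
    - by move=> u _ i j; rewrite mxE normr0 sumr_ge0// => k _; exact: sumr_ge0.
    - by left; rewrite /x Xv.
    - by rewrite ltW//= lexx.
  by rewrite /x XT mul1mx; apply/eqP.
(* The cofactor formula instead of [invmx]: determinant and cofactors are polynomials in the
   entries, hence differentiable. *)
pose V t := (\det (X t))^-1 *: \adj (X t).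
exists X, Y, V; split => // t tT.
have XVdet u : \det (X u) != 0 -> X u *m V u = 1%:M.
  by move=> du; rewrite /V -scalemxAr mul_mx_adj scale_scalar_mx mulVf.
have XV := XVdet t (Xu t tT); split => //; first exact: mulmx1C.
have dXt : derivable X t 1 by case: (mx_is_deriveE (dX t)).
apply: mx_is_derive_inv (dX t) _ _.
  have cdet : (\det (X u) : R) @[u --> t] --> (\det (X t) : R).
    by apply: derivable_cvg; exact: derivable_det.
  (* Nonvanishing is known only up to [T]; continuity of the determinant extends it to a
     neighbourhood, also when t = T. *)
  have : \forall u \near t, \det (X u) != 0.
    exact: (cvgr_neq0 _ cdet (Xu t tT)).
  by apply: filterS => u; exact: XVdet.
have [Vd _] : derivable V t 1 /\ derive1 V t = 
    ((\det (X t))^-1 *: derive1 (fun u => \adj (X u)) t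
    + (derive1 (fun u => (\det (X u))^-1) t) *: \adj (X t)).
  apply: mx_is_deriveE; apply: mx_is_deriveZ.
    rewrite derive1E; apply: derivableP; apply: derivableV; first exact: Xu.
    exact: derivable_det.
  by apply: mx_is_derive1; exact: derivable_adj.
exact: Vd.
Qed.

End Riccati.

(** * Calculus with continuity on a compact interval *)

Section Within.
Context {R : realType}.

Lemma cvg_mxP (T : Type) (F : set_system T) {FF : Filter F} m p
    (f : T -> 'M[R]_(m, p)) (l : 'M[R]_(m, p)) :
  f @ F --> l <-> forall i j, f x i j @[x --> F] --> l i j.
Proof.
split=> [fl i j|fl].
  apply: (cvg_comp f (fun M : 'M[R]_(m, p) => M i j)); first exact: fl.
  exact: coord_continuous.
apply/cvgrPdist_le => /= e e0; near=> x.
rewrite /Num.Def.normr/= mx_normrE (bigmax_le _ (ltW e0))//= => i _.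
rewrite !mxE/=; move: i; near: x; apply: filter_forall => /= i.
exact: ((cvgrPdist_le _ _).1 (fl i.1 i.2)).
Unshelve. all: by end_near. Qed.

Lemma within_mxP (A : set R) m p (F : R -> 'M[R]_(m, p)) :
  {within A, continuous F} <->
  forall i j, {within A, continuous (fun t => F t i j)}.
Proof.
split=> [cF i j x|cF x]; first by have /cvg_mxP := cF x; exact.
by apply/cvg_mxP => i j; exact: cF.
Qed.

Lemma within_mulmx (A : set R) m p q (F : R -> 'M[R]_(m, p))
    (G : R -> 'M[R]_(p, q)) :
  {within A, continuous F} -> {within A, continuous G} ->
  {within A, continuous (fun t => F t *m G t)}.
Proof.
move=> /within_mxP cF /within_mxP cG; apply/within_mxP => i j x.
rewrite (_ : (fun _ => _) = fun t => \sum_k F t i k * G t k j); last first.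
  by apply/funext => t; rewrite mxE.
by apply: cvg_sumr => k; apply: cvgM; [exact: cF|exact: cG].
Qed.

Lemma within_trmx (A : set R) m p (F : R -> 'M[R]_(m, p)) :
  {within A, continuous F} -> {within A, continuous (fun t => (F t)^T)}.
Proof.
move=> /within_mxP cF; apply/within_mxP => i j x.
rewrite (_ : (fun _ => _) = fun t => F t j i); last first.
  by apply/funext => t; rewrite mxE.
exact: cF.
Qed.

Lemma within_cst (A : set R) (V : topologicalType) (v : V) :
  {within A, continuous (fun _ : R => v)}.
Proof. by move=> x; exact: cvg_cst. Qed.

Lemma within_D (A : set R) (V : normedModType R) (F G : R -> V) :
  {within A, continuous F} -> {within A, continuous G} ->
  {within A, continuous (fun t => F t + G t)}.
Proof. by move=> cF cG x; apply: cvgD; [exact: cF|exact: cG]. Qed.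

Lemma within_N (A : set R) (V : normedModType R) (F : R -> V) :
  {within A, continuous F} -> {within A, continuous (fun t => - F t)}.
Proof. by move=> cF x; apply: cvgN; exact: cF. Qed.

Lemma within_Z (A : set R) (V : normedModType R) (g : R -> R) (F : R -> V) :
  {within A, continuous g} -> {within A, continuous F} ->
  {within A, continuous (fun t => g t *: F t)}.
Proof. by move=> cg cF x; apply: cvgZ; [exact: cg|exact: cF]. Qed.

Lemma within_M (A : set R) (F G : R -> R) :
  {within A, continuous F} -> {within A, continuous G} ->
  {within A, continuous (fun t => F t * G t)}.
Proof. by move=> cF cG x; apply: cvgM; [exact: cF|exact: cG]. Qed.

Lemma within_sum (A : set R) (I : finType) (F : I -> R -> R) :
  (forall i, {within A, continuous (F i)}) ->
  {within A, continuous (fun t => \sum_i F i t)}.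
Proof. by move=> cF x; apply: cvg_sumr => i; exact: cF. Qed.

Lemma within_norm (A : set R) (F : R -> R) :
  {within A, continuous F} -> {within A, continuous (fun t => `|F t|)}.
Proof. by move=> cF x; apply: cvg_norm; exact: cF. Qed.

Lemma within_expR (A : set R) (c : R) :
  {within A, continuous (fun t => expR (c * t))}.
Proof.
apply: continuous_subspaceT => y; apply: continuous_comp.
  by apply: cvgM; [exact: cvg_cst|exact: cvg_id].
exact: continuous_expR.
Qed.

Lemma is_derive_expRM (c t : R) :
  is_derive t 1 (fun u => expR (c * u)) (c * expR (c * t)).
Proof.
have dl : is_derive t 1 (fun v : R => c * v) c.
  rewrite (_ : (fun _ => _) = c \*: id)//.
  by apply: is_derive_eq; rewrite /GRing.scale /= mulr1.
by rewrite mulrC; exact: is_derive1_comp.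
Qed.

Lemma within_derive_mx (a b : R) m p (F F' : R -> 'M[R]_(m, p)) :
  (forall t, a <= t <= b -> mx_is_derive F t (F' t)) ->
  {within `[a, b], continuous F}.
Proof.
move=> dF; apply/subspace_continuousP => t /=; rewrite in_itv/= => tab.
by apply: cvg_within_filter; exact: mx_is_derive_continuous (dF t tab).
Qed.

Lemma within_bounded (f : R -> R) (a b : R) :
  {within `[a, b], continuous f} ->
  exists2 L : R, 0 <= L & forall t, a <= t <= b -> `|f t| <= L.
Proof.
move=> cf; have /compact_bounded[M [_ HM]] :=
  continuous_compact cf (segment_compact (a := a) (b := b)).
exists (`|M| + 1) => [|t tab]; first by rewrite addr_ge0.
apply: HM; first by rewrite (le_lt_trans (ler_norm M))// ltrDl.
by exists t => //=; rewrite in_itv.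
Qed.

Lemma within_bounded_mx m p (F : R -> 'M[R]_(m, p)) (a b : R) :
  {within `[a, b], continuous F} ->
  exists2 L : R, 0 <= L & forall t, a <= t <= b -> forall i j, `|F t i j| <= L.
Proof.
move=> /within_mxP cF.
have cs : {within `[a, b], continuous (fun t => \sum_i \sum_j `|F t i j|)}.
  by apply: within_sum => i; apply: within_sum => j; exact: within_norm.
have [L L0 HL] := within_bounded cs; exists L => // t tab i j.
apply: le_trans (HL t tab); apply: le_trans (ler_norm _).
rewrite (bigD1 i)//= (bigD1 j)//= -addrA lerDl.
by rewrite addr_ge0// ?sumr_ge0// => k _; exact: sumr_ge0.
Qed.

Lemma within_integrable (f : R -> R) (a b : R) :
  {within `[a, b], continuous f} ->
  lebesgue_measure.-integrable `[a, b] (EFin \o f).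
Proof. by move=> cf; apply: continuous_compact_integrable => //; exact: segment_compact. Qed.

Lemma within_sub (V : topologicalType) (f : R -> V) (a b c d : R) :
  c <= a -> b <= d -> {within `[c, d], continuous f} ->
  {within `[a, b], continuous f}.
Proof.
move=> ca bd; apply: continuous_subspaceW => x /=; rewrite !in_itv/=.
by move=> /andP[ax xb]; rewrite (le_trans ca ax) (le_trans xb bd).
Qed.

Lemma within_primitive (c : R -> R) (T : R) : 0 <= T ->
  {within `[0, T], continuous c} ->
  let C t := (\int[lebesgue_measure]_(s in `[0%R, t]) c s)%R in
  [/\ C 0 = 0, {within `[0, T], continuous C} &
      forall t, 0 < t < T -> is_derive t 1 C (c t)].
Proof.
move=> T0 cc C; have ic := within_integrable cc; split.
- by rewrite /C set_itv1 Rintegral_set1.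
- exact: parameterized_integral_continuous.
- move=> t /andP[t0 tT].
  have ct : {for t, continuous c}.
    have /(continuous_within_itvP c (lt_trans t0 tT))[cc1 _ _] := cc.
    by apply: cc1; rewrite in_itv/= t0.
  have [dC C't] := continuous_FTC1_closed tT ic t0 ct.
  by rewrite -[c t]C't derive1E; apply: derivableP.
Qed.

Lemma within_FTC2 (F c : R -> R) (T t : R) :
  {within `[0, T], continuous c} -> {within `[0, T], continuous F} ->
  (forall u, 0 < u < T -> is_derive u 1 F (c u)) -> 0 <= t <= T ->
  \int[lebesgue_measure]_(s in `[0%R, t]) c s = F t - F 0.
Proof.
move=> cc cF dF /andP[]; rewrite le_eqVlt => /predU1P[<- _|t0 tT].
  by rewrite set_itv1 Rintegral_set1 subrr.
have cct : {within `[0, t], continuous c} by exact: within_sub cc.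
have cFt : {within `[0, t], continuous F} by exact: within_sub cF.
have dFt u : u \in `]0, t[ -> is_derive u 1 F (c u).
  by rewrite in_itv/= => /andP[u0 ut]; apply: dF; rewrite u0 (lt_le_trans ut tT).
rewrite /Rintegral (@continuous_FTC2 _ _ F)//.
- have /(continuous_within_itvP F t0)[_ F0 Ft] := cFt.
  by split => // u ut; have [] := dFt u ut.
- by move=> u ut; rewrite derive1E; have [_ ->] := dFt u ut.
Qed.

End Within.

(** * Discounted Riccati equations and variation of constants *)

Section RiccatiSolution.
Context {R : realType}.

Lemma mx_is_derive_expZ (m p : nat) (c t : R) (F : R -> 'M[R]_(m, p)) F' :
  mx_is_derive F t F' ->
  mx_is_derive (fun u => expR (c * u) *: F u) t
    (expR (c * t) *: F' + (c * expR (c * t)) *: F t).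
Proof. by move=> dF; apply: mx_is_deriveZ => //; exact: is_derive_expRM. Qed.

(* [Phi] is a fundamental matrix of the closed-loop system and [Psi] its
   inverse; the discount is absorbed by the factor [expR (rho / 2 * t)]. *)
Lemma riccati_solution n (A S Q : 'M[R]_n) (rho T : R) :
  sym_mx S -> pos_semidef S -> sym_mx Q -> pos_semidef Q ->
  exists P Phi Psi : R -> 'M[R]_n,
    [/\ P T = 0,
        forall t, t <= T -> (P t)^T = P t,
        forall t, t <= T -> mx_is_derive P t
          (rho *: P t - A^T *m P t - P t *m A + P t *m S *m P t - Q),
        forall t, t <= T -> Psi t *m Phi t = 1%:M /\ Phi t *m Psi t = 1%:M &
        forall t, t <= T ->
          mx_is_derive Phi t ((A - S *m P t) *m Phi t) /\
          mx_is_derive Psi t (- (Psi t *m (A - S *m P t)))].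
Proof.
move=> symS psdS symQ psdQ.
(* Replacing A by A - rho / 2 turns A^T P + P A into A^T P + P A - rho P. *)
pose c := rho / 2.
have [X [Y [V [dX dY [XT YT] XY XV]]]] :=
  riccati_fundamental (A - c%:M) T symS psdS symQ psdQ.
pose P t := Y t *m V t.
have YE t : t <= T -> Y t = P t *m X t.
  by move=> /XV[VX _ _]; rewrite /P -mulmxA VX mulmx1.
exists P, (fun t => expR (c * t) *: X t), (fun t => expR (- c * t) *: V t).
have symP t : t <= T -> (P t)^T = P t.
  move=> tT; have [VX XV1 _] := XV t tT.
  have : (V t)^T *m ((X t)^T *m Y t) *m V t = (V t)^T *m ((Y t)^T *m X t) *m V t.
    by rewrite XY.
  rewrite !mulmxA -trmx_mul XV1 trmx1 mul1mx -(mulmxA _ (X t)) XV1 mulmx1.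
  by rewrite /P trmx_mul => ->.
split.
- by rewrite /P YT mul0mx.
- exact: symP.
- move=> t tT; have [VX XV1 dV] := XV t tT.
  apply: mx_is_derive_eq (mx_is_deriveM (dY t) dV) _.
  rewrite mulmxN !mulmxA -/(P t) mulmxBl mulNmx.
  rewrite -[Q *m X t *m V t]mulmxA XV1 mulmx1.
  rewrite -[_^T *m Y t *m V t]mulmxA -/(P t).
  rewrite -[P t *m (_ - _) *m V t]mulmxA mulmxBl -[S *m Y t *m V t]mulmxA.
  rewrite -/(P t) -[(A - _) *m X t *m V t]mulmxA XV1 mulmx1.
  rewrite !(mulmxBr, trmxB) tr_scalar_mx mulmxBl mul_scalar_mx mul_mx_scalar.
  rewrite (mulmxA _ S) (_ : rho *: P t = c *: P t + c *: P t).
    by rewrite -(mulmxA A^T) -(mulmxA (P t *m S)) -!/(P t); mx_abel.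
  by rewrite -scalerDl -splitr.
- move=> t tT; have [VX XV1 _] := XV t tT.
  rewrite -!scalemxAl -!scalemxAr !scalerA -!expRD VX XV1.
  by rewrite -!mulrDl addNr addrN mul0r expR0 !scale1r.
- move=> t tT; have [VX XV1 dV] := XV t tT; split.
    apply: mx_is_derive_eq (mx_is_derive_expZ c (dX t)) _.
    rewrite YE// !mulmxBl mul_scalar_mx (mulrC c (expR _)) -(scalerA (expR _)).
    rewrite -scalerDr.
    by rewrite -!scalemxAr -scalerBr mulmxA addrAC subrK.
  apply: mx_is_derive_eq (mx_is_derive_expZ (- c) dV) _.
  rewrite YE// mulmxA -mulmxBl -[V t *m _ *m V t]mulmxA -[_ *m X t *m V t]mulmxA.
  rewrite XV1 mulmx1 (mulrC (- c) (expR _)) -(scalerA (expR _)) -scalerDr -scalemxAl.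
  rewrite -[RHS]scalerN; congr (_ *: _).
  rewrite !(mulmxBl, mulmxBr) mul_mx_scalar scaleNr.
  by mx_abel.
Qed.

(** The explicit formula, rather than an abstract existence theorem, lets the measurability and
    adaptedness of the closed-loop state be read off. The integrated equation is the form that
    [is_state] asks for. *)
Lemma variation_of_constants n (F Phi Psi : R -> 'M[R]_n) (c : R -> 'cV[R]_n)
    (y0 : 'cV[R]_n) (T : R) : 0 <= T ->
  {within `[0, T], continuous F} ->
  (forall t, 0 <= t <= T -> mx_is_derive Phi t (F t *m Phi t)) ->
  (forall t, 0 <= t <= T -> Phi t *m Psi t = 1%:M) ->
  {within `[0, T], continuous Psi} ->
  {within `[0, T], continuous c} ->
  let y t := Phi t *m (Psi 0 *m y0 + \col_k
    (\int[lebesgue_measure]_(s in `[0, t]) (Psi s *m c s) k 0)) in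
  [/\ {within `[0, T], continuous y}, y 0 = y0,
      forall t, 0 < t < T -> mx_is_derive y t (F t *m y t + c t) &
      forall t, 0 <= t <= T -> y t = y0 +
        \col_k (\int[lebesgue_measure]_(s in `[0, t]) (F s *m y s + c s) k 0)].
Proof.
move=> T0 cF dPhi PhiPsi cPsi cc y.
pose z t := Psi 0 *m y0 + \col_k
    (\int[lebesgue_measure]_(s in `[0, t]) (Psi s *m c s) k 0).
have /within_mxP cPc := within_mulmx cPsi cc.
have cPhi := within_derive_mx dPhi.
have cz : {within `[0, T], continuous z}.
  apply: within_D; first exact: within_cst.
  apply/within_mxP => i j; rewrite (_ : (fun _ => _) =
      fun t => \int[lebesgue_measure]_(s in `[0, t]) (Psi s *m c s) i 0).
    by have [] := within_primitive T0 (cPc i 0).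
  by apply/funext => t; rewrite mxE.
have cy : {within `[0, T], continuous y} by exact: within_mulmx.
have z0 : z 0 = Psi 0 *m y0.
  rewrite /z (_ : \col__ _ = 0) ?addr0//; apply/matrixP => i j.
  by rewrite !mxE set_itv1 Rintegral_set1.
have T00 : 0 <= (0 : R) <= T by rewrite lexx.
have y0E : y 0 = y0 by rewrite /y -/(z 0) z0 mulmxA PhiPsi// mul1mx.
have dy t : 0 < t < T -> mx_is_derive y t (F t *m y t + c t).
  move=> tT; have tT' : 0 <= t <= T by case/andP: tT => /ltW -> /ltW ->.
  have dz : mx_is_derive z t (Psi t *m c t).
    rewrite -[X in mx_is_derive _ _ X]add0r; apply: mx_is_deriveD.
      exact: mx_is_derive_cst.
    move=> i j; rewrite ord1 (_ : (fun _ => _) =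
      fun t => \int[lebesgue_measure]_(s in `[0, t]) (Psi s *m c s) i 0).
      by have [_ _] := within_primitive T0 (cPc i 0); apply.
    by apply/funext => u; rewrite mxE.
  apply: mx_is_derive_eq (mx_is_deriveM (dPhi t tT') dz) _.
  by rewrite !mulmxA PhiPsi// mul1mx -mulmxA.
split=> // t tT; apply/matrixP => i j; rewrite ord1 [RHS]mxE [X in _ = _ + X]mxE.
have /within_mxP cFy : {within `[0, T], continuous (fun s => F s *m y s + c s)}.
  by apply: within_D => //; exact: within_mulmx.
have /within_mxP cy' := cy.
have := within_FTC2 (cFy i 0) (cy' i 0) (fun u uT => dy u uT i 0) tT.
by move=> ->; rewrite y0E subrKC.
Qed.

End RiccatiSolution.

(** * Existence and uniqueness for the coupled system of P, K and s *)

Section RiccatiSystem.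
Context {R : realType}.
Variables (n r : nat) (T rho : R).
Variables (A : 'M[R]_n) (B : 'M[R]_(n, r)) (G Gamma Q : 'M[R]_n).
Variables (Rc : 'M[R]_r) (eta : 'cV[R]_n) (f : R -> 'cV[R]_n).

Let S := B *m invmx Rc *m B^T.

Lemma pos_def_unitmx : pos_def Rc -> Rc \in unitmx.
Proof.
move=> pR; rewrite unitmxE unitfE; apply/negP => /eqP/det0_kernel[v v0 Rv].
by have := pR v v0; rewrite /quad -mulmxA Rv mulmx0 mxE ltxx.
Qed.

Lemma pos_def_psd : pos_def Rc -> pos_semidef Rc.
Proof.
move=> pR z; have [->|/pR/ltW//] := eqVneq z 0.
by rewrite /quad mulmx0 mxE.
Qed.

Lemma sym_gain : sym_mx Rc -> sym_mx S.
Proof.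
by move=> sR; rewrite /sym_mx /S !trmx_mul trmxK trmx_inv sR mulmxA.
Qed.

(** The form of S = B Rc^-1 B^T at z is the form of [Rc] at Rc^-1 B^T z. *)
Lemma psd_gain : sym_mx Rc -> pos_def Rc -> pos_semidef S.
Proof.
move=> sR pR z; have uR := pos_def_unitmx pR.
have := pos_def_psd pR (invmx Rc *m B^T *m z).
rewrite /quad !trmx_mul trmxK trmx_inv sR /S !mulmxA.
by rewrite -[_ *m invmx Rc *m Rc]mulmxA mulVmx// mulmx1.
Qed.

Definition QQ : 'M[R]_n := Q - Q_Gamma Gamma Q.

Lemma QQE : QQ = (1%:M - Gamma)^T *m Q *m (1%:M - Gamma).
Proof.
rewrite /QQ /Q_Gamma trmxB trmx1 !(mulmxBl, mulmxBr) !mul1mx !mulmx1.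
by mx_abel.
Qed.

Lemma sym_QQ : sym_mx Q -> sym_mx QQ.
Proof. by move=> sQ; rewrite /sym_mx QQE !trmx_mul trmxK sQ mulmxA. Qed.

Lemma psd_QQ : pos_semidef Q -> pos_semidef QQ.
Proof.
move=> pQ z; have := pQ ((1%:M - Gamma) *m z).
by rewrite QQE /quad !trmx_mul !mulmxA.
Qed.

(* The derivatives prescribed by the three equations; [Pi] stands for [P + K],
   which solves a Riccati equation of its own. *)
Definition P_rhs (P : 'M[R]_n) : 'M[R]_n :=
  rho *: P - A^T *m P - P *m A + P *m S *m P - Q.

Definition K_rhs (P K : 'M[R]_n) : 'M[R]_n :=
  rho *: K - (A + G)^T *m K - K *m (A + G) + P *m S *m K + K *m S *m P
  - G^T *m P - P *m G + K *m S *m K + Q_Gamma Gamma Q.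

Definition s_rhs (Pi : 'M[R]_n) (s ft : 'cV[R]_n) : 'cV[R]_n :=
  rho *: s - (A + G - S *m Pi)^T *m s - Pi *m ft + eta_bar Gamma Q eta.

Lemma P_equationP P : P_equation T rho A B Q Rc P <->
  [/\ {within `[0, T], continuous P}, P T = 0 &
      forall t, 0 < t < T -> mx_is_derive P t (P_rhs (P t))].
Proof.
have E (D M : 'M[R]_n) : (rho *: M = D + A^T *m M + M *m A
        - M *m B *m invmx Rc *m B^T *m M + Q) <-> D = P_rhs M.
  by rewrite /P_rhs /S !mulmxA; split=> [->|->]; mx_abel.
split=> -[cP PT dP]; split => // t /dP.
  by move=> [/mx_is_derive1 d /E <-].
by move=> /mx_is_deriveE[d dE]; split => //; apply/E.
Qed.

Lemma K_equationP P K : K_equation T rho A B G Gamma Q Rc P K <->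
  [/\ {within `[0, T], continuous K}, K T = 0 &
      forall t, 0 < t < T -> mx_is_derive K t (K_rhs (P t) (K t))].
Proof.
have E (D P0 M : 'M[R]_n) : (rho *: M = D + (A + G)^T *m M + M *m (A + G)
        - P0 *m B *m invmx Rc *m B^T *m M - M *m B *m invmx Rc *m B^T *m P0
        + G^T *m P0 + P0 *m G
        - M *m B *m invmx Rc *m B^T *m M - Q_Gamma Gamma Q) <-> D = K_rhs P0 M.
  by rewrite /K_rhs /S !mulmxA; split=> [->|->]; move: (Q_Gamma _ _) => q; mx_abel.
split=> -[cP PT dP]; split => // t /dP.
  by move=> [/mx_is_derive1 d /E <-].
by move=> /mx_is_deriveE[d dE]; split => //; apply/E.
Qed.

Lemma s_equationP P K s : s_equation T rho A B G Gamma Q Rc eta f P K s <->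
  [/\ {within `[0, T], continuous s}, s T = 0 &
      forall t, 0 < t < T -> mx_is_derive s t (s_rhs (P t + K t) (s t) (f t))].
Proof.
have E (D v : 'cV[R]_n) (M : 'M[R]_n) ft : (rho *: v = D
        + (A + G - B *m invmx Rc *m B^T *m M)^T *m v
        + M *m ft - eta_bar Gamma Q eta) <-> D = s_rhs M v ft.
  by rewrite /s_rhs /S; split=> [->|->]; move: (eta_bar _ _ _) => q; mx_abel.
split=> -[cP PT dP]; split => // t /dP.
  by move=> [/mx_is_derive1 d /E <-].
by move=> /mx_is_deriveE[d dE]; split => //; apply/E.
Qed.

Lemma ode_bounded m p (M : R -> 'M[R]_(m, p)) : {within `[0, T], continuous M} ->
  exists2 L : R, 0 <= L & forall t, 0 < t < T -> forall i j, `|M t i j| <= L.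
Proof.
move=> /within_bounded_mx[L L0 HL]; exists L => // t /andP[t0 tT]; apply: HL.
by rewrite !ltW.
Qed.

Lemma linear_ode_unique m p (D : R -> 'M[R]_(m, p)) (M1 : R -> 'M[R]_m)
    (M2 : R -> 'M[R]_p) :
  {within `[0, T], continuous D} ->
  {within `[0, T], continuous M1} -> {within `[0, T], continuous M2} ->
  (forall t, 0 < t < T -> mx_is_derive D t (M1 t *m D t + D t *m M2 t)) ->
  D T = 0 -> forall t, 0 <= t <= T -> D t = 0.
Proof.
move=> cD /ode_bounded[L1 L10 H1] /ode_bounded[L2 L20 H2] dD DT.
apply: (@gronwall_zero_mx _ _ _ D M1 M2 0 T (Num.max L1 L2)) => //.
- by rewrite le_max L10.
- by move=> t tT i j; rewrite le_max H1.
- by move=> t tT i j; rewrite le_max H2 ?orbT.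
- by right.
Qed.

(** Since P' S P' - P S P = P' S (P' - P) + (P' - P) S P, the difference of two solutions solves a
    linear equation with bounded coefficients, and it vanishes at [T]. *)
Lemma P_unique P P' : P_equation T rho A B Q Rc P -> P_equation T rho A B Q Rc P' ->
  forall t, 0 <= t <= T -> P' t = P t.
Proof.
move=> /P_equationP[cP PT dP] /P_equationP[cP' PT' dP'] t tT.
apply/eqP; rewrite -subr_eq0; apply/eqP; move: t tT.
apply: (@linear_ode_unique _ _ _ (fun t => rho%:M - A^T + P' t *m S)
   (fun t => - A + S *m P t)).
- by apply: within_D => //; exact: within_N.
- by apply: within_D; [exact: within_cst|apply: within_mulmx => //; exact: within_cst].
- by apply: within_D; [exact: within_cst|apply: within_mulmx => //; exact: within_cst].
- move=> t tT; apply: mx_is_derive_eq (mx_is_deriveB (dP' t tT) (dP t tT)) _.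
  rewrite /P_rhs !(mulmxDl, mulmxDr, mulmxBl, mulmxBr, mulNmx, mulmxN).
  by rewrite !mul_scalar_mx !mulmxA; mx_abel.
- by rewrite PT PT' subrr.
Qed.

Lemma K_unique P K K' : {within `[0, T], continuous P} ->
  K_equation T rho A B G Gamma Q Rc P K -> K_equation T rho A B G Gamma Q Rc P K' ->
  forall t, 0 <= t <= T -> K' t = K t.
Proof.
move=> cP /K_equationP[cK KT dK] /K_equationP[cK' KT' dK'] t tT.
apply/eqP; rewrite -subr_eq0; apply/eqP; move: t tT.
have cst0 m p (M : 'M[R]_(m, p)) : {within `[0, T], continuous (fun _ : R => M)}.
  exact: within_cst.
apply: (@linear_ode_unique _ _ _
   (fun t => rho%:M - (A + G)^T + P t *m S + K' t *m S)
   (fun t => - (A + G) + S *m P t + S *m K t)).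
- by apply: within_D => //; exact: within_N.
- apply: within_D; last exact: within_mulmx cK' (cst0 _ _ S).
  by apply: within_D; [exact: cst0|exact: within_mulmx cP (cst0 _ _ S)].
- apply: within_D; last exact: within_mulmx (cst0 _ _ S) cK.
  by apply: within_D; [exact: cst0|exact: within_mulmx (cst0 _ _ S) cP].
- move=> t tT; apply: mx_is_derive_eq (mx_is_deriveB (dK' t tT) (dK t tT)) _.
  rewrite /K_rhs !(mulmxDl, mulmxDr, mulmxBl, mulmxBr, mulNmx, mulmxN).
  by rewrite !mul_scalar_mx !mulmxA; move: (Q_Gamma _ _) => q; mx_abel.
- by rewrite KT KT' subrr.
Qed.

Lemma s_unique P K s s' :
  {within `[0, T], continuous P} -> {within `[0, T], continuous K} ->
  s_equation T rho A B G Gamma Q Rc eta f P K s ->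
  s_equation T rho A B G Gamma Q Rc eta f P K s' ->
  forall t, 0 <= t <= T -> s' t = s t.
Proof.
move=> cP cK /s_equationP[cs sT ds] /s_equationP[cs' sT' ds'] t tT.
apply/eqP; rewrite -subr_eq0; apply/eqP; move: t tT.
have cst0 m p (M : 'M[R]_(m, p)) : {within `[0, T], continuous (fun _ : R => M)}.
  exact: within_cst.
apply: (@linear_ode_unique _ _ _
   (fun t => rho%:M - (A + G - S *m (P t + K t))^T) (fun t => 0)) => //.
- by apply: within_D => //; exact: within_N.
- apply: within_D; first exact: cst0.
  apply: (within_N (F := fun t => (A + G - S *m (P t + K t))^T)).
  apply: (within_trmx (F := fun t => A + G - S *m (P t + K t))).
  apply: within_D; first exact: cst0.
  apply: (within_N (F := fun t => S *m (P t + K t))).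
  by apply: (within_mulmx (G := fun t => P t + K t)) => //; exact: within_D.
- move=> t tT; apply: mx_is_derive_eq (mx_is_deriveB (ds' t tT) (ds t tT)) _.
  rewrite /s_rhs mulmx0 addr0 mulmxBl mul_scalar_mx mulmxBr scalerBr.
  by move: (eta_bar _ _ _) => q; mx_abel.
- by rewrite sT sT' subrr.
Qed.

(** The system is triangular: once the P agree, both K solve the same equation, and then so do both
    s. *)
Lemma riccati_system_unique P K s P' K' s' :
  riccati_system T rho A B G Gamma Q Rc eta f P K s ->
  riccati_system T rho A B G Gamma Q Rc eta f P' K' s' ->
  forall t, 0 <= t <= T -> [/\ P' t = P t, K' t = K t & s' t = s t].
Proof.
move=> [eP eK es] [eP' eK' es'].
have PP := P_unique eP eP'.
have oo_cc t : 0 < t < T -> 0 <= t <= T by case/andP => /ltW -> /ltW ->.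
have eK2 : K_equation T rho A B G Gamma Q Rc P K'.
  apply/K_equationP; move/K_equationP : eK' => [cK KT dK]; split => // t tT.
  by rewrite -PP ?oo_cc//; exact: dK.
have cP : {within `[0, T], continuous P} by case: eP.
have cK : {within `[0, T], continuous K} by case: eK.
have KK := K_unique cP eK eK2.
have es2 : s_equation T rho A B G Gamma Q Rc eta f P K s'.
  apply/s_equationP; move/s_equationP : es' => [cs sT ds]; split => // t tT.
  by rewrite -PP ?oo_cc// -KK ?oo_cc//; exact: ds.
have ss := s_unique cP cK es es2.
by move=> t tT; rewrite PP ?KK ?ss.
Qed.

(* [PhiP] is a fundamental matrix of the deviations from the average, [PhiM]
   of the average itself. *)
Lemma riccati_system_exists :
  0 < T -> {within `[0, +oo[, continuous f} ->
  sym_mx Q -> sym_mx Rc -> pos_def Rc -> pos_semidef Q ->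
  exists (P K : R -> 'M[R]_n) (s : R -> 'cV[R]_n)
      (PhiP PsiP PhiM PsiM : R -> 'M[R]_n),
    [/\ riccati_system T rho A B G Gamma Q Rc eta f P K s,
        forall t, t <= T -> (P t + K t)^T = P t + K t,
        forall t, t <= T -> [/\ mx_is_derive PhiP t ((A - S *m P t) *m PhiP t),
          PhiP t *m PsiP t = 1%:M &
          mx_is_derive PsiP t (- (PsiP t *m (A - S *m P t)))] &
        forall t, t <= T ->
          [/\ mx_is_derive PhiM t ((A + G - S *m (P t + K t)) *m PhiM t),
          PhiM t *m PsiM t = 1%:M &
          mx_is_derive PsiM t (- (PsiM t *m (A + G - S *m (P t + K t))))]].
Proof.
move=> T0 cf sQ sR pR pQ.
have [P [PhiP [PsiP [PT symP dP invP dPhiP]]]] :=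
  riccati_solution A rho T (sym_gain sR) (psd_gain sR pR) sQ pQ.
have [M [PhiM [PsiM [MT symM dM invM dPhiM]]]] :=
  riccati_solution (A + G) rho T (sym_gain sR) (psd_gain sR pR) (sym_QQ sQ)
    (psd_QQ pQ).
(* The equation of [K] alone has the weight -Q_Gamma, which need not have a sign; the sum [M] is
   built instead, and [K] recovered as a difference. *)
pose K t := M t - P t.
have PK t : P t + K t = M t by rewrite /K addrCA subrr addr0.
have cT m p (F F' : R -> 'M[R]_(m, p)) :
    (forall t, t <= T -> mx_is_derive F t (F' t)) -> {within `[0, T], continuous F}.
  by move=> dF; apply: within_derive_mx => t /andP[_]; exact: dF.
have cM := cT _ _ _ _ dM; have cP := cT _ _ _ _ dP.
have cPhiM := cT _ _ _ _ (fun t tT => (dPhiM t tT).1).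
have cPsiM := cT _ _ _ _ (fun t tT => (dPhiM t tT).2).
have cfT : {within `[0, T], continuous f}.
  apply: continuous_subspaceW cf => x /=; rewrite !in_itv/= => /andP[-> _].
  by [].
(* The transpose of [PsiM], multiplied by exp(rho t), solves the homogeneous part of the equation of
   [s]. Its inverse applied to the forcing is [c], and subtracting the value of the primitive at [T]
   gives the terminal condition. *)
pose c t := expR (- rho * t) *: ((PhiM t)^T *m (eta_bar Gamma Q eta - M t *m f t)).
have /within_mxP cc : {within `[0, T], continuous c}.
  apply: within_Z; first exact: within_expR.
  apply: within_mulmx; first exact: within_trmx.
  by apply: within_D; [exact: within_cst|apply: within_N; exact: within_mulmx].
pose C t : 'cV[R]_n := \col_k (\int[lebesgue_measure]_(s in `[0, t]) c s k 0).
have CE k : (fun t => C t k 0) =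
    fun t => \int[lebesgue_measure]_(s in `[0, t]) c s k 0.
  by apply/funext => t; rewrite mxE.
have cC : {within `[0, T], continuous C}.
  apply/within_mxP => i j; rewrite ord1 CE.
  by have [] := within_primitive (ltW T0) (cc i 0).
have dC t : 0 < t < T -> mx_is_derive C t (c t).
  move=> tT i j; rewrite ord1 CE.
  by have [_ _] := within_primitive (ltW T0) (cc i 0); apply.
pose s t := expR (rho * t) *: ((PsiM t)^T *m (C t - C T)).
have oo_T t : 0 < t < T -> t <= T by case/andP => _ /ltW.
exists P, K, s, PhiP, PsiP, PhiM, PsiM; split.
- split.
  + apply/P_equationP; split => // t /oo_T tT; exact: dP.
  + apply/K_equationP; split.
    * by apply: within_D => //; exact: within_N.
    * by rewrite /K MT PT subrr.
    * move=> t /oo_T tT.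
      apply: mx_is_derive_eq (mx_is_deriveB (dM t tT) (dP t tT)) _.
      rewrite -!PK /K_rhs /QQ.
      move: (K t) (P t) => k p.
      rewrite !(mulmxDl, mulmxDr) !trmxD !mulmxDl !scalerDr.
      by move: (Q_Gamma _ _) => q; mx_abel.
  + apply/s_equationP; split.
    * apply: within_Z; first exact: within_expR.
      apply: within_mulmx; first exact: within_trmx.
      by apply: within_D => //; exact: within_cst.
    * by rewrite /s subrr mulmx0 scaler0.
    * move=> t tT; have tT' := oo_T t tT; have [dPhi dPsi] := dPhiM t tT'.
      have dCT : mx_is_derive (fun u => C u - C T) t (c t).
        rewrite -[X in mx_is_derive _ _ X]subr0.
        by apply: mx_is_deriveB; [exact: dC|exact: mx_is_derive_cst].
      apply: mx_is_derive_eq (mx_is_derive_expZ rho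
        (mx_is_deriveM (mx_is_derive_tr dPsi) dCT)) _.
      rewrite PK /s_rhs trmxN trmx_mul mulNmx -[in RHS]/(s t) scalerDr.
      rewrite -scalerA -/(s t) -mulmxA scalerN scalemxAr -/(s t).
      move: (s t) => st; rewrite /c -scalemxAr scalerA -expRD mulNr subrr expR0 scale1r mulmxA.
      rewrite -trmx_mul (invM t tT').2 trmx1 mul1mx.
      move: (eta_bar _ _ _) => q; mx_abel.
- by move=> t tT; rewrite PK symM.
- by move=> t tT; split; [case: (dPhiP t tT)|case: (invP t tT)|case: (dPhiP t tT)].
- by move=> t tT; rewrite PK; split; [case: (dPhiM t tT)|case: (invM t tT)|case: (dPhiM t tT)].
Qed.

End RiccatiSystem.

(** * Square-integrable functions and normal moments *)

Section SquareIntegrable.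
Context {d : measure_display} {T : measurableType d} {R : realType}.
Variables (mu : {measure set T -> \bar R}) (D : set T).
Hypothesis mD : measurable D.
Implicit Types X Y : T -> R.

Definition L2 X : Prop := measurable_fun D X /\
  (\int[mu]_(x in D) ((X x) ^+ 2)%:E < +oo)%E.

Lemma EFin_Rintegral X : mu.-integrable D (EFin \o X) ->
  ((\int[mu]_(x in D) X x)%:E = \int[mu]_(x in D) (X x)%:E)%E.
Proof. by move=> iX; rewrite /Rintegral fineK//; exact: integrable_fin_num. Qed.

Lemma L2_sqr X : L2 X -> mu.-integrable D (EFin \o (fun x => X x ^+ 2)).
Proof.
move=> [mX X2]; apply/integrableP; split.
  by apply/measurable_EFinP; exact: measurable_funX.
rewrite (le_lt_trans _ X2)// le_eqVlt; apply/orP; left; apply/eqP.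
by apply: eq_integral => x _ /=; rewrite ger0_norm// sqr_ge0.
Qed.

Lemma L2P X : measurable_fun D X ->
  mu.-integrable D (EFin \o (fun x => X x ^+ 2)) -> L2 X.
Proof.
move=> mX /integrableP[_]; split => //; apply: le_lt_trans b.
rewrite le_eqVlt; apply/orP; left; apply/eqP.
by apply: eq_integral => x _ /=; rewrite ger0_norm// sqr_ge0.
Qed.

Lemma integrable_le X Y : measurable_fun D X ->
  (forall x, D x -> `|X x| <= Y x) -> mu.-integrable D (EFin \o Y) ->
  mu.-integrable D (EFin \o X).
Proof.
move=> mX XY iY; apply: le_integrable iY => //; first exact/measurable_EFinP.
by move=> x Dx /=; rewrite lee_fin (le_trans (XY x Dx))// ler_norm.
Qed.

Lemma integrable_addr X Y : mu.-integrable D (EFin \o X) ->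
  mu.-integrable D (EFin \o Y) -> mu.-integrable D (EFin \o (fun x => X x + Y x)).
Proof. by move=> iX iY; exact: (integrableD mD iX iY). Qed.

Lemma integrable_subr X Y : mu.-integrable D (EFin \o X) ->
  mu.-integrable D (EFin \o Y) -> mu.-integrable D (EFin \o (fun x => X x - Y x)).
Proof. by move=> iX iY; exact: (integrableB mD iX iY). Qed.

Lemma integrable_scale (c : R) X : mu.-integrable D (EFin \o X) ->
  mu.-integrable D (EFin \o (fun x => c * X x)).
Proof. by move=> iX; exact: (integrableZl mD c iX). Qed.

Lemma integrable_sumr (I : finType) (X : I -> T -> R) :
  (forall i, mu.-integrable D (EFin \o X i)) ->
  mu.-integrable D (EFin \o (fun x => \sum_i X i x)).
Proof.
move=> iX; rewrite (_ : EFin \o _ = fun x => (\sum_i (X i x)%:E)%E).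
  by apply: integrable_sum => // i _; exact: iX.
by apply/funext => x /=; rewrite sumEFin.
Qed.

Lemma Rintegral_sumr (I : finType) (X : I -> T -> R) :
  (forall i, mu.-integrable D (EFin \o X i)) ->
  \int[mu]_(x in D) (\sum_i X i x) = \sum_i \int[mu]_(x in D) X i x.
Proof.
move=> iX; apply: EFin_inj; rewrite EFin_Rintegral; last exact: integrable_sumr.
under eq_integral do rewrite -sumEFin.
rewrite integral_sum//= -sumEFin; apply: eq_bigr => i _.
by rewrite EFin_Rintegral.
Qed.

Lemma L2_mul X Y : L2 X -> L2 Y ->
  mu.-integrable D (EFin \o (fun x => X x * Y x)).
Proof.
move=> lX lY; apply: (@integrable_le _ (fun x => X x ^+ 2 + Y x ^+ 2)).
- by apply: measurable_funM; [case: lX|case: lY].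
- move=> x _; rewrite normrM -(real_normK (num_real (X x))).
  rewrite -(real_normK (num_real (Y x))).
  by have := sqr_ge0 (`|X x| - `|Y x|); have := normr_ge0 (X x);
    have := normr_ge0 (Y x); nra.
- by apply: integrable_addr; exact: L2_sqr.
Qed.

Lemma L2_le X Y : measurable_fun D X -> L2 Y ->
  (forall x, D x -> `|X x| <= `|Y x|) -> L2 X.
Proof.
move=> mX lY XY; apply: L2P => //; apply: integrable_le (L2_sqr lY).
  exact: measurable_funX.
move=> x Dx; rewrite normrX -(real_normK (num_real (Y x))).
by rewrite lerXn2r// ?nnegrE// XY.
Qed.

Lemma L2D X Y : L2 X -> L2 Y -> L2 (fun x => X x + Y x).
Proof.
move=> lX lY; have mXY : measurable_fun D (fun x => X x + Y x).
  by apply: measurable_funD; [case: lX|case: lY].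
apply: L2P => //.
apply: (@integrable_le _ (fun x => 2 * X x ^+ 2 + 2 * Y x ^+ 2)).
- exact: measurable_funX.
- move=> x _; rewrite ger0_norm ?sqr_ge0//.
  by have := sqr_ge0 (X x - Y x); nra.
- by apply: integrable_addr; apply: integrable_scale; exact: L2_sqr.
Qed.

Lemma L2Z (c : R) X : L2 X -> L2 (fun x => c * X x).
Proof.
move=> lX; have mX : measurable_fun D (fun x => c * X x).
  by apply: measurable_funM => //; case: lX.
apply: L2P => //; rewrite (_ : (fun x => _) = fun x => c ^+ 2 * X x ^+ 2).
  by apply: integrable_scale; exact: L2_sqr.
by apply/funext => x; rewrite exprMn.
Qed.

Lemma L2N X : L2 X -> L2 (fun x => - X x).
Proof. by move=> /(L2Z (-1)); under eq_fun do rewrite mulN1r. Qed.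

Lemma L2B X Y : L2 X -> L2 Y -> L2 (fun x => X x - Y x).
Proof. by move=> lX lY; apply: L2D => //; exact: L2N. Qed.

Lemma L2_0 : L2 (fun _ => 0).
Proof.
split; first exact: measurable_cst.
rewrite (eq_integral (fun _ => 0%E)) ?integral0 ?ltry//.
by move=> x _; rewrite expr0n.
Qed.

Lemma L2_sum (I : Type) (s : seq I) (X : I -> T -> R) :
  (forall i, L2 (X i)) -> L2 (fun x => \sum_(i <- s) X i x).
Proof.
move=> lX; elim: s => [|i s IH].
  by under eq_fun do rewrite big_nil; exact: L2_0.
by under eq_fun do rewrite big_cons; exact: L2D.
Qed.

Lemma integrable_cstr (c : R) : (mu D < +oo)%E ->
  mu.-integrable D (EFin \o (fun _ => c)).
Proof.
move=> muD; apply/integrableP; split.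
  by apply/measurable_EFinP; exact: measurable_cst.
rewrite integral_cst//= lte_mul_pinfty//.
Qed.

Lemma L2_cst (c : R) : (mu D < +oo)%E -> L2 (fun _ => c).
Proof.
by move=> muD; apply: L2P; [exact: measurable_cst|exact: integrable_cstr].
Qed.

Lemma L2_integrable X : (mu D < +oo)%E -> L2 X -> mu.-integrable D (EFin \o X).
Proof.
move=> muD lX; rewrite (_ : X = fun x => X x * 1).
  by apply: L2_mul => //; exact: L2_cst.
by apply/funext => x; rewrite mulr1.
Qed.

Lemma L2_eq X Y : (forall x, D x -> X x = Y x) -> L2 X -> L2 Y.
Proof.
move=> XY [mX X2]; split.
  by apply: eq_measurable_fun mX => x; rewrite inE => /XY.
by rewrite (eq_integral (fun x => (X x ^+ 2)%:E))// => x; rewrite inE => /XY ->.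
Qed.

(* The bound is the arithmetic-geometric mean inequality, with weight e. *)
Lemma L2_orthogonal_limit X Y (Yn : nat -> T -> R) :
  L2 X -> L2 Y -> (forall m, L2 (Yn m)) ->
  (forall m, \int[mu]_(x in D) (X x * Yn m x) = 0) ->
  (fun m => \int[mu]_(x in D) ((Yn m x - Y x) ^+ 2)%:E)%E @ \oo --> 0%E ->
  \int[mu]_(x in D) (X x * Y x) = 0.
Proof.
move=> lX lY lYn oYn cv.
pose q := \int[mu]_(x in D) (X x ^+ 2).
pose I := \int[mu]_(x in D) (X x * Y x).
have q0 : 0 <= q by apply: Rintegral_ge0 => x _; exact: sqr_ge0.
have key m (e : R) : 0 < e ->
    `|I| <= e * q + e^-1 * \int[mu]_(x in D) ((Yn m x - Y x) ^+ 2).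
  move=> e0; have lB : L2 (fun x => Yn m x - Y x) by exact: L2B.
  have -> : I = - \int[mu]_(x in D) (X x * (Yn m x - Y x)).
    have -> : \int[mu]_(x in D) (X x * (Yn m x - Y x)) =
        \int[mu]_(x in D) (X x * Yn m x - X x * Y x).
      by apply: eq_Rintegral => x _; rewrite mulrBr.
    by rewrite RintegralB ?oYn ?sub0r ?opprK//; exact: L2_mul.
  rewrite normrN (le_trans (le_normr_Rintegral _ _))//; first exact: L2_mul.
  rewrite /q -RintegralZl//; last exact: L2_sqr.
  rewrite -RintegralZl//; last exact: L2_sqr.
  rewrite -RintegralD//; last 2 first.
    by apply: integrable_scale; exact: L2_sqr.
    by apply: integrable_scale; exact: L2_sqr.
  apply: le_Rintegral => //.
  - by apply: (@integrable_norm _ _ _ mu D (fun x => X x * (Yn m x - Y x))) => //; exact: L2_mul.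
  - by apply: integrable_addr; apply: integrable_scale; exact: L2_sqr.
  - move=> x _; rewrite normrM; set a := X x; set b := _ - _.
    rewrite -(real_normK (num_real a)) -(real_normK (num_real b)).
    have h : 0 <= e^-1 * (e * `|a| - `|b|) ^+ 2 by rewrite mulr_ge0 ?sqr_ge0// invr_ge0 ltW.
    have eE : e^-1 * (e * `|a| - `|b|) ^+ 2 =
      e * `|a| ^+ 2 + e^-1 * `|b| ^+ 2 - 2 * (`|a| * `|b|).
      by field; rewrite gt_eqF.
    have := mulr_ge0 (normr_ge0 a) (normr_ge0 b); rewrite eE in h; lra.
(* The index m goes to infinity with [e] fixed, which leaves [e * q]; afterwards [e] goes to 0. *)
have key2 (e : R) : 0 < e -> `|I| <= e * q.
  move=> e0; apply/ler_addgt0Pr => _/posnumP[h].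
  have he : 0 < e * h%:num by rewrite mulr_gt0.
  have /fine_cvgP[_ /cvgrPdist_lt/(_ _ he)] := cv.
  move=> [m _ /(_ m (leqnn m))] /=; rewrite sub0r normrN => hm'.
  have hm := ltW (le_lt_trans (ler_norm _) hm').
  apply: le_trans (key m e e0) _.
  by rewrite lerD2l mulrC ler_pdivrMr// mulrC.
apply/eqP; rewrite -normr_le0; apply/ler_addgt0Pr => _/posnumP[h]; rewrite add0r.
have q1 : 0 < q + 1 by rewrite ltr_wpDl.
apply: le_trans (key2 (h%:num / (q + 1)) _) _; first by rewrite divr_gt0.
by rewrite mulrAC ler_pdivrMr// ler_wpM2l// lerDl.
Qed.

End SquareIntegrable.

(** * Orthogonality from independence *)

Section Independence.
Context {R : realType} {d : measure_display} {Omega : measurableType d}.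
Variable Pr : probability Omega R.

(** Independence makes the law of (X, Y) the product of the two laws, as both agree on rectangles.
    By Fubini the integral of x y is then that of x times the mean of Y. *)
Lemma indep_mul_mean0 (F : set (set Omega)) (X Y : Omega -> R) :
  measurable_fun setT X -> measurable_fun setT Y ->
  (forall S, measurable S -> F (X @^-1` S)) ->
  independent2 Pr F (sigma_of setT (fun (_ : unit) => Y)) ->
  L2 Pr setT X -> L2 Pr setT Y -> \int[Pr]_w Y w = 0 ->
  \int[Pr]_w (X w * Y w) = 0.
Proof.
move=> mX mY FX ind lX lY EY.
have iXY : Pr.-integrable setT (EFin \o (fun w => X w * Y w)) by exact: L2_mul.
have iY : Pr.-integrable setT (EFin \o Y) by apply: L2_integrable => //; exact: fin_num_fun_lty.
pose X' : {mfun Omega >-> R} :=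
  MeasurableFun.Pack (MeasurableFun.Class (isMeasurableFun.Build _ _ _ _ X mX)).
pose Y' : {mfun Omega >-> R} :=
  MeasurableFun.Pack (MeasurableFun.Class (isMeasurableFun.Build _ _ _ _ Y mY)).
pose XY w := (X w, Y w).
have mXY : measurable_fun setT XY by exact: measurable_fun_pair.
pose XY' : {mfun Omega >-> (R * R)%type} :=
  MeasurableFun.Pack (MeasurableFun.Class (isMeasurableFun.Build _ _ _ _ XY mXY)).
pose PX := distribution Pr X'; pose PY := distribution Pr Y'.
pose PXY := distribution Pr XY'.
have PE A : measurable A -> (PX \x PY)%E A = PXY A.
  apply: product_measure_unique => B C mB mC.
  change (Pr ((X @^-1` B) `&` (Y @^-1` C)) = (Pr (X @^-1` B) * Pr (Y @^-1` C))%E).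
  apply: ind; first exact: FX.
  apply: sub_sigma_algebra; exists tt => //; exists C => //.
  by rewrite setTI.
pose g (p : R * R) := (p.1 * p.2)%:E.
have mg : measurable_fun setT g.
  by apply/measurable_EFinP; apply: measurable_funM.
have iPXY : PXY.-integrable setT g.
  by apply: integrable_pushforward => //; rewrite preimage_setT.
have ig : (PX \x PY)%E.-integrable setT g.
  apply/integrableP; split => //.
  rewrite (eq_measure_integral PXY) => [|A mA _]; last exact: PE.
  by move/integrableP : iPXY => [].
apply: EFin_inj; rewrite EFin_Rintegral//.
have -> : (\int[Pr]_w (X w * Y w)%:E = \int[PXY]_p g p)%E.
  by rewrite /PXY integral_pushforward// ?preimage_setT.
rewrite (eq_measure_integral (PX \x PY)%E) => [|A mA _]; last exact/esym/PE.
rewrite -integral12_prod_meas1// [LHS](_ : _ = \int[PX]_x (fun=> 0) x)%E.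
  by rewrite integral0.
apply: eq_integral => x _; rewrite /fubini_F /g /=.
have iid : PY.-integrable setT (EFin \o (@id R)).
  by apply: integrable_pushforward => //; rewrite ?preimage_setT//; exact/measurable_EFinP.
under eq_integral do rewrite EFinM.
rewrite integralZl//.
have -> : (\int[PY]_y y%:E = \int[Pr]_w (Y w)%:E)%E.
  by rewrite /PY integral_pushforward ?preimage_setT//; exact/measurable_EFinP.
by rewrite -EFin_Rintegral// EY mule0.
Qed.

End Independence.

(** * Mean and variance of the centred normal law *)

Section NormalMoments.
Context {R : realType}.
Local Notation mu := (@lebesgue_measure R).

(** From exp(x) >= x the term is at most 1 / (c n), hence at most 2 / (c (n + 1)) for n >= 1. *)
Lemma expR_sqr_cvg0 (c : R) : 0 < c ->
  (n%:R * expR (- c * n%:R ^+ 2)) @[n --> \oo] --> (0 : R).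
Proof.
move=> c0.
apply: (@squeeze_cvgr _ _ _ _ (fun=> 0) (fun n => c^-1 * harmonic n * 2)).
- near=> n; rewrite mulr_ge0 ?expR_ge0//=.
  rewrite mulNr expRN -ler_pdivlMr ?invr_gt0 ?expR_gt0// invrK.
  rewrite /harmonic /=.
  have n1 : (1 <= n%:R :> R) by rewrite ler1n; near: n; exists 1%N.
  have e1 : c * n%:R ^+ 2 <= expR (c * n%:R ^+ 2).
    by rewrite (le_trans _ (expR_ge1Dx _))// lerDr.
  apply: (@le_trans _ _ (c^-1 * n.+1%:R^-1 * 2 * (c * n%:R ^+ 2))).
    have -> : c^-1 * n.+1%:R^-1 * 2 * (c * n%:R ^+ 2) = n%:R * ((2 * n%:R) / n.+1%:R) :> R.
      by field; rewrite !gt_eqF//= ltr0n.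
    rewrite ler_peMr// ler_pdivlMr ?ltr0n// mul1r -natr1 mulr_natl mulr2n.
    by rewrite lerD.
  by rewrite ler_wpM2l// !mulr_ge0// ?invr_ge0// ltW.
- exact: cvg_cst.
- rewrite -[X in _ --> X](mul0r 2) -(mulr0 c^-1).
  apply: cvgM; last exact: cvg_cst.
  by apply: cvgM; [exact: cvg_cst|exact: cvg_harmonic].
Unshelve. all: by end_near. Qed.

Variables (s : R).
Hypothesis s0 : 0 < s.
Let N : probability (measurableTypeR R) R := normal_prob 0 s.
Let pdf := normal_pdf 0 s.

Let s_neq0 : s != 0. Proof. by rewrite gt_eqF. Qed.

(** On a compact interval f is bounded, so integrability for the normal law is immediate; the
    Radon-Nikodym derivative is then identified almost everywhere with the density. *)
Lemma integral_normal_prob_itv (f : R -> R) (a b : R) :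
  {within `[a, b], continuous f} ->
  (\int[N]_(x in `[a, b]) (f x)%:E =
   \int[mu]_(x in `[a, b]) (f x * pdf x)%:E)%E.
Proof.
move=> cf.
have mf : measurable_fun `[a, b] (EFin \o f).
  by apply/measurable_EFinP; exact: subspace_continuous_measurable_fun.
have [L L0 HL] := within_bounded cf.
have iN : N.-integrable `[a, b] (EFin \o f).
  apply: (@integrable_le _ _ _ N _ _ f (fun=> L)) => //; first exact/measurable_EFinP.
  apply: (@integrable_cstr _ _ _ N `[a, b]%classic (measurable_itv _) L).
  exact: le_lt_trans (probability_le1 N (measurable_itv _)) (ltry 1).
rewrite -(Radon_Nikodym_change_of_variables (normal_prob_dominates 0 s))//=.
under [RHS]eq_integral do rewrite EFinM.
have mpdf : measurable_fun `[a, b] (EFin \o pdf).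
  by apply/measurable_funTS/measurable_EFinP; exact: measurable_normal_pdf.
apply: ae_eq_integral => //.
- apply: emeasurable_funM => //; apply: (measurable_int mu).
  apply: (integrableS _ _ (@subsetT _ _)) => //=.
  by apply: Radon_Nikodym_integrable; exact: normal_prob_dominates.
- exact: emeasurable_funM.
- apply: ae_eqe_mul2l => /=.
  rewrite Radon_NikodymE//=; first exact: normal_prob_dominates.
  move=> abmu; case: cid => /= h [h1 h2 h3].
  apply: integral_ae_eq => //=; first exact: integrableS h2.
  by move=> E E01 mE; rewrite -h3.
Qed.

Let pdfE x : pdf x = normal_peak s * expR (- x ^+ 2 / (s ^+ 2 *+ 2)).
Proof. by rewrite /pdf normal_pdfE// /normal_fun subr0. Qed.

Let is_derive_pdf (x : R) : is_derive x 1 pdf (- (x / s ^+ 2) * pdf x).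
Proof.
rewrite (_ : pdf = fun x => normal_peak s * expR (- x ^+ 2 / (s ^+ 2 *+ 2))).
  have d1 : is_derive x 1 (fun x : R => - x ^+ 2 / (s ^+ 2 *+ 2)) (- (x / s ^+ 2)).
    have d0 := is_deriveZ (- (s ^+ 2 *+ 2)^-1) (is_deriveX 2 (is_derive_id x (1 : R))).
    rewrite (_ : (fun _ => _) = - (s ^+ 2 *+ 2)^-1 \*: (id ^+ 2 : R -> R)).
      by apply: is_derive_eq d0 _; rewrite /GRing.scale /=; field; rewrite s_neq0.
    apply/funext => y.
    by rewrite [RHS](_ : _ = - (s ^+ 2 *+ 2)^-1 * y ^+ 2)// mulNr [RHS]mulNr mulrC.
  have d2 := is_derive1_comp (is_derive_expR _) d1.
  apply: is_derive_eq (is_deriveM (is_derive_cst (normal_peak s) x (1 : R)) d2) _.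
  by rewrite /GRing.scale /=; ring.
by apply/funext => y; rewrite pdfE.
Qed.

Let cvg_pdf : (n%:R * pdf n%:R) @[n --> \oo] --> (0 : R).
Proof.
under eq_fun do rewrite pdfE mulrCA.
have h : (n%:R * expR (- n%:R ^+ 2 / (s ^+ 2 *+ 2))) @[n --> \oo] --> (0 : R).
  have := @expR_sqr_cvg0 (s ^+ 2 *+ 2)^-1.
  rewrite invr_gt0 pmulrn_lgt0// exprn_gt0// => /(_ isT) h.
  rewrite (_ : (fun _ => _) =
    fun n : nat => n%:R * expR (- (s ^+ 2 *+ 2)^-1 * n%:R ^+ 2)); first exact: h.
  by apply/funext => n; rewrite mulNr [in RHS]mulNr (mulrC (_ ^-1)).
have := cvgM (cvg_cst (normal_peak s)) h; rewrite mulr0; exact.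
Qed.

(** The added terms make the integrand nonnegative, so that monotone convergence along [-n, n]
    applies before any integrability is known. The value c = 0 yields the variance, and c = 1, by
    difference, the mean. *)
Lemma normal_moments (c : R) : (forall x : R, 0 <= x ^+ 2 + 1 + c * x) ->
  (\int[N]_x (x ^+ 2 + 1 + c * x)%:E = (s ^+ 2 + 1)%:E)%E.
Proof.
move=> g0; pose g (x : R) := x ^+ 2 + 1 + c * x.
have cg : continuous g.
  move=> x; apply: cvgD; last by apply: cvgM; [exact: cvg_cst|exact: cvg_id].
  by apply: cvgD; [exact: exprn_continuous|exact: cvg_cst].
have cpdf : continuous pdf.
  by apply: continuous_normal_pdf; rewrite gt_eqF.
pose F n : set (measurableTypeR R) := `[- n%:R, n%:R]%classic.
have mF n : measurable (F n) by exact: measurable_itv.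
have UF : \bigcup_n F n = setT.
  apply/seteqP; split => // x _.
  exists (Num.truncn `|x|).+1 => //; rewrite /F /= in_itv/= -ler_norml.
  by rewrite ltW// truncnS_gt.
have ndF : nondecreasing_seq F.
  move=> m n mn; apply/subsetPset => x; rewrite /F /= !in_itv/= -!ler_norml.
  by move=> h; rewrite (le_trans h)// ler_nat.
have key n : (\int[N]_(x in F n.+1) (g x)%:E =
    (s ^+ 2 + 1)%:E * N (F n.+1) + (- (2 * s ^+ 2 * (n.+1%:R * pdf n.+1%:R)))%:E)%E.
  have n0 : - n.+1%:R < (n.+1%:R : R) by rewrite gtrN.
  rewrite integral_normal_prob_itv; last exact: continuous_subspaceT.
  (* A primitive of (x^2 - s^2 + c x) pdf, because pdf' = -(x / s^2) pdf. In the difference of its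
     end values [c] cancels, [pdf] being even, and what is left is a multiple of n pdf(n), which
     tends to 0. *)
  pose G x := - (s ^+ 2 * ((x + c) * pdf x)).
  have dG (x : R) : is_derive x 1 G ((x ^+ 2 - s ^+ 2 + c * x) * pdf x).
    have d1 : is_derive x 1 (fun x : R => x + c) (1 + 0) by exact: is_deriveD.
    have d2 := is_deriveM d1 (is_derive_pdf x).
    have d3 := is_deriveN (is_deriveZ (s ^+ 2) d2).
    apply: is_derive_eq d3 _; rewrite /GRing.scale /=.
    by field; rewrite s_neq0.
  have NE : N (F n.+1) = (\int[mu]_(x in F n.+1) (pdf x)%:E)%E by [].
  have ipdf : mu.-integrable (F n.+1) (EFin \o pdf).
    by apply: within_integrable; exact: continuous_subspaceT.
  have E1 : (\int[mu]_(x in F n.+1) ((x ^+ 2 - s ^+ 2 + c * x) * pdf x)%:E =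
      (- (2 * s ^+ 2 * (n.+1%:R * pdf n.+1%:R)))%:E)%E.
    rewrite (@continuous_FTC2 _ _ G)//.
    - rewrite -EFinB /G; congr EFin.
      have -> : pdf (- n.+1%:R) = pdf n.+1%:R by rewrite !pdfE sqrrN.
      ring.
    - apply: continuous_subspaceT => x; apply: cvgM; last exact: cpdf.
      apply: cvgD; last by apply: cvgM; [exact: cvg_cst|exact: cvg_id].
      by apply: cvgD; [exact: exprn_continuous|exact: cvg_cst].
    - split => [x _||]; first by have [] := dG x.
        by apply: cvg_at_right_filter; apply: derivable_cvg; have [] := dG (- n.+1%:R).
      by apply: cvg_at_left_filter; apply: derivable_cvg; have [] := dG n.+1%:R.
    - by move=> x _; rewrite derive1E; have [_ ->] := dG x.
  rewrite -E1 NE -integralZl//.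
  rewrite -integralD//.
  - apply: eq_integral => x _; rewrite -EFinM -EFinD; congr EFin; rewrite /g; ring.
  - by apply: integrableZl.
  - apply: within_integrable; apply: continuous_subspaceT => x.
    apply: cvgM; last exact: cpdf.
    apply: cvgD; last by apply: cvgM; [exact: cvg_cst|exact: cvg_id].
    by apply: cvgD; [exact: exprn_continuous|exact: cvg_cst].
have mg : measurable_fun (setT : set (measurableTypeR R)) (EFin \o g).
  by apply/measurable_EFinP; exact: continuous_measurable_fun.
have cv1 := @ge0_nondecreasing_set_cvg_integral _ _ _ F (EFin \o g) N ndF mF
  (fun i => measurable_funTS mg) (fun i x _ => g0 x).
have cv2 : (fun n => N (F n)) @ \oo --> 1%E.
  have := nondecreasing_cvg_mu (mu := N) mF _ ndF.
  rewrite UF; rewrite [X in _ --> X](_ : _ = 1%E); last exact: probability_setT.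
  by apply.
rewrite UF -cvg_shiftS /= in cv1.
have /cvg_lim <- := cv1; last by [].
apply: cvg_lim => //; under eq_fun do rewrite key.
have c1 : ((s ^+ 2 + 1)%:E * N (F n.+1))%E @[n --> \oo] -->
    ((s ^+ 2 + 1)%:E * 1)%E.
  by apply: cvgeZl => //; rewrite (cvg_shiftS (fun n => N (F n))).
have c2 : (- (2 * s ^+ 2 * (n.+1%:R * pdf n.+1%:R)))%:E @[n --> \oo] --> 0%:E.
  apply/cvg_EFin; first by near=> n.
  have h : (n.+1%:R * pdf n.+1%:R) @[n --> \oo] --> (0 : R).
    by rewrite (cvg_shiftS (fun n => n%:R * pdf n%:R)).
  by have := cvgN (cvgM (cvg_cst (2 * s ^+ 2)) h); rewrite mulr0 oppr0; exact.
by have := cvgeD _ c1 c2; rewrite mule1 adde0; apply.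
Unshelve. all: by end_near. Qed.

End NormalMoments.

(** * The filtration and the Brownian increments *)

Section SigmaAlgebras.
Context {R : realType} {d : measure_display} {Omega : measurableType d}.

(** Stated for a bare family of sets, as the filtrations are such families; [meas_wrtP] reads a
    generated one as a measurable type, where the usual closure properties are available. *)
Definition meas_wrt (F : set (set Omega)) (X : Omega -> R) : Prop :=
  forall S, measurable S -> F (X @^-1` S).

Lemma meas_wrtP (G : set (set Omega)) (X : Omega -> R) :
  meas_wrt <<s G >> X <->
  measurable_fun setT (X : g_sigma_algebraType G -> R).
Proof.
split=> [mX _ S mS|mX S mS]; first by rewrite setTI; exact: mX.
by rewrite -[_ @^-1` _]setTI; exact: (mX measurableT S mS).
Qed.

Lemma meas_wrt_sub (F F' : set (set Omega)) X :
  F `<=` F' -> meas_wrt F X -> meas_wrt F' X.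
Proof. by move=> FF' mX S mS; exact/FF'/mX. Qed.

Lemma meas_wrt_measurable (F : set (set Omega)) X :
  F `<=` measurable -> meas_wrt F X -> measurable_fun setT X.
Proof. by move=> Fm mX _ S mS; rewrite setTI; exact/Fm/mX. Qed.

Lemma sigma_of_sub (I : Type) (D : set I) (X : I -> Omega -> R) F :
  sigma_algebra setT F -> (forall i, D i -> meas_wrt F (X i)) ->
  sigma_of D X `<=` F.
Proof.
move=> sF mX; apply: smallest_sub => // A [i Di [S mS <-]].
by rewrite setTI; exact: mX.
Qed.

Lemma meas_wrt_sigma_of (I : Type) (D : set I) (X : I -> Omega -> R) i :
  D i -> meas_wrt (sigma_of D X) (X i).
Proof.
move=> Di S mS; apply: sub_sigma_algebra; exists i => //; exists S => //.
by rewrite setTI.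
Qed.

Lemma sigma_algebra_gen (G : set (set Omega)) : sigma_algebra setT <<s G >>.
Proof. exact: smallest_sigma_algebra. Qed.

Lemma gen_setT (G : set (set Omega)) : <<s G >> setT.
Proof. exact: (@measurableT _ (g_sigma_algebraType G)). Qed.

Lemma gen_setI (G : set (set Omega)) A B :
  <<s G >> A -> <<s G >> B -> <<s G >> (A `&` B).
Proof. exact: (@measurableI _ (g_sigma_algebraType G)). Qed.

End SigmaAlgebras.

Section Filtration.
Context {R : realType} {d : measure_display} {Omega : measurableType d}.
Variable Pr : probability Omega R.
Variables (n N : nat) (x0 : 'I_N -> Omega -> 'cV[R]_n) (W : 'I_N -> R -> Omega -> R).
Hypothesis hW : forall i, brownian_motion Pr (W i).
Hypothesis hWindep :
  mutually_independent Pr (fun i => sigma_of `[0, +oo[ (W i)).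
Hypothesis hx0meas : forall i, measurable_vec (x0 i).
Hypothesis hx0W : independent2 Pr
  <<s \bigcup_(i in [set: 'I_N]) sigma_vec (x0 i) >>
  <<s \bigcup_(i in [set: 'I_N]) sigma_of `[0, +oo[ (W i) >>.

Local Notation Ft := (filtration x0 W).

Lemma filtration_W i s t : 0 <= s <= t -> meas_wrt (Ft t) (W i s).
Proof.
move=> st S mS; apply: sub_sigma_algebra; exists i => //.
apply: sub_sigma_algebra; right; apply: (@meas_wrt_sigma_of _ _ _ _ `[0, t]%classic) => //=.
Qed.

Lemma filtration_x0 i k t : meas_wrt (Ft t) (fun w => x0 i w k 0).
Proof.
move=> S mS; apply: sub_sigma_algebra; exists i => //.
apply: sub_sigma_algebra; left.
exact: (@meas_wrt_sigma_of _ _ _ _ setT (fun k w => x0 i w k 0) k).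
Qed.

Lemma filtration_sub (F : set (set Omega)) t : sigma_algebra setT F ->
  (forall i s, 0 <= s <= t -> meas_wrt F (W i s)) ->
  (forall i k, meas_wrt F (fun w => x0 i w k 0)) -> Ft t `<=` F.
Proof.
move=> sF FW Fx; apply: smallest_sub => // A [i _]; apply: smallest_sub => // {}A [].
  by apply: sigma_of_sub => // k _; exact: Fx.
by apply: sigma_of_sub => // s /=; rewrite in_itv/=; exact: FW.
Qed.

Lemma filtration_mono s t : s <= t -> Ft s `<=` Ft t.
Proof.
move=> st; apply: filtration_sub => [|i u /andP[u0 us]|i k].
- exact: sigma_algebra_gen.
- by apply: filtration_W; rewrite u0 (le_trans us).
- exact: filtration_x0.
Qed.

Lemma filtration_measurable t : Ft t `<=` measurable.
Proof.
apply: filtration_sub => [|i s /andP[s0 _] S mS|i k S mS].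
- exact: sigma_algebra_measurable.
- by rewrite -[_ @^-1` _]setTI; apply: (brownian_measurable (hW i) s0).
- by rewrite -[_ @^-1` _]setTI; apply: hx0meas.
Qed.

Lemma brownian_sub i (D : set R) : D `<=` `[0, +oo[ ->
  sigma_of D (W i) `<=` sigma_of `[0, +oo[ (W i).
Proof.
move=> D0; apply: sigma_of_sub => [|t /D0 Dt]; first exact: sigma_algebra_gen.
exact: meas_wrt_sigma_of.
Qed.

Lemma brownian_all_measurable i : sigma_of `[0, +oo[ (W i) `<=` measurable.
Proof.
apply: sigma_of_sub; first exact: sigma_algebra_measurable.
move=> t /=; rewrite in_itv/= andbT => t0 S mS.
by rewrite -[_ @^-1` _]setTI; exact: (brownian_measurable (hW i) t0).
Qed.

Lemma increment_sub i (s t : R) : 0 <= s -> 0 <= t ->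
  sigma_of setT (fun (_ : unit) w => W i t w - W i s w) `<=`
  sigma_of `[0, +oo[ (W i).
Proof.
move=> s0 t0; apply: sigma_of_sub => [|_ _]; first exact: sigma_algebra_gen.
apply/meas_wrtP; apply: measurable_funB; apply/meas_wrtP.
  by apply: meas_wrt_sigma_of => /=; rewrite in_itv/= andbT.
by apply: meas_wrt_sigma_of => /=; rewrite in_itv/= andbT.
Qed.

(* The rectangles C0 `&` bigcap_j Dj form a pi-system generating the
   filtration at time t; on them, independence is a product of the
   hypotheses. *)
Lemma filtration_indep i (t b : R) : 0 <= t -> t < b ->
  independent2 Pr (Ft t) (sigma_of setT (fun (_ : unit) w => W i b w - W i t w)).
Proof.
move=> t0 tb A E FA EE; have b0 : 0 <= b by rewrite (le_trans t0)// ltW.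
have E0 : sigma_of `[0, +oo[ (W i) E by exact: (increment_sub t0 b0).
have mE : measurable E by exact: brownian_all_measurable E0.
pose S0 := <<s \bigcup_(i in [set: 'I_N]) sigma_vec (x0 i) >>.
pose SW j := sigma_of `[0, t] (W j).
pose Gt := [set A | exists C (D : 'I_N -> set Omega),
  [/\ S0 C, forall j, SW j (D j) & A = C `&` \bigcap_(j in [set: 'I_N]) D j]].
have S0m : S0 `<=` measurable.
  apply: smallest_sub; first exact: sigma_algebra_measurable.
  move=> B [j _]; apply: sigma_of_sub; first exact: sigma_algebra_measurable.
  by move=> k _ S mS; rewrite -[_ @^-1` _]setTI; apply: hx0meas.
have SWall j : SW j `<=` sigma_of `[0, +oo[ (W j).
  by apply: brownian_sub => s /=; rewrite !in_itv/= andbT => /andP[].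
have bcI (D D' : 'I_N -> set Omega) : \bigcap_(j in [set: 'I_N]) D j `&`
    \bigcap_(j in [set: 'I_N]) D' j = \bigcap_(j in [set: 'I_N]) (D j `&` D' j).
  by rewrite bigcapI.
have GtI : setI_closed Gt.
  move=> B B' [C [D [SC SD ->]]] [C' [D' [SC' SD' ->]]].
  exists (C `&` C'), (fun j => D j `&` D' j); split.
  - exact: gen_setI.
  - by move=> j; apply: gen_setI; [exact: SD|exact: SD'].
  - by rewrite -bcI setIACA.
have bcm (D : 'I_N -> set Omega) : (forall j, sigma_of `[0, +oo[ (W j) (D j)) ->
    <<s \bigcup_(i in [set: 'I_N]) sigma_of `[0, +oo[ (W i) >>
      (\bigcap_(j in [set: 'I_N]) D j).
  move=> mD; pose GG := \bigcup_(i in [set: 'I_N]) sigma_of `[0, +oo[ (W i).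
  apply: (@fin_bigcap_measurable _ (g_sigma_algebraType GG)) => // j _.
  by apply: sub_sigma_algebra; exists j.
have Wm : <<s \bigcup_(i in [set: 'I_N]) sigma_of `[0, +oo[ (W i) >> `<=` measurable.
  apply: smallest_sub; first exact: sigma_algebra_measurable.
  by move=> B [j _]; exact: brownian_all_measurable.
have Gtm : Gt `<=` measurable.
  move=> B [C [D [SC SD ->]]]; apply: measurableI; first exact: S0m.
  by apply: Wm; apply: bcm => j; apply: SWall; exact: SD.
have key C (D : 'I_N -> set Omega) : S0 C -> (forall j, sigma_of `[0, +oo[ (W j) (D j)) ->
    Pr (C `&` \bigcap_(j in [set: 'I_N]) D j) = (Pr C * \prod_(j < N) Pr (D j))%E.
  by move=> SC SD; rewrite hx0W// ?hWindep//; exact: bcm.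
have GE B : Gt B -> Pr (B `&` E) = (Pr B * Pr E)%E.
  move=> [C [D [SC SD ->]]].
  (* [E] lies in the sigma-algebra of [W i], so it is absorbed into the i-th factor and the product
     formula [key] applies a second time; the Brownian property then splits that factor. *)
  pose D' j := if j == i then D j `&` E else D j.
  have -> : (C `&` \bigcap_(j in [set: 'I_N]) D j) `&` E =
      C `&` \bigcap_(j in [set: 'I_N]) D' j.
    rewrite -setIA; congr (_ `&` _); apply/seteqP; split=> [w [Dw Ew] j _|w Dw].
      by rewrite /D'; case: eqP => _; [split => //|]; exact: Dw.
    split=> [j _|]; last by have := Dw i I; rewrite /D' eqxx => -[].
    by have := Dw j I; rewrite /D'; case: eqP => // _ [].
  rewrite key// ?key//; last 2 first.
  - by move=> j; exact: SWall.
  - by move=> j; rewrite /D'; case: eqP => [->|_]; [apply: gen_setI => //|]; exact: SWall.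
  rewrite -muleA; congr (_ * _)%E.
  rewrite (bigD1 i)//= [in RHS](bigD1 i)//= {1}/D' eqxx.
  rewrite (brownian_indep (hW i) t0 tb (SD i) EE) muleAC; congr (_ * _)%E.
  congr (_ * _)%E; apply: eq_bigr => j ji.
  by rewrite /D' (negbTE ji).
have Fsub : Ft t `<=` <<s Gt >>.
  apply: filtration_sub => [|j s st S mS|j k S mS].
  - exact: sigma_algebra_gen.
  - apply: sub_sigma_algebra.
    exists setT, (fun l => if l == j then W j s @^-1` S else setT); split.
    + exact: gen_setT.
    + move=> l; case: eqP => [->|_]; last exact: gen_setT.
      by apply: meas_wrt_sigma_of => //=; rewrite in_itv.
    + rewrite setTI; apply/seteqP; split=> [w Sw l _|w /(_ j I)].
        by case: eqP.
      by rewrite eqxx.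
  - apply: sub_sigma_algebra; exists ((fun w => x0 j w k 0) @^-1` S), (fun=> setT); split.
    + apply: sub_sigma_algebra; exists j => //.
      exact: (@meas_wrt_sigma_of _ _ _ _ setT (fun k w => x0 j w k 0) k).
    + by move=> l; exact: gen_setT.
    + by rewrite bigcapT ?setIT//; apply/seteqP; split.
(* For fixed [E] both sides are finite measures in [A]: the restriction of [Pr] to [E], and [Pr]
   scaled by the probability of [E]. They agree on the pi-system. *)
pose pE : {nonneg R} := NngNum (fine_ge0 (measure_ge0 Pr E)).
have pEE : (pE%:num%:E = Pr E)%E by rewrite /= fineK// fin_num_measure.
suff : mrestr Pr mE A = mscale pE Pr A by rewrite /mrestr /mscale pEE muleC.
apply: (@g_sigma_algebra_measure_unique _ R Omega Gt Gtm (fun=> setT) _ _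
  (mrestr Pr mE) (mscale pE Pr) GtI _ _ A (Fsub A FA)).
- move=> _; exists setT, (fun=> setT); split.
  + exact: gen_setT.
  + by move=> j; exact: gen_setT.
  + by rewrite setTI; apply/seteqP; split.
- by apply/seteqP; split => // w _; exists 0%N.
- by move=> B GB; have := GE B GB; rewrite muleC -pEE; exact.
- move=> _; suff : (Pr (setT `&` E) < +oo)%E by [].
  by rewrite setTI (le_lt_trans (probability_le1 Pr mE))// ltry.
Qed.

Lemma brownian_increment_moments i (a b : R) : 0 <= a -> a <= b ->
  [/\ L2 Pr setT (fun w => W i b w - W i a w),
      \int[Pr]_w (W i b w - W i a w) = 0 &
      \int[Pr]_w ((W i b w - W i a w) ^+ 2) = b - a].
Proof.
move=> a0; rewrite le_eqVlt => /predU1P[<-|ab].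
  have E : (fun w => W i a w - W i a w) = fun=> 0 by apply/funext => w; rewrite subrr.
  rewrite E; split; first exact: L2_0.
    by rewrite Rintegral_cst// mul0r.
  under eq_Rintegral do rewrite subrr expr0n/=.
  by rewrite Rintegral_cst// mul0r subrr.
have b0 : 0 <= b by rewrite (le_trans a0)// ltW.
pose D w := W i b w - W i a w.
have mD : measurable_fun setT D.
  by apply: measurable_funB; exact: (brownian_measurable (hW i)).
pose s := Num.sqrt (b - a).
have s0 : 0 < s by rewrite sqrtr_gt0 subr_gt0.
have s2 : s ^+ 2 = b - a by rewrite sqr_sqrtr// subr_ge0 ltW.
have tr (c : R) : (forall x : R, 0 <= x ^+ 2 + 1 + c * x) ->
    (\int[Pr]_w (D w ^+ 2 + 1 + c * D w)%:E = (s ^+ 2 + 1)%:E)%E.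
  move=> c0; rewrite -(normal_moments s0 c0).
  pose D' : {mfun Omega >-> measurableTypeR R} :=
    MeasurableFun.Pack (MeasurableFun.Class
      (@isMeasurableFun.Build _ _ Omega (measurableTypeR R) D mD)).
  have mg : measurable_fun setT (fun x : measurableTypeR R => (x ^+ 2 + 1 + c * x)%:E).
    apply/measurable_EFinP; apply: measurable_funD; last exact: measurable_funM.
    by apply: measurable_funD => //; exact: measurable_funX.
  rewrite -[LHS](_ : (\int[distribution Pr D']_x (x ^+ 2 + 1 + c * x)%:E = _)%E).
    apply: eq_measure_integral => S mS _.
    by have := brownian_normal (hW i) a0 ab mS.
  rewrite /distribution ge0_integral_pushforward// => x _.
  by rewrite lee_fin.
have h0 : forall x : R, 0 <= x ^+ 2 + 1 + 0 * x.
  by move=> x; rewrite mul0r addr0 addr_ge0// sqr_ge0.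
have h1 : forall x : R, 0 <= x ^+ 2 + 1 + 1 * x.
  by move=> x; have := sqr_ge0 (x + 1); have := sqr_ge0 x; nra.
(* The first gives square integrability and the variance; subtracting it from the second leaves the
   mean. *)
have t0 := tr 0 h0; have t1 := tr 1 h1.
have mD2 : measurable_fun setT (fun w => D w ^+ 2) by exact: measurable_funX.
have LD : L2 Pr setT D.
  split => //; rewrite (@le_lt_trans _ _ (s ^+ 2 + 1)%:E) ?ltry// -t0.
  apply: ge0_le_integral => //.
  - by move=> w _; rewrite lee_fin sqr_ge0.
  - exact/measurable_EFinP.
  - apply/measurable_EFinP; apply: measurable_funD; last exact: measurable_funM.
    exact: measurable_funD.
  - by move=> w _; rewrite lee_fin mul0r addr0 lerDl.
have PrT : (Pr setT < +oo)%E by rewrite probability_setT ltry.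
have iD := L2_integrable measurableT PrT LD.
have iD2 := L2_sqr LD.
have i1 : Pr.-integrable setT (EFin \o (fun=> 1)) by exact: integrable_cstr.
have t0R : \int[Pr]_w (D w ^+ 2 + 1 + 0 * D w) = s ^+ 2 + 1 by rewrite /Rintegral t0.
have t1R : \int[Pr]_w (D w ^+ 2 + 1 + 1 * D w) = s ^+ 2 + 1 by rewrite /Rintegral t1.
have E1 : \int[Pr]_w (1 : R) = 1.
  by rewrite Rintegral_cst// mul1r [X in fine X](@probability_setT _ _ _ Pr).
have h := RintegralD measurableT iD2 i1; rewrite E1 in h.
have E2 : \int[Pr]_w (D w ^+ 2) = s ^+ 2.
  apply: (@addIr _ 1); rewrite -t0R -h.
  by apply: eq_Rintegral => w _; rewrite mul0r addr0.
split => //; last by rewrite E2.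
have h' := RintegralD measurableT (integrable_addr measurableT iD2 i1) iD.
apply: (@addrI _ (s ^+ 2 + 1)); rewrite addr0 -{2}t1R -{1}E2 -h -h'.
by apply: eq_Rintegral => w _; rewrite mul1r.
Qed.

Lemma brownian_orthogonal i (t b : R) (X : Omega -> R) : 0 <= t -> t <= b ->
  meas_wrt (Ft t) X -> L2 Pr setT X ->
  \int[Pr]_w (X w * (W i b w - W i t w)) = 0.
Proof.
move=> t0; rewrite le_eqVlt => /predU1P[<-|tb] FX LX.
  under eq_Rintegral do rewrite subrr mulr0.
  by rewrite Rintegral_cst// mul0r.
have [LD ED _] := brownian_increment_moments i t0 (ltW tb).
apply: (@indep_mul_mean0 _ _ _ _ (Ft t)) => //.
- by case: LX.
- by case: LD.
- exact: filtration_indep.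
Qed.

End Filtration.

(** * The stochastic integral *)

Section Gram.
Context {R : realType} {d1 d2 : measure_display}
  {T1 : measurableType d1} {T2 : measurableType d2}.
Variables (m1 : {measure set T1 -> \bar R}) (m2 : {measure set T2 -> \bar R}).
Variables (D1 : set T1) (D2 : set T2).
Hypotheses (mD1 : measurable D1) (mD2 : measurable D2).

Lemma Rintegral_sqr_sum d (T : measurableType d) (m : {measure set T -> \bar R})
    (D : set T) (I : finType) (F : I -> T -> R) (c : I -> R) :
  measurable D -> (forall i, L2 m D (F i)) ->
  \int[m]_(x in D) ((\sum_i c i * F i x) ^+ 2) =
  \sum_i \sum_j c i * c j * \int[m]_(x in D) (F i x * F j x).
Proof.
move=> mD LF.
have iF i j : m.-integrable D (EFin \o (fun x => F i x * F j x)) by exact: L2_mul.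
have iF2 i j : m.-integrable D (EFin \o (fun x => c i * c j * (F i x * F j x))).
  exact: integrable_scale.
transitivity (\int[m]_(x in D) (\sum_i \sum_j c i * c j * (F i x * F j x))).
  apply: eq_Rintegral => x _; rewrite expr2 mulr_suml; apply: eq_bigr => i _.
  by rewrite mulr_sumr; apply: eq_bigr => j _; rewrite mulrACA.
rewrite Rintegral_sumr// => [|i]; last exact: integrable_sumr.
apply: eq_bigr => i _; rewrite Rintegral_sumr//.
by apply: eq_bigr => j _; rewrite RintegralZl.
Qed.

(** Only inner products enter, so equal Gram matrices suffice, even for the nested intervals to
    which this is applied. *)
Lemma gram_isometry (I : finType) (F : I -> T1 -> R) (G : I -> T2 -> R)
    (c : I -> R) :
  (forall i, L2 m1 D1 (F i)) -> (forall i, L2 m2 D2 (G i)) ->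
  (forall i j, \int[m1]_(x in D1) (F i x * F j x) =
               \int[m2]_(x in D2) (G i x * G j x)) ->
  \int[m1]_(x in D1) ((\sum_i c i * F i x) ^+ 2) =
  \int[m2]_(x in D2) ((\sum_i c i * G i x) ^+ 2).
Proof.
move=> LF LG FG; rewrite !Rintegral_sqr_sum//.
by apply: eq_bigr => i _; apply: eq_bigr => j _; rewrite FG.
Qed.

End Gram.

Section Steps.
Context {R : realType} {d : measure_display} {Omega : measurableType d}.
Variable Pr : probability Omega R.
Variables (n N : nat) (x0 : 'I_N -> Omega -> 'cV[R]_n) (W : 'I_N -> R -> Omega -> R).
Hypothesis hW : forall i, brownian_motion Pr (W i).
Hypothesis hWindep :
  mutually_independent Pr (fun i => sigma_of `[0, +oo[ (W i)).
Hypothesis hx0meas : forall i, measurable_vec (x0 i).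
Hypothesis hx0W : independent2 Pr
  <<s \bigcup_(i in [set: 'I_N]) sigma_vec (x0 i) >>
  <<s \bigcup_(i in [set: 'I_N]) sigma_of `[0, +oo[ (W i) >>.
Variables (T : R) (i0 : 'I_N).
Hypothesis T0 : 0 <= T.

Local Notation Ft := (filtration x0 W).
Local Notation mu := (@lebesgue_measure R).

(** Increments from time 0, because [W 0] vanishes only almost surely. For u <= v the second factor
    is the first plus an increment orthogonal to it. *)
Lemma brownian_covariance (u v : R) : 0 <= u -> 0 <= v ->
  \int[Pr]_w ((W i0 u w - W i0 0 w) * (W i0 v w - W i0 0 w)) = Num.min u v.
Proof.
wlog uv : u v / u <= v.
  move=> h u0 v0; have [uv|/ltW vu] := leP u v; first by rewrite h// min_l.
  by under eq_Rintegral do rewrite mulrC; rewrite h// min_l.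
move=> u0 v0; rewrite min_l//.
have [L1 _ E1] := brownian_increment_moments hW i0 (lexx 0) u0.
have [L2v _ _] := brownian_increment_moments hW i0 u0 uv.
transitivity (\int[Pr]_w ((W i0 u w - W i0 0 w) ^+ 2 +
    (W i0 u w - W i0 0 w) * (W i0 v w - W i0 u w))).
  by apply: eq_Rintegral => w _; ring.
rewrite RintegralD//; [|exact: L2_sqr|exact: L2_mul].
rewrite E1 subr0 (brownian_orthogonal hW hWindep hx0meas hx0W)// ?addr0//.
apply/meas_wrtP; apply: measurable_funB; apply/meas_wrtP; apply: filtration_W.
  by rewrite u0 lexx.
by rewrite lexx.
Qed.

Lemma indic_covariance (t u v : R) : 0 <= u -> 0 <= v -> u <= t -> v <= t ->
  \int[mu]_(s in `[0, t]) (\1_(`]0, u]%classic) s * \1_(`]0, v]%classic) s) =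
  Num.min u v.
Proof.
move=> u0 v0 ut vt.
have E : `]0%R, u]%classic `&` `]0%R, v]%classic = `]0%R, Num.min u v]%classic.
  apply/seteqP; split=> x /=; rewrite !in_itv/= le_min.
    by move=> [/andP[-> ->] /andP[_ ->]].
  by move=> /and3P[-> -> ->].
transitivity (\int[mu]_(s in `[0, t]) (\1_(`]0%R, Num.min u v]%classic) s : R)).
  by apply: eq_Rintegral => s _; rewrite -E indicI.
rewrite /Rintegral integral_indic//= setIidl; last first.
  move=> x /=; rewrite !in_itv/= le_min => /and3P[x0' xu xv].
  by rewrite ltW//= (le_trans xu).
rewrite lebesgue_measure_itv/= lte_fin.
have [|] := ltP 0 (Num.min u v); first by rewrite oppr0 addr0.
by move=> h; apply/eqP; rewrite eq_le h le_min u0 v0.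
Qed.

Lemma lebesgue_itv_fin (a b : R) : (mu `[a, b]%classic < +oo)%E.
Proof.
by rewrite lebesgue_measure_itv/=; case: ifP => // _; rewrite -EFinB ltry.
Qed.

Lemma L2_indic (t u : R) : L2 mu `[0, t] (\1_(`]0, u]%classic) : R -> R).
Proof.
have m : measurable (`[0, t]%classic : set (measurableTypeR R)) by [].
apply: (@L2_le _ _ _ mu _ m _ (fun=> 1)); first exact: measurable_indic.
  apply: (L2_cst m 1); exact: lebesgue_itv_fin.
by move=> x _; rewrite normr1 indicE; case: (_ \in _); rewrite ?normr1 ?normr0.
Qed.

Lemma indic_itvB (a b t s : R) : 0 <= a -> a <= b -> 0 <= s <= t ->
  \1_(`]a, b]%classic) s =
  \1_(`]0, Num.min t b]%classic) s - \1_(`]0, Num.min t a]%classic) s :> R.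
Proof.
move=> a0 ab /andP[s0 st]; rewrite !indicE !mem_setE !in_itv/= !le_min st/=.
have [sa|sa] := leP s a => /=.
  by rewrite (le_trans sa ab) subrr.
by rewrite (le_lt_trans a0 sa) subr0.
Qed.

(* Step functions and their integrals as linear combinations, with the same
   coefficients, of 1_]0, u] and W u - W 0, whose Gram matrices agree. *)
Lemma step_representation (phi : step_fun n T) (l : 'I_n) (t : R) : 0 <= t <= T ->
  exists (I : finType) (u c : I -> R),
    [/\ forall i, 0 <= u i <= t,
        forall w, step_integral phi (W i0) t w l 0 =
          \sum_i c i * (W i0 (u i) w - W i0 0 w) &
        forall s, 0 <= s <= t -> step_eval phi s l 0 =
          \sum_i c i * \1_(`]0, u i]%classic) s].
Proof.
move=> /andP[t0 tT].
have tk0 k : 0 <= step_time phi k.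
  elim: k => [|k IH]; first exact: step_time_ge0.
  exact: le_trans IH (step_time_mono _ _).
exists ('I_(step_size phi) + 'I_(step_size phi))%type,
  (fun x : 'I_(step_size phi) + 'I_(step_size phi) =>
     match x with inl k => Num.min t (step_time phi k.+1)
                       | inr k => Num.min t (step_time phi k) end),
  (fun x : 'I_(step_size phi) + 'I_(step_size phi) =>
     match x with inl k => step_val phi k l 0
                       | inr k => - step_val phi k l 0 end); split.
- by move=> [k|k]; rewrite le_min t0 tk0/= ge_min lexx.
- move=> w; rewrite big_sumType /= -big_split /= /step_integral summxE.
  by apply: eq_bigr => k _; rewrite mxE; ring.
- move=> s st; rewrite big_sumType /= -big_split /= /step_eval summxE.
  apply: eq_bigr => k _; rewrite mxE (@indic_itvB _ _ t)//; first by ring.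
  exact: step_time_mono.
Qed.

(** The two index sets are put side by side, which avoids a common refinement of the partitions. *)
Lemma step_difference_representation (phi psi : step_fun n T) (l : 'I_n) (t : R) :
  0 <= t <= T ->
  exists (I : finType) (u c : I -> R),
    [/\ forall i, 0 <= u i <= t,
        forall w, step_integral phi (W i0) t w l 0 - step_integral psi (W i0) t w l 0 =
          \sum_i c i * (W i0 (u i) w - W i0 0 w) &
        forall s, 0 <= s <= t -> step_eval phi s l 0 - step_eval psi s l 0 =
          \sum_i c i * \1_(`]0, u i]%classic) s].
Proof.
move=> tT; have [I [u [c [u0 iE eE]]]] := step_representation phi l tT.
have [J [v [b [v0 jE fE]]]] := step_representation psi l tT.
exists (I + J)%type, (fun x : I + J => match x with inl i => u i | inr j => v j end),
  (fun x : I + J => match x with inl i => c i | inr j => - b j end); split.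
- by case.
- move=> w; rewrite big_sumType /= iE jE; congr (_ + _).
  by rewrite -sumrN; apply: eq_bigr => j _; rewrite mulNr.
- move=> s st; rewrite big_sumType /= eE// fE//; congr (_ + _).
  by rewrite -sumrN; apply: eq_bigr => j _; rewrite mulNr.
Qed.

Lemma brownian_L2 (u : R) : 0 <= u -> L2 Pr setT (fun w => W i0 u w - W i0 0 w).
Proof. by move=> u0; have [] := brownian_increment_moments hW i0 (lexx 0) u0. Qed.

Lemma step_difference_isometry (phi psi : step_fun n T) (l : 'I_n) (t : R) :
  0 <= t <= T ->
  L2 Pr setT (fun w => step_integral phi (W i0) t w l 0 - step_integral psi (W i0) t w l 0) /\
  \int[Pr]_w ((step_integral phi (W i0) t w l 0 - step_integral psi (W i0) t w l 0) ^+ 2)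
  = \int[mu]_(s in `[0, t]) ((step_eval phi s l 0 - step_eval psi s l 0) ^+ 2).
Proof.
move=> tT; have [I [u [c [u0 iE eE]]]] := step_difference_representation phi psi l tT.
have LF i : L2 Pr setT (fun w => W i0 (u i) w - W i0 0 w).
  by apply: brownian_L2; case/andP: (u0 i).
split.
  apply: (@L2_eq _ _ _ _ _ (fun w => \sum_i c i * (W i0 (u i) w - W i0 0 w))).
    by move=> w _; rewrite iE.
  by apply: L2_sum => // i; apply: L2Z.
under eq_Rintegral do rewrite iE.
rewrite (@gram_isometry _ _ _ _ _ Pr mu setT `[0, t]%classic _ _ I _
  (fun i => \1_(`]0, u i]%classic)))//.
- by apply: eq_Rintegral => s; rewrite inE/= in_itv/= => st; rewrite eE.
- by move=> i; exact: L2_indic.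
- move=> i j; have /andP[ui0 uit] := u0 i; have /andP[uj0 ujt] := u0 j.
  by rewrite brownian_covariance// indic_covariance.
Qed.

Lemma step_integral_L2 (phi : step_fun n T) (l : 'I_n) (t : R) : 0 <= t <= T ->
  L2 Pr setT (fun w => step_integral phi (W i0) t w l 0).
Proof.
move=> tT; have [I [u [c [u0 iE eE]]]] := step_representation phi l tT.
apply: (@L2_eq _ _ _ _ _ (fun w => \sum_i c i * (W i0 (u i) w - W i0 0 w))).
  by move=> w _; rewrite iE.
apply: L2_sum => // i; apply: L2Z => //.
by apply: brownian_L2; case/andP: (u0 i).
Qed.

Lemma step_integral_adapted (phi : step_fun n T) (l : 'I_n) (t : R) : 0 <= t <= T ->
  meas_wrt (Ft t) (fun w => step_integral phi (W i0) t w l 0).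
Proof.
move=> tT; have [I [u [c [u0 iE eE]]]] := step_representation phi l tT.
have -> : (fun w => step_integral phi (W i0) t w l 0) =
    fun w => \sum_i c i * (W i0 (u i) w - W i0 0 w) by apply/funext.
apply/meas_wrtP; apply: measurable_sum => i; apply: measurable_funM => //.
apply: measurable_funB; apply/meas_wrtP; apply: filtration_W => //.
by rewrite lexx; case/andP: tT.
Qed.

Lemma step_integral_orthogonal (phi : step_fun n T) (l : 'I_n) (s t : R)
    (X : Omega -> R) : 0 <= s -> s <= t -> t <= T ->
  meas_wrt (Ft s) X -> L2 Pr setT X ->
  \int[Pr]_w (X w * (step_integral phi (W i0) t w l 0 -
                     step_integral phi (W i0) s w l 0)) = 0.
Proof.
move=> s0 st tT FX LX.
(* Each increment between truncated times becomes one that starts at [s], trivial when b < s; [X] is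
   orthogonal to all of these. *)
have E (b : R) w : W i0 (Num.min t b) w - W i0 (Num.min s b) w =
    W i0 (Num.max s (Num.min t b)) w - W i0 s w.
  have [sb|bs] := leP s b.
    by rewrite max_r// le_min st.
  rewrite (min_r (le_trans (ltW bs) st)) max_l ?subrr//; exact: ltW.
have orth (b : R) : \int[Pr]_w (X w *
    (W i0 (Num.max s (Num.min t b)) w - W i0 s w)) = 0.
  by apply: (brownian_orthogonal hW hWindep hx0meas hx0W) => //; rewrite le_max lexx.
have Lb (b : R) : L2 Pr setT (fun w => W i0 (Num.max s (Num.min t b)) w - W i0 s w).
  by have [] := brownian_increment_moments hW i0 (a := s)
    (b := Num.max s (Num.min t b)) s0; rewrite ?le_max ?lexx.
have iXb (b : R) : Pr.-integrable setT (EFin \o (fun w => X w *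
    (W i0 (Num.max s (Num.min t b)) w - W i0 s w))) by exact: L2_mul.
pose G k w := step_val phi k l 0 * (X w *
   (W i0 (Num.max s (Num.min t (step_time phi k.+1))) w - W i0 s w)) -
   step_val phi k l 0 * (X w *
   (W i0 (Num.max s (Num.min t (step_time phi k))) w - W i0 s w)).
transitivity (\int[Pr]_w (\sum_(k < step_size phi) G k w)).
  apply: eq_Rintegral => w _; rewrite /step_integral !summxE -sumrB mulr_sumr.
  by apply: eq_bigr => k _; rewrite !mxE /G -!E; ring.
have iG k : Pr.-integrable setT (EFin \o G k).
  by apply: integrable_subr => //; exact: integrable_scale.
rewrite Rintegral_sumr// big1// => k _; rewrite /G.
rewrite RintegralB//; try exact: integrable_scale.
by rewrite !RintegralZl// !orth !mulr0 subrr.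
Qed.

End Steps.

Section L2Limits.
Context {d : measure_display} {T : measurableType d} {R : realType}.
Variables (mu : {measure set T -> \bar R}) (D : set T).
Hypothesis mD : measurable D.

Lemma L2_ae0 (X : T -> R) : L2 mu D X -> \int[mu]_(x in D) (X x ^+ 2) = 0 ->
  {ae mu, forall x, D x -> X x = 0}.
Proof.
move=> LX X0; have iX := L2_sqr LX.
have mX2 : measurable_fun D (EFin \o (fun x => X x ^+ 2)).
  by case/integrableP: iX.
have : ae_eq mu D (EFin \o (fun x => X x ^+ 2)) (cst 0%E).
  apply/(ae_eq_integral_abs mu mD mX2).
  rewrite (eq_integral (fun x => (X x ^+ 2)%:E)).
    by rewrite -EFin_Rintegral// X0.
  by move=> x _ /=; rewrite ger0_norm// sqr_ge0.
apply: filterS => x /= + Dx => /(_ Dx) [] /eqP.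
by rewrite sqrf_eq0 => /eqP.
Qed.

Lemma Rintegral_cvg0 (f : nat -> T -> R) :
  (fun m => \int[mu]_(x in D) (f m x)%:E)%E @ \oo --> 0%E ->
  (fun m => \int[mu]_(x in D) f m x) @ \oo --> (0 : R).
Proof. by move=> /fine_cvgP[_]. Qed.

Lemma integral_cvg0 (f : nat -> T -> R) :
  (forall m, mu.-integrable D (EFin \o f m)) ->
  (fun m => \int[mu]_(x in D) f m x) @ \oo --> (0 : R) ->
  (fun m => \int[mu]_(x in D) (f m x)%:E)%E @ \oo --> 0%E.
Proof.
move=> If cv; rewrite (_ : (fun _ => _) =
    fun m => (\int[mu]_(x in D) f m x)%:E).
  by apply/cvg_EFin => //; near=> m.
by apply/funext => m; rewrite EFin_Rintegral.
Unshelve. all: by end_near. Qed.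

Lemma cvg0_2D (u v : nat -> R) : u @ \oo --> (0 : R) -> v @ \oo --> (0 : R) ->
  2 * u m + 2 * v m @[m --> \oo] --> (0 : R).
Proof.
move=> cu cv.
have c1 : 2 * u m @[m --> \oo] --> 2 * (0 : R) by apply: cvgM => //; exact: cvg_cst.
have c2 : 2 * v m @[m --> \oo] --> 2 * (0 : R) by apply: cvgM => //; exact: cvg_cst.
by have := cvgD c1 c2; rewrite mulr0 addr0; exact.
Qed.

Lemma L2_sqrD_le (X Y : T -> R) : L2 mu D X -> L2 mu D Y ->
  \int[mu]_(x in D) ((X x + Y x) ^+ 2) <=
  2 * \int[mu]_(x in D) (X x ^+ 2) + 2 * \int[mu]_(x in D) (Y x ^+ 2).
Proof.
move=> LX LY; rewrite -!RintegralZl//; try exact: L2_sqr.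
rewrite -RintegralD//; try by apply: integrable_scale => //; exact: L2_sqr.
apply: le_Rintegral => //.
- by apply: L2_sqr; exact: L2D.
- by apply: integrable_addr => //; apply: integrable_scale => //; exact: L2_sqr.
- by move=> x _; have := sqr_ge0 (X x - Y x); nra.
Qed.

Lemma L2_sqr_ge0 (X : T -> R) : 0 <= \int[mu]_(x in D) (X x ^+ 2).
Proof. by apply: Rintegral_ge0 => x _; exact: sqr_ge0. Qed.

Lemma measurable_sqnorm k (X : T -> 'cV[R]_k) :
  (forall j, measurable_fun D (fun x => X x j 0)) ->
  measurable_fun D (fun x => sqnorm (X x)).
Proof.
by move=> mX; apply: measurable_sum => j; exact: measurable_funX.
Qed.

Lemma sqr_le_sqnorm k (z : 'cV[R]_k) j : z j 0 ^+ 2 <= sqnorm z.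
Proof.
by rewrite /sqnorm (bigD1 j)//= lerDl sumr_ge0// => i _; exact: sqr_ge0.
Qed.

Lemma sqnorm_cvg0_coord k (X : nat -> T -> 'cV[R]_k) j :
  (forall m j, measurable_fun D (fun x => X m x j 0)) ->
  (fun m => \int[mu]_(x in D) (sqnorm (X m x))%:E)%E @ \oo --> 0%E ->
  (fun m => \int[mu]_(x in D) (X m x j 0 ^+ 2)%:E)%E @ \oo --> 0%E.
Proof.
move=> mX cv; apply: (squeeze_cvge _ (cvg_cst 0%E) cv); near=> m.
apply/andP; split.
  by apply: integral_ge0 => x _; rewrite lee_fin sqr_ge0.
apply: ge0_le_integral => //.
- by move=> x _; rewrite lee_fin sqr_ge0.
- by apply/measurable_EFinP; exact: measurable_funX.
- by apply/measurable_EFinP; exact: measurable_sqnorm.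
- by move=> x _; rewrite lee_fin sqr_le_sqnorm.
Unshelve. all: by end_near. Qed.

End L2Limits.

Section Ito.
Context {R : realType} {d : measure_display} {Omega : measurableType d}.
Variable Pr : probability Omega R.
Variables (n N : nat) (x0 : 'I_N -> Omega -> 'cV[R]_n) (W : 'I_N -> R -> Omega -> R).
Hypothesis hW : forall i, brownian_motion Pr (W i).
Hypothesis hWindep :
  mutually_independent Pr (fun i => sigma_of `[0, +oo[ (W i)).
Hypothesis hx0meas : forall i, measurable_vec (x0 i).
Hypothesis hx0W : independent2 Pr
  <<s \bigcup_(i in [set: 'I_N]) sigma_vec (x0 i) >>
  <<s \bigcup_(i in [set: 'I_N]) sigma_of `[0, +oo[ (W i) >>.
Variables (T : R) (i0 : 'I_N) (sigma : R -> 'cV[R]_n).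
Hypothesis T0 : 0 <= T.
Hypothesis hsigma : {within `[0, T], continuous sigma}.

Local Notation Ft := (filtration x0 W).
Local Notation mu := (@lebesgue_measure R).

Let mI (t : R) : measurable (`[0, t]%classic : set (measurableTypeR R)).
Proof. exact: measurable_itv. Qed.

Lemma sigma_L2 l : L2 mu `[0, T] (fun s => sigma s l 0).
Proof.
have /within_mxP cs := hsigma.
have [L L0 HL] := within_bounded (cs l 0).
apply: (@L2_le _ _ _ mu _ (mI T) _ (fun=> L)).
- have h : measurable_fun (`[0, T]%classic : set R) (fun s => sigma s l 0).
    by apply: subspace_continuous_measurable_fun => //; exact: cs.
  exact: h.
- by apply: (L2_cst (mI T)); exact: lebesgue_itv_fin.
- by move=> s /=; rewrite in_itv/= => sT; rewrite (ger0_norm L0) HL.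
Qed.

Lemma step_eval_L2 (phi : step_fun n T) l : L2 mu `[0, T] (fun s => step_eval phi s l 0).
Proof.
have TT : 0 <= T <= T by rewrite lexx T0.
have [I [u [c [_ _ eE]]]] := step_representation W i0 phi l TT.
apply: (@L2_eq _ _ _ mu _ (fun s => \sum_i c i * \1_(`]0, u i]%classic) s)).
  by move=> s /=; rewrite in_itv/= => sT; rewrite eE.
by apply: (L2_sum (mI T)) => i; apply: (L2Z (mI T)); exact: L2_indic.
Qed.

Lemma L2_subitv (X : R -> R) (t : R) : t <= T -> L2 mu `[0, T] X -> L2 mu `[0, t] X.
Proof.
move=> tT [mX X2]; have sub : `[0, t]%classic `<=` `[0, T]%classic.
  by apply: subset_itvl; rewrite bnd_simp.
split; first exact: measurable_funS mX.
apply: le_lt_trans X2; apply: ge0_subset_integral => //.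
  by apply/measurable_EFinP; exact: measurable_funX.
by move=> x _; rewrite lee_fin sqr_ge0.
Qed.

Lemma Rintegral_sqr_subitv (X : R -> R) (t : R) : t <= T -> L2 mu `[0, T] X ->
  \int[mu]_(s in `[0, t]) (X s ^+ 2) <= \int[mu]_(s in `[0, T]) (X s ^+ 2).
Proof.
move=> tT LX; have sub : `[0, t]%classic `<=` `[0, T]%classic.
  by apply: subset_itvl; rewrite bnd_simp.
rewrite -lee_fin !EFin_Rintegral//; last 2 first.
  exact: L2_sqr.
  by apply: L2_sqr; exact: L2_subitv.
apply: ge0_subset_integral => //.
  by case/integrableP: (L2_sqr LX).
by move=> x _; rewrite lee_fin sqr_ge0.
Qed.

Section OneIntegral.
Variables (M : R -> Omega -> 'cV[R]_n) (phi : nat -> step_fun n T).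
Hypothesis mM : forall t, 0 <= t <= T -> measurable_vec (M t).
Hypothesis cvphi : ((fun m => \int[mu]_(t in `[0%R, T])
        (sqnorm (step_eval (phi m) t - sigma t))%:E)%E @ \oo --> 0%E).
Hypothesis cvM : forall t : R, 0 <= t <= T ->
      (fun m => \int[Pr]_w
        (sqnorm (step_integral (phi m) (W i0) t w - M t w))%:E)%E @ \oo --> 0%E.

Let SL2 m t l : 0 <= t <= T ->
  L2 Pr setT (fun w => step_integral (phi m) (W i0) t w l 0).
Proof. by move=> tT; exact: step_integral_L2. Qed.

Lemma ito_coord_cvg t l : 0 <= t <= T ->
  (fun m => \int[Pr]_w
     ((step_integral (phi m) (W i0) t w l 0 - M t w l 0) ^+ 2)%:E)%E @ \oo --> 0%E.
Proof.
move=> tT.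
have E m w j : (step_integral (phi m) (W i0) t w - M t w) j 0 =
   step_integral (phi m) (W i0) t w j 0 - M t w j 0 by rewrite !mxE.
have mS m j : measurable_fun setT
    (fun w => (step_integral (phi m) (W i0) t w - M t w) j 0).
  under eq_fun do rewrite E.
  by apply: measurable_funB; [case: (SL2 m j tT)|exact: mM].
have := @sqnorm_cvg0_coord _ _ _ Pr setT measurableT n
  (fun m w => step_integral (phi m) (W i0) t w - M t w) l mS (cvM tT).
apply: cvg_trans; apply: near_eq_cvg; near=> m.
by apply: eq_integral => w _; rewrite E.
Unshelve. all: by end_near.
Qed.

Lemma ito_L2 t l : 0 <= t <= T -> L2 Pr setT (fun w => M t w l 0).
Proof.
(* Convergence to 0 makes the distance of [M t] to some step integral finite, and one such m is
   enough. *)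
move=> tT; have /fine_cvgP[[m _ /(_ m (leqnn m)) fin] _] := ito_coord_cvg l tT.
have mS : measurable_fun setT (fun w =>
    step_integral (phi m) (W i0) t w l 0 - M t w l 0).
  by apply: measurable_funB; [case: (SL2 m l tT)|exact: mM].
have LS : L2 Pr setT (fun w => step_integral (phi m) (W i0) t w l 0 - M t w l 0).
  by split => //; rewrite ltey_eq fin.
apply: (@L2_eq _ _ _ _ _ (fun w => step_integral (phi m) (W i0) t w l 0 -
  (step_integral (phi m) (W i0) t w l 0 - M t w l 0))).
  by move=> w _; rewrite subKr.
by apply: L2B => //; exact: SL2.
Qed.

Lemma ito_phi_cvg l : (fun m => \int[mu]_(s in `[0, T])
  ((step_eval (phi m) s l 0 - sigma s l 0) ^+ 2)) @ \oo --> (0 : R).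
Proof.
apply: Rintegral_cvg0.
have E m s j : (step_eval (phi m) s - sigma s) j 0 =
   step_eval (phi m) s j 0 - sigma s j 0 by rewrite !mxE.
have mS m j : measurable_fun (`[0, T]%classic : set (measurableTypeR R))
    (fun s => (step_eval (phi m) s - sigma s) j 0).
  rewrite (_ : (fun s => _) =
      (fun s => step_eval (phi m) s j 0 - sigma s j 0)); last first.
    by apply/funext => s; exact: E.
  by apply: measurable_funB; [case: (step_eval_L2 (phi m) j)|case: (sigma_L2 j)].
have := @sqnorm_cvg0_coord _ _ _ mu _ (mI T) n
  (fun m s => step_eval (phi m) s - sigma s) l mS cvphi.
apply: cvg_trans; apply: near_eq_cvg; near=> m.
by apply: eq_integral => s _; rewrite E.
Unshelve. all: by end_near.
Qed.

Lemma ito_orthogonal (s t : R) l (X : Omega -> R) : 0 <= s -> s <= t -> t <= T ->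
  meas_wrt (Ft s) X -> L2 Pr setT X ->
  \int[Pr]_w (X w * (M t w l 0 - M s w l 0)) = 0.
Proof.
move=> s0 st tT FX LX.
have sT : 0 <= s <= T by rewrite s0 (le_trans st).
have tT' : 0 <= t <= T by rewrite (le_trans s0 st).
pose S m u w := step_integral (phi m) (W i0) u w l 0.
apply: (@L2_orthogonal_limit _ _ _ Pr _ measurableT X _
   (fun m w => S m t w - S m s w)) => //.
- by apply: L2B => //; exact: ito_L2.
- by move=> m; apply: L2B => //; exact: SL2.
- by move=> m; exact: step_integral_orthogonal.
have LSM m u : 0 <= u <= T -> L2 Pr setT (fun w => S m u w - M u w l 0).
  by move=> uT; apply: L2B => //; [exact: SL2|exact: ito_L2].
have E m w : S m t w - S m s w - (M t w l 0 - M s w l 0) =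
    (S m t w - M t w l 0) + - (S m s w - M s w l 0) by ring.
apply: integral_cvg0 => //.
  move=> m; apply: L2_sqr; apply: L2B => //; apply: L2B => //; try exact: SL2;
    exact: ito_L2.
have c1 := Rintegral_cvg0 (ito_coord_cvg l tT').
have c2 := Rintegral_cvg0 (ito_coord_cvg l sT).
have c3 := cvg0_2D c1 c2.
apply: (squeeze_cvgr _ (cvg_cst 0) c3); near=> m; apply/andP; split.
  exact: L2_sqr_ge0.
under eq_Rintegral do rewrite E.
apply: le_trans (L2_sqrD_le measurableT (LSM m t tT') _) _.
  by apply: L2N => //; exact: LSM.
by under [X in _ + 2 * X <= _]eq_Rintegral do rewrite sqrrN.
Unshelve. all: by end_near. Qed.

End OneIntegral.

(** The two versions may come from different approximating sequences. Their distance is bounded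
    through the step integrals of both, and these are, by the isometry, as far apart as the step
    functions in L^2(0, T), which both tend to [sigma]. *)
Lemma ito_unique (M1 M2 : R -> Omega -> 'cV[R]_n) :
  ito_integral Pr T sigma (W i0) M1 -> ito_integral Pr T sigma (W i0) M2 ->
  forall t l, 0 <= t <= T -> {ae Pr, forall w, M1 t w l 0 = M2 t w l 0}.
Proof.
move=> [mM1 [phi1 [cp1 cM1]]] [mM2 [phi2 [cp2 cM2]]] t l tT.
pose S1 m w := step_integral (phi1 m) (W i0) t w l 0.
pose S2 m w := step_integral (phi2 m) (W i0) t w l 0.
have LM1 : L2 Pr setT (fun w => M1 t w l 0) by exact: (ito_L2 mM1 cM1).
have LM2 : L2 Pr setT (fun w => M2 t w l 0) by exact: (ito_L2 mM2 cM2).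
have LS1 m : L2 Pr setT (S1 m) by exact: step_integral_L2.
have LS2 m : L2 Pr setT (S2 m) by exact: step_integral_L2.
have LD : L2 Pr setT (fun w => M1 t w l 0 - M2 t w l 0) by exact: L2B.
have c1 := Rintegral_cvg0 (ito_coord_cvg mM1 cM1 l tT).
have c2 := Rintegral_cvg0 (ito_coord_cvg mM2 cM2 l tT).
have p1 := ito_phi_cvg cp1 l; have p2 := ito_phi_cvg cp2 l.
have LB1 m : L2 Pr setT (fun w => S1 m w - M1 t w l 0) by exact: L2B.
have LB2 m : L2 Pr setT (fun w => S2 m w - M2 t w l 0) by exact: L2B.
have LS12 m : L2 Pr setT (fun w => S1 m w - S2 m w) by exact: L2B.
have Lp1 m : L2 mu `[0, T] (fun s => step_eval (phi1 m) s l 0 - sigma s l 0).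
  by apply: (L2B (mI T)); [exact: step_eval_L2|exact: sigma_L2].
have Lp2 m : L2 mu `[0, T] (fun s => step_eval (phi2 m) s l 0 - sigma s l 0).
  by apply: (L2B (mI T)); [exact: step_eval_L2|exact: sigma_L2].
have tTr : t <= T by case/andP: tT.
have bnd m : \int[Pr]_w ((M1 t w l 0 - M2 t w l 0) ^+ 2) <=
    2 * (2 * \int[Pr]_w ((S1 m w - M1 t w l 0) ^+ 2) +
         2 * \int[Pr]_w ((S2 m w - M2 t w l 0) ^+ 2)) +
    2 * (2 * \int[mu]_(s in `[0, T]) ((step_eval (phi1 m) s l 0 - sigma s l 0) ^+ 2) +
         2 * \int[mu]_(s in `[0, T]) ((step_eval (phi2 m) s l 0 - sigma s l 0) ^+ 2)).
  have E w : M1 t w l 0 - M2 t w l 0 =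
     (- (S1 m w - M1 t w l 0) + (S2 m w - M2 t w l 0)) + (S1 m w - S2 m w) by ring.
  under eq_Rintegral do rewrite E.
  have LB1' : L2 Pr setT (fun w => - (S1 m w - M1 t w l 0)) by exact: L2N.
  have LB12 : L2 Pr setT (fun w => - (S1 m w - M1 t w l 0) + (S2 m w - M2 t w l 0)).
    exact: L2D.
  apply: le_trans (L2_sqrD_le measurableT LB12 (LS12 m)) _.
  apply: lerD; rewrite ler_wpM2l//.
    apply: le_trans (L2_sqrD_le measurableT LB1' (LB2 m)) _.
    by under [X in 2 * X + _ <= _]eq_Rintegral do rewrite sqrrN.
  have [_ ->] := step_difference_isometry hW hWindep hx0meas hx0W i0 (phi1 m) (phi2 m) l tT.
  have E' s : step_eval (phi1 m) s l 0 - step_eval (phi2 m) s l 0 =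
    (step_eval (phi1 m) s l 0 - sigma s l 0) + - (step_eval (phi2 m) s l 0 - sigma s l 0).
    by ring.
  under eq_Rintegral do rewrite E'.
  have Lp2' : L2 mu `[0, T] (fun s => - (step_eval (phi2 m) s l 0 - sigma s l 0)).
    exact: (L2N (mI T)).
  apply: le_trans (Rintegral_sqr_subitv tTr (L2D (mI T) (Lp1 m) Lp2')) _.
  apply: le_trans (L2_sqrD_le (mI T) (Lp1 m) Lp2') _.
  by under [X in _ + 2 * X <= _]eq_Rintegral do rewrite sqrrN.
have lim0 := cvg0_2D (cvg0_2D c1 c2) (cvg0_2D p1 p2).
have q0 : \int[Pr]_w ((M1 t w l 0 - M2 t w l 0) ^+ 2) = 0.
  apply/eqP; rewrite eq_le L2_sqr_ge0 andbT.
  rewrite -(cvg_lim _ lim0)//; apply: limr_ge; last by near=> m; exact: bnd.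
  by apply/cvg_ex; exists 0.
have := L2_ae0 measurableT LD q0; apply: filterS => w /(_ I)/eqP.
by rewrite subr_eq0 => /eqP.
Unshelve. all: by end_near. Qed.

End Ito.

(** * Existence of a continuous adapted stochastic integral *)

Section Limsup.
Context {R : realType}.

(* A total, measurability-preserving substitute for the limit of a sequence. *)
Definition limsupR (g : nat -> R) : R := fine (limn_esup (fun m => (g m)%:E)).

Lemma limsupR_cvg (g : nat -> R) (l : R) : g @ \oo --> l -> limsupR g = l.
Proof.
move=> gl; rewrite /limsupR.
have h : (fun m => (g m)%:E) @ \oo --> l%:E by apply/cvg_EFin => //; near=> m.
by have [_ ->] := cvg_limn_einf_sup h.
Unshelve. all: by end_near. Qed.

Lemma measurable_limsupR d (T : measurableType d) (D : set T) (h : nat -> T -> R) :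
  (forall m, measurable_fun D (h m)) ->
  measurable_fun D (fun x => limsupR (h ^~ x)).
Proof.
move=> mh; rewrite /limsupR.
have h1 : measurable_fun D (fun x => limn_esup (fun m => (h m x)%:E)).
  by apply: measurable_fun_limn_esup => m; apply/measurable_EFinP; exact: mh.
exact: (measurableT_comp (@fine_measurable R _ measurableT) h1).
Qed.

End Limsup.

(** * Uniform grids and left-endpoint approximation *)

Section Grid.
Context {R : realType}.
Variable T : R.
Hypothesis T0 : 0 < T.

Definition grid (p k : nat) : R := k%:R * (T / p%:R).

Lemma grid0 p : grid p 0 = 0. Proof. by rewrite /grid mul0r. Qed.

Lemma grid_ge0 p k : 0 <= grid p k.
Proof. by rewrite /grid mulr_ge0// divr_ge0// ltW. Qed.

Lemma gridS p k : grid p k.+1 = grid p k + T / p%:R.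
Proof. by rewrite /grid -natr1 mulrDl mul1r. Qed.

Lemma grid_mono p k : grid p k <= grid p k.+1.
Proof. by rewrite gridS lerDl divr_ge0// ltW. Qed.

Lemma grid_le p j k : (j <= k)%N -> grid p j <= grid p k.
Proof. by move=> jk; rewrite /grid ler_wpM2r ?ler_nat// divr_ge0// ltW. Qed.

Lemma gridT p : (0 < p)%N -> grid p p = T.
Proof. by move=> p0; rewrite /grid mulrC divfK// pnatr_eq0 -lt0n. Qed.

Lemma grid_leT p k : (0 < p)%N -> (k <= p)%N -> 0 <= grid p k <= T.
Proof. by move=> p0 kp; rewrite grid_ge0 -[X in _ <= X](gridT p0) grid_le. Qed.

Lemma grid_cell p (t : R) : (0 < p)%N -> 0 < t <= T ->
  exists2 k, (k < p)%N & grid p k < t <= grid p k.+1.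
Proof.
move=> p0 /andP[t0]; rewrite -(gridT p0); move: {2 3}p => q.
elim: q => [|q IH] tq; first by move: t0; rewrite ltNge -(grid0 p) tq.
have [/IH[k kq kt]|qt] := leP t (grid p q); first by exists k => //; exact: ltnW.
by exists q => //; rewrite qt tq.
Qed.

Lemma grid_floor_cvg (p k : nat -> nat) (t : R) :
  (forall m, (m < p m)%N) ->
  (forall m, grid (p m) (k m) < t <= grid (p m) (k m).+1) ->
  grid (p m) (k m) @[m --> \oo] --> t.
Proof.
move=> mp kt; have h0 : (t - T * harmonic m) @[m --> \oo] --> t.
  rewrite -[X in _ --> X](subr0 t); apply: cvgB; first exact: cvg_cst.
  rewrite -[X in _ --> X](mulr0 T).
  by apply: cvgM; [exact: cvg_cst|exact: cvg_harmonic].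
apply: (squeeze_cvgr _ h0 (cvg_cst t)); near=> m.
have /andP[kt1 kt2] := kt m; rewrite (ltW kt1) andbT lerBlDr.
apply: le_trans kt2 _; rewrite gridS lerD2l ler_wpM2l//; first exact: ltW.
by rewrite lef_pV2 ?posrE ?ltr0n// ?(leq_trans _ (mp m))// ler_nat.
Unshelve. all: by end_near. Qed.

Lemma within_cvg_seq (c : R -> R) (u : nat -> R) (t : R) :
  {within `[0, T], continuous c} -> 0 <= t <= T ->
  (forall m, 0 <= u m <= T) -> u @ \oo --> t -> c (u m) @[m --> \oo] --> c t.
Proof.
move=> /subspace_continuousP cc tT uT ut.
have tin : (`[0, T]%classic : set R) t by rewrite /= in_itv.
apply: (cvg_comp u c _ (cc t tin)) => A; rewrite /within/= => wA.
have : \forall m \near \oo, `[0, T]%classic (u m) -> A (u m) by exact: (ut _ wA).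
by apply: filterS => m; apply; rewrite /= in_itv/= uT.
Qed.

(** Each t is a limit of grid points to its left, since p m > m makes the mesh shrink. This extends
    to all times what is known almost surely at countably many of them. *)
Lemma grid_dense (c : R -> R) (e : R) (p : nat -> nat) :
  (forall m, (m < p m)%N) ->
  {within `[0, T], continuous c} ->
  (forall m k, (k <= p m)%N -> `|c (grid (p m) k)| <= e) ->
  forall t, 0 <= t <= T -> `|c t| <= e.
Proof.
move=> mp cc ce t tT; have p0 m : (0 < p m)%N by rewrite (leq_trans _ (mp m)).
have [->|tn0] := eqVneq t 0; first by rewrite -(grid0 (p 0)); exact: ce.
have t0 : 0 < t <= T by rewrite lt0r tn0.
have /choice[k kP] : forall m, exists k, (k < p m)%N /\ grid (p m) k < t <= grid (p m) k.+1.
  by move=> m; have [k] := grid_cell (p0 m) t0; exists k.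
have ku m : 0 <= grid (p m) (k m) <= T.
  by apply: grid_leT => //; case: (kP m) => /ltnW.
have cv := within_cvg_seq cc tT ku (grid_floor_cvg mp (fun m => (kP m).2)).
have cvn : `|c (grid (p m) (k m))| @[m --> \oo] --> `|c t| by exact: cvg_norm cv.
 rewrite -(cvg_lim _ cvn)//.
apply: limr_le; first by apply/cvg_ex; exists `|c t|.
by near=> m; apply: ce; case: (kP m) => /ltnW.
Unshelve. all: by end_near. Qed.

Definition grid_indic (p k : nat) (t : R) : R :=
  \1_(`]grid p k, grid p k.+1]%classic) t.

Lemma grid_indicE p k j t : grid p k < t <= grid p k.+1 ->
  grid_indic p j t = (j == k)%:R.
Proof.
move=> /andP[kt tk]; rewrite /grid_indic indicE mem_setE in_itv/=; congr (_%:R).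
have [->|] := eqVneq j k; first by rewrite kt tk.
rewrite neq_ltn => /orP[jk|kj].
  by rewrite [X in _ && X]leNgt (le_lt_trans (grid_le p jk) kt) andbF.
by rewrite [X in X && _]ltNge (le_trans tk (grid_le p kj)).
Qed.

(** The value on a cell is taken at its left end, so that for an adapted process it is known at time
    t. No cell contains 0, where the function is 0. *)
Definition grid_step (c : R -> R) (m : nat) (t : R) : R :=
  \sum_(k < m.+1) grid_indic m.+1 k t * c (grid m.+1 k).

Lemma grid_stepE c m k t : (k < m.+1)%N -> grid m.+1 k < t <= grid m.+1 k.+1 ->
  grid_step c m t = c (grid m.+1 k).
Proof.
move=> km kt; rewrite /grid_step (bigD1 (Ordinal km))//= big1 ?addr0.
  by rewrite (grid_indicE _ kt) eqxx mul1r.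
by move=> j jk; rewrite (grid_indicE _ kt) (negbTE (jk : j != k :> nat)) mul0r.
Qed.

Lemma grid_step_cvg (c : R -> R) t : {within `[0, T], continuous c} ->
  0 < t <= T -> grid_step c m t @[m --> \oo] --> c t.
Proof.
move=> cc t0; have tT : 0 <= t <= T by case/andP: t0 => /ltW -> ->.
have /choice[k kP] : forall m, exists k, (k < m.+1)%N /\ grid m.+1 k < t <= grid m.+1 k.+1.
  by move=> m; have [k] := grid_cell (ltn0Sn m) t0; exists k.
have -> : (fun m => grid_step c m t) = (fun m => c (grid m.+1 (k m))).
  by apply/funext => m; apply: grid_stepE; case: (kP m).
apply: within_cvg_seq => //; first by move=> m; apply: grid_leT => //; case: (kP m) => /ltnW.
exact: (@grid_floor_cvg (fun m => m.+1) k t _ (fun m => (kP m).2)).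
Qed.

Lemma grid_step_bound (c : R -> R) (L : R) m t : 0 <= L ->
  (forall s, 0 <= s <= T -> `|c s| <= L) -> 0 <= t <= T -> `|grid_step c m t| <= L.
Proof.
move=> L0 cL /andP[]; rewrite le_eqVlt => /orP[/eqP <- _|t0 tT].
  rewrite /grid_step big1 ?normr0// => k _; rewrite /grid_indic indicE mem_setE.
  by rewrite in_itv/= ltNge grid_ge0 mul0r.
have [|k km kt] := @grid_cell m.+1 t (ltn0Sn m); first by rewrite t0.
by rewrite (grid_stepE _ km kt) cL// grid_leT// ltnW.
Qed.

End Grid.

Section Regularization.
Context {R : realType} {d : measure_display} {Omega : measurableType d}.
Variable T : R.
Hypothesis T0 : 0 < T.
Variable F : R -> set (set Omega).
Hypothesis sF : forall t, sigma_algebra setT (F t).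
Hypothesis Fmono : forall s t, s <= t -> F s `<=` F t.
Hypothesis Fm : forall t, F t `<=` measurable.

Lemma meas_wrt_algebraP (H : set (set Omega)) (X : Omega -> R) :
  sigma_algebra setT H ->
  meas_wrt H X <-> measurable_fun setT (X : g_sigma_algebraType H -> R).
Proof. by move=> sH; rewrite -meas_wrtP sigma_algebra_id. Qed.

Lemma meas_wrt_limsupR t (h : nat -> Omega -> R) :
  (forall m, meas_wrt (F t) (h m)) -> meas_wrt (F t) (fun w => limsupR (h ^~ w)).
Proof.
move=> mh; apply/(meas_wrt_algebraP _ (sF t)).
by apply: measurable_limsupR => m; apply/(meas_wrt_algebraP _ (sF t)).
Qed.

(** The alternative is meant for grid points after t: the process there need not be measurable at
    time t, but its coefficient vanishes. *)
Lemma meas_wrt_sum t (I : Type) (r : seq I) (a : I -> R) (h : I -> Omega -> R) :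
  (forall i, a i = 0 \/ meas_wrt (F t) (h i)) ->
  meas_wrt (F t) (fun w => \sum_(i <- r) a i * h i w).
Proof.
move=> mh; apply/(meas_wrt_algebraP _ (sF t)); apply: measurable_sum => i.
have [->|/(meas_wrt_algebraP _ (sF t)) mi] := mh i.
  rewrite (_ : (fun _ => _) = cst 0); first exact: measurable_cst.
  by apply/funext => w; rewrite mul0r.
exact: measurable_funM.
Qed.

Section Process.
Variable z : R -> Omega -> R.
Hypothesis Fz : forall t, 0 <= t <= T -> meas_wrt (F t) (z t).

Let mz t : 0 <= t <= T -> measurable_fun setT (z t).
Proof. by move=> tT; apply: meas_wrt_measurable (Fz tT). Qed.

Let grid_in m (k : 'I_m.+1) : 0 <= grid T m.+1 k <= T.
Proof. by apply: grid_leT => //; exact: ltnW. Qed.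

Let T_in : 0 <= (0 : R) <= T. Proof. by rewrite lexx ltW. Qed.

(* Equal to z along its continuous paths, but jointly measurable and adapted
   without exception: the filtrations contain no null sets. *)
Definition regul (t : R) (w : Omega) : R := limsupR (fun m =>
  \1_([set 0]%classic) t * z 0 w +
  grid_step T (z ^~ w) m t).

Lemma regul_measurable :
  measurable_fun setT (fun p : measurableTypeR R * Omega => regul p.1 p.2).
Proof.
apply: (@measurable_limsupR R _ _ setT (fun m (p : measurableTypeR R * Omega) => \1_([set 0]%classic) p.1 * z 0 p.2 +
  grid_step T (z ^~ p.2) m p.1)) => m.
have mM (D : set R) s : measurable D -> 0 <= s <= T ->
    measurable_fun setT (fun p : measurableTypeR R * Omega => (\1_D p.1 : R) * z s p.2).
  move=> mD sT; apply: measurable_funM.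
    have h : measurable_fun setT (\1_D : measurableTypeR R -> R).
      exact: measurable_indic.
    by apply: (measurableT_comp h).
  by apply: (measurableT_comp (mz sT)).
apply: measurable_funD; first exact: mM.
by apply: measurable_sum => k; apply: mM.
Qed.

Lemma regul_adapted t : 0 <= t <= T -> meas_wrt (F t) (regul t).
Proof.
move=> tT; apply: meas_wrt_limsupR => m; apply/(meas_wrt_algebraP _ (sF t)).
apply: measurable_funD.
  apply: measurable_funM => //; apply/(meas_wrt_algebraP _ (sF t)).
  by apply: meas_wrt_sub (Fz T_in); apply: Fmono; case/andP: tT.
apply/(meas_wrt_algebraP _ (sF t)).
apply: meas_wrt_sum => k; rewrite /grid_indic indicE mem_setE in_itv/=.
have [kt|_] := ltP (grid T m.+1 k) t; last by left.
by right; apply: meas_wrt_sub (Fz (grid_in k)); exact/Fmono/ltW.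
Qed.

Lemma regulE t w : 0 <= t <= T -> {within `[0, T], continuous (z ^~ w)} ->
  regul t w = z t w.
Proof.
move=> /andP[]; rewrite le_eqVlt => /orP[/eqP <- _ _|t0 tT cz].
  apply: limsupR_cvg; rewrite (_ : (fun m => _) = fun=> z 0 w); first exact: cvg_cst.
  apply/funext => m; rewrite indicE mem_set// mul1r /grid_step big1 ?addr0// => k _.
  by rewrite /grid_indic indicE mem_setE in_itv/= ltNge grid_ge0// mul0r.
apply: limsupR_cvg; rewrite (_ : (fun m => _) = fun m => grid_step T (z ^~ w) m t).
  by apply: grid_step_cvg => //; rewrite t0.
apply/funext => m; rewrite indicE memNset ?mul0r ?add0r//= => t00.
by move: t0; rewrite t00 ltxx.
Qed.

(** Riemann sums at left endpoints, truncated at t: each term is known at time t, and the upper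
    limit is defined at every sample point. For the Lebesgue integral itself, adaptedness would call
    for progressive measurability of [z]. *)
Definition rint (t : R) (w : Omega) : R := limsupR (fun m => \sum_(k < m.+1)
  (Num.min t (grid T m.+1 k.+1) - Num.min t (grid T m.+1 k)) * z (grid T m.+1 k) w).

Lemma rint_adapted t : 0 <= t <= T -> meas_wrt (F t) (rint t).
Proof.
move=> tT; apply: meas_wrt_limsupR => m; apply: meas_wrt_sum => k.
have [kt|tk] := leP (grid T m.+1 k) t.
  by right; apply: meas_wrt_sub (Fz (grid_in k)); exact/Fmono.
by left; rewrite min_l ?subrr// (le_trans (ltW tk))// grid_mono.
Qed.

End Process.

Lemma grid_step_integral (c : R -> R) m t : 0 <= t <= T ->
  \int[lebesgue_measure]_(s in `[0, t]) grid_step T c m s =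
  \sum_(k < m.+1) (Num.min t (grid T m.+1 k.+1) - Num.min t (grid T m.+1 k)) *
    c (grid T m.+1 k).
Proof.
move=> /andP[t0 tT].
have mt : measurable (`[0, t]%classic : set (measurableTypeR R)).
  exact: measurable_itv.
have I1 k : L2 lebesgue_measure `[0, t] (grid_indic T m.+1 k).
  apply: L2_eq (L2B mt (L2_indic t (Num.min t (grid T m.+1 k.+1)))
     (L2_indic t (Num.min t (grid T m.+1 k)))) => s /=; rewrite in_itv/= => st.
  by rewrite /grid_indic (@indic_itvB _ _ _ t)// ?grid_ge0// grid_mono.
have fin := lebesgue_itv_fin 0 t.
have I2 k := L2_integrable mt fin (I1 k).
have II (u : R) : 0 <= u <= t -> \int[lebesgue_measure]_(s in `[0, t]) \1_(`]0, u]%classic) s = u.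
  move=> u0; have := indic_covariance; move=> /(_ R t u u).
  case/andP: u0 => u0 ut /(_ u0 u0 ut ut); rewrite minxx => E; rewrite -[RHS]E.
  by apply: eq_Rintegral => s _; rewrite indicE; case: (_ \in _); rewrite ?mulr1 ?mulr0.
rewrite Rintegral_sumr//; last first.
  move=> k; rewrite (_ : (fun _ => _) =
      fun s => c (grid T m.+1 k) * grid_indic T m.+1 k s).
    exact: (integrable_scale mt).
  by apply/funext => s; rewrite mulrC.
apply: eq_bigr => k _; under eq_Rintegral do rewrite mulrC.
rewrite RintegralZl// mulrC; congr (_ * _).
under eq_Rintegral => s.
  rewrite inE/= in_itv/= => st.
  rewrite /grid_indic (@indic_itvB _ _ _ t)// ?grid_ge0// ?grid_mono//.
  over.
by rewrite RintegralB//; try exact: (L2_integrable mt fin (L2_indic _ _)); rewrite !II//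
  ge_min lexx le_min t0 grid_ge0.
Qed.

Lemma grid_step_measurable (c : R -> R) m :
  measurable_fun setT (grid_step T c m).
Proof.
apply: measurable_sum => k; apply: measurable_funM => //.
exact: measurable_indic.
Qed.

Lemma grid_step_integral_cvg (c : R -> R) t : 0 <= t <= T ->
  {within `[0, T], continuous c} ->
  (fun m => \int[lebesgue_measure]_(s in `[0, t]) grid_step T c m s) @ \oo -->
  \int[lebesgue_measure]_(s in `[0, t]) c s.
Proof.
move=> /andP[t0 tT] cc.
have mt : measurable (`[0, t]%classic : set (measurableTypeR R)).
  exact: measurable_itv.
have [L L0 HL] := within_bounded cc.
have sub s : s \in `[0, t] -> 0 <= s <= T.
  by rewrite in_itv/= => /andP[-> st]; exact: le_trans st tT.
have cct : {within `[0, t], continuous c}.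
  by apply: continuous_subspaceW cc => s /= /sub; rewrite in_itv.
have ic := within_integrable cct.
have := @dominated_convergence _ _ _ (@lebesgue_measure R) `[0, t]%classic mt
  (fun m s => (grid_step T c m s)%:E) (EFin \o c) (fun=> L%:E).
move=> H; case: H.
- move=> m; apply/measurable_EFinP; apply: measurable_funS (grid_step_measurable c m) => //.
- by case/integrableP: ic.
(* Time 0, which lies in no cell, is the only possible exception to the convergence. *)
- exists [set 0]; split => //; first exact: lebesgue_measure_set1.
  move=> s /=; apply: contra_notP => s0 /sub st.
  apply/cvg_EFin; first by near=> m.
  apply: grid_step_cvg => //; case/andP: st => ss sT; rewrite sT andbT.
  by rewrite lt_neqAle ss andbT eq_sym; apply/eqP.
- exact: (integrable_cstr mt L (lebesgue_itv_fin 0 t)).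
- apply: aeW => s m /= /sub st; rewrite lee_fin; exact: grid_step_bound.
by move=> _ _; rewrite -(EFin_Rintegral mt ic) => /fine_cvgP[].
Unshelve. all: by end_near. Qed.

Lemma rintE (z : R -> Omega -> R) t w : 0 <= t <= T ->
  {within `[0, T], continuous (z ^~ w)} ->
  rint z t w = \int[lebesgue_measure]_(s in `[0, t]) z s w.
Proof.
move=> tT cz; apply: limsupR_cvg.
have := grid_step_integral_cvg tT cz; apply: cvg_trans; apply: near_eq_cvg.
by near=> m; rewrite grid_step_integral.
Unshelve. all: by end_near. Qed.

End Regularization.

(** * A maximal inequality for sequences with orthogonal increments *)

Section MaximalInequality.
Context {R : realType} {d : measure_display} {Omega : measurableType d}.
Variable Pr : probability Omega R.
Variables (H : nat -> set (set Omega)) (S : nat -> Omega -> R).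
Hypothesis sH : forall j, sigma_algebra setT (H j).
Hypothesis Hmono : forall j, H j `<=` H j.+1.
Hypothesis Hm : forall j, H j `<=` measurable.
Hypothesis HS : forall j, meas_wrt (H j) (S j).
Hypothesis LS : forall j, L2 Pr setT (S j).
Hypothesis orthS : forall j X, meas_wrt (H j) X -> L2 Pr setT X ->
  \int[Pr]_w (X w * (S j.+1 w - S j w)) = 0.

(* The process stopped when it first exceeds e in absolute value. *)
Fixpoint stopped (e : R) (j : nat) (w : Omega) : R :=
  if j is i.+1 then
    stopped e i w + (`|stopped e i w| <= e)%R%:R * (S i.+1 w - S i w)
  else S 0%N w.

Let flag e j w : R := (`|stopped e j w| <= e)%R%:R.

Lemma stopped_meas e j : meas_wrt (H j) (stopped e j) /\ meas_wrt (H j) (flag e j).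
Proof.
have flagP j0 : meas_wrt (H j0) (stopped e j0) -> meas_wrt (H j0) (flag e j0).
  move=> /(meas_wrt_algebraP _ (sH j0)) mZ; apply/(meas_wrt_algebraP _ (sH j0)).
  rewrite (_ : flag e j0 = fun w => if `|stopped e j0 w| <= e then 1 else 0).
    apply: measurable_fun_ifT => //; apply: measurable_fun_ler => //.
    exact: measurableT_comp.
  by apply/funext => w; rewrite /flag; case: ifP.
elim: j => [|j [IH1 IH2]]; first by split; [exact: HS|apply: flagP; exact: HS].
suff h : meas_wrt (H j.+1) (stopped e j.+1) by split => //; exact: flagP.
have up X : meas_wrt (H j) X -> measurable_fun setT (X : g_sigma_algebraType (H j.+1) -> R).
  by move=> mX; apply/(meas_wrt_algebraP _ (sH j.+1)); exact: meas_wrt_sub mX.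
apply/(meas_wrt_algebraP _ (sH j.+1)); apply: measurable_funD; first exact: up.
apply: measurable_funM; first exact: up.
by apply: measurable_funB; [exact/(meas_wrt_algebraP _ (sH j.+1))|exact: up].
Qed.

Let mflag e j : measurable_fun setT (flag e j).
Proof. by have [_ ?] := stopped_meas e j; exact: (meas_wrt_measurable (@Hm j)). Qed.

Let L2_flag e j X : L2 Pr setT X -> L2 Pr setT (fun w => flag e j w * X w).
Proof.
move=> LX; apply: (L2_le measurableT _ LX); first by apply: measurable_funM => //; case: LX.
by move=> w _; rewrite /flag normrM; case: (_ <= e); rewrite ?normr1 ?normr0 ?mul1r ?mul0r.
Qed.

Lemma stopped_L2 e j : L2 Pr setT (stopped e j).
Proof.
elim: j => [|j IH]; first exact: LS.
by apply: L2D => //; apply: L2_flag; exact: L2B.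
Qed.

Lemma sqr_increment (X Y : Omega -> R) : L2 Pr setT X -> L2 Pr setT Y ->
  \int[Pr]_w (X w * Y w) = 0 ->
  \int[Pr]_w ((X w + Y w) ^+ 2) =
  \int[Pr]_w (X w ^+ 2) + \int[Pr]_w (Y w ^+ 2).
Proof.
move=> LX LY XY0.
rewrite (@eq_Rintegral _ _ _ Pr setT (fun w => (X w ^+ 2 + Y w ^+ 2) + 2 * (X w * Y w))); last first.
  by move=> w _; ring.
rewrite RintegralD//; last 2 first.
- by apply: integrable_addr => //; exact: L2_sqr.
- by apply: integrable_scale => //; exact: L2_mul.
rewrite RintegralZl//; last exact: L2_mul.
by rewrite XY0 mulr0 addr0 RintegralD//; exact: L2_sqr.
Qed.

(** Squared norms add over orthogonal increments, and stopping multiplies each increment by a flag 0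
    or 1 that is known beforehand. *)
Lemma stopped_sqr_le e j :
  \int[Pr]_w (stopped e j w ^+ 2) <= \int[Pr]_w (S j w ^+ 2).
Proof.
elim: j => [|j IH] //.
have [mZ mf] := stopped_meas e j.
have LD : L2 Pr setT (fun w => S j.+1 w - S j w) by exact: L2B.
have -> : \int[Pr]_w (S j.+1 w ^+ 2) =
    \int[Pr]_w (S j w ^+ 2) + \int[Pr]_w ((S j.+1 w - S j w) ^+ 2).
  rewrite -sqr_increment//; last exact: orthS.
  by apply: eq_Rintegral => w _; rewrite subrKC.
rewrite /= sqr_increment//; last 3 first.
- exact: stopped_L2.
- exact: L2_flag.
- under eq_Rintegral do rewrite mulrA; apply: orthS; last first.
    under eq_fun do rewrite mulrC; apply: L2_flag; exact: stopped_L2.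
  apply/(meas_wrt_algebraP _ (sH j)); apply: measurable_funM;
    exact/(meas_wrt_algebraP _ (sH j)).
apply: lerD => //; apply: le_Rintegral => //.
- by apply: L2_sqr; exact: L2_flag.
- exact: L2_sqr.
- by move=> w _; case: (_ <= e); rewrite ?mul1r// mul0r expr0n sqr_ge0.
Qed.

(** Up to the first time beyond [e] the stopped process follows [S], and from then on it is frozen
    at a value beyond [e]. *)
Lemma stopped_exceeds e p w :
  (exists2 j, (j <= p)%N & e < `|S j w|) -> e < `|stopped e p w|.
Proof.
move=> [j jp eS].
suff : e < `|stopped e p w| \/
    stopped e p w = S p w /\ forall j, (j <= p)%N -> `|S j w| <= e.
  by case=> // -[_ /(_ j jp)]; rewrite leNgt eS.
elim: p {j jp eS} => [|p IH] /=.
  have [Se|eS] := leP `|S 0 w| e; last by left.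
  by right; split => // j; rewrite leqn0 => /eqP ->.
case: IH => [eZ|[-> SE]]; first by left; rewrite leNgt eZ mul0r addr0.
rewrite SE// mul1r subrKC.
have [Se|eS] := leP `|S p.+1 w| e; last by left.
by right; split => // j; rewrite leq_eqVlt => /orP[/eqP ->//|]; exact: SE.
Qed.

(** Chebyshev's inequality for the single variable [stopped e p], whose second moment is at most
    that of [S p]. *)
Lemma maximal_inequality (e : R) p : 0 < e ->
  ((e ^+ 2)%:E * Pr [set w | exists2 j, (j <= p)%N & (e < `|S j w|)%R] <=
  (\int[Pr]_w (S p w ^+ 2))%:E)%E.
Proof.
move=> e0.
have mS j : measurable_fun setT (S j) by exact: (meas_wrt_measurable (@Hm j)).
have mE : measurable [set w | exists2 j, (j <= p)%N & e < `|S j w|].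
  rewrite (_ : [set _ | _] = \bigcup_(j in [set j | (j <= p)%N]) [set w | e < `|S j w|]).
    apply: bigcup_measurable => j _; rewrite -[X in measurable X]setTI.
    have := @measurable_fun_ltr _ _ _ setT (fun=> e) (fun w => `|S j w|) (measurable_cst _)
      (measurableT_comp (@normr_measurable R setT) (mS j)).
    by move=> /(_ measurableT [set true] I); congr measurable;
      apply/seteqP; split=> x /=.
  by apply/seteqP; split=> w /= -[j jp eS]; exists j.
have LZ := stopped_L2 e p.
apply: (@le_trans _ _ (\int[Pr]_w (stopped e p w ^+ 2))%:E); last first.
  by rewrite lee_fin stopped_sqr_le.
rewrite EFin_Rintegral; last exact: L2_sqr.
rewrite -integral_cst//.
apply: (@le_trans _ _ (\int[Pr]_(w in [set w | exists2 j, (j <= p)%N & (e < `|S j w|)%R])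
   (stopped e p w ^+ 2)%:E)%E).
  apply: ge0_le_integral => //.
  - by move=> w _; rewrite lee_fin sqr_ge0.
  - apply/measurable_EFinP; apply: measurable_funX; apply: measurable_funS LZ.1 => //.
  - move=> w /stopped_exceeds /ltW eZ; rewrite lee_fin -[X in _ <= X]real_normK ?num_real//.
    by rewrite lerXn2r// nnegrE ltW.
apply: ge0_subset_integral => //.
  by apply/measurable_EFinP; apply: measurable_funX; case: LZ.
  by move=> w _; rewrite lee_fin sqr_ge0.
exact: measurableT.
Qed.

End MaximalInequality.

Lemma sqnorm_integral_le d (T : measurableType d) (R : realType)
    (mu : {measure set T -> \bar R}) (D : set T) (mD : measurable D) k
    (X : T -> 'cV[R]_k) (c : R) :
  (forall j, L2 mu D (fun x => X x j 0)) ->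
  (forall j, \int[mu]_(x in D) (X x j 0 ^+ 2) <= c) ->
  (\int[mu]_(x in D) (sqnorm (X x))%:E <= (k%:R * c)%:E)%E.
Proof.
move=> LX Xc; rewrite -EFin_Rintegral//; last first.
  by apply: integrable_sumr => // j; exact: L2_sqr.
rewrite lee_fin Rintegral_sumr//; last by move=> j; exact: L2_sqr.
apply: (@le_trans _ _ (\sum_(j < k) c)); first by apply: ler_sum => j _; exact: Xc.
by rewrite sumr_const card_ord mulr_natl.
Qed.

Lemma limn_einf_le (R : realType) (u : nat -> \bar R) (c : \bar R) :
  (\forall m \near \oo, (u m <= c)%E) -> (limn_einf u <= c)%E.
Proof.
move=> uc; rewrite limn_einf_lim; apply: lime_le; first exact: is_cvg_einfs.
apply: filterS uc => m; apply: le_trans; apply: ereal_inf_lbound.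
by exists m => //=.
Qed.

(** * Almost surely uniform limits of step integrals *)

Section ItoExistence.
Context {R : realType} {d : measure_display} {Omega : measurableType d}.
Variable Pr : probability Omega R.
Variables (n N : nat) (x0 : 'I_N -> Omega -> 'cV[R]_n) (W : 'I_N -> R -> Omega -> R).
Hypothesis hW : forall i, brownian_motion Pr (W i).
Hypothesis hWindep :
  mutually_independent Pr (fun i => sigma_of `[0, +oo[ (W i)).
Hypothesis hx0meas : forall i, measurable_vec (x0 i).
Hypothesis hx0W : independent2 Pr
  <<s \bigcup_(i in [set: 'I_N]) sigma_vec (x0 i) >>
  <<s \bigcup_(i in [set: 'I_N]) sigma_of `[0, +oo[ (W i) >>.
Variables (T : R) (i0 : 'I_N) (sigma : R -> 'cV[R]_n).
Hypothesis T0 : 0 < T.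
Hypothesis hsigma : {within `[0, T], continuous sigma}.

Local Notation Ft := (filtration x0 W).
Local Notation mu := (@lebesgue_measure R).

Let T0' : 0 <= T. Proof. exact: ltW. Qed.
Let TT : 0 <= T <= T. Proof. by rewrite lexx andbT. Qed.

Let mI (t : R) : measurable (`[0, t]%classic : set (measurableTypeR R)).
Proof. exact: measurable_itv. Qed.

Let csigma l : {within `[0, T], continuous (fun s => sigma s l 0)}.
Proof. by have /within_mxP/(_ l 0) := hsigma. Qed.

Definition grid_step_fun (m : nat) : step_fun n T :=
  @StepFun _ _ _ m.+1 (grid T m.+1) (fun k => sigma (grid T m.+1 k))
    (grid_ge0 T0 _ _) (grid_mono T0 _)
    (eq_ind_r (fun u => u <= T) (lexx T) (gridT T (ltn0Sn m))).

Lemma grid_step_funE m t l :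
  step_eval (grid_step_fun m) t l 0 = grid_step T (fun s => sigma s l 0) m t.
Proof. by rewrite summxE; apply: eq_bigr => k _; rewrite mxE. Qed.

Let sq_error (phi : step_fun n T) l : R :=
  \int[mu]_(s in `[0, T]) ((step_eval phi s l 0 - sigma s l 0) ^+ 2).

Let error_L2 (phi : step_fun n T) l :
  L2 mu `[0, T] (fun s => step_eval phi s l 0 - sigma s l 0).
Proof.
by apply: (L2B (mI T)); [exact: (step_eval_L2 W i0)|exact: sigma_L2].
Qed.

Lemma grid_step_L2_cvg l : (fun m => sq_error (grid_step_fun m) l) @ \oo --> (0 : R).
Proof.
have [L L0 HL] := within_bounded (@csigma l).
have sub s : s \in `[0, T] -> 0 <= s <= T by rewrite in_itv.
have := @dominated_convergence _ _ _ mu `[0, T]%classic (mI T)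
  (fun m s => ((step_eval (grid_step_fun m) s l 0 - sigma s l 0) ^+ 2)%:E)
  (fun=> 0%:E) (fun=> ((2 * L) ^+ 2)%:E).
move=> H; case: H.
- by move=> m; apply/measurable_EFinP; apply: measurable_funX; case: (error_L2 (grid_step_fun m) l).
- exact: measurable_cst.
- exists [set 0]; split => //; first exact: lebesgue_measure_set1.
  move=> s /=; apply: contra_notP => s0 /sub /andP[ss sT].
  apply/cvg_EFin; first by near=> m.
  have cs : grid_step T (fun s => sigma s l 0) m s @[m --> \oo] --> sigma s l 0.
    by apply: grid_step_cvg => //; rewrite sT andbT lt_neqAle ss andbT eq_sym; apply/eqP.
  have c2 : (grid_step T (fun s => sigma s l 0) m s - sigma s l 0) ^+ 2
      @[m --> \oo] --> (sigma s l 0 - sigma s l 0) ^+ 2.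
    by apply: cvgM; apply: cvgB => //; exact: cvg_cst.
  rewrite subrr expr0n /= in c2; apply: cvg_trans c2; apply: near_eq_cvg.
  by near=> m; rewrite /= grid_step_funE.
- exact: (integrable_cstr (mI T) _ (lebesgue_itv_fin 0 T)).
- apply: aeW => s m /= /sub st; rewrite lee_fin grid_step_funE ger0_norm ?sqr_ge0//.
  rewrite -real_normK ?num_real// lerXn2r ?nnegrE ?mulr_ge0//.
  rewrite (le_trans (ler_normB _ _))// mulrDl mul1r lerD ?HL//.
  by apply: grid_step_bound.
by move=> _ _; rewrite integral0 => /fine_cvgP[].
Unshelve. all: by end_near. Qed.

Lemma step_fun_approximation (kappa : R) : 0 < kappa ->
  exists phi : step_fun n T, forall l, sq_error phi l <= kappa.
Proof.
move=> k0.
have h : \forall m \near \oo, forall l : 'I_n, sq_error (grid_step_fun m) l <= kappa.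
  apply: filter_forall => l; have /cvgrPdist_le /(_ kappa k0) := grid_step_L2_cvg l.
  by apply: filterS => m; rewrite sub0r normrN; exact: le_trans (ler_norm _).
by have [m _ /(_ m (leqnn m))] := h; exists (grid_step_fun m).
Qed.

(* The thresholds e_m and the precision e_m^3 / 4 of the m-th approximation
   turn the maximal inequality into the summable bound e_m. *)
Let e (m : nat) : R := 1 / (2 ^ m.+1)%:R.

Let e_gt0 m : 0 < e m. Proof. by rewrite divr_gt0// ltr0n expn_gt0. Qed.

Let eS m : e m = 2 * e m.+1.
Proof.
rewrite /e (expnS _ m.+1) natrM; field.
by rewrite pnatr_eq0 expn_eq0.
Qed.

Let e_cvg : e @ \oo --> (0 : R).
Proof.
have h : `|1 / 2 : R| < 1 by rewrite ger0_norm; lra.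
rewrite (_ : e = geometric (1 / 2) (1 / 2)); first exact: cvg_geometric.
apply/funext => m; rewrite /geometric/= /e natrX exprSr expr_div_n expr1n.
by field; rewrite expf_neq0 ?pnatr_eq0.
Qed.

Section Limit.
Variable phi : nat -> step_fun n T.
Hypothesis phiP : forall m l, sq_error (phi m) l <= e m ^+ 3 / 4.

Let S m t w l : R := step_integral (phi m) (W i0) t w l 0.

Let LS m t l : 0 <= t <= T -> L2 Pr setT (fun w => S m t w l).
Proof. by move=> tT; exact: step_integral_L2. Qed.

(** By the isometry this is a squared distance of step functions, each within e^3 / 4 of [sigma];
    the quarter makes 2/4 + 2/4 = 1 in (a + b)^2 <= 2 a^2 + 2 b^2. *)
Lemma step_cauchy m q t l : (m <= q)%N -> 0 <= t <= T ->
  \int[Pr]_w ((S q t w l - S m t w l) ^+ 2) <= e m ^+ 3.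
Proof.
move=> mq tT; have /andP[t0 tT'] := tT.
have [_ ->] := step_difference_isometry hW hWindep hx0meas hx0W i0 (phi q) (phi m) l tT.
have LD := L2N (mI T) (error_L2 (phi m) l).
have E' s : step_eval (phi q) s l 0 - step_eval (phi m) s l 0 =
    (step_eval (phi q) s l 0 - sigma s l 0) + - (step_eval (phi m) s l 0 - sigma s l 0).
  by ring.
under eq_Rintegral do rewrite E'.
apply: le_trans (Rintegral_sqr_subitv tT' (L2D (mI T) (error_L2 (phi q) l) LD)) _.
apply: le_trans (L2_sqrD_le (mI T) (error_L2 (phi q) l) LD) _.
under [X in _ + 2 * X <= _]eq_Rintegral do rewrite sqrrN.
have eqm : e q <= e m.
  by rewrite /e !div1r lef_pV2 ?posrE ?ltr0n ?expn_gt0// ler_nat leq_exp2l.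
have e3 : e q ^+ 3 <= e m ^+ 3 by rewrite lerXn2r// nnegrE ltW.
have := phiP m l; have := phiP q l; rewrite /sq_error => h1 h2; lra.
Qed.

Lemma step_integral_continuous m l w :
  {within `[0, +oo[, continuous (fun t => W i0 t w)} ->
  {within `[0, T], continuous (fun t => S m t w l)}.
Proof.
move=> /subspace_continuousP cW.
have cmin a : 0 <= a -> {within `[0, T], continuous (fun t => W i0 (Num.min t a) w)}.
  move=> a0; apply/subspace_continuousP => t /=; rewrite in_itv/= => /andP[t0 tT].
  have tin : `[0, +oo[%classic (Num.min t a) by rewrite /= in_itv/= andbT le_min t0.
  have cm : Num.min x a @[x --> t] --> Num.min t a.
    apply/cvgrPdist_lt => eps eps0; near=> x.
    have : `|t - x| < eps by near: x; exact: cvgr_dist_lt.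
    rewrite !ltr_norml => /andP[h1 h2].
    by have [ta|ta] := leP t a; have [xa|xa] := leP x a; apply/andP; split; lra.
  move=> A /(cW _ tin) wA.
  have hA : \forall x \near t, `[0, +oo[%classic (Num.min x a) -> A (W i0 (Num.min x a) w).
    exact: (cm _ wA).
  suff : \forall x \near t, `[0, T]%classic x -> A (W i0 (Num.min x a) w) by [].
  by apply: filterS hA => x xA /= xT; apply: xA; move: xT;
    rewrite /= !in_itv/= andbT le_min => /andP[-> _].
have E : (fun t => S m t w l) = fun t => \sum_(k < step_size (phi m))
    (W i0 (Num.min t (step_time (phi m) k.+1)) w - W i0 (Num.min t (step_time (phi m) k)) w)
      * step_val (phi m) k l 0.
  by apply/funext => t; rewrite /S summxE; apply: eq_bigr => k _; rewrite mxE.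
have tk0 k : 0 <= step_time (phi m) k.
  by elim: k => [|k IH]; [exact: step_time_ge0|exact: le_trans IH (step_time_mono _ _)].
rewrite E; apply: within_sum => k; apply: within_M; last exact: within_cst.
by apply: within_D; [|apply: within_N]; exact: cmin.
Unshelve. all: by end_near. Qed.

(** Dyadic grids are nested: the exceptional sets [bad] increase with k, so the probability of their
    union is the limit of their probabilities. *)
Let dyadic k j : R := grid T (2 ^ k) j.

Let dyadic_in k j : (j <= 2 ^ k)%N -> 0 <= dyadic k j <= T.
Proof. by move=> jk; apply: grid_leT => //; rewrite expn_gt0. Qed.

Let D m t w l : R := S m.+1 t w l - S m t w l.

Let bad m l k : set Omega :=
  [set w | exists2 j, (j <= 2 ^ k)%N & e m < `|D m (dyadic k j) w l|].

Let mD m t l : 0 <= t <= T -> measurable_fun setT (fun w => D m t w l).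
Proof. by move=> tT; case: (L2B measurableT (LS m.+1 l tT) (LS m l tT)). Qed.

Let mbad m l k : measurable (bad m l k).
Proof.
rewrite (_ : bad m l k = \bigcup_(j in [set j | (j <= 2 ^ k)%N])
    [set w | e m < `|D m (dyadic k j) w l|]).
  apply: bigcup_measurable => j jk; rewrite -[X in measurable X]setTI.
  have := @measurable_fun_ltr _ _ _ setT (fun=> e m) (fun w => `|D m (dyadic k j) w l|)
    (measurable_cst _) (measurableT_comp (@normr_measurable R setT) (mD m l (dyadic_in jk))).
  by move=> /(_ measurableT [set true] I); congr measurable; apply/seteqP; split.
by apply/seteqP; split=> w /= -[j jp eS']; exists j.
Qed.

Let bad_prob m l k : (Pr (bad m l k) <= (e m)%:E)%E.
Proof.
(* The maximal inequality takes a sequence indexed by all naturals; after the index 2^k the dyadic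
   times would leave [0, T]. *)
pose u j := Num.min T (dyadic k j).
have u0 j : 0 <= u j by rewrite le_min T0' grid_ge0.
have uT j : 0 <= u j <= T by rewrite u0 ge_min lexx.
have uS j : u j <= u j.+1.
  by rewrite le_min ge_min lexx/= ge_min grid_mono ?orbT.
have LD j : L2 Pr setT (fun w => D m (u j) w l) by apply: L2B => //; exact: LS.
have := @maximal_inequality R d Omega Pr (fun j => Ft (u j)) (fun j w => D m (u j) w l)
  _ _ _ _ LD _ (e m) (2 ^ k)%N (e_gt0 m).
have uE j : (j <= 2 ^ k)%N -> u j = dyadic k j.
  by move=> /dyadic_in /andP[_ jT]; rewrite /u min_r.
rewrite (_ : [set _ | _] = bad m l k); last first.
  by apply/seteqP; split=> w /= -[j jk]; [rewrite uE//|rewrite -uE//]; exists j.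
move=> H; have {H} := H _ _ _ _ _.
have -> : \int[Pr]_w ((D m (u (2 ^ k)%N) w l) ^+ 2) =
    \int[Pr]_w ((S m.+1 (u (2 ^ k)%N) w l - S m (u (2 ^ k)%N) w l) ^+ 2) by [].
have c := step_cauchy l (leqnSn m) (uT (2 ^ k)%N).
have e2 : 0 < e m ^+ 2 by rewrite exprn_gt0.
have fin : Pr (bad m l k) \is a fin_num by exact: fin_num_measure.
move=> H; have {H} : ((e m ^+ 2)%:E * Pr (bad m l k) <= (e m ^+ 3)%:E)%E.
  have c' : ((\int[Pr]_w ((S m.+1 (u (2 ^ k)%N) w l - S m (u (2 ^ k)%N) w l) ^+ 2))%:E <= (e m ^+ 3)%:E)%E.
    by rewrite lee_fin.
  apply: le_trans c'; apply: H.
  - by move=> j; exact: sigma_algebra_gen.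
  - by move=> j; exact: filtration_mono.
  - by move=> j; exact: (filtration_measurable hW hx0meas).
  - move=> j; apply/meas_wrtP; apply: measurable_funB; apply/meas_wrtP;
      exact: step_integral_adapted.
  - move=> j X FX LX.
    have LSd q : L2 Pr setT (fun w => S q (u j.+1) w l - S q (u j) w l).
      by apply: L2B => //; exact: LS.
    rewrite (@eq_Rintegral _ _ _ Pr setT (fun w => X w * (S m.+1 (u j.+1) w l - S m.+1 (u j) w l)
      - X w * (S m (u j.+1) w l - S m (u j) w l))); last by move=> w _; rewrite /D; ring.
    have uT' : u j.+1 <= T by case/andP: (uT j.+1).
    rewrite RintegralB//; try exact: L2_mul.
    by rewrite !(step_integral_orthogonal hW hWindep hx0meas hx0W)// subrr.
rewrite -(fineK fin) -EFinM !lee_fin (exprSr _ 2) => h.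
by rewrite -(ler_pM2l e2).
Qed.

(** Borel-Cantelli, the probabilities being at most [e m], which are summable: almost surely only
    finitely many m violate the bound at some dyadic time, and continuity of the paths takes care of
    the other times. *)
Lemma increments_ae_bounded l : {ae Pr, forall w, exists m0, forall m, (m0 <= m)%N ->
  forall t, 0 <= t <= T -> `|D m t w l| <= e m}.
Proof.
have mU m : measurable (\bigcup_k bad m l k) by exact: bigcupT_measurable.
have PU m : (Pr (\bigcup_k bad m l k) <= (e m)%:E)%E.
  have nd : nondecreasing_seq (bad m l).
    apply/nondecreasing_seqP => k; apply/subsetPset => w [j jk ej].
    exists (2 * j)%N; first by rewrite expnS leq_mul.
    suff -> : dyadic k.+1 (2 * j) = dyadic k j by [].
    rewrite /dyadic /grid expnS !natrM; field.
    by rewrite pnatr_eq0 expn_eq0.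
  have cv := @nondecreasing_cvg_mu _ _ _ Pr (bad m l) (@mbad m l) (mU m) nd.
  rewrite -(cvg_lim _ cv)//; apply: lime_le; first by apply/cvg_ex; eexists; exact: cv.
  by apply: nearW => k; exact: bad_prob.
have fin : (\sum_(m <oo) Pr (\bigcup_k bad m l k) < +oo)%E.
  apply: (@le_lt_trans _ _ (\sum_(m <oo) (e m)%:E)%E); first exact: lee_nneseries.
  exact: le_lt_trans (epsilon_trick0 xpredT (ler01 : 0 <= 1 :> R)) (ltry _).
have z0 := lim_sup_set_cvg0 mU fin.
have cW := brownian_continuous (hW i0).
have h : {ae Pr, forall w, ~ lim_sup_set (fun m => \bigcup_k bad m l k) w}.
  exists (lim_sup_set (fun m => \bigcup_k bad m l k)); split => //.
  - apply: bigcap_measurable => // m _; exact: bigcup_measurable.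
  - by move=> w /=; apply: contra_notP.
apply: filterS2 cW h => w cw nw.
have [m0 m0P] : exists m0, forall m, (m0 <= m)%N -> ~ (\bigcup_k bad m l k) w.
  apply: contra_notP nw => nm m _; apply: contra_notP nm => nb; exists m => q mq bq.
  by apply: nb; exists q.
exists m0 => m mm0; apply: (@grid_dense _ T T0 _ _ (fun k => (2 ^ k)%N)).
- by move=> k; rewrite ltn_expl.
- by apply: within_D; [|apply: within_N]; exact: step_integral_continuous.
- move=> k j jk; rewrite leNgt; apply/negP => ej; apply: (m0P m mm0).
  by exists k => //; exists j.
Qed.

Lemma uniform_limit (s : nat -> R -> R) (m0 : nat) :
  (forall m, {within `[0, T], continuous (s m)}) ->
  (forall m, (m0 <= m)%N -> forall t, 0 <= t <= T -> `|s m.+1 t - s m t| <= e m) ->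
  {within `[0, T], continuous (fun t => limsupR (s ^~ t))} /\
  forall t, 0 <= t <= T -> s ^~ t @ \oo --> limsupR (s ^~ t).
Proof.
move=> cs inc.
(* Since e m = 2 e (m + 1), the bounds from m to m + q telescope to 2 e m - 2 e (m + q), a form that
   passes through the induction. *)
have tail m q t : (m0 <= m)%N -> 0 <= t <= T ->
    `|s (m + q)%N t - s m t| <= 2 * e m - 2 * e (m + q)%N.
  move=> mm tT; elim: q => [|q IH]; first by rewrite addn0 !subrr normr0.
  rewrite addnS -(subrKA (s (m + q)%N t)) (le_trans (ler_normD _ _))//.
  have := inc (m + q)%N (leq_trans mm (leq_addr _ _)) t tT; rewrite (eS (m + q)).
  by move: IH; rewrite (eS (m + q)); lra.
have tail' m q t : (m0 <= m)%N -> (m <= q)%N -> 0 <= t <= T -> `|s q t - s m t| <= 2 * e m.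
  move=> mm mq tT; rewrite -(subnKC mq) (le_trans (tail _ _ _ mm tT))//.
  by rewrite gerBl mulr_ge0// ltW.
have cv t : 0 <= t <= T -> s ^~ t @ \oo --> limsupR (s ^~ t).
  move=> tT; suff /cvg_ex[l sl] : cvgn (s ^~ t) by rewrite (limsupR_cvg sl).
  apply: cauchy_cvg; apply: cauchy_exP => eps eps0.
  have e2 : (fun m => 2 * e m) @ \oo --> (0 : R).
    by rewrite -[X in _ --> X](mulr0 2); apply: cvgM => //; exact: cvg_cst.
  have /cvgrPdist_lt /(_ _ eps0) h := e2.
  near \oo => m; exists (s m t).
  have m0m : (m0 <= m)%N by near: m; exact: nbhs_infty_ge.
  have em : 2 * e m < eps.
    by near: m; apply: filterS h => m; rewrite sub0r normrN; exact: le_lt_trans (ler_norm _).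
  suff : \forall q \near \oo, ball (s m t) eps (s q t) by [].
  near=> q; rewrite /ball/= distrC; apply: le_lt_trans em; apply: tail' => //.
  by near: q; exact: nbhs_infty_ge.
split => //; have dist m t : (m0 <= m)%N -> 0 <= t <= T ->
    `|limsupR (s ^~ t) - s m t| <= 2 * e m.
  move=> mm tT; have cn : `|s q t - s m t| @[q --> \oo] --> `|limsupR (s ^~ t) - s m t|.
    by apply: cvg_norm; apply: cvgB; [exact: cv|exact: cvg_cst].
  rewrite -(cvg_lim _ cn)//; apply: limr_le; first by apply/cvg_ex; eexists; exact: cn.
  by near=> q; apply: tail' => //; near: q; exact: nbhs_infty_ge.
apply/subspace_continuousP => t tin; have tT : 0 <= t <= T by move: tin; rewrite /= in_itv.
apply/cvgrPdist_lt => eps eps0.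
have e2 : (fun m => 2 * e m) @ \oo --> (0 : R).
  by rewrite -[X in _ --> X](mulr0 2); apply: cvgM => //; exact: cvg_cst.
have /cvgrPdist_lt /(_ (eps / 4)) h := e2; have eps4 : 0 < eps / 4 by lra.
near \oo => m.
have m0m : (m0 <= m)%N by near: m; exact: nbhs_infty_ge.
have em : 2 * e m < eps / 4.
  near: m; have := h eps4.
  by apply: filterS => m; rewrite sub0r normrN; exact: le_lt_trans (ler_norm _).
have /subspace_continuousP /(_ t tin) /cvgrPdist_lt /(_ _ eps4) nt := cs m.
have wT : within `[0, T] (nbhs t) `[0, T]%classic by exact: withinT.
apply: filterS2 wT nt => u uT h3.
have h1 := dist m t m0m tT; have h2 : `|limsupR (s ^~ u) - s m u| <= 2 * e m.
  by apply: dist => //; move: uT; rewrite /= in_itv.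
change (`|limsupR (s ^~ t) - limsupR (s ^~ u)| < eps).
have h3' : `|s m t - s m u| < eps / 4 := h3.
rewrite distrC in h2.
have := ler_normD (limsupR (s ^~ t) - s m t) ((s m t - s m u) + (s m u - limsupR (s ^~ u))).
have := ler_normD (s m t - s m u) (s m u - limsupR (s ^~ u)).
by rewrite !subrKA; move: h1 h2 h3' em; lra.
Unshelve. all: by end_near. Qed.

Definition step_limit t w : 'cV[R]_n := \col_l limsupR (fun m => S m t w l).
Local Notation M := step_limit.

Lemma step_limitE t w l : M t w l 0 = limsupR (fun m => S m t w l). Proof. by rewrite mxE. Qed.

Lemma step_limit_ae : {ae Pr, forall w, forall l,
  {within `[0, T], continuous (fun t => M t w l 0)} /\
  forall t, 0 <= t <= T -> (fun m => S m t w l) @ \oo --> M t w l 0}.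
Proof.
apply: filter_forall => l.
apply: filterS2 (brownian_continuous (hW i0)) (increments_ae_bounded l) => w cw [m0 inc].
have [||c1 c2] := @uniform_limit (fun m t => S m t w l) m0.
- by move=> m; exact: step_integral_continuous.
- exact: inc.
split; last by move=> t tT; rewrite step_limitE; exact: c2.
by rewrite (_ : (fun t => M t w l 0) = fun t => limsupR (fun m => S m t w l)) //;
  apply/funext => t; rewrite step_limitE.
Qed.

Lemma step_limit_adapted t l : 0 <= t <= T -> meas_wrt (Ft t) (fun w => M t w l 0).
Proof.
move=> tT; rewrite (_ : (fun w => M t w l 0) = fun w => limsupR (fun m => S m t w l)).
  2: by apply/funext => w; rewrite step_limitE.
apply/meas_wrtP; by apply: measurable_limsupR => m; apply/meas_wrtP; exact: step_integral_adapted.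
Qed.

Lemma step_limit_measurable t : 0 <= t <= T -> measurable_vec (M t).
Proof.
move=> tT l; apply: meas_wrt_measurable (step_limit_adapted l tT).
exact: (filtration_measurable hW hx0meas).
Qed.

(** The limit was taken almost surely; Fatou's lemma applied to [step_cauchy] as q grows shows that
    it is also a limit in L^2, which the definition of the integral requires. *)
Lemma step_limit_error m t l : 0 <= t <= T ->
  L2 Pr setT (fun w => S m t w l - M t w l 0) /\
  \int[Pr]_w ((S m t w l - M t w l 0) ^+ 2) <= e m ^+ 3.
Proof.
move=> tT; have mSM : measurable_fun setT (fun w => S m t w l - M t w l 0).
  by apply: measurable_funB; [case: (LS m l tT)|exact: step_limit_measurable].
have bnd : (\int[Pr]_w ((S m t w l - M t w l 0) ^+ 2)%:E <= (e m ^+ 3)%:E)%E.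
  pose f q w := ((S q t w l - S m t w l) ^+ 2)%:E.
  have mf q : measurable_fun setT (f q).
    apply/measurable_EFinP; apply: measurable_funX.
    by case: (L2B measurableT (LS q l tT) (LS m l tT)).
  have f0 q w : setT w -> (0 <= f q w)%E by move=> _; rewrite lee_fin sqr_ge0.
  have fat := fatou Pr measurableT mf f0.
  apply: (@le_trans _ _ (\int[Pr]_w limn_einf (f ^~ w))%E); last first.
    apply: le_trans fat _; apply: limn_einf_le; near=> q.
    rewrite -(EFin_Rintegral measurableT); last by apply: L2_sqr; apply: L2B => //; exact: LS.
    by rewrite lee_fin; apply: step_cauchy => //; near: q; exact: nbhs_infty_ge.
  rewrite le_eqVlt; apply/orP; left; apply/eqP.
  apply: ge0_ae_eq_integral => //.
  - by apply/measurable_EFinP; exact: measurable_funX.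
  - by apply: measurableT_comp => //; apply: measurable_fun_limn_esup => q;
      exact: measurableT_comp.
  - by move=> w _; rewrite lee_fin sqr_ge0.
  - move=> w _; rewrite limn_einf_lim; apply: lime_ge; first exact: is_cvg_einfs.
    by apply: nearW => q; apply: le_ereal_inf_tmp => _ [p _ <-]; exact: f0.
  apply: filterS step_limit_ae => w /(_ l)[_ /(_ t tT) cw] _.
  have cv : f ^~ w @ \oo --> ((S m t w l - M t w l 0) ^+ 2)%:E.
    apply/cvg_EFin; first by near=> q.
    have -> : (S m t w l - M t w l 0) ^+ 2 = (M t w l 0 - S m t w l) ^+ 2 by ring.
    by apply: cvgM; apply: cvgB => //; exact: cvg_cst.
  by have [-> _] := cvg_limn_einf_sup cv.
have LSM : L2 Pr setT (fun w => S m t w l - M t w l 0).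
  by split => //; apply: le_lt_trans bnd (ltry _).
by split => //; rewrite -lee_fin EFin_Rintegral//; exact: L2_sqr.
Unshelve. all: by end_near. Qed.

Let e3_cvg (c : R) : (fun m => (c * e m ^+ 3)%:E) @ \oo --> 0%E.
Proof.
apply/cvg_EFin; first by near=> m.
have e2 : (fun m => c * e m ^+ 3) @ \oo --> c * (0 : R) ^+ 3.
  by apply: cvgM; [exact: cvg_cst|apply: cvgM => //; apply: cvgM].
by rewrite expr0n mulr0 in e2.
Unshelve. all: by end_near. Qed.

Lemma step_limit_ito : ito_integral Pr T sigma (W i0) M.
Proof.
split; first exact: step_limit_measurable.
exists phi; split.
  apply: (squeeze_cvge _ (cvg_cst 0%E) (e3_cvg n%:R)); near=> m.
  apply/andP; split.
    by apply: integral_ge0 => t _; rewrite lee_fin; apply: sumr_ge0 => l _; exact: sqr_ge0.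
  apply: (sqnorm_integral_le (mI T)) => l.
    rewrite (_ : (fun s => _) = fun s => step_eval (phi m) s l 0 - sigma s l 0).
      exact: error_L2.
    by apply/funext => s; rewrite !mxE.
  rewrite (@eq_Rintegral _ _ _ mu `[0, T]
    (fun s => (step_eval (phi m) s l 0 - sigma s l 0) ^+ 2)); last first.
    by move=> s _; rewrite !mxE.
  apply: le_trans (phiP m l) _; rewrite ler_pdivrMr// ler_peMr ?exprn_ge0// ?ltW//.
  by rewrite (ltr_nat _ 1 4).
move=> t tT; apply: (squeeze_cvge _ (cvg_cst 0%E) (e3_cvg n%:R)); near=> m.
apply/andP; split.
  by apply: integral_ge0 => w _; rewrite lee_fin; apply: sumr_ge0 => l _; exact: sqr_ge0.
apply: (sqnorm_integral_le measurableT) => l.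
  rewrite (_ : (fun w => _) = fun w => S m t w l - M t w l 0).
    by case: (step_limit_error m l tT) => L _.
  by apply/funext => w; rewrite !mxE.
rewrite (@eq_Rintegral _ _ _ Pr setT (fun w => (S m t w l - M t w l 0) ^+ 2)).
  by case: (step_limit_error m l tT).
by move=> w _; rewrite !mxE.
Unshelve. all: by end_near. Qed.

End Limit.

Theorem ito_exists : exists M : R -> Omega -> 'cV[R]_n,
  [/\ ito_integral Pr T sigma (W i0) M,
      forall t l, 0 <= t <= T -> meas_wrt (Ft t) (fun w => M t w l 0),
      forall l, measurable_fun setT (fun p : measurableTypeR R * Omega => M p.1 p.2 l 0) &
      {ae Pr, forall w, {within `[0, T], continuous (M ^~ w)}}].
Proof.
have /choice[phi phiP] : forall m, exists phi : step_fun n T,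
    forall l, sq_error phi l <= e m ^+ 3 / 4.
  by move=> m; apply: step_fun_approximation; rewrite divr_gt0 ?exprn_gt0.
have := step_limit_ito phiP; have := step_limit_ae phiP.
have := @step_limit_adapted phi.
move: (step_limit phi) => M0 FM aM iM.
(* The limit [M0] is adapted, but nothing is known about its joint measurability; its regularisation
   has both properties and agrees with it along continuous paths. *)
pose M t w : 'cV[R]_n := \col_l regul T (fun t w => M0 t w l 0) t w.
have MEl t l : (fun w => M t w l 0) = regul T (fun t w => M0 t w l 0) t.
  by apply/funext => w; rewrite mxE.
have ME : {ae Pr, forall w, (forall t, 0 <= t <= T -> M t w = M0 t w) /\
    {within `[0, T], continuous (M0 ^~ w)}}.
  apply: filterS aM => w aw; split.
    move=> t tT; apply/matrixP => l j; rewrite ord1 mxE regulE//.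
    by case: (aw l).
  by apply/within_mxP => l j; rewrite ord1; case: (aw l).
have sF t : sigma_algebra setT (Ft t) by exact: sigma_algebra_gen.
have Fmono s t : s <= t -> Ft s `<=` Ft t by exact: filtration_mono.
have Fm t : Ft t `<=` measurable by exact: (filtration_measurable hW hx0meas).
have FM' t l : 0 <= t <= T -> meas_wrt (Ft t) (fun w => M t w l 0).
  move=> tT; rewrite MEl.
  by apply: (regul_adapted T0 sF Fmono) => // s sT; exact: FM.
have mS (psi : step_fun n T) (Z : R -> Omega -> 'cV[R]_n) t : 0 <= t <= T ->
    (forall l, meas_wrt (Ft t) (fun w => Z t w l 0)) ->
    measurable_fun setT (fun w => (sqnorm (step_integral psi (W i0) t w - Z t w))%:E).
  move=> tT FZ; apply/measurable_EFinP; apply: measurable_sqnorm => l.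
  rewrite (_ : (fun w => _) = fun w => step_integral psi (W i0) t w l 0 - Z t w l 0).
    apply: measurable_funB; last by apply: meas_wrt_measurable (FZ l).
    by case: (step_integral_L2 hW i0 psi l tT).
  by apply/funext => w; rewrite !mxE.
exists M; split.
- have [_ [psi [c1 c2]]] := iM; split.
    by move=> t tT l; apply: meas_wrt_measurable (FM' t l tT).
  exists psi; split; first exact: c1.
  move=> t tT; have := c2 t tT; apply: cvg_trans.
  apply: near_eq_cvg; near=> m.
  apply: ge0_ae_eq_integral => //.
  + by apply: mS => // l; exact: FM.
  + by apply: mS => // l; exact: FM'.
  + by move=> w _; rewrite lee_fin; apply: sumr_ge0 => l _; exact: sqr_ge0.
  + by move=> w _; rewrite lee_fin; apply: sumr_ge0 => l _; exact: sqr_ge0.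
  + by apply: filterS ME => w [E _] _; rewrite E.
- exact: FM'.
- move=> l; rewrite (_ : (fun p => _) = fun p : measurableTypeR R * Omega =>
     regul T (fun t w => M0 t w l 0) p.1 p.2).
    by apply: (regul_measurable T0 Fm) => s sT; exact: FM.
  by apply/funext => p; rewrite mxE.
- apply: filterS ME => w [ME cM0].
  apply: (@subspace_eq_continuous _ _ _ (M0 ^~ w)); last exact: cM0.
  by move=> t; rewrite inE /= in_itv/= => tT; exact: (esym (ME t tT)).
Unshelve. all: by end_near. Qed.

End ItoExistence.

(** * The closed-loop state *)

Section VectorMeasurability.
Context {R : realType} {d : measure_display} {Omega : measurableType d}.
Variable H : set (set Omega).
Hypothesis sH : sigma_algebra setT H.

Definition vmeas k (X : Omega -> 'cV[R]_k) : Prop :=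
  forall j, meas_wrt H (fun w => X w j 0).

Lemma vmeas_cst k (v : 'cV[R]_k) : vmeas (fun=> v).
Proof. by move=> j; apply/(meas_wrt_algebraP _ sH); exact: measurable_cst. Qed.

Lemma vmeas_D k (X Y : Omega -> 'cV[R]_k) :
  vmeas X -> vmeas Y -> vmeas (fun w => X w + Y w).
Proof.
move=> mX mY j; apply/(meas_wrt_algebraP _ sH).
rewrite (_ : (fun w => _) = fun w => X w j 0 + Y w j 0).
  by apply: measurable_funD; exact/(meas_wrt_algebraP _ sH).
by apply/funext => w; rewrite mxE.
Qed.

Lemma vmeas_mulmx k m (P : 'M[R]_(m, k)) (X : Omega -> 'cV[R]_k) :
  vmeas X -> vmeas (fun w => P *m X w).
Proof.
move=> mX j; apply/(meas_wrt_algebraP _ sH).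
rewrite (_ : (fun w => _) = fun w => \sum_i P j i * X w i 0).
  by apply: measurable_sum => i; apply: measurable_funM => //; exact/(meas_wrt_algebraP _ sH).
by apply/funext => w; rewrite mxE.
Qed.

Lemma vmeas_Z k (c : R) (X : Omega -> 'cV[R]_k) :
  vmeas X -> vmeas (fun w => c *: X w).
Proof.
move=> mX; rewrite (_ : (fun w => _) = fun w => c%:M *m X w).
  exact: vmeas_mulmx.
by apply/funext => w; rewrite mul_scalar_mx.
Qed.

Lemma vmeas_N k (X : Omega -> 'cV[R]_k) : vmeas X -> vmeas (fun w => - X w).
Proof.
move=> mX; rewrite (_ : (fun w => _) = fun w => -1 *: X w); first exact: vmeas_Z.
by apply/funext => w; rewrite scaleN1r.
Qed.

Lemma vmeas_sum k (I : Type) (s : seq I) (X : I -> Omega -> 'cV[R]_k) :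
  (forall i, vmeas (X i)) -> vmeas (fun w => \sum_(i <- s) X i w).
Proof.
move=> mX; elim: s => [|i s IH].
  rewrite (_ : (fun w => _) = fun=> 0); first exact: vmeas_cst.
  by apply/funext => w; rewrite big_nil.
rewrite (_ : (fun w => _) = fun w => X i w + \sum_(i <- s) X i w).
  exact: vmeas_D.
by apply/funext => w; rewrite big_cons.
Qed.

End VectorMeasurability.

Section LinearStates.
Context {R : realType} {d : measure_display} {Omega : measurableType d}.
Variable T : R.
Hypothesis T0 : 0 < T.
Variable F : R -> set (set Omega).
Hypothesis sF : forall t, sigma_algebra setT (F t).
Hypothesis Fmono : forall s t, s <= t -> F s `<=` F t.
Hypothesis Fm : forall t, F t `<=` measurable.

Definition vregul k (z : R -> Omega -> 'cV[R]_k) (t : R) (w : Omega) : 'cV[R]_k :=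
  \col_l regul T (fun t w => z t w l 0) t w.

Section Regul.
Variables (k : nat) (z : R -> Omega -> 'cV[R]_k).
Hypothesis Fz : forall t, 0 <= t <= T -> vmeas (F t) (z t).

Lemma vregul_measurable l :
  measurable_fun setT (fun p : measurableTypeR R * Omega => vregul z p.1 p.2 l 0).
Proof.
rewrite (_ : (fun p => _) = fun p : measurableTypeR R * Omega =>
   regul T (fun t w => z t w l 0) p.1 p.2).
  by apply: (regul_measurable T0 Fm) => s sT; exact: Fz.
by apply/funext => p; rewrite mxE.
Qed.

Lemma vregul_adapted t : 0 <= t <= T -> vmeas (F t) (vregul z t).
Proof.
move=> tT l; rewrite (_ : (fun w => _) = regul T (fun t w => z t w l 0) t).
  by apply: (regul_adapted T0 sF Fmono) => // s sT; exact: Fz.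
by apply/funext => w; rewrite mxE.
Qed.

Lemma vregulE t w : 0 <= t <= T -> {within `[0, T], continuous (z ^~ w)} ->
  vregul z t w = z t w.
Proof.
move=> tT /within_mxP cz; apply/matrixP => l j; rewrite ord1 mxE regulE//.
Qed.

End Regul.

Variables (n : nat) (Phi Psi : R -> 'M[R]_n).

(** Variation of constants with [rint] for the integral, so that the value is adapted at every
    sample point and correct where the forcing has a continuous path. *)
Definition voc (y0 : Omega -> 'cV[R]_n) (c : R -> Omega -> 'cV[R]_n)
    (t : R) (w : Omega) : 'cV[R]_n :=
  Phi t *m (Psi 0 *m y0 w +
    \col_k rint T (fun s w => (Psi s *m c s w) k 0) t w).

Lemma voc_adapted y0 c : vmeas (F 0) y0 ->
  (forall t, 0 <= t <= T -> vmeas (F t) (c t)) ->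
  forall t, 0 <= t <= T -> vmeas (F t) (voc y0 c t).
Proof.
move=> Fy Fc t tT; apply: vmeas_mulmx => //; apply: vmeas_D => //.
  apply: vmeas_mulmx => // j; apply: meas_wrt_sub (Fy j).
  by apply: Fmono; case/andP: tT.
move=> l; rewrite (_ : (fun w => _) = rint T (fun s w => (Psi s *m c s w) l 0) t).
  by apply: (rint_adapted T0 sF Fmono) => // s sT; exact: vmeas_mulmx (Fc s sT) _.
by apply/funext => w; rewrite mxE.
Qed.

Lemma vocE y0 c w : {within `[0, T], continuous Psi} ->
  {within `[0, T], continuous (c ^~ w)} -> forall t, 0 <= t <= T ->
  voc y0 c t w = Phi t *m (Psi 0 *m y0 w + \col_k
    (\int[lebesgue_measure]_(s in `[0, t]) (Psi s *m c s w) k 0)).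
Proof.
move=> cP cc t tT; congr (_ *m (_ + _)); apply/matrixP => k j; rewrite !mxE.
apply: rintE => //.
by have /within_mxP/(_ k 0) := within_mulmx cP cc.
Qed.

End LinearStates.

(** * Pathwise solution of the closed loop *)

Section ClosedLoopPath.
Context {R : realType}.
Variables (n r N : nat) (T : R).
Hypotheses (hN : (0 < N)%N) (T0 : 0 <= T).
Variables (A : 'M[R]_n) (B : 'M[R]_(n, r)) (G : 'M[R]_n) (Rc : 'M[R]_r).
Variables (P K : R -> 'M[R]_n) (s f : R -> 'cV[R]_n).
Variables (PhiP PsiP PhiM PsiM : R -> 'M[R]_n).
Let S := B *m invmx Rc *m B^T.
Hypothesis cP : {within `[0, T], continuous P}.
Hypothesis cK : {within `[0, T], continuous K}.
Hypothesis cs : {within `[0, T], continuous s}.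
Hypothesis cf : {within `[0, T], continuous f}.
Hypothesis hPhiP : forall t, t <= T ->
  [/\ mx_is_derive PhiP t ((A - S *m P t) *m PhiP t),
      PhiP t *m PsiP t = 1%:M &
      mx_is_derive PsiP t (- (PsiP t *m (A - S *m P t)))].
Hypothesis hPhiM : forall t, t <= T ->
  [/\ mx_is_derive PhiM t ((A + G - S *m (P t + K t)) *m PhiM t),
      PhiM t *m PsiM t = 1%:M &
      mx_is_derive PsiM t (- (PsiM t *m (A + G - S *m (P t + K t))))].

Definition avg k (v : 'I_N -> 'cV[R]_k) : 'cV[R]_k := N%:R^-1 *: \sum_j v j.

(** Subtracting the noise from the state leaves a pathwise differential equation, into which the
    noise returns as a forcing, multiplied by the closed-loop matrix. The terms in [f] and [s],
    common to all agents, belong to the average. *)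
Definition mean_forcing (m : 'I_N -> R -> 'cV[R]_n) (t : R) : 'cV[R]_n :=
  (A + G - S *m (P t + K t)) *m avg (m ^~ t) + (f t - S *m s t).

Definition deviation_forcing (m : 'I_N -> R -> 'cV[R]_n) i (t : R) : 'cV[R]_n :=
  (A - S *m P t) *m (m i t - avg (m ^~ t)).

Definition voc_path (Phi Psi : R -> 'M[R]_n) (y0 : 'cV[R]_n) (c : R -> 'cV[R]_n)
    (t : R) : 'cV[R]_n :=
  Phi t *m (Psi 0 *m y0 +
    \col_k (\int[lebesgue_measure]_(s in `[0, t]) (Psi s *m c s) k 0)).

Variables (a : 'I_N -> 'cV[R]_n) (m : 'I_N -> R -> 'cV[R]_n).
Hypothesis cm : forall i, {within `[0, T], continuous (m i)}.

(* Y is the average of the processes z i - m i and D i their deviation from it;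
   the two satisfy decoupled linear equations. *)
Let Y := voc_path PhiM PsiM (avg a) (mean_forcing m).
Let D i := voc_path PhiP PsiP (a i - avg a) (deviation_forcing m i).
Let z i t := D i t + Y t + m i t.

Lemma avg_sub0 k (v : 'I_N -> 'cV[R]_k) : \sum_i (v i - avg v) = 0.
Proof.
rewrite big_split/= sumr_const card_ord /avg -scaler_nat scalerN scalerA.
by rewrite divff ?scale1r ?subrr// pnatr_eq0 -lt0n.
Qed.

Lemma within_avg : {within `[0, T], continuous (fun t => avg (m ^~ t))}.
Proof.
apply: within_Z; first exact: within_cst.
apply/within_mxP => i j.
rewrite (_ : (fun t => _) = fun t => \sum_l m l t i j).
  by apply: within_sum => l; have /within_mxP/(_ i j) := @cm l.
by apply/funext => t; rewrite summxE.
Qed.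

Let cSP : {within `[0, T], continuous (fun t => A - S *m P t)}.
Proof.
apply: within_D; first exact: within_cst; apply: within_N.
by apply: within_mulmx; [exact: within_cst|exact: cP].
Qed.

Let cSM : {within `[0, T], continuous (fun t => A + G - S *m (P t + K t))}.
Proof.
apply: within_D; first exact: within_cst; apply: within_N.
by apply: within_mulmx; [exact: within_cst|exact: within_D].
Qed.

Lemma within_mean_forcing : {within `[0, T], continuous (mean_forcing m)}.
Proof.
apply: within_D; first by apply: within_mulmx; [exact: cSM|exact: within_avg].
apply: within_D; first exact: cf; apply: within_N.
by apply: within_mulmx; [exact: within_cst|exact: cs].
Qed.

Lemma within_deviation_forcing i : {within `[0, T], continuous (deviation_forcing m i)}.
Proof.
apply: within_mulmx; first exact: cSP.
by apply: within_D; [exact: cm|apply: within_N; exact: within_avg].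
Qed.

Let cPsiP : {within `[0, T], continuous PsiP}.
Proof.
apply: (@within_derive_mx R 0 T n n PsiP (fun t => - (PsiP t *m (A - S *m P t)))).
by move=> t /andP[_ /hPhiP[_ _]].
Qed.

Let cPsiM : {within `[0, T], continuous PsiM}.
Proof.
apply: (@within_derive_mx R 0 T n n PsiM
  (fun t => - (PsiM t *m (A + G - S *m (P t + K t))))).
by move=> t /andP[_ /hPhiM[_ _]].
Qed.

Let YP := @variation_of_constants R n _ PhiM PsiM _ (avg a) T T0 cSM
  (fun t tT => let: And3 x _ _ := hPhiM (proj2 (andP tT)) in x)
  (fun t tT => let: And3 _ x _ := hPhiM (proj2 (andP tT)) in x)
  cPsiM within_mean_forcing.

Let DP i := @variation_of_constants R n _ PhiP PsiP _ (a i - avg a) T T0 cSP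
  (fun t tT => let: And3 x _ _ := hPhiP (proj2 (andP tT)) in x)
  (fun t tT => let: And3 _ x _ := hPhiP (proj2 (andP tT)) in x)
  cPsiP (@within_deviation_forcing i).

Lemma closed_loop_continuous i : {within `[0, T], continuous (z i)}.
Proof.
apply: within_D; last exact: cm.
by apply: within_D; [case: (DP i)|case: YP].
Qed.

(** The deviations depend linearly on initial data and forcings that sum to 0 over the agents, so
    they sum to 0 themselves; hence [Y] really is the average of the noise-free parts. *)
Lemma closed_loop_avg t : 0 <= t <= T -> avg (z ^~ t) = Y t + avg (m ^~ t).
Proof.
move=> tT; have [t0 tT'] := andP tT.
have DS : \sum_i D i t = 0.
  rewrite -mulmx_sumr big_split/= -mulmx_sumr avg_sub0 mulmx0 add0r.
  rewrite (_ : \sum_i _ = 0) ?mulmx0//; apply/matrixP => k j.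
  rewrite summxE mxE; under eq_bigr do rewrite mxE.
  have mt : measurable (`[0, t]%classic : set (measurableTypeR R)).
    exact: measurable_itv.
  rewrite -(Rintegral_sumr mt); last first.
    move=> i; apply: within_integrable; apply: (within_sub (lexx 0) tT').
    by have /within_mxP/(_ k 0) := within_mulmx cPsiP (@within_deviation_forcing i).
  rewrite (@eq_Rintegral _ _ _ lebesgue_measure `[0, t] (cst 0)); last first.
    move=> u _ /=; rewrite -summxE -!mulmx_sumr avg_sub0 !mulmx0.
    by rewrite mxE.
  by rewrite Rintegral_cst// mul0r.
have E (y : 'cV[R]_n) : N%:R^-1 *: (y *+ N) = y.
  by rewrite -[y *+ N]scaler_nat scalerA mulVf ?scale1r// pnatr_eq0 -lt0n.
by rewrite {1}/avg /z !big_split/= DS add0r sumr_const card_ord scalerDr E.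
Qed.

Lemma closed_loop_equation i t : 0 <= t <= T ->
  z i t = a i + \col_k (\int[lebesgue_measure]_(u in `[0, t])
    (A *m z i u + B *m (- (invmx Rc *m B^T *m (P u *m z i u + K u *m avg (z ^~ u) + s u)))
     + G *m avg (z ^~ u) + f u) k 0) + m i t.
Proof.
move=> tT; have [t0 tT'] := andP tT.
have [cD _ _ DE] := DP i; have [cY _ _ YE] := YP.
rewrite {1}/z; congr (_ + _); rewrite [D i t](DE t tT) [Y t](YE t tT).
rewrite addrACA subrK; congr (_ + _); apply/matrixP => k j; rewrite !mxE.
rewrite -RintegralD//; last 2 first.
- apply: within_integrable; apply: (within_sub (lexx 0) tT').
  have /within_mxP/(_ k 0) := within_D (within_mulmx cSP cD) (@within_deviation_forcing i).
  by [].
- apply: within_integrable; apply: (within_sub (lexx 0) tT').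
  have /within_mxP/(_ k 0) := within_D (within_mulmx cSM cY) within_mean_forcing.
  by [].
apply: eq_Rintegral => u; rewrite inE/= in_itv/= => /andP[u0 ut].
have uT : 0 <= u <= T by rewrite u0 (le_trans ut).
have -> : forall X Z : 'cV[R]_n, X k 0 + Z k 0 = (X + Z) k 0.
  by move=> X Z; rewrite mxE.
rewrite (closed_loop_avg uT); congr (fun_of_matrix _ k 0).
rewrite -[PhiP u *m _]/(D i u) -[PhiM u *m _]/(Y u) /mean_forcing /deviation_forcing /z.
move: (D i u) (Y u) (m i u) (avg (m ^~ u)) => d y mi mb.
rewrite /S mulmxN !(mulmxDl, mulmxDr, mulNmx, mulmxN) !mulmxA; mx_abel.
Qed.

End ClosedLoopPath.

(** * An adapted and jointly measurable closed-loop state *)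

Section StateExists.
Context {R : realType} {d : measure_display} {Omega : measurableType d}.
Variable Pr : probability Omega R.
Variables (n r N : nat) (T : R).
Variables (A : 'M[R]_n) (B : 'M[R]_(n, r)) (G : 'M[R]_n) (Rc : 'M[R]_r).
Variables (f sigma : R -> 'cV[R]_n).
Variables (x0 : 'I_N -> Omega -> 'cV[R]_n) (W : 'I_N -> R -> Omega -> R).
Hypotheses (hN : (0 < N)%N) (T0 : 0 < T).
Hypothesis hW : forall i, brownian_motion Pr (W i).
Hypothesis hWindep :
  mutually_independent Pr (fun i => sigma_of `[0, +oo[ (W i)).
Hypothesis hx0meas : forall i, measurable_vec (x0 i).
Hypothesis hx0W : independent2 Pr
  <<s \bigcup_(i in [set: 'I_N]) sigma_vec (x0 i) >>
  <<s \bigcup_(i in [set: 'I_N]) sigma_of `[0, +oo[ (W i) >>.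
Hypothesis hsigma : {within `[0, T], continuous sigma}.
Variables (P K : R -> 'M[R]_n) (s : R -> 'cV[R]_n).
Variables (PhiP PsiP PhiM PsiM : R -> 'M[R]_n).
Let S := B *m invmx Rc *m B^T.
Hypothesis cP : {within `[0, T], continuous P}.
Hypothesis cK : {within `[0, T], continuous K}.
Hypothesis cs : {within `[0, T], continuous s}.
Hypothesis cf : {within `[0, T], continuous f}.
Hypothesis hPhiP : forall t, t <= T ->
  [/\ mx_is_derive PhiP t ((A - S *m P t) *m PhiP t),
      PhiP t *m PsiP t = 1%:M &
      mx_is_derive PsiP t (- (PsiP t *m (A - S *m P t)))].
Hypothesis hPhiM : forall t, t <= T ->
  [/\ mx_is_derive PhiM t ((A + G - S *m (P t + K t)) *m PhiM t),
      PhiM t *m PsiM t = 1%:M &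
      mx_is_derive PsiM t (- (PsiM t *m (A + G - S *m (P t + K t))))].

Local Notation Ft := (filtration x0 W).

Definition continuous_adapted k (z : 'I_N -> R -> Omega -> 'cV[R]_k) : Prop :=
  [/\ forall i l, measurable_fun setT
        (fun p : measurableTypeR R * Omega => z i p.1 p.2 l 0),
      forall i t, 0 <= t <= T -> vmeas (Ft t) (z i t) &
      {ae Pr, forall w, forall i, {within `[0, T], continuous (z i ^~ w)}}].

Lemma noises_exist : exists M : 'I_N -> R -> Omega -> 'cV[R]_n,
  continuous_adapted M /\ forall i, ito_integral Pr T sigma (W i) (M i).
Proof.
have /choice[M MP] := fun i => ito_exists hW hWindep hx0meas hx0W i T0 hsigma.
exists M; split; last by move=> i; case: (MP i).
split.
- by move=> i l; case: (MP i).
- by move=> i t tT l; case: (MP i) => _ h _ _; exact: h.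
- by apply: filter_forall => i; case: (MP i).
Qed.

Lemma closed_loop_drift (x : 'I_N -> R -> Omega -> 'cV[R]_n) (z : 'I_N -> R -> 'cV[R]_n)
    i t w : (forall j u, 0 <= u <= t -> x j u w = z j u) ->
  \col_k (\int[lebesgue_measure]_(u in `[0, t])
    drift A B G f (feedback B Rc P K s x) x i u w k 0) =
  \col_k (\int[lebesgue_measure]_(u in `[0, t])
    (A *m z i u + B *m (- (invmx Rc *m B^T *m (P u *m z i u + K u *m avg (z ^~ u) + s u)))
     + G *m avg (z ^~ u) + f u) k 0).
Proof.
move=> xz; apply/matrixP => k j; rewrite [LHS]mxE [RHS]mxE.
apply: eq_Rintegral => u; rewrite inE/= in_itv/= => ut.
have avgE : average x u w = avg (z ^~ u).
  by rewrite /average /avg; congr (_ *: _); apply: eq_bigr => l _; rewrite xz.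
by rewrite /drift /feedback avgE xz.
Qed.

Lemma closed_loop_exists (M : 'I_N -> R -> Omega -> 'cV[R]_n) : continuous_adapted M ->
  exists x : 'I_N -> R -> Omega -> 'cV[R]_n, continuous_adapted x /\
    {ae Pr, forall w, forall i t, 0 <= t <= T -> x i t w = x0 i w
       + \col_k (\int[lebesgue_measure]_(u in `[0, t])
                  drift A B G f (feedback B Rc P K s x) x i u w k 0)
       + M i t w}.
Proof.
move=> [jM FM cM].
have sF t : sigma_algebra setT (Ft t) by exact: sigma_algebra_gen.
have Fmono u t : u <= t -> Ft u `<=` Ft t by exact: filtration_mono.
have Fm t : Ft t `<=` measurable by exact: (filtration_measurable hW hx0meas).
have Fx0 t i : vmeas (Ft t) (x0 i) by move=> j; exact: filtration_x0.
have Favg k t (X : 'I_N -> Omega -> 'cV[R]_k) : (forall i, vmeas (Ft t) (X i)) ->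
    vmeas (Ft t) (fun w => avg (X ^~ w)).
  by move=> FX; apply: vmeas_Z => //; exact: vmeas_sum.
pose m w := fun i t => M i t w.
pose cY t w := mean_forcing A B G Rc P K s f (m w) t.
pose cD i t w := deviation_forcing A B Rc P (m w) i t.
pose Y := voc T PhiM PsiM (fun w => avg (x0 ^~ w)) cY.
pose D i := voc T PhiP PsiP (fun w => x0 i w - avg (x0 ^~ w)) (cD i).
pose z i t w := D i t w + Y t w + M i t w.
have FY t : 0 <= t <= T -> vmeas (Ft t) (Y t).
  apply: (voc_adapted T0 sF Fmono); first exact: Favg.
  move=> u uT; apply: vmeas_D => //; last exact: vmeas_cst.
  by apply: vmeas_mulmx => //; apply: Favg => i; exact: FM.
have FD i t : 0 <= t <= T -> vmeas (Ft t) (D i t).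
  apply: (voc_adapted T0 sF Fmono).
    by apply: vmeas_D => //; apply: vmeas_N => //; exact: Favg.
  move=> u uT; apply: vmeas_mulmx => //; apply: vmeas_D => //; first exact: FM.
  by apply: vmeas_N => //; apply: Favg => j; exact: FM.
have Fz i t : 0 <= t <= T -> vmeas (Ft t) (z i t).
  move=> tT; apply: vmeas_D => //; last exact: FM.
  by apply: vmeas_D => //; [exact: FD|exact: FY].
(* [z] is adapted, but a state must also be jointly measurable; the regularised process has both
   properties and coincides with [z] along continuous paths. *)
pose x i := vregul T (z i).
have T0' : 0 <= T by exact: ltW.
have cPsiP : {within `[0, T], continuous PsiP}.
  apply: (@within_derive_mx R 0 T n n PsiP (fun t => - (PsiP t *m (A - S *m P t)))).
  by move=> t /andP[_ /hPhiP[_ _]].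
have cPsiM : {within `[0, T], continuous PsiM}.
  apply: (@within_derive_mx R 0 T n n PsiM
    (fun t => - (PsiM t *m (A + G - S *m (P t + K t))))).
  by move=> t /andP[_ /hPhiM[_ _]].
have good w : (forall i, {within `[0, T], continuous (M i ^~ w)}) ->
    (forall i, {within `[0, T], continuous (x i ^~ w)}) /\
    forall i t, 0 <= t <= T -> x i t w = x0 i w
       + \col_k (\int[lebesgue_measure]_(u in `[0, t])
                  drift A B G f (feedback B Rc P K s x) x i u w k 0)
       + M i t w.
  move=> cMw; pose zp i t := voc_path PhiP PsiP (x0 i w - avg (x0 ^~ w))
      (deviation_forcing A B Rc P (m w) i) t +
    voc_path PhiM PsiM (avg (x0 ^~ w)) (mean_forcing A B G Rc P K s f (m w)) t + m w i t.
  have zE i t : 0 <= t <= T -> z i t w = zp i t.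
    move=> tT; rewrite /z /zp; congr (_ + _ + _).
      by apply: (vocE T0) => //; exact: within_deviation_forcing.
    by apply: (vocE T0) => //; exact: within_mean_forcing.
  have czp i : {within `[0, T], continuous (zp i)}.
    have := @closed_loop_continuous R n r N T T0' A B G Rc P K s f PhiP PsiP PhiM PsiM cP cK cs cf hPhiP hPhiM (x0 ^~ w) (m w) cMw i.
    exact.
  have cz i : {within `[0, T], continuous (z i ^~ w)}.
    apply: (@subspace_eq_continuous _ _ _ (zp i)); last exact: czp.
    by move=> t; rewrite inE /= in_itv/= => tT; exact: (esym (zE i t tT)).
  have xz i t : 0 <= t <= T -> x i t w = zp i t.
    by move=> tT; rewrite /x vregulE// zE.
  have E i t : 0 <= t <= T -> zp i t = x0 i w + \col_k (\int[lebesgue_measure]_(u in `[0, t])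
    (A *m zp i u + B *m (- (invmx Rc *m B^T *m (P u *m zp i u + K u *m avg (zp ^~ u) + s u)))
     + G *m avg (zp ^~ u) + f u) k 0) + M i t w.
    exact: (closed_loop_equation hN T0' cP cK cs cf hPhiP hPhiM (x0 ^~ w) cMw).
  clear cz zE; clearbody zp x.
  split.
    move=> i; apply: (@subspace_eq_continuous _ _ _ (zp i)); last exact: czp.
    by move=> t; rewrite inE /= in_itv/= => tT; exact: (esym (xz i t tT)).
  move=> i t tT; rewrite (xz i t tT) (E i t tT).
  have xz' j u : 0 <= u <= t -> x j u w = zp j u.
    move=> /andP[u0 ut]; apply: xz.
    by rewrite u0 (le_trans ut)//; case/andP: tT.
  by rewrite (closed_loop_drift i xz').
exists x; split; last by apply: filterS cM => w /good[].
split.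
- by move=> i l; apply: (vregul_measurable T0 Fm) => t; exact: Fz.
- by move=> i t tT; apply: (vregul_adapted T0 sF Fmono) => // u; exact: Fz.
- by apply: filterS cM => w /good[].
Qed.

End StateExists.

(** * Estimates for states and controls *)

Lemma integrable_ae_eq d (T : measurableType d) (R : realType)
    (mu : {measure set T -> \bar R}) (D : set T) (f g : T -> \bar R) :
  measurable D -> measurable_fun D g -> {ae mu, forall x, D x -> f x = g x} ->
  mu.-integrable D f -> mu.-integrable D g.
Proof.
move=> mD mg fg /integrableP[mf fi]; apply/integrableP; split => //.
have <- : (\int[mu]_(x in D) `|f x| = \int[mu]_(x in D) `|g x|)%E.
  apply: ge0_ae_eq_integral => //; try exact: measurableT_comp.
  by apply: filterS fg => x h /h /= ->.
by [].
Qed.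

(** * Integration on the product of time and sample space *)

Section TimeSpace.
Context {R : realType} {d : measure_display} {Omega : measurableType d}.
Variables (Pr : probability Omega R) (T : R).

Local Notation mu := (@lebesgue_measure R).
Local Notation TO := (measurableTypeR R * Omega)%type.

Definition timespace : set TO := `[0, T]%classic `*` [set: Omega].
Local Notation D := timespace.
Definition timespace_measure : {measure set TO -> \bar R} := (mu \x Pr)%E.
Local Notation mP := timespace_measure.

Let mI : measurable (`[0, T]%classic : set (measurableTypeR R)).
Proof. exact: measurable_itv. Qed.

Lemma measurable_timespace : measurable D.
Proof. by apply: measurableX. Qed.
Let mD := measurable_timespace.

Lemma timespace_finite : (mP D < +oo)%E.
Proof.
have -> : mP D = (mu `[0%R, T]%classic * Pr setT)%E by exact: product_measure1E.
by rewrite probability_setT mule1 lebesgue_itv_fin.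
Qed.

Let patch_time (f : TO -> R) t w :
  ((EFin \o f) \_ D) (t, w) = ((fun t => (f (t, w))%:E) \_ `[0, T]) t.
Proof.
rewrite !patchE; congr (if _ then _ else _).
by apply/idP/idP; rewrite !inE; [case|split].
Qed.

Section Sections.
Variable f : TO -> R.
Hypothesis mf : measurable_fun D f.

Lemma measurable_time_section w :
  measurable_fun (`[0, T]%classic : set (measurableTypeR R)) (fun t => f (t, w)).
Proof.
apply: (@measurable_comp _ _ _ _ _ _ D f _ (fun t => (t, w))) => //.
- by move=> _ [t tT <-].
- by apply: measurable_funS (pair2_measurable w).
Qed.

Lemma measurable_space_section t : 0 <= t <= T ->
  measurable_fun setT (fun w => f (t, w)).
Proof.
move=> tT; apply: (@measurable_comp _ _ _ _ _ _ D f _ (fun w => (t, w))) => //.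
  by move=> _ [w _ <-]; split => //=; rewrite in_itv.
exact: pair1_measurable.
Qed.

End Sections.

Lemma timespace_tonelli (f : TO -> R) : measurable_fun D f ->
  (forall p, D p -> 0 <= f p) ->
  [/\ (\int[mP]_(p in D) (f p)%:E =
       \int[Pr]_w \int[mu]_(t in `[0%R, T]) (f (t, w))%:E)%E,
      (\int[mP]_(p in D) (f p)%:E =
       \int[mu]_(t in `[0%R, T]) \int[Pr]_w (f (t, w))%:E)%E,
      measurable_fun setT (fun w => \int[mu]_(t in `[0%R, T]) (f (t, w))%:E)%E &
      measurable_fun (`[0, T]%classic : set (measurableTypeR R))
        (fun t => \int[Pr]_w (f (t, w))%:E)%E].
Proof.
move=> mf f0; have mfD : measurable_fun setT ((EFin \o f) \_ D).
  apply: (iffLR (measurable_restrictT _ mD)); exact/measurable_EFinP.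
have fD0 p : (0 <= ((EFin \o f) \_ D) p)%E.
  by rewrite patchE; case: ifPn => //; rewrite inE lee_fin; exact: f0.
have E w : (\int[mu]_(t in `[0%R, T]) (f (t, w))%:E =
            \int[mu]_t ((EFin \o f) \_ D) (t, w))%E.
  by rewrite integral_mkcond; apply: eq_integral => t _; rewrite patch_time.
split.
- rewrite integral_mkcond (fubini_tonelli2 _ mfD fD0).
  by apply: eq_integral => w _; rewrite E.
- rewrite integral_mkcond (fubini_tonelli1 _ mfD fD0) [RHS]integral_mkcond.
  apply: eq_integral => t _; rewrite /fubini_F patchE; case: ifPn => tT.
    by apply: eq_integral => w _; rewrite patch_time patchE tT.
  rewrite -[RHS](integral0 Pr setT); apply: eq_integral => w _.
  by rewrite patch_time patchE (negbTE tT).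
- by under eq_fun do rewrite E; exact: measurable_fun_fubini_tonelli_G.
- have mF := @measurable_fun_fubini_tonelli_F _ _ _ _ R Pr _ mfD fD0.
  have mF' : measurable_fun (`[0, T]%classic : set (measurableTypeR R))
      (fubini_F Pr ((EFin \o f) \_ D)) by exact: measurable_funS mF.
  apply: eq_measurable_fun mF' => t tT.
  by apply: eq_integral => w _; rewrite patch_time patchE tT.
Qed.

(** The inner integrals are real, with default values on the null set of sections that are not
    integrable; they match the extended-real ones only almost everywhere, which is enough for the
    outer integrals. *)
Lemma timespace_fubini (f : TO -> R) : mP.-integrable D (EFin \o f) ->
  measurable_fun D f /\
  [/\ {ae Pr, forall w, mu.-integrable `[0, T] (EFin \o (fun t => f (t, w)))},
      Pr.-integrable setT (EFin \o (fun w => \int[mu]_(t in `[0, T]) f (t, w))),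
      \int[mP]_(p in D) f p = \int[Pr]_w \int[mu]_(t in `[0, T]) f (t, w),
      mu.-integrable `[0, T] (EFin \o (fun t => \int[Pr]_w f (t, w))) &
      \int[mP]_(p in D) f p = \int[mu]_(t in `[0, T]) \int[Pr]_w f (t, w)].
Proof.
move=> If; have mf : measurable_fun D f.
  by case/integrableP: (If) => /measurable_EFinP.
split => //; have IfD : mP.-integrable setT ((EFin \o f) \_ D).
  exact: (iffLR (integrable_mkcond _ mD)).
have E w : (\int[mu]_t ((EFin \o f) \_ D) (t, w) =
            \int[mu]_(t in `[0%R, T]) (f (t, w))%:E)%E.
  by rewrite [RHS]integral_mkcond; apply: eq_integral => t _; rewrite patch_time.
have ae1 : {ae Pr, forall w, mu.-integrable `[0, T] (EFin \o (fun t => f (t, w)))}.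
  have := ae_integrable2 IfD; apply: filterS => w h.
  apply: (iffRL (integrable_mkcond _ mI)); apply: eq_integrable h => // t _.
have finE : {ae Pr, forall w, (\int[mu]_(t in `[0%R, T]) (f (t, w))%:E)%E =
    (\int[mu]_(t in `[0, T]) f (t, w))%:E}.
  by apply: filterS ae1 => w h; rewrite EFin_Rintegral.
have mG := measurable_fubini_G IfD.
have iG : Pr.-integrable setT (fubini_G mu ((EFin \o f) \_ D)).
  have mfD : measurable_fun setT ((EFin \o f) \_ D) by case/integrableP: IfD.
  have mfa : measurable_fun setT (abse \o ((EFin \o f) \_ D)) by exact: measurableT_comp.
  apply/integrableP; split => //.
  apply: le_lt_trans (iffLR (integrable21ltyP mu Pr mfD) IfD).
  apply: ge0_le_integral => //.
  - exact: measurableT_comp.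
  - by have := @measurable_fun_fubini_tonelli_G _ _ _ _ R mu _ mfa (fun p => abse_ge0 _).
  - move=> w _; apply: le_abse_integral => //.
    by apply: measurableT_comp mfD _.
have iG' : Pr.-integrable setT (fun w => \int[mu]_(t in `[0%R, T]) (f (t, w))%:E)%E.
  by apply: eq_integrable iG => // w _; rewrite /fubini_G E.
have mR : measurable_fun setT (fun w => \int[mu]_(t in `[0, T]) f (t, w)).
  apply: (measurableT_comp (@fine_measurable R _ measurableT)).
  by case/integrableP: iG'.
have iR : Pr.-integrable setT (EFin \o (fun w => \int[mu]_(t in `[0, T]) f (t, w))).
  apply: (integrable_ae_eq measurableT _ _ iG'); first exact/measurable_EFinP.
  by apply: filterS finE => w h _.
pose H t := (\int[Pr]_w (f (t, w))%:E)%E.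
have HF t : fubini_F Pr ((EFin \o f) \_ D) t = (H \_ `[0, T]) t.
  rewrite /fubini_F patchE; case: ifPn => tT.
    by apply: eq_integral => w _; rewrite patch_time patchE tT.
  rewrite -[RHS](integral0 Pr setT); apply: eq_integral => w _.
  by rewrite patch_time patchE (negbTE tT).
have iH : mu.-integrable `[0, T] H.
  apply: (iffRL (integrable_mkcond _ mI)).
  by apply: eq_integrable (integrable_fubini_F IfD) => // t _; rewrite HF.
have mh : measurable_fun (`[0, T]%classic : set (measurableTypeR R)) (fine \o H).
  apply: (measurableT_comp (@fine_measurable R _ measurableT)).
  by case/integrableP: iH.
have aeH : {ae mu, forall t, `[0, T]%classic t -> H t = (fine (H t))%:E}.
  by have := integrable_ae mI iH; apply: filterS => t h /h ?; rewrite fineK.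
have ih : mu.-integrable `[0, T] (EFin \o (fine \o H)).
  by apply: (integrable_ae_eq mI _ aeH iH); exact/measurable_EFinP.
split => //.
- apply: EFin_inj; rewrite (EFin_Rintegral measurableT iR) (EFin_Rintegral mD If).
  rewrite [LHS]integral_mkcond -(integral21_prod_meas1 IfD).
  apply: ae_eq_integral => //.
  + by case/integrableP: iR.
  + by apply: filterS finE => w h _; rewrite /fubini_G E.
- apply: EFin_inj; rewrite (EFin_Rintegral mD If) [RHS](EFin_Rintegral mI ih).
  rewrite [LHS]integral_mkcond -(integral12_prod_meas1 IfD).
  transitivity (\int[mu]_(t in `[0%R, T]) H t)%E.
    by rewrite [RHS]integral_mkcond; apply: eq_integral => t _; rewrite HF.
  by apply: ae_eq_integral => //; [case/integrableP: iH|case/integrableP: ih].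
Qed.

(** Cauchy-Schwarz, from the nonnegative integral of the square of |g| minus its mean
    [gamma / T]. *)
Lemma Rintegral_sqr_le (g : R -> R) : 0 < T -> L2 mu `[0, T] g ->
  (\int[mu]_(t in `[0, T]) `|g t|) ^+ 2 <= T * \int[mu]_(t in `[0, T]) (g t ^+ 2).
Proof.
move=> T0 Lg; have fin := lebesgue_itv_fin 0 T.
have Lg' : L2 mu `[0, T] (fun t => `|g t|).
  apply: (L2_le mI _ Lg); first by apply: measurableT_comp => //; case: Lg.
  by move=> t _; rewrite normr_id.
set gamma := \int[mu]_(t in `[0, T]) `|g t|.
have h : 0 <= \int[mu]_(t in `[0, T]) ((`|g t| - gamma / T) ^+ 2) by exact: L2_sqr_ge0.
have E : \int[mu]_(t in `[0, T]) ((`|g t| - gamma / T) ^+ 2) =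
    \int[mu]_(t in `[0, T]) (g t ^+ 2) - gamma ^+ 2 / T.
  rewrite (@eq_Rintegral _ _ _ mu `[0, T]
    (fun t => (g t ^+ 2 + (gamma / T) ^+ 2) - (2 * gamma / T) * `|g t|)); last first.
    by move=> t _; rewrite sqrrB real_normK ?num_real//; field; rewrite gt_eqF.
  have i1 := L2_integrable mI fin Lg'; have i2 := L2_sqr Lg.
  have i3 := integrable_cstr mI ((gamma / T) ^+ 2) fin.
  rewrite RintegralB//; last 2 first.
  - exact: (integrable_addr mI).
  - exact: (integrable_scale mI).
  have i4 : \int[mu]_(t in `[0, T]) ((gamma / T) ^+ 2) = (gamma / T) ^+ 2 * T.
    have muT : mu `[0%R, T]%classic = T%:E.
      by rewrite lebesgue_measure_itv/= lte_fin T0 sube0.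
    have := Rintegral_cst mu mI ((gamma / T) ^+ 2).
    by rewrite (_ : fine _ = T)//; exact: (congr1 fine muT).
  rewrite RintegralD// i4 RintegralZl// -/gamma.
  by field; rewrite gt_eqF.
have : 0 <= T * (\int[mu]_(t in `[0, T]) (g t ^+ 2) - gamma ^+ 2 / T).
  by rewrite mulr_ge0 ?(ltW T0)// -E.
by rewrite mulrBr mulrCA mulfV ?gt_eqF// mulr1 subr_ge0.
Qed.

(** Pathwise Gronwall estimates bound a process by the time integral of |g|; Cauchy-Schwarz in time
    turns this into a square-integrable bound on the product space. *)
Lemma L2_path_bound (X g : TO -> R) (c : Omega -> R) (C : R) : 0 < T ->
  measurable_fun D X -> L2 Pr setT c -> L2 mP D g ->
  {ae Pr, forall w, forall t, 0 <= t <= T ->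
     `|X (t, w)| <= c w + C * \int[mu]_(s in `[0, T]) `|g (s, w)|} ->
  L2 mP D X.
Proof.
move=> T0 mX Lc Lg XB; split => //.
have mX2 : measurable_fun D (fun p => X p ^+ 2) by exact: measurable_funX.
have [-> _ mS _] := timespace_tonelli mX2 (fun p _ => sqr_ge0 _).
have [_ [ae1 i2 _ _ _]] := timespace_fubini (L2_sqr Lg).
(* By (a + b)^2 <= 2 a^2 + 2 b^2 and Cauchy-Schwarz, [b w / T] bounds the square of the path at
   every time; the factor [T] comes from integrating in time. *)
pose b w := T * (2 * c w ^+ 2 + 2 * (C ^+ 2 * T) *
  \int[mu]_(t in `[0, T]) (g (t, w) ^+ 2)).
have ib : Pr.-integrable setT (EFin \o b).
  apply: integrable_scale => //; apply: integrable_addr => //.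
    by apply: integrable_scale => //; exact: L2_sqr.
  exact: integrable_scale.
have b0 w : 0 <= b w.
  have h := L2_sqr_ge0 mu `[0, T]%classic (fun t => g (t, w)).
  have T0' := ltW T0.
  by rewrite /b mulr_ge0// addr_ge0// mulr_ge0// ?sqr_ge0// mulr_ge0// mulr_ge0// sqr_ge0.
apply: (@le_lt_trans _ _ (\int[Pr]_w (b w)%:E)%E); last first.
  by rewrite -(EFin_Rintegral measurableT ib) ltry.
apply: ae_ge0_le_integral => //.
- by move=> w _; apply: integral_ge0 => t _; rewrite lee_fin sqr_ge0.
- by move=> w _; rewrite lee_fin.
- by case/integrableP: ib.
have mg : measurable_fun D g by case: Lg.
apply: filterS2 XB ae1 => w XB ig _.
have Lgw : L2 mu `[0, T] (fun t => g (t, w)).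
  by apply: L2P => //; exact: measurable_time_section.
have cs := Rintegral_sqr_le T0 Lgw.
set gamma := \int[mu]_(s in `[0, T]) `|g (s, w)| in XB cs.
apply: (@le_trans _ _ (\int[mu]_(t in `[0%R, T]) (b w / T)%:E)%E).
  apply: ge0_le_integral => //.
  - by move=> t _; rewrite lee_fin sqr_ge0.
  - by apply/measurable_EFinP; apply: measurable_funX; exact: measurable_time_section.
  - move=> t; rewrite /= in_itv/= => tT; rewrite lee_fin /b mulrAC mulfV ?gt_eqF// mul1r.
    have := XB t tT; have := normr_ge0 (X (t, w)).
    rewrite -(real_normK (num_real (X (t, w)))) => n0 nB.
    have h1 : `|X (t, w)| ^+ 2 <= (c w + C * gamma) ^+ 2.
      by rewrite lerXn2r ?nnegrE// (le_trans n0).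
    have h2 := sqr_ge0 (c w - C * gamma).
    have h3 : C ^+ 2 * gamma ^+ 2 <= C ^+ 2 * (T * \int[mu]_(t in `[0, T]) (g (t, w) ^+ 2)).
      by rewrite ler_wpM2l ?sqr_ge0.
    by move: h1 h2 h3; nra.
have muT : mu `[0%R, T]%classic = T%:E by rewrite lebesgue_measure_itv/= lte_fin T0 sube0.
have -> : (\int[mu]_(_ in `[0%R, T]) (b w / T)%:E = (b w / T)%:E * T%:E)%E.
  by rewrite integral_cst//; congr (_ * _)%E; exact: muT.
by rewrite -EFinM lee_fin divfK// gt_eqF.
Qed.

End TimeSpace.

Lemma gronwall_integral (R : realType) (phi : R -> R) (a L T : R) :
  0 <= T -> 0 <= L -> {within `[0, T], continuous phi} ->
  (forall t, 0 <= t <= T ->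
     phi t <= a + L * \int[lebesgue_measure]_(s in `[0, t]) phi s) ->
  forall t, 0 <= t <= T -> phi t <= a * expR (L * t).
Proof.
move=> T0 L0 cphi phiB t tT.
have [C0 cC dC] := within_primitive T0 cphi.
set C := fun t : R => \int[lebesgue_measure]_(s in `[0, t]) phi s in C0 cC dC.
(* Its derivative exp(-L u) L (phi - a - L C) is nonpositive by hypothesis, and its value at 0 is
   [a]. *)
pose psi u := expR (- L * u) * (a + L * C u).
have dpsi u : 0 < u < T ->
    is_derive u 1 psi (expR (- L * u) * L * (phi u - (a + L * C u))).
  move=> uT; have d1 := is_derive_expRM (- L) u.
  have d2 := is_deriveD (is_derive_cst a u (1 : R)) (is_deriveZ L (dC u uT)).
  have d3 := is_deriveM d1 d2.
  apply: is_derive_eq d3 _; rewrite /GRing.scale /=.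
  by change ((cst a + L \*: C) u) with (a + L * C u); ring.
have cpsi : {within `[0, T], continuous psi}.
  apply: within_M; first exact: within_expR.
  apply: within_D; first exact: within_cst.
  by apply: within_M; [exact: within_cst|exact: cC].
have [t0 tT'] := andP tT.
have mono : psi t <= psi 0.
  apply: (@ler0_derive1_nincr _ psi 0 T _ _ cpsi 0 t (lexx 0) t0 tT') => u;
    rewrite in_itv/= => uT; first by have [] := dpsi u uT.
  rewrite derive1E; have [_ ->] := dpsi u uT.
  rewrite mulr_ge0_le0 ?mulr_ge0 ?expR_ge0// subr_le0; apply: phiB.
  by case/andP: uT => /ltW -> /ltW ->.
move: mono; rewrite /psi (C0 : C 0 = 0) mulr0 expR0 mul1r mulr0 addr0 => mono.
apply: le_trans (phiB t tT) _; rewrite -/(C t).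
have := ler_wpM2r (expR_ge0 (L * t)) mono.
by rewrite mulrAC -expRD mulNr addNr expR0 mul1r.
Qed.

Section L1Norm.
Context {R : realType}.

(** The sum norm: bounding the norm of an integral by the integral of the norm then goes coordinate
    by coordinate. *)
Definition l1 k (v : 'cV[R]_k) : R := \sum_j `|v j 0|.
Definition entry_sum m k (M : 'M[R]_(m, k)) : R := \sum_i \sum_j `|M i j|.

Lemma l1_ge0 k (v : 'cV[R]_k) : 0 <= l1 v.
Proof. by apply: sumr_ge0 => j _. Qed.

Lemma entry_sum_ge0 m k (M : 'M[R]_(m, k)) : 0 <= entry_sum M.
Proof. by apply: sumr_ge0 => i _; apply: sumr_ge0. Qed.

Lemma le_l1 k (v : 'cV[R]_k) j : `|v j 0| <= l1 v.
Proof. by rewrite /l1 (bigD1 j)//= lerDl sumr_ge0. Qed.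

Lemma l1D k (u v : 'cV[R]_k) : l1 (u + v) <= l1 u + l1 v.
Proof. by rewrite -big_split; apply: ler_sum => j _; rewrite mxE ler_normD. Qed.

Lemma l1N k (v : 'cV[R]_k) : l1 (- v) = l1 v.
Proof. by apply: eq_bigr => j _; rewrite mxE normrN. Qed.

Lemma l1Z k c (v : 'cV[R]_k) : l1 (c *: v) = `|c| * l1 v.
Proof. by rewrite mulr_sumr; apply: eq_bigr => j _; rewrite mxE normrM. Qed.

Lemma l1_sum k (I : finType) (v : I -> 'cV[R]_k) : l1 (\sum_i v i) <= \sum_i l1 (v i).
Proof.
rewrite [leRHS]exchange_big; apply: ler_sum => j _; rewrite summxE.
exact: ler_norm_sum.
Qed.

Lemma l1_mulmx m k (M : 'M[R]_(m, k)) (v : 'cV[R]_k) : l1 (M *m v) <= entry_sum M * l1 v.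
Proof.
rewrite mulr_suml; apply: ler_sum => i _; rewrite mxE.
apply: le_trans (ler_norm_sum _ _ _) _; rewrite mulr_suml; apply: ler_sum => j _.
by rewrite normrM ler_wpM2l// le_l1.
Qed.

Lemma l1_mulmx_le m k (M : 'M[R]_(m, k)) (v : 'cV[R]_k) (c : R) :
  (forall i j, `|M i j| <= c) -> l1 (M *m v) <= (m * k)%:R * c * l1 v.
Proof.
move=> Mc; apply: le_trans (l1_mulmx M v) _; rewrite ler_wpM2r ?l1_ge0//.
apply: (@le_trans _ _ (\sum_(i < m) \sum_(j < k) c)).
  by apply: ler_sum => i _; apply: ler_sum.
by rewrite !sumr_const !card_ord -mulrnA mulr_natl mulnC.
Qed.

Lemma l1_avg N k (v : 'I_N -> 'cV[R]_k) : l1 (avg v) <= \sum_i l1 (v i).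
Proof.
rewrite /avg l1Z; apply: le_trans (_ : _ <= 1 * l1 (\sum_i v i)) _.
  rewrite ler_wpM2r ?l1_ge0// normfV normr_nat.
  case: N v => [v|N v]; first by rewrite invr0 ler01.
  by rewrite invf_le1 ?ltr0n// ler1n.
by rewrite mul1r l1_sum.
Qed.

Lemma l1_bounded k (v : 'cV[R]_k) (c : R) :
  (forall i j, `|v i j| <= c) -> l1 v <= k%:R * c.
Proof.
move=> vc; apply: (@le_trans _ _ (\sum_(j < k) c)); first by apply: ler_sum.
by rewrite sumr_const card_ord mulr_natl.
Qed.

End L1Norm.

(** * Gronwall bounds for coupled integral equations *)

Section VectorIntegrable.
Context {R : realType}.
Variable T : R.
Hypothesis T0 : 0 <= T.
Local Notation mu := (@lebesgue_measure R).

Let mI (t : R) : measurable (`[0, t]%classic : set (measurableTypeR R)).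
Proof. exact: measurable_itv. Qed.

Definition vint k (v : R -> 'cV[R]_k) : Prop :=
  forall j, mu.-integrable `[0, T] (EFin \o (fun t => v t j 0)).

Lemma vint_D k (u v : R -> 'cV[R]_k) : vint u -> vint v -> vint (fun t => u t + v t).
Proof.
move=> iu iv j; rewrite (_ : (fun t => _) = fun t => u t j 0 + v t j 0).
  exact: (integrable_addr (mI T)).
by apply/funext => t; rewrite mxE.
Qed.

Lemma vint_sum k (I : finType) (v : I -> R -> 'cV[R]_k) :
  (forall i, vint (v i)) -> vint (fun t => \sum_i v i t).
Proof.
move=> iv j; rewrite (_ : (fun t => _) = fun t => \sum_i v i t j 0).
  by apply: (integrable_sumr (mI T)) => i; exact: iv.
by apply/funext => t; rewrite summxE.
Qed.

Lemma vint_mulmx m k (M : 'M[R]_(m, k)) (v : R -> 'cV[R]_k) :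
  vint v -> vint (fun t => M *m v t).
Proof.
move=> iv i; rewrite (_ : (fun t => _) = fun t => \sum_j M i j * v t j 0).
  by apply: (integrable_sumr (mI T)) => j; apply: (integrable_scale (mI T)); exact: iv.
by apply/funext => t; rewrite mxE.
Qed.

Lemma vint_Z k c (v : R -> 'cV[R]_k) : vint v -> vint (fun t => c *: v t).
Proof.
move=> iv; rewrite (_ : (fun t => _) = fun t => c%:M *m v t); first exact: vint_mulmx.
by apply/funext => t; rewrite mul_scalar_mx.
Qed.

Lemma vint_N k (v : R -> 'cV[R]_k) : vint v -> vint (fun t => - v t).
Proof.
move=> iv; rewrite (_ : (fun t => _) = fun t => -1 *: v t); first exact: vint_Z.
by apply/funext => t; rewrite scaleN1r.
Qed.

Lemma vint_continuous k (v : R -> 'cV[R]_k) :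
  {within `[0, T], continuous v} -> vint v.
Proof. by move=> /within_mxP cv j; apply: within_integrable; exact: cv. Qed.

Lemma vint_avg N k (v : 'I_N -> R -> 'cV[R]_k) :
  (forall i, vint (v i)) -> vint (fun t => avg (v ^~ t)).
Proof. by move=> iv; apply: vint_Z; exact: vint_sum. Qed.

Lemma integrable_subitv (g : R -> R) t : t <= T ->
  mu.-integrable `[0, T] (EFin \o g) -> mu.-integrable `[0, t] (EFin \o g).
Proof.
move=> tT; apply: integrableS => //; by apply: subset_itvl; rewrite bnd_simp.
Qed.

Lemma integrable_l1 k (v : R -> 'cV[R]_k) : vint v ->
  mu.-integrable `[0, T] (EFin \o (fun t => l1 (v t))).
Proof.
move=> iv; apply: (integrable_sumr (mI T)) => j.
exact: (integrable_norm (iv j)).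
Qed.

Lemma Rintegral_ge0_subitv (g : R -> R) t : 0 <= t <= T -> (forall s, 0 <= g s) ->
  mu.-integrable `[0, T] (EFin \o g) ->
  \int[mu]_(s in `[0, t]) g s <= \int[mu]_(s in `[0, T]) g s.
Proof.
move=> /andP[t0 tT] g0 ig; have igt := integrable_subitv tT ig.
rewrite -lee_fin !EFin_Rintegral//; apply: ge0_subset_integral => //.
- by case/integrableP: ig.
- by move=> s _; rewrite lee_fin.
- by apply: subset_itvl; rewrite bnd_simp.
Qed.

(** The agents are coupled through their average, so Gronwall is applied to the sum of all norms;
    adding the N inequalities produces the factors N. *)
Lemma linear_system_bound n N (y b : 'I_N -> R -> 'cV[R]_n) (a : 'I_N -> 'cV[R]_n)
    (g : R -> R) (L : R) : 0 <= L -> (forall s, 0 <= g s) ->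
  mu.-integrable `[0, T] (EFin \o g) ->
  (forall i, {within `[0, T], continuous (y i)}) -> (forall i, vint (b i)) ->
  (forall i t, 0 <= t <= T ->
     y i t = a i + \col_k (\int[mu]_(s in `[0, t]) (b i s) k 0)) ->
  (forall i s, 0 <= s <= T -> l1 (b i s) <= L * \sum_j l1 (y j s) + g s) ->
  forall i t, 0 <= t <= T ->
  l1 (y i t) <= (\sum_i l1 (a i) + N%:R * \int[mu]_(s in `[0, T]) g s) *
                expR (N%:R * L * T).
Proof.
move=> L0 g0 ig cy ib yE bB i t tT.
pose phi s := \sum_j l1 (y j s).
have cphi : {within `[0, T], continuous phi}.
  apply: within_sum => j; apply: within_sum => k; apply: within_norm.
  by have /within_mxP/(_ k 0) := cy j.
have iphi := within_integrable cphi.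
have phiB u : 0 <= u <= T -> phi u <= (\sum_i l1 (a i) + N%:R * \int[mu]_(s in `[0, T]) g s)
    + N%:R * L * \int[mu]_(s in `[0, u]) phi s.
  move=> uT; have [u0 uT'] := andP uT.
  have B1 j : l1 (y j u) <= l1 (a j) + (L * \int[mu]_(s in `[0, u]) phi s +
      \int[mu]_(s in `[0, T]) g s).
    rewrite yE//; apply: le_trans (l1D _ _) _; rewrite lerD2l.
    apply: (@le_trans _ _ (\int[mu]_(s in `[0, u]) l1 (b j s))).
      rewrite Rintegral_sumr//; last first.
        by move=> k; apply: integrable_norm; apply: integrable_subitv uT' _; exact: ib.
      apply: ler_sum => k _; rewrite mxE; apply: le_normr_Rintegral => //.
      by apply: integrable_subitv uT' _; exact: ib.
    have iphiu := integrable_subitv uT' iphi; have igu := integrable_subitv uT' ig.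
    apply: le_trans (_ : \int[mu]_(s in `[0, u]) (L * phi s + g s) <= _).
      apply: le_Rintegral => //.
      - by apply: integrable_subitv uT' _; exact: integrable_l1.
      - by apply: (integrable_addr (mI u)) => //; exact: (integrable_scale (mI u)).
      - move=> s /=; rewrite in_itv/= => /andP[s0 su]; apply: bB.
        by rewrite s0 (le_trans su).
    rewrite RintegralD// ?RintegralZl// ?lerD2l; last exact: (integrable_scale (mI u)).
    exact: Rintegral_ge0_subitv.
  apply: le_trans (ler_sum _ (fun j _ => B1 j)) _.
  rewrite big_split/= sumr_const card_ord -[X in _ + X <= _]mulr_natl.
  by rewrite le_eqVlt; apply/orP; left; apply/eqP; ring.
have gr := gronwall_integral T0 _ cphi phiB tT.
apply: (@le_trans _ _ (phi t)).
  by rewrite /phi (bigD1 i)//= lerDl sumr_ge0// => j _; exact: l1_ge0.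
apply: le_trans (gr _) _; first by rewrite mulr_ge0.
rewrite ler_wpM2l ?ler_expR//.
  rewrite addr_ge0 ?sumr_ge0// ?mulr_ge0 ?Rintegral_ge0//.
  by move=> j _; exact: l1_ge0.
by rewrite ler_wpM2l ?mulr_ge0//; case/andP: tT.
Qed.

End VectorIntegrable.

(** * Differences of two states *)

Section Differences.
Context {R : realType} {d : measure_display} {Omega : measurableType d}.
Variable Pr : probability Omega R.
Variables (n r N : nat) (T : R).
Variables (A : 'M[R]_n) (B : 'M[R]_(n, r)) (G : 'M[R]_n).
Variables (f sigma : R -> 'cV[R]_n).
Variables (x0 : 'I_N -> Omega -> 'cV[R]_n) (W : 'I_N -> R -> Omega -> R).
Hypothesis T0 : 0 < T.
Hypothesis hW : forall i, brownian_motion Pr (W i).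
Hypothesis hWindep :
  mutually_independent Pr (fun i => sigma_of `[0, +oo[ (W i)).
Hypothesis hx0meas : forall i, measurable_vec (x0 i).
Hypothesis hx0W : independent2 Pr
  <<s \bigcup_(i in [set: 'I_N]) sigma_vec (x0 i) >>
  <<s \bigcup_(i in [set: 'I_N]) sigma_of `[0, +oo[ (W i) >>.
Hypothesis hsigma : {within `[0, T], continuous sigma}.
Hypothesis cf : {within `[0, T], continuous f}.

Local Notation Ft := (filtration x0 W).
Local Notation mu := (@lebesgue_measure R).
Local Notation D := (@timespace R d Omega T).
Local Notation mP := (timespace_measure Pr).
Local Notation TO := (measurableTypeR R * Omega)%type.

Let T0' : 0 <= T. Proof. exact: ltW. Qed.
Let mI (t : R) : measurable (`[0, t]%classic : set (measurableTypeR R)).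
Proof. exact: measurable_itv. Qed.
Let mD : measurable D := measurable_timespace T.

Lemma adaptedP k (z : R -> Omega -> 'cV[R]_k) :
  adapted T Ft z <-> forall t, 0 <= t <= T -> vmeas (Ft t) (z t).
Proof.
split=> [az t tT j|vz t tT].
  apply: meas_wrt_sub (az t tT) _.
  exact: (@meas_wrt_sigma_of _ _ _ _ setT (fun k w => z t w k 0) j).
by apply: sigma_of_sub => [|j _]; [exact: sigma_algebra_gen|exact: vz].
Qed.

Lemma jointly_measurable_sqnorm k (z : R -> Omega -> 'cV[R]_k) :
  jointly_measurable T z -> measurable_fun D (fun p => sqnorm (z p.1 p.2)).
Proof. by move=> jz; apply: measurable_sqnorm. Qed.

Lemma L2_adaptedP k (z : R -> Omega -> 'cV[R]_k) :
  L2_adapted Pr T Ft z <-> (forall t, 0 <= t <= T -> vmeas (Ft t) (z t)) /\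
    forall j, L2 mP D (fun p => z p.1 p.2 j 0).
Proof.
split.
  move=> [jz /adaptedP az fz]; split => // j; split; first exact: jz.
  have mz := jointly_measurable_sqnorm jz.
  have [E _ _ _] := timespace_tonelli Pr mz (fun p _ => sumr_ge0 _ (fun i _ => sqr_ge0 _)).
  rewrite -E in fz; apply: le_lt_trans fz; apply: ge0_le_integral => //.
  - by move=> p _; rewrite lee_fin sqr_ge0.
  - by apply/measurable_EFinP; apply: measurable_funX; exact: jz.
  - exact/measurable_EFinP.
  - by move=> p _; rewrite lee_fin sqr_le_sqnorm.
move=> [az Lz]; have jz : jointly_measurable T z by move=> j; case: (Lz j).
split => //; first exact/adaptedP.
have mz := jointly_measurable_sqnorm jz.
have [<- _ _ _] := timespace_tonelli Pr mz (fun p _ => sumr_ge0 _ (fun i _ => sqr_ge0 _)).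
have iz : mP.-integrable D (EFin \o (fun p => sqnorm (z p.1 p.2))).
  by apply: (integrable_sumr mD) => j; exact: L2_sqr.
by rewrite -(EFin_Rintegral mD iz) ltry.
Qed.

Lemma L2_path (g : TO -> R) : L2 mP D g ->
  {ae Pr, forall w, mu.-integrable `[0, T] (EFin \o (fun t => g (t, w)))}.
Proof.
move=> Lg; have ig := L2_integrable mD (timespace_finite Pr T) Lg.
by have [_ []] := timespace_fubini ig.
Qed.

Lemma control_vint (u : 'I_N -> R -> Omega -> 'cV[R]_r) :
  admissible Pr T x0 W u -> {ae Pr, forall w, forall i, vint T (u i ^~ w)}.
Proof.
move=> au; apply: filter_forall => i; apply: filter_forall => j.
by have /L2_adaptedP[_ /(_ j)/L2_path] := au i.
Qed.

Lemma ito_L2_timespace i (M : R -> Omega -> 'cV[R]_n) l :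
  ito_integral Pr T sigma (W i) M -> (forall t, 0 <= t <= T -> vmeas (Ft t) (M t)) ->
  jointly_measurable T M -> L2 mP D (fun p => M p.1 p.2 l 0).
Proof.
move=> [mM [phi [c1 c2]]] FM jM; split; first exact: jM.
have LM t : 0 <= t <= T -> L2 Pr setT (fun w => M t w l 0).
  by move=> tT; exact: (ito_L2 hW mM c2).
have TT : 0 <= T <= T by rewrite lexx T0'.
(* The increment after t is orthogonal to the value at t, so the second moment grows with time and
   its value at [T] bounds all of them. *)
have mono t : 0 <= t <= T ->
    \int[Pr]_w (M t w l 0 ^+ 2) <= \int[Pr]_w (M T w l 0 ^+ 2).
  move=> tT; have [t0 tT'] := andP tT.
  have LD : L2 Pr setT (fun w => M T w l 0 - M t w l 0) by apply: L2B => //; exact: LM.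
  rewrite (@eq_Rintegral _ _ _ Pr setT (fun w => (M t w l 0 + (M T w l 0 - M t w l 0)) ^+ 2)
    (fun w => M T w l 0 ^+ 2)); last by move=> w _; rewrite subrKC.
  rewrite sqr_increment//; [|exact: LM|].
    by rewrite lerDl L2_sqr_ge0.
  apply: (ito_orthogonal hW hWindep hx0meas hx0W mM c2 l t0 tT' (lexx T) _ (LM t tT)).
  exact: FM.
have mz : measurable_fun D (fun p => M p.1 p.2 l 0 ^+ 2).
  by apply: measurable_funX; exact: jM.
have [_ -> _ mz'] := timespace_tonelli Pr mz (fun p _ => sqr_ge0 _).
apply: (@le_lt_trans _ _ (\int[mu]_(t in `[0%R, T]) (\int[Pr]_w (M T w l 0 ^+ 2))%:E)%E).
  apply: ge0_le_integral => //.
  - by move=> t _; apply: integral_ge0 => w _; rewrite lee_fin sqr_ge0.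
  - move=> t /=; rewrite in_itv/= => tT.
    rewrite -(EFin_Rintegral measurableT); last by apply: L2_sqr; exact: LM.
    by rewrite lee_fin mono.
have iT := integrable_cstr (mI T) (\int[Pr]_w (M T w l 0 ^+ 2)) (lebesgue_itv_fin 0 T).
by rewrite -(EFin_Rintegral (mI T) iT) ltry.
Qed.

Lemma avgB k (v v' : 'I_N -> 'cV[R]_k) : avg v' - avg v = avg (fun j => v' j - v j).
Proof. by rewrite /avg -scalerBr sumrB. Qed.

Lemma drift_vint (u : 'I_N -> R -> Omega -> 'cV[R]_r)
    (x : 'I_N -> R -> Omega -> 'cV[R]_n) w i :
  (forall i, vint T (u i ^~ w)) -> (forall i, {within `[0, T], continuous (x i ^~ w)}) ->
  vint T (fun t => drift A B G f u x i t w).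
Proof.
move=> iu cx; have ix j := vint_continuous (cx j).
apply: (vint_D (u := fun t => A *m x i t w + B *m u i t w + G *m average x t w)).
  apply: (vint_D (u := fun t => A *m x i t w + B *m u i t w)).
    by apply: vint_D; exact: vint_mulmx.
  by apply: vint_mulmx; exact: vint_avg.
exact: vint_continuous.
Qed.

Definition state_pair_path u (x : 'I_N -> R -> Omega -> 'cV[R]_n) u'
    (x' : 'I_N -> R -> Omega -> 'cV[R]_n) (w : Omega) : Prop :=
  [/\ forall i, {within `[0, T], continuous (fun t => x' i t w - x i t w)},
      forall i, vint T (fun t => u' i t w - u i t w) &
      forall i t, 0 <= t <= T -> x' i t w - x i t w =
        \col_k (\int[mu]_(s in `[0, t]) (A *m (x' i s w - x i s w) +
          B *m (u' i s w - u i s w) + G *m avg (fun j => x' j s w - x j s w)) k 0)].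

(** Each state comes with its own version of the stochastic integral, and two versions agree almost
    surely at each fixed time. Outside one null set the noise therefore cancels at all dyadic times;
    continuity of both sides extends the equation to the remaining times. *)
Lemma state_difference u x u' x' :
  admissible Pr T x0 W u -> is_state Pr T A B G f sigma x0 W u x ->
  admissible Pr T x0 W u' -> is_state Pr T A B G f sigma x0 W u' x' ->
  {ae Pr, forall w, state_pair_path u x u' x' w}.
Proof.
move=> au sx au' sx'.
have cx : {ae Pr, forall w, forall i, {within `[0, T], continuous (x i ^~ w)}}.
  by apply: filter_forall => i; case: (sx i).
have cx' : {ae Pr, forall w, forall i, {within `[0, T], continuous (x' i ^~ w)}}.
  by apply: filter_forall => i; case: (sx' i).
have vu := control_vint au; have vu' := control_vint au'.
have gridE : {ae Pr, forall w, forall i m j, (j <= 2 ^ m)%N -> let t := grid T (2 ^ m) j in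
    forall k, (x' i t w - x i t w) k 0 =
      \int[mu]_(s in `[0, t]) (drift A B G f u' x' i s w k 0) -
      \int[mu]_(s in `[0, t]) (drift A B G f u x i s w k 0)}.
  apply: filter_forall => i; have [_ _ [M iM xE]] := sx i; have [_ _ [M' iM' xE']] := sx' i.
  apply: ae_foralln => m; apply: ae_foralln => j.
  have [jm|jm] := leqP j (2 ^ m); last exact: filterE.
  have tT : 0 <= grid T (2 ^ m) j <= T by apply: grid_leT => //; rewrite expn_gt0.
  have MM : {ae Pr, forall w, forall k, M (grid T (2 ^ m) j) w k 0 = M' (grid T (2 ^ m) j) w k 0}.
    apply: filter_forall => k.
    exact: (ito_unique hW hWindep hx0meas hx0W T0' hsigma iM iM' k tT).
  apply: filterS3 xE xE' MM => w xE xE' MM _ t0 k; rewrite /t0.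
  rewrite (xE' _ tT) (xE _ tT) !mxE MM.
  set I1 := \int[mu]_(_ in _) _; set I2 := \int[mu]_(_ in _) _; ring.
apply: filterS3 gridE (filterI cx cx') (filterI vu vu').
move=> w gE cxx vuu; have [cxw cxw'] : _ /\ _ := cxx; have [vuw vuw'] : _ /\ _ := vuu.
have idr i := drift_vint i vuw cxw; have idr' i := drift_vint i vuw' cxw'.
split.
- by move=> i; apply: within_D => //; exact: within_N.
- by move=> i; apply: vint_D => //; exact: vint_N.
move=> i t tT; apply/matrixP => k l; rewrite ord1 [RHS]mxE.
pose b s := drift A B G f u' x' i s w - drift A B G f u x i s w.
have ib : vint T b by apply: vint_D => //; exact: vint_N.
rewrite (@eq_Rintegral _ _ _ mu `[0, t] (fun s => b s k 0)); last first.
  move=> s _; congr (fun_of_matrix _ k 0); rewrite /b /drift -avgB.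
  rewrite -[average x' s w]/(avg (fun j => x' j s w)) -[average x s w]/(avg (fun j => x j s w)).
  rewrite !mulmxBr; mx_abel.
pose e s := (x' i s w - x i s w) k 0 - \int[mu]_(s in `[0, s]) b s k 0.
have ce : {within `[0, T], continuous e}.
  apply: within_D; last by apply: within_N; exact: parameterized_integral_continuous.
  have /within_mxP/(_ k 0) := within_D (cxw' i) (within_N (cxw i)).
  by [].
suff : `|e t| <= 0 by rewrite normr_le0 subr_eq0 => /eqP.
apply: (@grid_dense R T T0 e 0 (fun m => 2 ^ m)%N) => //.
  by move=> m; rewrite ltn_expl.
move=> m j jm; have := gE i m j jm k; rewrite /e /= => ->.
have tT' : grid T (2 ^ m) j <= T.
  by have /andP[] : 0 <= grid T (2 ^ m) j <= T by apply: grid_leT => //; rewrite expn_gt0.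
rewrite -RintegralB//; last 2 first.
- by apply: integrable_subitv tT' _; exact: idr'.
- by apply: integrable_subitv tT' _; exact: idr.
rewrite (@eq_Rintegral _ _ _ mu `[0, grid T (2 ^ m) j] (fun s => b s k 0)).
  by rewrite subrr normr0.
by move=> s _; rewrite /b !mxE.
Qed.

Definition vL2 k (X : TO -> 'cV[R]_k) : Prop := forall j, L2 mP D (fun p => X p j 0).

Lemma vL2_D k (X Y : TO -> 'cV[R]_k) : vL2 X -> vL2 Y -> vL2 (fun p => X p + Y p).
Proof.
move=> LX LY j; rewrite (_ : (fun p => _) = fun p => X p j 0 + Y p j 0).
  exact: (L2D mD (LX j) (LY j)).
by apply/funext => p; rewrite mxE.
Qed.

Lemma vL2_sum k (I : finType) (X : I -> TO -> 'cV[R]_k) :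
  (forall i, vL2 (X i)) -> vL2 (fun p => \sum_i X i p).
Proof.
move=> LX j; rewrite (_ : (fun p => _) = fun p => \sum_i X i p j 0).
  by apply: (L2_sum mD) => i; exact: LX.
by apply/funext => p; rewrite summxE.
Qed.

Lemma L2_time_mul (a : R -> R) (X : TO -> R) : {within `[0, T], continuous a} ->
  L2 mP D X -> L2 mP D (fun p => a p.1 * X p).
Proof.
move=> ca LX; have [L L0 aL] := within_bounded ca.
have ma : measurable_fun D (fun p : TO => a p.1).
  apply: (@measurable_comp _ _ _ _ _ _ (`[0, T]%classic : set (measurableTypeR R)) a D fst).
  - exact: mI.
  - by move=> _ [p [pT _] <-].
  - have h : measurable_fun (`[0, T]%classic : set R) a.
      by apply: subspace_continuous_measurable_fun => //; exact: ca.
    exact: h.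
  - exact: measurable_funS measurable_fst.
apply: (L2_le mD _ (L2Z mD L LX)); first by apply: measurable_funM => //; case: LX.
move=> [t w] [/= + _]; rewrite in_itv/= => tT.
by rewrite !normrM ler_wpM2r// (ger0_norm L0) aL.
Qed.

Lemma L2_time (a : R -> R) : {within `[0, T], continuous a} ->
  L2 mP D (fun p => a p.1).
Proof.
move=> ca; rewrite (_ : (fun p => _) = fun p : TO => a p.1 * 1).
  by apply: L2_time_mul => //; apply: (L2_cst mD 1); exact: timespace_finite.
by apply/funext => p; rewrite mulr1.
Qed.

Lemma vL2_time k (v : R -> 'cV[R]_k) : {within `[0, T], continuous v} ->
  vL2 (fun p => v p.1).
Proof. by move=> /within_mxP cv j; apply: (@L2_time (fun t => v t j 0)); exact: cv. Qed.

Lemma vL2_time_mulmx m k (M : R -> 'M[R]_(m, k)) (X : TO -> 'cV[R]_k) :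
  {within `[0, T], continuous M} -> vL2 X -> vL2 (fun p => M p.1 *m X p).
Proof.
move=> /within_mxP cM LX i.
rewrite (_ : (fun p => _) = fun p => \sum_j M p.1 i j * X p j 0).
  apply: (L2_sum mD) => j; apply: (@L2_time_mul (fun t => M t i j)) => //.
by apply/funext => p; rewrite mxE.
Qed.

Lemma vL2_mulmx m k (M : 'M[R]_(m, k)) (X : TO -> 'cV[R]_k) :
  vL2 X -> vL2 (fun p => M *m X p).
Proof. by move=> LX; apply: (vL2_time_mulmx (M := fun=> M)) => //; exact: within_cst. Qed.

Lemma vL2_Z k c (X : TO -> 'cV[R]_k) : vL2 X -> vL2 (fun p => c *: X p).
Proof.
move=> LX; rewrite (_ : (fun p => _) = fun p => c%:M *m X p); first exact: vL2_mulmx.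
by apply/funext => p; rewrite mul_scalar_mx.
Qed.

Lemma vL2_N k (X : TO -> 'cV[R]_k) : vL2 X -> vL2 (fun p => - X p).
Proof.
move=> LX; rewrite (_ : (fun p => _) = fun p => -1 *: X p); first exact: vL2_Z.
by apply/funext => p; rewrite scaleN1r.
Qed.

Lemma vL2_avg k (X : 'I_N -> TO -> 'cV[R]_k) :
  (forall i, vL2 (X i)) -> vL2 (fun p => avg (X ^~ p)).
Proof. by move=> LX; apply: vL2_Z; exact: vL2_sum. Qed.

Lemma L2_l1 k (X : TO -> 'cV[R]_k) : vL2 X -> L2 mP D (fun p => l1 (X p)).
Proof.
move=> LX; apply: (L2_sum mD) => j; apply: (L2_le mD _ (LX j)).
  by apply: measurableT_comp => //; case: (LX j).
by move=> p _; rewrite normr_id.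
Qed.

Lemma admissible_vL2 (u : 'I_N -> R -> Omega -> 'cV[R]_r) i :
  admissible Pr T x0 W u -> vL2 (fun p => u i p.1 p.2).
Proof. by move=> /(_ i)/L2_adaptedP[]. Qed.

Lemma state_pair_bound u x u' x' (w : Omega) : state_pair_path u x u' x' w ->
  let g t := entry_sum B * \sum_j l1 (u' j t w - u j t w) in
  mu.-integrable `[0, T] (EFin \o g) -> forall i t, 0 <= t <= T ->
  l1 (x' i t w - x i t w) <= N%:R * (\int[mu]_(t in `[0, T]) g t) *
    expR (N%:R * (entry_sum A + entry_sum G) * T).
Proof.
move=> [cd iv dE] g ig i t tT.
have g0 s : 0 <= g s.
  by rewrite mulr_ge0 ?entry_sum_ge0// sumr_ge0// => j _; exact: l1_ge0.
have ib j : vint T (fun s => A *m (x' j s w - x j s w) +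
    B *m (u' j s w - u j s w) + G *m avg (fun l => x' l s w - x l s w)).
  have id l := vint_continuous (cd l).
  apply: vint_D; last by apply: vint_mulmx; exact: (vint_avg id).
  by apply: vint_D; apply: vint_mulmx.
have dE' j t0 : 0 <= t0 <= T -> x' j t0 w - x j t0 w = 0 +
        \col_k (\int[mu]_(s in `[0, t0]) (A *m (x' j s w - x j s w) +
          B *m (u' j s w - u j s w) + G *m avg (fun j => x' j s w - x j s w)) k 0).
  by move=> t0T; rewrite add0r; exact: dE.
have bnd := linear_system_bound T0' (addr_ge0 (entry_sum_ge0 A) (entry_sum_ge0 G))
  g0 ig cd ib dE' _ i tT.
apply: le_trans (bnd _) _; last first.
  by rewrite big1 ?add0r// => j _; rewrite /l1 big1// => l _; rewrite mxE normr0.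
move=> j s sT; apply: le_trans (l1D _ _) _.
have h1 := le_trans (l1D (A *m (x' j s w - x j s w)) (B *m (u' j s w - u j s w)))
  (lerD (l1_mulmx _ _) (l1_mulmx _ _)).
have h2 := le_trans (l1_mulmx G (avg (fun l => x' l s w - x l s w)))
  (ler_wpM2l (entry_sum_ge0 G) (l1_avg _)).
have h3 : l1 (x' j s w - x j s w) <= \sum_l l1 (x' l s w - x l s w).
  by rewrite (bigD1 j)//= lerDl sumr_ge0// => l _; exact: l1_ge0.
have h4 : l1 (u' j s w - u j s w) <= \sum_l l1 (u' l s w - u l s w).
  by rewrite (bigD1 j)//= lerDl sumr_ge0// => l _; exact: l1_ge0.
have h5 := ler_wpM2l (entry_sum_ge0 A) h3; have h6 := ler_wpM2l (entry_sum_ge0 B) h4.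
by rewrite /g; move: h1 h2 h5 h6; lra.
Qed.

(** Square integrability is not part of the notion of state. For the difference it follows from
    Gronwall, whose bound involves only the difference of the controls. *)
Lemma state_difference_L2 u x u' x' :
  admissible Pr T x0 W u -> is_state Pr T A B G f sigma x0 W u x ->
  admissible Pr T x0 W u' -> is_state Pr T A B G f sigma x0 W u' x' ->
  forall i, vL2 (fun p => x' i p.1 p.2 - x i p.1 p.2).
Proof.
move=> au sx au' sx' i k.
pose v j (p : TO) := u' j p.1 p.2 - u j p.1 p.2.
have Lv j : vL2 (v j).
  by apply: vL2_D; [exact: admissible_vL2|apply: vL2_N; exact: admissible_vL2].
pose g p := entry_sum B * \sum_j l1 (v j p).
have Lg : L2 mP D g by apply: (L2Z mD); apply: (L2_sum mD) => j; exact: L2_l1.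
have g0 p : 0 <= g p.
  by rewrite mulr_ge0 ?entry_sum_ge0// sumr_ge0// => j _; exact: l1_ge0.
pose C := N%:R * expR (N%:R * (entry_sum A + entry_sum G) * T).
apply: (@L2_path_bound _ _ _ Pr T _ g (fun=> 0) C T0) => //.
- rewrite (_ : (fun p => _) = fun p => x' i p.1 p.2 k 0 - x i p.1 p.2 k 0).
    by apply: measurable_funB; [case: (sx' i) => /(_ k)|case: (sx i) => /(_ k)].
  by apply/funext => p; rewrite !mxE.
- exact: L2_0.
have := L2_path Lg; apply: filterS2 (state_difference au sx au' sx') => w sw ig t tT.
apply: le_trans (le_l1 _ _) _; apply: le_trans (state_pair_bound sw ig i tT) _.
rewrite add0r (@eq_Rintegral _ _ _ mu `[0, T] (fun s => `|g (s, w)|)); last first.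
  by move=> s _; rewrite ger0_norm.
by rewrite /C mulrAC.
Qed.

(** The case of equal controls, in which the forcing of the Gronwall bound is 0. *)
Lemma state_unique u x x' : admissible Pr T x0 W u ->
  is_state Pr T A B G f sigma x0 W u x -> is_state Pr T A B G f sigma x0 W u x' ->
  {ae Pr, forall w, forall i t, 0 <= t <= T -> x' i t w = x i t w}.
Proof.
move=> au sx sx'; have := state_difference au sx au sx'.
apply: filterS => w sw i t tT; apply/eqP; rewrite -subr_eq0; apply/eqP.
have g0 : (fun t => entry_sum B * \sum_j l1 (u j t w - u j t w)) = fun=> 0.
  apply/funext => v; rewrite big1 ?mulr0// => j _.
  by rewrite subrr /l1 big1// => k _; rewrite mxE normr0.
have := state_pair_bound sw; rewrite /= g0 => /(_ _ i t tT).
rewrite Rintegral_cst// mul0r mulr0 mul0r => H.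
have {}H : l1 (x' i t w - x i t w) <= 0.
  by apply: H; exact: (integrable_cstr (mI T) 0 (lebesgue_itv_fin 0 T)).
apply/matrixP => k j; rewrite ord1 [RHS]mxE; apply/eqP; rewrite -normr_le0.
exact: le_trans (le_l1 _ _) H.
Qed.

End Differences.

(** * Admissibility of the feedback *)

Section ClosedLoopL2.
Context {R : realType} {d : measure_display} {Omega : measurableType d}.
Variable Pr : probability Omega R.
Variables (n r N : nat) (T : R).
Variables (A : 'M[R]_n) (B : 'M[R]_(n, r)) (G : 'M[R]_n) (Rc : 'M[R]_r).
Variables (f sigma : R -> 'cV[R]_n).
Variables (x0 : 'I_N -> Omega -> 'cV[R]_n) (W : 'I_N -> R -> Omega -> R).
Hypothesis T0 : 0 < T.
Hypothesis hW : forall i, brownian_motion Pr (W i).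
Hypothesis hWindep :
  mutually_independent Pr (fun i => sigma_of `[0, +oo[ (W i)).
Hypothesis hx0meas : forall i, measurable_vec (x0 i).
Hypothesis hx0W : independent2 Pr
  <<s \bigcup_(i in [set: 'I_N]) sigma_vec (x0 i) >>
  <<s \bigcup_(i in [set: 'I_N]) sigma_of `[0, +oo[ (W i) >>.
Hypothesis hx0L2 : forall i k, L2 Pr setT (fun w => x0 i w k 0).
Hypothesis hsigma : {within `[0, T], continuous sigma}.
Variables (P K : R -> 'M[R]_n) (s : R -> 'cV[R]_n).
Hypothesis cP : {within `[0, T], continuous P}.
Hypothesis cK : {within `[0, T], continuous K}.
Hypothesis cs : {within `[0, T], continuous s}.
Hypothesis cf : {within `[0, T], continuous f}.

Local Notation Ft := (filtration x0 W).
Local Notation mu := (@lebesgue_measure R).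
Local Notation D := (@timespace R d Omega T).
Local Notation mP := (timespace_measure Pr).
Local Notation TO := (measurableTypeR R * Omega)%type.

Variables (M x : 'I_N -> R -> Omega -> 'cV[R]_n).
Hypothesis nM : continuous_adapted Pr T x0 W M.
Hypothesis iM : forall i, ito_integral Pr T sigma (W i) (M i).
Hypothesis nx : continuous_adapted Pr T x0 W x.
Let u := feedback B Rc P K s x.
Hypothesis xE : {ae Pr, forall w, forall i t, 0 <= t <= T -> x i t w = x0 i w
       + \col_k (\int[mu]_(v in `[0, t]) drift A B G f u x i v w k 0) + M i t w}.

Let T0' : 0 <= T. Proof. exact: ltW. Qed.
Let mD : measurable D := measurable_timespace T.

Lemma continuous_adapted_jointly (z : 'I_N -> R -> Omega -> 'cV[R]_n) i :
  continuous_adapted Pr T x0 W z -> jointly_measurable T (z i).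
Proof. by move=> [jz _ _] l; apply: measurable_funS (jz i l). Qed.

Lemma noise_vL2 i : vL2 Pr T (fun p => M i p.1 p.2).
Proof.
move=> l; apply: (ito_L2_timespace T0 hW hWindep hx0meas hx0W l (iM i)).
  by case: nM => _ + _; exact.
exact: continuous_adapted_jointly.
Qed.

Lemma closed_loop_is_state : is_state Pr T A B G f sigma x0 W u x.
Proof.
move=> i; split; first exact: continuous_adapted_jointly.
  by case: nx => _ _; apply: filterS.
by exists (M i) => //; apply: filterS xE => w; exact.
Qed.

Lemma closed_loop_drift_bound : exists2 L : R, 0 <= L & forall w i t, 0 <= t <= T ->
  l1 (drift A B G f u x i t w) <= L * (1 + \sum_j l1 (x j t w)).
Proof.
have [LP LP0 bP] := within_bounded_mx cP; have [LK LK0 bK] := within_bounded_mx cK.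
have [Ls Ls0 bs] := within_bounded_mx cs; have [Lf Lf0 bf] := within_bounded_mx cf.
pose kk : R := (n * n)%:R; pose nn : R := n%:R.
pose eB := entry_sum B * entry_sum (invmx Rc *m B^T).
have eB0 : 0 <= eB by rewrite mulr_ge0 ?entry_sum_ge0.
exists (entry_sum A + entry_sum G + eB * (kk * LP + kk * LK + nn * Ls) + nn * Lf).
  by rewrite ?(addr_ge0, mulr_ge0) ?entry_sum_ge0.
move=> w i t tT; set X := \sum_j l1 (x j t w).
have X0 : 0 <= X by apply: sumr_ge0 => j _; exact: l1_ge0.
have xX : l1 (x i t w) <= X.
  by rewrite /X (bigD1 i)//= lerDl sumr_ge0// => j _; exact: l1_ge0.
have aX : l1 (average x t w) <= X by exact: l1_avg.
have hA : l1 (A *m x i t w) <= entry_sum A * X.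
  by apply: le_trans (l1_mulmx _ _) _; rewrite ler_wpM2l ?entry_sum_ge0.
have hG : l1 (G *m average x t w) <= entry_sum G * X.
  by apply: le_trans (l1_mulmx _ _) _; rewrite ler_wpM2l ?entry_sum_ge0.
have hP : l1 (P t *m x i t w) <= kk * LP * X.
  by apply: le_trans (l1_mulmx_le _ (bP t tT)) _; rewrite ler_wpM2l ?mulr_ge0.
have hK : l1 (K t *m average x t w) <= kk * LK * X.
  by apply: le_trans (l1_mulmx_le _ (bK t tT)) _; rewrite ler_wpM2l ?mulr_ge0.
have hs := l1_bounded (bs t tT); have hf := l1_bounded (bf t tT).
have hp : l1 (P t *m x i t w + K t *m average x t w + s t) <=
    kk * LP * X + kk * LK * X + nn * Ls.
  by apply: le_trans (l1D _ _) _; apply: lerD => //; apply: le_trans (l1D _ _) _; exact: lerD.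
have hu : l1 (B *m u i t w) <= eB * (kk * LP * X + kk * LK * X + nn * Ls).
  apply: le_trans (l1_mulmx _ _) _; rewrite /eB -mulrA ler_wpM2l ?entry_sum_ge0//.
  rewrite l1N; apply: le_trans (l1_mulmx _ _) _.
  by rewrite ler_wpM2l ?entry_sum_ge0.
have hd : l1 (drift A B G f u x i t w) <= entry_sum A * X +
    eB * (kk * LP * X + kk * LK * X + nn * Ls) + entry_sum G * X + nn * Lf.
  apply: le_trans (l1D _ _) _; apply: lerD => //.
  apply: le_trans (l1D _ _) _; apply: lerD => //.
  by apply: le_trans (l1D _ _) _; apply: lerD.
apply: le_trans hd _.
have k0 : 0 <= kk by []; have n0 : 0 <= nn by [].
have t1 : 0 <= eB * (nn * Ls) * X by rewrite mulr_ge0// mulr_ge0// mulr_ge0.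
have t2 : 0 <= nn * Lf * X by rewrite mulr_ge0// mulr_ge0.
have t3 : 0 <= entry_sum A + entry_sum G by rewrite addr_ge0 ?entry_sum_ge0.
have t4 : 0 <= eB * (kk * LP) by rewrite mulr_ge0// mulr_ge0.
have t5 : 0 <= eB * (kk * LK) by rewrite mulr_ge0// mulr_ge0.
by rewrite -subr_ge0; move: t1 t2 t3 t4 t5; nra.
Qed.

(** The control is a function of the state, so its integrability cannot be used first. But x - M
    solves an integral equation whose drift grows at most affinely in x, and Gronwall bounds it by
    the initial values and the noise, which are square integrable. *)
Lemma closed_loop_vL2 i : vL2 Pr T (fun p => x i p.1 p.2).
Proof.
have [L L0 bL] := closed_loop_drift_bound.
pose g (p : TO) := L * (1 + \sum_j l1 (M j p.1 p.2)).
have Lg : L2 mP D g.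
  apply: (L2Z mD); apply: (L2D mD); first by apply: (L2_cst mD 1); exact: timespace_finite.
  by apply: (L2_sum mD) => j; apply: L2_l1; exact: noise_vL2.
have g0 p : 0 <= g p.
  by rewrite mulr_ge0 ?addr_ge0// sumr_ge0// => j _; exact: l1_ge0.
pose E := expR (N%:R * L * T).
have vY : vL2 Pr T (fun p => x i p.1 p.2 - M i p.1 p.2).
  move=> k; apply: (@L2_path_bound _ _ _ Pr T _ g
    (fun w => E * \sum_j l1 (x0 j w)) (E * N%:R) T0 _ _ Lg).
  - rewrite (_ : (fun p => _) = fun p => x i p.1 p.2 k 0 - M i p.1 p.2 k 0).
      by apply: measurable_funB; [exact: continuous_adapted_jointly nx k|exact: continuous_adapted_jointly nM k].
    by apply/funext => p; rewrite !mxE.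
  - apply: (L2Z measurableT); apply: (L2_sum measurableT) => j.
    apply: (L2_sum measurableT) => l; apply: (L2_le measurableT _ (hx0L2 j l)).
      by apply: measurableT_comp => //; case: (hx0L2 j l).
    by move=> w _; rewrite normr_id.
  have [_ _ cx] := nx; have [_ _ cM] := nM.
  have good : {ae Pr, forall w, (forall i, {within `[0, T], continuous (x i ^~ w)}) /\
      (forall i, {within `[0, T], continuous (M i ^~ w)})}.
    by apply: filterS2 cx cM => w; split.
  apply: filterS3 xE good (L2_path Lg) => w xEw [cxw cMw] ig t tT.
  have cy j : {within `[0, T], continuous (fun t => x j t w - M j t w)}.
    by apply: within_D => //; exact: within_N.
  have iu j : vint T (u j ^~ w).
    apply: vint_N; apply: vint_mulmx; apply: vint_continuous.
    apply: within_D => //; apply: within_D; apply: within_mulmx => //.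
    exact: within_avg.
  have ib j : vint T (fun t => drift A B G f u x j t w) by exact: drift_vint.
  have yE j t0 : 0 <= t0 <= T -> x j t0 w - M j t0 w = x0 j w +
      \col_k (\int[mu]_(v in `[0, t0]) drift A B G f u x j v w k 0).
    by move=> t0T; rewrite (xEw j t0 t0T) addrK.
  apply: le_trans (le_l1 _ _) _.
  have bnd := linear_system_bound T0' L0 (fun s => g0 (s, w)) ig cy ib yE _ i tT.
  apply: le_trans (bnd _) _; last first.
    rewrite mulrDl [X in X + _]mulrC (@eq_Rintegral _ _ _ mu `[0, T] (fun s => `|g (s, w)|)).
      by rewrite [X in _ + X <= _]mulrC mulrA.
    by move=> v _; rewrite ger0_norm.
  move=> j v vT; apply: le_trans (bL w j v vT) _.
  rewrite /g -mulrDr ler_wpM2l//= addrCA lerD2l -big_split/=; apply: ler_sum => l _.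
  by have := l1D (x l v w - M l v w) (M l v w); rewrite subrK.
have := vL2_D vY (noise_vL2 i); congr vL2; apply/funext => p; exact: subrK.
Qed.

Lemma closed_loop_admissible : admissible Pr T x0 W u.
Proof.
move=> i; apply/L2_adaptedP; split.
  move=> t tT; have sF : sigma_algebra setT (Ft t) by exact: sigma_algebra_gen.
  have [_ Fx _] := nx.
  have Fa : vmeas (Ft t) (fun w => avg (fun j => x j t w)).
    by apply: vmeas_Z => //; apply: vmeas_sum => // j; exact: Fx.
  apply: vmeas_N => //; apply: vmeas_mulmx => //; apply: vmeas_D => //; last exact: vmeas_cst.
  by apply: vmeas_D => //; apply: vmeas_mulmx => //; exact: Fx.
have Lx := closed_loop_vL2.
apply: vL2_N; apply: vL2_mulmx; apply: vL2_D; last exact: vL2_time.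
apply: vL2_D; apply: vL2_time_mulmx => //.
exact: (vL2_avg Lx).
Qed.

End ClosedLoopL2.

(** * Optimality of the feedback *)

Section Parts.
Context {R : realType}.
Variable T : R.
Hypothesis T0 : 0 <= T.
Local Notation mu := (@lebesgue_measure R).

Let mI (t : R) : measurable (`[0, t]%classic : set (measurableTypeR R)).
Proof. exact: measurable_itv. Qed.

(** The integrand is the derivative of [w] times the primitive of [h]; this product vanishes at 0
    with the primitive and at [T] with [w]. *)
Lemma parts_continuous (w c h : R -> R) :
  {within `[0, T], continuous w} -> {within `[0, T], continuous c} ->
  (forall t, 0 < t < T -> is_derive t 1 w (c t)) -> w T = 0 ->
  {within `[0, T], continuous h} ->
  \int[mu]_(t in `[0, T]) (c t * \int[mu]_(s in `[0, t]) h s + w t * h t) = 0.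
Proof.
move=> cw cc dw wT ch; have [H0 cH dH] := within_primitive T0 ch.
set H := fun t : R => \int[mu]_(s in `[0, t]) h s in H0 cH dH.
have TT : 0 <= T <= T by rewrite lexx T0.
have E := @within_FTC2 R (fun t => w t * H t) (fun t => c t * H t + w t * h t) T T.
rewrite [LHS]E//.
- by rewrite wT (H0 : H 0 = 0) mul0r mulr0 subrr.
- by apply: within_D; exact: within_M.
- exact: within_M.
- move=> u uT; apply: is_derive_eq (is_deriveM (dw u uT) (dH u uT)) _.
  by rewrite /GRing.scale/=; ring.
Qed.

Lemma integrable_continuous_mul (a k : R -> R) : {within `[0, T], continuous a} ->
  mu.-integrable `[0, T] (EFin \o k) ->
  mu.-integrable `[0, T] (EFin \o (fun t => a t * k t)).
Proof.
move=> ca ik; have [L L0 aL] := within_bounded ca.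
apply: (integrable_le (mI T) _ _ (integrable_scale (mI T) L (integrable_norm ik))).
  apply: measurable_funM; last by case/integrableP: ik => /measurable_EFinP.
  have h : measurable_fun (`[0, T]%classic : set R) a.
    by apply: subspace_continuous_measurable_fun => //; exact: ca.
  exact: h.
by move=> t /=; rewrite in_itv/= => tT; rewrite normrM ler_wpM2r// aL.
Qed.

Lemma integrable_parts (w c k : R -> R) :
  {within `[0, T], continuous w} -> {within `[0, T], continuous c} ->
  mu.-integrable `[0, T] (EFin \o k) -> mu.-integrable `[0, T]
    (EFin \o (fun t => c t * \int[mu]_(s in `[0, t]) k s + w t * k t)).
Proof.
move=> cw cc ik; apply: (integrable_addr (mI T)); last exact: integrable_continuous_mul.
apply: integrable_continuous_mul => //; apply: within_integrable.
exact: parameterized_integral_continuous.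
Qed.

(* By density of the continuous functions in L^1. *)
Lemma parts_integrable (w c g : R -> R) :
  {within `[0, T], continuous w} -> {within `[0, T], continuous c} ->
  (forall t, 0 < t < T -> is_derive t 1 w (c t)) -> w T = 0 ->
  mu.-integrable `[0, T] (EFin \o g) ->
  \int[mu]_(t in `[0, T]) (c t * \int[mu]_(s in `[0, t]) g s + w t * g t) = 0.
Proof.
move=> cw cc dw wT ig.
have fin := lebesgue_itv_fin 0 T.
have [h_ [ch ih hg]] := approximation_continuous_integrable (mI T) fin ig.
have [Lw Lw0 Bw] := within_bounded cw; have [Lc Lc0 Bc] := within_bounded cc.
set J := LHS.
(* After subtraction of the identity for [h_ m], only the L^1 distance of [g] and [h_ m] enters the
   bound. *)
have Jm m : `|J| <= (Lc * T + Lw) * \int[mu]_(t in `[0, T]) `|g t - h_ m t|.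
  have chm : {within `[0, T], continuous (h_ m)} by apply: continuous_subspaceT; exact: ch.
  have im : mu.-integrable `[0, T] (EFin \o (fun t => g t - h_ m t)).
    exact: (integrable_subr (mI T) ig (ih m)).
  set eps := \int[mu]_(t in `[0, T]) `|g t - h_ m t|.
  have -> : J = \int[mu]_(t in `[0, T])
      (c t * \int[mu]_(s in `[0, t]) (g s - h_ m s) + w t * (g t - h_ m t)).
    rewrite -[LHS]subr0 -[X in _ - X = _](parts_continuous cw cc dw wT chm).
    rewrite -RintegralB//; [|exact: integrable_parts|exact: integrable_parts].
    apply: eq_Rintegral => t; rewrite inE/= in_itv/= => /andP[t0 tT].
    rewrite RintegralB//; [ring|exact: integrable_subitv ig|exact: integrable_subitv (ih m)].
  apply: le_trans (le_normr_Rintegral _ _) _ => //; first exact: integrable_parts.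
  have -> : (Lc * T + Lw) * eps =
      \int[mu]_(t in `[0, T]) (Lc * eps + Lw * `|g t - h_ m t|).
    rewrite RintegralD//; last 2 first.
    - exact: (integrable_cstr (mI T)).
    - exact: (integrable_scale (mI T) Lw (integrable_norm im)).
    have E2 : \int[mu]_(t in `[0, T]) (Lw * `|g t - h_ m t|) = Lw * eps.
      by rewrite RintegralZl//; exact: (integrable_norm im).
    have E : \int[mu]_(t in `[0, T]) (Lc * eps) = Lc * eps * T.
      have := Rintegral_cst mu (mI T) (Lc * eps).
      rewrite (_ : fine _ = T)//; have : mu `[0%R, T]%classic = T%:E.
        rewrite lebesgue_measure_itv/= lte_fin; case: ltP => [|T0'].
          by rewrite sube0.
        by have -> : T = 0 by apply/eqP; rewrite eq_le T0 T0'.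
      by move=> /(congr1 fine).
    by rewrite E E2; ring.
  apply: le_Rintegral => //.
  - exact: (integrable_norm (integrable_parts cw cc im)).
  - apply: (integrable_addr (mI T)); first exact: (integrable_cstr (mI T)).
    exact: (integrable_scale (mI T) Lw (integrable_norm im)).
  - move=> t /=; rewrite in_itv/= => tT; have [t0 tT'] := andP tT.
    apply: le_trans (ler_normD _ _) _; rewrite !normrM; apply: lerD; last first.
      by rewrite ler_wpM2r// Bw.
    apply: ler_pM => //; first exact: Bc.
    apply: le_trans (le_normr_Rintegral _ _) _ => //; first exact: integrable_subitv im.
    by apply: Rintegral_ge0_subitv => //; exact: (integrable_norm im).
have cv : (Lc * T + Lw) * \int[mu]_(t in `[0, T]) `|g t - h_ m t| @[m --> \oo] --> (0 : R).
  rewrite -[X in _ --> X](mulr0 (Lc * T + Lw)); apply: cvgM; first exact: cvg_cst.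
  exact: (Rintegral_cvg0 hg).
apply/eqP; rewrite -normr_le0 -(cvg_lim _ cv)//; apply: limr_ge.
  by apply/cvg_ex; eexists; exact: cv.
by near=> m; exact: Jm.
Unshelve. all: by end_near. Qed.

End Parts.

Lemma Rintegral_ae_eq d (T : measurableType d) (R : realType)
    (mu : {measure set T -> \bar R}) (D : set T) (f g : T -> R) :
  measurable D -> measurable_fun D f -> measurable_fun D g ->
  {ae mu, forall x, D x -> f x = g x} ->
  \int[mu]_(x in D) f x = \int[mu]_(x in D) g x.
Proof.
move=> mD mf mg fg; rewrite /Rintegral; congr fine; apply: ae_eq_integral => //.
- exact/measurable_EFinP.
- exact/measurable_EFinP.
- by apply: filterS fg => x h /h ->.
Qed.

(** * Pairing the noise with the difference of two states *)

Section NoiseOrthogonality.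
Context {R : realType} {d : measure_display} {Omega : measurableType d}.
Variable Pr : probability Omega R.
Variables (n r N : nat) (T : R).
Hypothesis T0 : 0 < T.
Variables (A : 'M[R]_n) (B : 'M[R]_(n, r)) (G : 'M[R]_n).
Variable F : R -> set (set Omega).
Hypothesis Fmono : forall s t, s <= t -> F s `<=` F t.

Local Notation mu := (@lebesgue_measure R).
Local Notation D := (@timespace R d Omega T).
Local Notation mP := (timespace_measure Pr).
Local Notation TO := (measurableTypeR R * Omega)%type.

Variables (delta : 'I_N -> TO -> 'cV[R]_n) (v : 'I_N -> TO -> 'cV[R]_r).
Hypothesis Ldelta : forall i, vL2 Pr T (delta i).
Hypothesis Lv : forall i, vL2 Pr T (v i).
Hypothesis Fv : forall i t, 0 <= t <= T -> vmeas (F t) (fun w => v i (t, w)).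

Definition difference_drift i (p : TO) : 'cV[R]_n :=
  A *m delta i p + B *m v i p + G *m avg (delta ^~ p).
Local Notation b := difference_drift.

Hypothesis delta_path : {ae Pr, forall w, forall i t, 0 <= t <= T ->
  delta i (t, w) = \col_k (\int[mu]_(s in `[0, t]) b i (s, w) k 0)}.

Variable m : R -> Omega -> R.
Hypothesis mjoint : measurable_fun D (fun p => m p.1 p.2).
Hypothesis mL2 : L2 mP D (fun p => m p.1 p.2).
Hypothesis mtL2 : forall t, 0 <= t <= T -> L2 Pr setT (m t).
Hypothesis morth : forall s t X, 0 <= s -> s <= t -> t <= T ->
  meas_wrt (F s) X -> L2 Pr setT X -> \int[Pr]_w (X w * (m t w - m s w)) = 0.

Let T0' : 0 <= T. Proof. exact: ltW. Qed.
Let mI (t : R) : measurable (`[0, t]%classic : set (measurableTypeR R)).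
Proof. exact: measurable_itv. Qed.
Let mD : measurable D := measurable_timespace T.

Lemma difference_drift_vL2 i : vL2 Pr T (b i).
Proof.
apply: vL2_D; last by apply: vL2_mulmx; exact: vL2_avg.
by apply: vL2_D; exact: vL2_mulmx.
Qed.

Lemma L2_space_section (g : TO -> R) : L2 mP D g ->
  {ae mu, forall t, `[0, T]%classic t -> L2 Pr setT (fun w => g (t, w))}.
Proof.
move=> Lg; have mg : measurable_fun D g by case: Lg.
have mg2 : measurable_fun D (fun p => g p ^+ 2) by exact: measurable_funX.
have [_ E _ mS] := timespace_tonelli Pr mg2 (fun p _ => sqr_ge0 _).
have iS : mu.-integrable `[0, T] (fun t => \int[Pr]_w (g (t, w) ^+ 2)%:E)%E.
  apply/integrableP; split => //.
  rewrite (eq_integral (fun t => \int[Pr]_w (g (t, w) ^+ 2)%:E)%E).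
    by rewrite -E; case: Lg.
  by move=> t _; rewrite gee0_abs// integral_ge0// => w _; rewrite lee_fin sqr_ge0.
have := integrable_ae (mI T) iS; apply: filterS => t h tT; split.
  by apply: (measurable_space_section mg); move: tT; rewrite /= in_itv.
by rewrite -ge0_fin_numE ?h// integral_ge0// => w _; rewrite lee_fin sqr_ge0.
Qed.

(** Square integrability on the product space passes to the sections at almost every time only. *)
Definition good_time t : Prop := forall i,
  (forall k, L2 Pr setT (fun w => delta i (t, w) k 0)) /\
  (forall k, L2 Pr setT (fun w => v i (t, w) k 0)).

Lemma good_time_ae :
  {ae mu, forall t : measurableTypeR R, `[0, T]%classic t -> good_time t}.
Proof.
have aed : {ae mu, forall t, forall i k, `[0, T]%classic t ->
    L2 Pr setT (fun w => delta i (t, w) k 0)}.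
  by apply: filter_forall => i; apply: filter_forall => k; exact: L2_space_section (Ldelta i k).
have aev : {ae mu, forall t, forall i k, `[0, T]%classic t ->
    L2 Pr setT (fun w => v i (t, w) k 0)}.
  by apply: filter_forall => i; apply: filter_forall => k; exact: L2_space_section (Lv i k).
have FF := ae_filter_ringOfSetsType mu.
apply: (@filterS2 _ _ FF _ _ _ _ aed aev) => t Ld Lvt tT i.
by split => k; [exact: Ld|exact: Lvt].
Qed.

Section FixedTime.
Variable t0 : R.
Hypothesis t0T : 0 <= t0 <= T.
Let zeta w := m T w - m t0 w.
Let h i (t : R) : 'cV[R]_n := \col_k \int[Pr]_w (delta i (t, w) k 0 * zeta w).
Let H i (t : R) : 'cV[R]_n := \col_k \int[Pr]_w (b i (t, w) k 0 * zeta w).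

Let zL2 : L2 Pr setT zeta.
Proof. by apply: L2B => //; apply: mtL2 => //; rewrite T0' lexx. Qed.

Lemma zeta_timespace : L2 mP D (fun p => zeta p.2).
Proof.
have mz : measurable_fun D (fun p : TO => zeta p.2).
  apply: (measurable_comp measurableT) => //; first by case: zL2.
  exact: measurable_funS measurable_snd.
split => //; have mz2 : measurable_fun D (fun p : TO => zeta p.2 ^+ 2).
  exact: measurable_funX.
have [_ -> _ _] := timespace_tonelli Pr mz2 (fun p _ => sqr_ge0 _).
rewrite (_ : (fun t => _) = (fun=> (\int[Pr]_w (zeta w ^+ 2))%:E)); last first.
  by apply/funext => t; rewrite EFin_Rintegral//; exact: L2_sqr.
have iT := integrable_cstr (mI T) (\int[Pr]_w (zeta w ^+ 2)) (lebesgue_itv_fin 0 T).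
by rewrite -(EFin_Rintegral (mI T) iT) ltry.
Qed.

(* delta is adapted only up to null sets, which the filtration does not contain.
   But v is adapted and thus orthogonal to the increment of m, so h solves a
   homogeneous linear equation. *)
Lemma covariance_drift t : 0 <= t <= t0 -> good_time t ->
  forall i, H i t = A *m h i t + G *m avg (h ^~ t).
Proof.
move=> /andP[tge0 tt0] gt i; have [t00 t0T'] := andP t0T.
have tT' : 0 <= t <= T by rewrite tge0 (le_trans tt0).
have Ld j k : L2 Pr setT (fun w => delta j (t, w) k 0) by case: (gt j).
have Lvt j k : L2 Pr setT (fun w => v j (t, w) k 0) by case: (gt j).
have vz j k : \int[Pr]_w (v j (t, w) k 0 * zeta w) = 0.
  apply: (morth t00 t0T' (lexx T)); last exact: Lvt.
  by apply: meas_wrt_sub (Fv j tT' k); exact: Fmono.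
have id j k : Pr.-integrable setT (EFin \o (fun w => delta j (t, w) k 0 * zeta w)).
  exact: L2_mul.
have iv j k : Pr.-integrable setT (EFin \o (fun w => v j (t, w) k 0 * zeta w)).
  exact: L2_mul.
apply/matrixP => k l; rewrite ord1 !mxE.
rewrite (@eq_Rintegral _ _ _ Pr setT (fun w =>
  (\sum_j A k j * (delta i (t, w) j 0 * zeta w) +
   \sum_j B k j * (v i (t, w) j 0 * zeta w)) +
  \sum_j G k j * (N%:R^-1 * \sum_q (delta q (t, w) j 0 * zeta w)))); last first.
  move=> w _; rewrite /b !mxE !mulrDl !mulr_suml; congr (_ + _ + _).
  - by apply: eq_bigr => j _; rewrite mulrA.
  - by apply: eq_bigr => j _; rewrite mulrA.
  - apply: eq_bigr => j _; rewrite !mxE summxE -!mulrA; congr (_ * (_ * _)).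
    by rewrite mulr_suml.
have i1 : Pr.-integrable setT (EFin \o (fun w => \sum_j A k j * (delta i (t, w) j 0 * zeta w))).
  by apply: integrable_sumr => // j; exact: integrable_scale.
have i2 : Pr.-integrable setT (EFin \o (fun w => \sum_j B k j * (v i (t, w) j 0 * zeta w))).
  by apply: integrable_sumr => // j; exact: integrable_scale.
have i4 j : Pr.-integrable setT (EFin \o (fun w => \sum_q (delta q (t, w) j 0 * zeta w))).
  exact: integrable_sumr.
have i5 j : Pr.-integrable setT (EFin \o (fun w => N%:R^-1 * \sum_q (delta q (t, w) j 0 * zeta w))).
  exact: integrable_scale.
have i3 : Pr.-integrable setT (EFin \o (fun w =>
    \sum_j G k j * (N%:R^-1 * \sum_q (delta q (t, w) j 0 * zeta w)))).
  by apply: integrable_sumr => // j; exact: integrable_scale.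
rewrite RintegralD//; last exact: integrable_addr.
rewrite RintegralD// !Rintegral_sumr//; last 3 first.
- by move=> j; exact: integrable_scale.
- by move=> j; exact: integrable_scale.
- by move=> j; exact: integrable_scale.
rewrite [X in _ + X + _]big1 ?addr0; last first.
  by move=> j _; rewrite RintegralZl// vz mulr0.
congr (_ + _); apply: eq_bigr => j _; rewrite RintegralZl// !mxE//.
by rewrite RintegralZl// Rintegral_sumr// summxE; congr (_ * (_ * _)); apply: eq_bigr => q _; rewrite mxE.
Qed.

Lemma covariance_path i t : 0 <= t <= T -> h i t = \col_k \int[mu]_(s in `[0, t]) H i s k 0.
Proof.
move=> tT; have [t00 tT'] := andP tT; apply/matrixP => k l; rewrite ord1 !mxE.
have sub : `[0, t]%classic `*` [set: Omega] `<=` D.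
  by move=> [s w] [/= + _]; rewrite in_itv/= => /andP[s0 st]; split => //=; rewrite in_itv/= s0 (le_trans st).
have ib : mP.-integrable (timespace t) (EFin \o (fun p => b i p k 0 * zeta p.2)).
  apply: integrableS (L2_mul mD (difference_drift_vL2 i k) zeta_timespace) => //.
  exact: measurable_timespace.
have [_ [_ iw E1 _ E2]] := timespace_fubini ib.
have -> : \int[mu]_(s in `[0, t]) H i s k 0 =
    \int[mu]_(s in `[0, t]) \int[Pr]_w (b i (s, w) k 0 * zeta w).
  by apply: eq_Rintegral => s _; rewrite mxE.
rewrite -E2 E1; apply: Rintegral_ae_eq => //.
- apply: measurable_funM; last by case: zL2.
  have md : measurable_fun D (fun p => delta i p k 0) by case: (Ldelta i k).
  exact: (measurable_space_section md tT).
- by case/integrableP: iw => /measurable_EFinP.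
have ip := L2_path (difference_drift_vL2 i k).
apply: filterS2 delta_path ip => w dE ibw _.
rewrite dE// mxE -RintegralZr//.
exact: integrable_subitv ibw.
Qed.

Lemma covariance_vint i : vint T (H i).
Proof.
move=> k; have ib := L2_mul mD (difference_drift_vL2 i k) zeta_timespace.
have [_ [_ _ _ iH _]] := timespace_fubini ib.
by apply: eq_integrable iH => // t _; rewrite /= mxE.
Qed.

(** By [covariance_path] and [covariance_drift], [h] is up to time [t0] the integral of a linear
    function of itself, and Gronwall with zero data applies. The restriction to times before [t0]
    keeps the controls orthogonal to the increment [zeta]. *)
Lemma covariance0 i t : 0 <= t <= t0 -> h i t = 0.
Proof.
move=> tt0; have [t00 t0T'] := andP t0T.
have sub u : 0 <= u <= t0 -> 0 <= u <= T by move=> /andP[-> /le_trans ->].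
have ch j : {within `[0, t0], continuous (h j)}.
  apply: (@subspace_eq_continuous _ _ _
    (fun u : R => \col_k (\int[mu]_(s in `[0, u]) H j s k 0) : 'cV[R]_n)).
    move=> u; rewrite inE/= in_itv/= => /sub uT.
    exact: (esym (covariance_path j uT)).
  apply/within_mxP => k l.
  rewrite (_ : (fun u => _) = fun u => \int[mu]_(s in `[0, u]) H j s k 0).
    apply: parameterized_integral_continuous => //.
    by apply: integrable_subitv t0T' _; exact: covariance_vint.
  by apply/funext => u; rewrite mxE.
have ib j : vint t0 (fun s => A *m h j s + G *m avg (h ^~ s)).
  apply: vint_D; apply: vint_mulmx; first exact: vint_continuous.
  by apply: vint_avg => l; exact: vint_continuous.
have hE j u : 0 <= u <= t0 -> h j u = 0 +
    \col_k (\int[mu]_(s in `[0, u]) (A *m h j s + G *m avg (h ^~ s)) k 0).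
  move=> ut0; have [u0 ut] := andP ut0; rewrite add0r (covariance_path j (sub u ut0)).
  apply/matrixP => k l; rewrite [LHS]mxE [RHS]mxE; apply: Rintegral_ae_eq => //.
  - have := integrable_subitv (le_trans ut t0T') (covariance_vint j k).
    by case/integrableP => /measurable_EFinP.
  - by have := integrable_subitv ut (ib j k); case/integrableP => /measurable_EFinP.
  have FF := ae_filter_ringOfSetsType mu.
  apply: (@filterS _ _ FF _ _ _ good_time_ae) => s gs; rewrite /= in_itv/= => /andP[s0 su].
  have st0 : 0 <= s <= t0 by rewrite s0 (le_trans su).
  by rewrite covariance_drift//; apply: gs; rewrite /= in_itv/=; exact: sub.
have L0 := addr_ge0 (entry_sum_ge0 A) (entry_sum_ge0 G).
have i0 : mu.-integrable `[0, t0] (EFin \o (fun=> (0 : R))) by exact: integrable0.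
have := linear_system_bound t00 L0 (fun=> lexx 0) i0 ch ib hE _ i tt0.
rewrite big1 ?add0r; last by move=> j _; rewrite /l1 big1// => l _; rewrite mxE normr0.
rewrite Rintegral_cst// mul0r mulr0 mul0r => h0.
apply/matrixP => k l; rewrite ord1 [RHS]mxE; apply/eqP; rewrite -normr_le0.
apply: le_trans (le_l1 (h i t) k) _; apply: h0 => j s st.
rewrite addr0; apply: le_trans (l1D _ _) _; rewrite mulrDl; apply: lerD.
  apply: le_trans (l1_mulmx _ _) _; rewrite ler_wpM2l ?entry_sum_ge0//.
  by rewrite (bigD1 j)//= lerDl sumr_ge0// => q _; exact: l1_ge0.
by apply: le_trans (l1_mulmx _ _) _; rewrite ler_wpM2l ?entry_sum_ge0// l1_avg.
Qed.

Lemma delta_orthogonal i k : \int[Pr]_w (delta i (t0, w) k 0 * zeta w) = 0.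
Proof.
have t00 : 0 <= t0 <= t0 by rewrite lexx andbT; case/andP: t0T.
have /(congr1 (fun M => fun_of_matrix M k 0)) := covariance0 i t00.
by rewrite !mxE.
Qed.

Lemma drift_orthogonal i k : good_time t0 ->
  \int[Pr]_w (b i (t0, w) k 0 * zeta w) = 0.
Proof.
move=> gt; have t00 : 0 <= t0 <= t0 by rewrite lexx andbT; case/andP: t0T.
have : H i t0 k 0 = 0.
  rewrite (covariance_drift t00 gt) covariance0// mulmx0 add0r.
  rewrite (_ : avg _ = 0); first by rewrite mulmx0 mxE.
  by rewrite /avg big1 ?scaler0// => j _; exact: covariance0.
by rewrite mxE.
Qed.

End FixedTime.

Lemma noise_orthogonal (w c : R -> R) i k :
  {within `[0, T], continuous w} -> {within `[0, T], continuous c} ->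
  (forall t, 0 < t < T -> is_derive t 1 w (c t)) -> w T = 0 ->
  \int[mP]_(p in D) ((c p.1 * delta i p k 0 + w p.1 * b i p k 0) * m p.1 p.2) = 0.
Proof.
move=> cw cc dw wT.
pose g (p : TO) := c p.1 * delta i p k 0 + w p.1 * b i p k 0.
have Lg : L2 mP D g.
  by apply: (L2D mD); apply: L2_time_mul => //; [exact: Ldelta|exact: difference_drift_vL2].
have TT : 0 <= T <= T by rewrite lexx T0'.
have mT : L2 mP D (fun p => m T p.2).
  have mz : measurable_fun D (fun p : TO => m T p.2).
    apply: (measurable_comp measurableT) => //; first by case: (mtL2 TT).
    exact: measurable_funS measurable_snd.
  split => //; have mz2 : measurable_fun D (fun p : TO => m T p.2 ^+ 2).
    exact: measurable_funX.
  have [_ -> _ _] := timespace_tonelli Pr mz2 (fun p _ => sqr_ge0 _).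
  rewrite (_ : (fun t => _) = (fun=> (\int[Pr]_w (m T w ^+ 2))%:E)); last first.
    by apply/funext => t; rewrite EFin_Rintegral//; apply: L2_sqr; exact: mtL2.
  have iT := integrable_cstr (mI T) (\int[Pr]_w (m T w ^+ 2)) (lebesgue_itv_fin 0 T).
  by rewrite -(EFin_Rintegral (mI T) iT) ltry.
have LmD : L2 mP D (fun p => m T p.2 - m p.1 p.2) by exact: (L2B mD).
have i1 := L2_mul mD Lg mT; have i2 := L2_mul mD Lg LmD.
rewrite (@eq_Rintegral _ _ _ mP D (fun p => g p * m T p.2 - g p * (m T p.2 - m p.1 p.2))).
  2: by move=> p _; rewrite /g; ring.
rewrite (RintegralB mD i1 i2).
have -> : \int[mP]_(p in D) (g p * m T p.2) = 0.
  have [_ [_ i3 -> _ _]] := timespace_fubini i1.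
  rewrite (@Rintegral_ae_eq _ _ _ Pr setT _ (fun=> 0)) ?Rintegral_cst ?mul0r//.
    by case/integrableP: i3 => /measurable_EFinP.
  have ip := L2_path (difference_drift_vL2 i k).
  have ig := L2_path Lg.
  apply: filterS3 delta_path ip ig => z dE ibz igz _ /=.
  rewrite RintegralZr//.
  rewrite (@eq_Rintegral _ _ _ mu `[0, T] (fun t => c t * \int[mu]_(s in `[0, t]) b i (s, z) k 0
     + w t * b i (t, z) k 0)).
    by rewrite parts_integrable// mul0r.
  by move=> t; rewrite inE/= in_itv/= => tT; rewrite /g /= dE// mxE.
(* The two terms use opposite orders of integration: time first for the terminal value, expectation
   first for the increment. *)
have -> : \int[mP]_(p in D) (g p * (m T p.2 - m p.1 p.2)) = 0; last by rewrite subrr.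
have [_ [_ _ _ i3 ->]] := timespace_fubini i2.
rewrite (@Rintegral_ae_eq _ _ _ mu `[0, T] _ (fun=> 0)) ?Rintegral_cst ?mul0r//.
  by case/integrableP: i3 => /measurable_EFinP.
have FF := ae_filter_ringOfSetsType mu.
apply: (@filterS _ _ FF _ _ _ good_time_ae) => t gt tT; have {}gt := gt tT.
have tT' : 0 <= t <= T by move: tT; rewrite /= in_itv.
have zL2 : L2 Pr setT (fun w => m T w - m t w) by apply: L2B => //; exact: mtL2.
have Lb : L2 Pr setT (fun w => b i (t, w) k 0).
  rewrite (_ : (fun w => _) = fun w =>
    (\sum_j A k j * delta i (t, w) j 0 + \sum_j B k j * v i (t, w) j 0) +
    \sum_j G k j * (N%:R^-1 * \sum_q delta q (t, w) j 0)); last first.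
    apply/funext => z; rewrite /b !mxE; congr (_ + _).
    by apply: eq_bigr => j _; rewrite !mxE summxE.
  have [Ld Lvt] : (forall j l, L2 Pr setT (fun w => delta j (t, w) l 0)) /\
      (forall j l, L2 Pr setT (fun w => v j (t, w) l 0)).
    by split => j l; case: (gt j).
  apply: L2D => //; first apply: L2D => //; apply: L2_sum => // j; apply: L2Z => //.
  by apply: L2Z => //; exact: L2_sum.
rewrite /g /= (@eq_Rintegral _ _ _ Pr setT (fun z =>
  c t * (delta i (t, z) k 0 * (m T z - m t z)) + w t * (b i (t, z) k 0 * (m T z - m t z)))).
  2: by move=> z _; ring.
have j1 : Pr.-integrable setT (EFin \o (fun z => delta i (t, z) k 0 * (m T z - m t z))).
  by apply: L2_mul => //; case: (gt i).
have j2 : Pr.-integrable setT (EFin \o (fun z => b i (t, z) k 0 * (m T z - m t z))).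
  exact: L2_mul.
rewrite RintegralD//; [|exact: integrable_scale|exact: integrable_scale].
by rewrite !RintegralZl// delta_orthogonal// drift_orthogonal// !mulr0 addr0.
Qed.

End NoiseOrthogonality.

(** * Inner products and averages *)

Section Duality.
Context {R : realType}.

Definition dot k (a b : 'cV[R]_k) : R := \sum_j a j 0 * b j 0.

Lemma dotE k (a b : 'cV[R]_k) : dot a b = (a^T *m b) 0 0.
Proof. by rewrite mxE; apply: eq_bigr => j _; rewrite mxE. Qed.

Lemma dotDl k (a b c : 'cV[R]_k) : dot (a + b) c = dot a c + dot b c.
Proof. by rewrite -big_split; apply: eq_bigr => j _; rewrite mxE mulrDl. Qed.

Lemma dotDr k (a b c : 'cV[R]_k) : dot a (b + c) = dot a b + dot a c.
Proof. by rewrite -big_split; apply: eq_bigr => j _; rewrite mxE mulrDr. Qed.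

Lemma dotZl k c (a b : 'cV[R]_k) : dot (c *: a) b = c * dot a b.
Proof. by rewrite mulr_sumr; apply: eq_bigr => j _; rewrite mxE mulrA. Qed.

Lemma dotC k (a b : 'cV[R]_k) : dot a b = dot b a.
Proof. by apply: eq_bigr => j _; rewrite mulrC. Qed.

Lemma dotZr k c (a b : 'cV[R]_k) : dot a (c *: b) = c * dot a b.
Proof. by rewrite dotC dotZl dotC. Qed.

Lemma dotNl k (a b : 'cV[R]_k) : dot (- a) b = - dot a b.
Proof. by rewrite -scaleN1r dotZl mulN1r. Qed.

Lemma dotNr k (a b : 'cV[R]_k) : dot a (- b) = - dot a b.
Proof. by rewrite dotC dotNl dotC. Qed.

Lemma dot_mulmx k q (M : 'M[R]_(k, q)) (a : 'cV[R]_k) (b : 'cV[R]_q) :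
  dot a (M *m b) = dot (M^T *m a) b.
Proof. by rewrite !dotE trmx_mul trmxK mulmxA. Qed.

Lemma dot_suml k (I : finType) (a : I -> 'cV[R]_k) b :
  \sum_i dot (a i) b = dot (\sum_i a i) b.
Proof.
rewrite /dot exchange_big; apply: eq_bigr => j _.
by rewrite summxE mulr_suml.
Qed.

Lemma dot_sumr k (I : finType) (a : I -> 'cV[R]_k) b :
  \sum_i dot b (a i) = dot b (\sum_i a i).
Proof. by rewrite dotC -dot_suml; apply: eq_bigr => i _; rewrite dotC. Qed.

(** Averaging over the agents is self-adjoint, so it moves from one argument to the other. *)
Lemma dot_avg_swap N k q (M : 'M[R]_(k, q)) (a : 'I_N -> 'cV[R]_k) (b : 'I_N -> 'cV[R]_q) :
  \sum_i dot (a i) (M *m avg b) = \sum_i dot (M^T *m avg a) (b i).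
Proof.
rewrite dot_suml dot_sumr dot_mulmx /avg -!scalemxAr !(dotZl, dotZr).
by rewrite -dot_mulmx.
Qed.

Lemma avg_D N k (a b : 'I_N -> 'cV[R]_k) : avg (fun i => a i + b i) = avg a + avg b.
Proof. by rewrite /avg big_split scalerDr. Qed.

Lemma avg_N N k (a : 'I_N -> 'cV[R]_k) : avg (fun i => - a i) = - avg a.
Proof. by rewrite /avg sumrN scalerN. Qed.

Lemma avg_mulmx N k q (M : 'M[R]_(k, q)) (a : 'I_N -> 'cV[R]_q) :
  avg (fun i => M *m a i) = M *m avg a.
Proof. by rewrite /avg -mulmx_sumr scalemxAr. Qed.

Lemma avg_cst N k (a : 'cV[R]_k) : (0 < N)%N -> avg (fun _ : 'I_N => a) = a.
Proof.
move=> N0; rewrite /avg sumr_const card_ord -[a *+ N]scaler_nat scalerA.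
by rewrite mulVf ?scale1r// pnatr_eq0 -lt0n.
Qed.

(** The gap between the two sides is exactly [quad M b], so no remainder has to be estimated. *)
Lemma quad_tangent k (M : 'M[R]_k) (a b : 'cV[R]_k) : sym_mx M -> pos_semidef M ->
  quad M a + 2 * dot (M *m a) b <= quad M (a + b).
Proof.
move=> sM pM; have := pM b; rewrite /quad.
have E (c e : 'cV[R]_k) : (c^T *m M *m e) 0 0 = dot (M *m c) e.
  by rewrite dotE trmx_mul sM.
rewrite !E mulmxDr !(dotDl, dotDr).
have -> : dot (M *m b) a = dot (M *m a) b.
  by rewrite [RHS]dotC dot_mulmx sM.
lra.
Qed.

End Duality.

(** * Pointwise algebra of the first variation *)

Section FirstVariationAlgebra.
Context {R : realType}.
Variables (n r N : nat) (rho : R).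
Hypothesis hN : (0 < N)%N.
Variables (A : 'M[R]_n) (B : 'M[R]_(n, r)) (G Gamma Q : 'M[R]_n).
Variables (Rc : 'M[R]_r) (eta : 'cV[R]_n).
Hypotheses (sQ : sym_mx Q) (sR : sym_mx Rc) (uR : Rc \in unitmx).
Let S := B *m invmx Rc *m B^T.

Variables (P K : 'M[R]_n) (s ft : 'cV[R]_n).
Hypothesis sPi : (P + K)^T = P + K.
Variables (x delta : 'I_N -> 'cV[R]_n) (v : 'I_N -> 'cV[R]_r).

Let p i := P *m x i + K *m avg x + s.
Let u i := - (invmx Rc *m B^T *m p i).
Let b i := A *m delta i + B *m v i + G *m avg delta.
Let drift i := A *m x i + B *m u i + G *m avg x + ft.

(** The formal derivative of the discounted costate, divided by the discount factor: the derivatives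
    of P, K, s are those prescribed by their equations, and the states move with their drift. *)
Definition adjoint_rhs i : 'cV[R]_n :=
  P_rhs rho A B Q Rc P *m x i + P *m drift i +
  (K_rhs rho A B G Gamma Q Rc P K *m avg x + K *m avg drift) +
  s_rhs rho A B G Gamma Q Rc eta (P + K) s ft - rho *: p i.

Lemma avg_costate : avg p = (P + K) *m avg x + s.
Proof. by rewrite /p !avg_D !avg_mulmx !avg_cst// mulmxDl. Qed.

Lemma avg_drift : avg drift = A *m avg x + G *m avg x + ft - S *m avg p.
Proof.
have Eu : avg u = - (invmx Rc *m B^T *m avg p) by rewrite /u avg_N avg_mulmx.
rewrite /drift (avg_D (fun i => A *m x i + B *m u i + G *m avg x)).
rewrite (avg_D (fun i => A *m x i + B *m u i)) (avg_D (fun i => A *m x i)).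
rewrite !avg_mulmx Eu !avg_cst// /S mulmxN !mulmxA; move: (avg p) => q; mx_abel.
Qed.

(** The quadratic terms of the Riccati equations cancel against the feedback in the drift, which
    leaves the linear costate equation. The transposed closed-loop matrix in the equation of s is
    opened by the symmetry of P + K. *)
Lemma adjoint_equation i : adjoint_rhs i =
  - (Q *m x i - Q_Gamma Gamma Q *m avg x - eta_bar Gamma Q eta +
     A^T *m p i + G^T *m avg p).
Proof.
have sS : S^T = S by exact: sym_gain.
have Ss : (A + G - S *m (P + K))^T = A^T + G^T - (P + K) *m S.
  by rewrite trmxB trmxD trmx_mul sPi sS.
rewrite /adjoint_rhs avg_drift avg_costate /s_rhs /P_rhs /K_rhs -/S Ss /drift /u /p trmxD.
rewrite (_ : B *m - _ = - (S *m (P *m x i + K *m avg x + s))); last first.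
  by rewrite mulmxN /S !mulmxA.
move: (Q_Gamma Gamma Q) (eta_bar Gamma Q eta) (avg x) (x i) S => qG eb xb xi S'.
rewrite !(mulmxDl, mulmxDr, mulmxN, mulNmx) -!scalemxAl !mulmxA.
mx_abel.
Qed.

Lemma first_variation_algebra :
  \sum_i (dot (Q *m (x i - Gamma *m avg x - eta)) (delta i - Gamma *m avg delta) +
          dot (Rc *m u i) (v i)) =
  - \sum_i (dot (adjoint_rhs i) (delta i) + dot (p i) (b i)).
Proof.
(* The feedback is chosen so that Rc u = -B^T p; the pairing of p with B v is that with the whole
   drift [b] minus the terms without control. *)
have E1 i : dot (Rc *m u i) (v i) =
    - dot (p i) (b i) + dot (A^T *m p i) (delta i) + dot (p i) (G *m avg delta).
  have -> : Rc *m u i = - (B^T *m p i).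
    by rewrite /u mulmxN !mulmxA mulmxV// mul1mx.
  by rewrite /b !dotDr !dot_mulmx dotNl; ring.
pose a i := x i - Gamma *m avg x - eta.
have avga : avg a = avg x - Gamma *m avg x - eta.
  by rewrite /a avg_D avg_N avg_D avg_N !avg_cst.
(* Averages of [delta] are moved onto the other factor, so that every term pairs with [delta i] and
   the sums can be compared agent by agent. *)
have E2 : \sum_i dot (Q *m a i) (Gamma *m avg delta) =
    \sum_i dot (Gamma^T *m (Q *m avg a)) (delta i).
  by rewrite (dot_avg_swap Gamma (fun i => Q *m a i)) avg_mulmx.
have E3 := dot_avg_swap G p delta.
transitivity (\sum_i dot (Q *m a i) (delta i) - \sum_i dot (Q *m a i) (Gamma *m avg delta)
  + (- \sum_i dot (p i) (b i) + \sum_i dot (A^T *m p i) (delta i) +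
     \sum_i dot (p i) (G *m avg delta))).
  rewrite -!sumrN -!big_split/=; apply: eq_bigr => i _.
  by rewrite E1 dotDr dotNr.
rewrite E2 E3 -!sumrN -!big_split/=; apply: eq_bigr => i _.
rewrite adjoint_equation dotNl.
have -> : dot (Q *m x i - Q_Gamma Gamma Q *m avg x - eta_bar Gamma Q eta +
     A^T *m p i + G^T *m avg p) (delta i) =
  dot (Q *m a i) (delta i) - dot (Gamma^T *m (Q *m avg a)) (delta i) +
  dot (A^T *m p i) (delta i) + dot (G^T *m avg p) (delta i).
  rewrite -dotNl -!dotDl; congr dot.
  rewrite avga /a /Q_Gamma /eta_bar.
  move: (avg p) (p i) (avg x) (x i) => pb pi xb xi.
  rewrite !(mulmxDl, mulmxDr, mulmxN, mulNmx) !mulmxA; mx_abel.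
ring.
Qed.

End FirstVariationAlgebra.

Section CostateParts.
Context {R : realType}.
Variables (T : R).
Hypothesis T0 : 0 <= T.
Local Notation mu := (@lebesgue_measure R).
Let mI (t : R) : measurable (`[0, t]%classic : set (measurableTypeR R)).
Proof. exact: measurable_itv. Qed.

Lemma mx_is_derive_avg N k (y : 'I_N -> R -> 'cV[R]_k) (a : 'I_N -> 'cV[R]_k) t :
  (forall i, mx_is_derive (y i) t (a i)) -> mx_is_derive (fun s => avg (y ^~ s)) t (avg a).
Proof.
move=> dy; have -> : avg a = N%:R^-1 *: \sum_i a i + 0 *: (\sum_i y i t).
  by rewrite scale0r addr0.
apply: (mx_is_deriveZ (g := cst N%:R^-1) (F := fun s => \sum_i y i s)).
rewrite (_ : (fun s => _) = \sum_i y i); last by apply/funext => s; rewrite fct_sumE.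
elim/big_ind2 : _ => [|F F' G G'|i _]; [exact: mx_is_derive_cst|exact: mx_is_deriveD|exact: dy].
Qed.

Lemma within_primitive_mx k (a : R -> 'cV[R]_k) : {within `[0, T], continuous a} ->
  let Z t : 'cV[R]_k := \col_l (\int[mu]_(s in `[0, t]) a s l 0) in
  {within `[0, T], continuous Z} /\ forall t, 0 < t < T -> mx_is_derive Z t (a t).
Proof.
move=> /within_mxP ca Z; split.
  apply/within_mxP => l j; rewrite (_ : (fun t => _) = fun t => \int[mu]_(s in `[0, t]) a s l 0).
    by have [] := within_primitive T0 (ca l 0).
  by apply/funext => t; rewrite mxE.
move=> t tT l j; rewrite ord1 (_ : (fun u => _) = fun t => \int[mu]_(s in `[0, t]) a s l 0).
  by have [_ _ dZ] := within_primitive T0 (ca l 0); exact: dZ.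
by apply/funext => u; rewrite mxE.
Qed.

Lemma costate_parts (I : finType) k (w c g : I -> R -> 'cV[R]_k) :
  (forall i, {within `[0, T], continuous (w i)}) ->
  (forall i, {within `[0, T], continuous (c i)}) ->
  (forall i t, 0 < t < T -> mx_is_derive (w i) t (c i t)) ->
  (forall i, w i T = 0) -> (forall i, vint T (g i)) ->
  \int[mu]_(t in `[0, T]) (\sum_i
    (dot (c i t) (\col_l (\int[mu]_(s in `[0, t]) g i s l 0)) + dot (w i t) (g i t))) = 0.
Proof.
move=> cw cc dw wT ig.
rewrite (_ : (fun t => _) = fun t => \sum_i \sum_l (c i t l 0 *
    \int[mu]_(s in `[0, t]) g i s l 0 + w i t l 0 * g i t l 0)); last first.
  apply/funext => t; apply: eq_bigr => i _; rewrite -big_split/=.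
  by apply: eq_bigr => l _; rewrite mxE.
have H i l : mu.-integrable `[0, T] (EFin \o (fun t => c i t l 0 *
    \int[mu]_(s in `[0, t]) g i s l 0 + w i t l 0 * g i t l 0)).
  apply: (integrable_parts T0) => //; last exact: ig.
    by move/within_mxP : (cw i); exact.
  by move/within_mxP : (cc i); exact.
rewrite (Rintegral_sumr (mI T)); last by move=> i; exact: (integrable_sumr (mI T)).
apply: big1 => i _; rewrite (Rintegral_sumr (mI T)) //; apply: big1 => l _.
apply: (parts_integrable T0) => //.
- by move/within_mxP : (cw i); exact.
- by move/within_mxP : (cc i); exact.
- by move=> t tT; exact: dw.
- by rewrite wT mxE.
- exact: ig.
Qed.

End CostateParts.

(** * The cost as a finite integral on the product space *)

Section CostIntegral.
Context {R : realType} {d : measure_display} {Omega : measurableType d}.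
Variable Pr : probability Omega R.
Variables (n r N : nat) (T rho : R).
Variables (Gamma Q : 'M[R]_n) (Rc : 'M[R]_r) (eta : 'cV[R]_n).
Local Notation mu := (@lebesgue_measure R).
Local Notation D := (@timespace R d Omega T).
Local Notation mP := (timespace_measure Pr).
Local Notation TO := (measurableTypeR R * Omega)%type.
Let mD : measurable D := measurable_timespace T.

Lemma vL2_dot k (X Y : TO -> 'cV[R]_k) : vL2 Pr T X -> vL2 Pr T Y ->
  mP.-integrable D (EFin \o (fun p => dot (X p) (Y p))).
Proof. by move=> LX LY; apply: (integrable_sumr mD) => j; exact: (L2_mul mD (LX j) (LY j)). Qed.

Lemma vL2_discount k (X : TO -> 'cV[R]_k) : vL2 Pr T X ->
  vL2 Pr T (fun p => expR (- rho * p.1) *: X p).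
Proof.
move=> LX j; rewrite (_ : (fun p => _) = fun p => expR (- rho * p.1) * X p j 0).
  by apply: (L2_time_mul (a := fun t => expR (- rho * t))) (LX j); exact: within_expR.
by apply/funext => p; rewrite mxE.
Qed.

Lemma vL2_dot_discount k (X Y : TO -> 'cV[R]_k) : vL2 Pr T X -> vL2 Pr T Y ->
  mP.-integrable D (EFin \o (fun p => expR (- rho * p.1) * dot (X p) (Y p))).
Proof.
move=> LX LY; rewrite (_ : (fun p => _) = fun p => dot (expR (- rho * p.1) *: X p) (Y p)).
  by apply: vL2_dot => //; exact: vL2_discount.
by apply/funext => p; rewrite dotZl.
Qed.

Definition cost_rate (x : 'I_N -> R -> Omega -> 'cV[R]_n)
    (u : 'I_N -> R -> Omega -> 'cV[R]_r) i (p : TO) : R :=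
  expR (- rho * p.1) *
    (quad Q (x i p.1 p.2 - Gamma *m average x p.1 p.2 - eta) + quad Rc (u i p.1 p.2)).

Section Costs.
Variables (x : 'I_N -> R -> Omega -> 'cV[R]_n) (u : 'I_N -> R -> Omega -> 'cV[R]_r).
Hypothesis Lx : forall i, vL2 Pr T (fun p => x i p.1 p.2).
Hypothesis Lu : forall i, vL2 Pr T (fun p => u i p.1 p.2).

Lemma vL2_tracking i :
  vL2 Pr T (fun p => x i p.1 p.2 - Gamma *m average x p.1 p.2 - eta).
Proof.
apply: vL2_D; last by apply: (vL2_time Pr (v := fun=> - eta)); exact: within_cst.
apply: vL2_D => //; apply: vL2_N; apply: vL2_mulmx.
exact: (vL2_avg (X := fun i p => x i p.1 p.2)).
Qed.

Lemma cost_rate_integrable i : mP.-integrable D (EFin \o cost_rate x u i).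
Proof.
have E k (M : 'M[R]_k) (z : 'cV[R]_k) : quad M z = dot z (M *m z).
  by rewrite /quad dotE mulmxA.
pose z p := x i p.1 p.2 - Gamma *m average x p.1 p.2 - eta.
rewrite (_ : cost_rate x u i = fun p => expR (- rho * p.1) * dot (z p) (Q *m z p) +
    expR (- rho * p.1) * dot (u i p.1 p.2) (Rc *m u i p.1 p.2)); last first.
  by apply/funext => p; rewrite /cost_rate !E mulrDr.
apply: (integrable_addr mD); apply: vL2_dot_discount => //.
- exact: vL2_tracking.
- exact/vL2_mulmx/vL2_tracking.
- exact: vL2_mulmx.
Qed.

Lemma agent_costE i : pos_semidef Q -> pos_semidef Rc ->
  agent_cost Pr T rho Gamma Q Rc eta x u i = (\int[mP]_(p in D) cost_rate x u i p)%:E.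
Proof.
move=> pQ pR; have ir := cost_rate_integrable i.
have mr : measurable_fun D (cost_rate x u i) by case/integrableP : ir => /measurable_EFinP.
have r0 p : D p -> 0 <= cost_rate x u i p.
  by move=> _; apply: mulr_ge0; [exact: expR_ge0|apply: addr_ge0; [exact: pQ|exact: pR]].
by rewrite (EFin_Rintegral mD ir); have [-> _ _ _] := timespace_tonelli Pr mr r0.
Qed.

Lemma social_costE : pos_semidef Q -> pos_semidef Rc ->
  social_cost Pr T rho Gamma Q Rc eta x u =
  (\int[mP]_(p in D) \sum_i cost_rate x u i p)%:E.
Proof.
move=> pQ pR; rewrite (Rintegral_sumr mD); last exact: cost_rate_integrable.
by rewrite -sumEFin; apply: eq_bigr => i _; rewrite agent_costE.
Qed.

End Costs.

End CostIntegral.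

(** * Vanishing first variation and comparison of costs *)

Section Optimality.
Context {R : realType} {d : measure_display} {Omega : measurableType d}.
Variable Pr : probability Omega R.
Variables (n r N : nat) (T rho : R).
Variables (A : 'M[R]_n) (B : 'M[R]_(n, r)) (G Gamma Q : 'M[R]_n) (Rc : 'M[R]_r).
Variables (eta : 'cV[R]_n) (f sigma : R -> 'cV[R]_n).
Variables (x0 : 'I_N -> Omega -> 'cV[R]_n) (W : 'I_N -> R -> Omega -> R).
Hypotheses (hN : (0 < N)%N) (T0 : 0 < T).
Hypotheses (sQ : sym_mx Q) (pQ : pos_semidef Q) (sR : sym_mx Rc) (pR : pos_def Rc).
Hypothesis hW : forall i, brownian_motion Pr (W i).
Hypothesis hWindep :
  mutually_independent Pr (fun i => sigma_of `[0, +oo[ (W i)).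
Hypothesis hx0meas : forall i, measurable_vec (x0 i).
Hypothesis hx0W : independent2 Pr
  <<s \bigcup_(i in [set: 'I_N]) sigma_vec (x0 i) >>
  <<s \bigcup_(i in [set: 'I_N]) sigma_of `[0, +oo[ (W i) >>.
Hypothesis hx0L2 : forall i k, L2 Pr setT (fun w => x0 i w k 0).
Hypothesis hsigma : {within `[0, T], continuous sigma}.
Hypothesis cf : {within `[0, T], continuous f}.
Variables (P K : R -> 'M[R]_n) (s : R -> 'cV[R]_n).
Hypothesis cP : {within `[0, T], continuous P}.
Hypothesis cK : {within `[0, T], continuous K}.
Hypothesis cs : {within `[0, T], continuous s}.
Hypotheses (PT : P T = 0) (KT : K T = 0) (sT : s T = 0).
Hypothesis dP : forall t, 0 < t < T -> mx_is_derive P t (P_rhs rho A B Q Rc (P t)).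
Hypothesis dK : forall t, 0 < t < T ->
  mx_is_derive K t (K_rhs rho A B G Gamma Q Rc (P t) (K t)).
Hypothesis ds : forall t, 0 < t < T ->
  mx_is_derive s t (s_rhs rho A B G Gamma Q Rc eta (P t + K t) (s t) (f t)).
Hypothesis sPi : forall t, t <= T -> (P t + K t)^T = P t + K t.

Local Notation Ft := (filtration x0 W).
Local Notation mu := (@lebesgue_measure R).
Local Notation D := (@timespace R d Omega T).
Local Notation mP := (timespace_measure Pr).
Local Notation TO := (measurableTypeR R * Omega)%type.

Variables (M x : 'I_N -> R -> Omega -> 'cV[R]_n).
Hypothesis nM : continuous_adapted Pr T x0 W M.
Hypothesis iM : forall i, ito_integral Pr T sigma (W i) (M i).
Hypothesis nx : continuous_adapted Pr T x0 W x.
Let u := feedback B Rc P K s x.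
Hypothesis xE : {ae Pr, forall w, forall i t, 0 <= t <= T -> x i t w = x0 i w
       + \col_k (\int[mu]_(v in `[0, t]) drift A B G f u x i v w k 0) + M i t w}.

Let T0' : 0 <= T. Proof. exact: ltW. Qed.
Let mI (t : R) : measurable (`[0, t]%classic : set (measurableTypeR R)).
Proof. exact: measurable_itv. Qed.
Let mD : measurable D := measurable_timespace T.
Let au : admissible Pr T x0 W u.
Proof. exact: (closed_loop_admissible T0 hW hWindep hx0meas hx0W hx0L2 cP cK cs cf nM iM nx xE). Qed.
Let su : is_state Pr T A B G f sigma x0 W u x.
Proof. exact: (closed_loop_is_state iM nx xE). Qed.
Let Lx i : vL2 Pr T (fun p => x i p.1 p.2).
Proof. exact: (closed_loop_vL2 T0 hW hWindep hx0meas hx0W hx0L2 cP cK cs cf nM iM nx xE). Qed.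
Let LM i : vL2 Pr T (fun p => M i p.1 p.2).
Proof. exact: (noise_vL2 T0 hW hWindep hx0meas hx0W nM iM). Qed.

Section Comparison.
Variables (u' : 'I_N -> R -> Omega -> 'cV[R]_r) (x' : 'I_N -> R -> Omega -> 'cV[R]_n).
Hypothesis au' : admissible Pr T x0 W u'.
Hypothesis su' : is_state Pr T A B G f sigma x0 W u' x'.

Let delta i (p : TO) : 'cV[R]_n := x' i p.1 p.2 - x i p.1 p.2.
Let v i (p : TO) : 'cV[R]_r := u' i p.1 p.2 - u i p.1 p.2.
Let b := difference_drift A B G delta v.
Let Mp i (p : TO) := M i p.1 p.2.
Let Xp i (p : TO) := x i p.1 p.2.

Let Ldelta i : vL2 Pr T (delta i).
Proof. exact: (state_difference_L2 T0 hW hWindep hx0meas hx0W hsigma cf au su au' su'). Qed.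
Let Lv i : vL2 Pr T (v i).
Proof. by apply: vL2_D; [exact: admissible_vL2 au'|apply: vL2_N; exact: admissible_vL2 au]. Qed.
Let Lb i : vL2 Pr T (b i).
Proof. exact: difference_drift_vL2. Qed.

Let delta_path : {ae Pr, forall w, forall i t, 0 <= t <= T ->
  delta i (t, w) = \col_k (\int[mu]_(s in `[0, t]) b i (s, w) k 0)}.
Proof.
have := state_difference T0 hW hWindep hx0meas hx0W hsigma cf au su au' su'.
by apply: filterS => w [_ _].
Qed.

Let Fv i t : 0 <= t <= T -> vmeas (Ft t) (fun w => v i (t, w)).
Proof.
move=> tT; have sF : sigma_algebra setT (Ft t) by exact: sigma_algebra_gen.
have /L2_adaptedP[Fu _] := au i; have /L2_adaptedP[Fu' _] := au' i.
by apply: vmeas_D => //; [exact: Fu'|apply: vmeas_N => //; exact: Fu].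
Qed.

(** Integrability is included because [fine] sends an infinite integral to 0 as well. *)
Definition null_integral (g : TO -> R) : Prop :=
  mP.-integrable D (EFin \o g) /\ \int[mP]_(p in D) g p = 0.

Lemma null_integralD g h : null_integral g -> null_integral h ->
  null_integral (fun p => g p + h p).
Proof.
move=> [ig g0] [ih h0]; split; first exact: (integrable_addr mD).
by rewrite RintegralD// g0 h0 addr0.
Qed.

Lemma null_integralZ c g : null_integral g -> null_integral (fun p => c * g p).
Proof.
move=> [ig g0]; split; first exact: (integrable_scale mD).
by rewrite RintegralZl// g0 mulr0.
Qed.

Lemma null_integral_sum (I : finType) (g : I -> TO -> R) :
  (forall i, null_integral (g i)) -> null_integral (fun p => \sum_i g i p).
Proof.
move=> ng; split; first by apply: (integrable_sumr mD) => i; case: (ng i).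
rewrite (Rintegral_sumr mD); last by move=> i; case: (ng i).
by rewrite big1// => i _; case: (ng i).
Qed.

(** Two indices, because the noise of agent j enters the costate of agent i through the average. *)
Lemma noise_null (w c : R -> 'M[R]_n) i j :
  {within `[0, T], continuous w} -> {within `[0, T], continuous c} ->
  (forall t, 0 < t < T -> mx_is_derive w t (c t)) -> w T = 0 ->
  null_integral (fun p => dot (c p.1 *m Mp j p) (delta i p) + dot (w p.1 *m Mp j p) (b i p)).
Proof.
move=> /within_mxP cw /within_mxP cc dw wT.
rewrite (_ : (fun p => _) = fun p => \sum_k \sum_l
    ((c p.1 k l * delta i p k 0 + w p.1 k l * b i p k 0) * Mp j p l 0)); last first.
  apply/funext => p; rewrite -big_split/=; apply: eq_bigr => k _.
  by rewrite !mxE !mulr_suml -big_split/=; apply: eq_bigr => l _; ring.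
apply: null_integral_sum => k; apply: null_integral_sum => l.
have [mM [phi [c1 c2]]] := iM j.
have Mt t : 0 <= t <= T -> L2 Pr setT (fun w => M j t w l 0).
  by move=> tT; exact: (ito_L2 hW mM c2 l tT).
split.
  apply: (L2_mul mD); last exact: LM.
  apply: (L2D mD).
    by apply: (L2_time_mul (a := fun t => c t k l)) => //; exact: Ldelta.
  by apply: (L2_time_mul (a := fun t => w t k l)) => //; exact: Lb.
have morth := fun s t X s0 st tT => @ito_orthogonal _ _ _ _ _ _ _ _ hW hWindep hx0meas hx0W
  _ _ _ _ mM c2 s t l X s0 st tT.
have Fmono s1 t : s1 <= t -> Ft s1 `<=` Ft t by exact: filtration_mono.
apply: (noise_orthogonal T0 Fmono Ldelta Lv Fv delta_path (m := fun t w => M j t w l 0)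
  (LM j l) Mt morth (w := fun t => w t k l) (c := fun t => c t k l)).
- exact: cw.
- exact: cc.
- by move=> t tT; exact: dw.
- by rewrite wT mxE.
Qed.

Let e (t : R) := expR (- rho * t).
Let disc k (F : R -> 'M[R]_(n, k)) (t : R) : 'M[R]_(n, k) := e t *: F t.
Let P1 t := P_rhs rho A B Q Rc (P t).
Let K1 t := K_rhs rho A B G Gamma Q Rc (P t) (K t).
Let s1 t := s_rhs rho A B G Gamma Q Rc eta (P t + K t) (s t) (f t).
Let ddisc k (F F1 : R -> 'M[R]_(n, k)) (t : R) : 'M[R]_(n, k) :=
  e t *: (F1 t - rho *: F t).

Let cS (F : R -> 'M[R]_n) (H : R -> 'M[R]_n) : {within `[0, T], continuous F} ->
  {within `[0, T], continuous H} ->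
  {within `[0, T], continuous (fun t => F t *m (B *m invmx Rc *m B^T) *m H t)}.
Proof.
by move=> cF cH; apply: within_mulmx => //; apply: within_mulmx => //; exact: within_cst.
Qed.

Let cl k (C : 'M[R]_n) (F : R -> 'M[R]_(n, k)) : {within `[0, T], continuous F} ->
  {within `[0, T], continuous (fun t => C *m F t)}.
Proof. by move=> cF; apply: within_mulmx => //; exact: within_cst. Qed.

Let cr (C : 'M[R]_n) (F : R -> 'M[R]_n) : {within `[0, T], continuous F} ->
  {within `[0, T], continuous (fun t => F t *m C)}.
Proof. by move=> cF; apply: within_mulmx => //; exact: within_cst. Qed.

Let cz k (c : R) (F : R -> 'M[R]_(n, k)) : {within `[0, T], continuous F} ->
  {within `[0, T], continuous (fun t => c *: F t)}.
Proof. by move=> cF; apply: within_Z => //; exact: within_cst. Qed.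

Let cP1 : {within `[0, T], continuous P1}.
Proof.
apply: within_D; last by apply: within_N; exact: within_cst.
apply: within_D; last exact: cS.
by apply: within_D; [apply: within_D; [exact: cz|apply: within_N; exact: cl]|apply: within_N; exact: cr].
Qed.

Let cK1 : {within `[0, T], continuous K1}.
Proof.
apply: within_D; last exact: within_cst.
apply: within_D; last exact: cS.
apply: within_D; last by apply: within_N; exact: cr.
apply: within_D; last by apply: within_N; exact: cl.
apply: within_D; last exact: cS.
apply: within_D; last exact: cS.
by apply: within_D; [apply: within_D; [exact: cz|apply: within_N; exact: cl]|apply: within_N; exact: cr].
Qed.

Let cs1 : {within `[0, T], continuous s1}.
Proof.
have cPK : {within `[0, T], continuous (fun t => P t + K t)} by exact: within_D.
apply: within_D; last exact: within_cst.
apply: within_D; last by apply: within_N; exact: within_mulmx.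
apply: within_D; first exact: cz.
apply: within_N; apply: within_mulmx; [apply: within_trmx|exact: cs].
apply: within_D; first exact: within_cst.
by apply: within_N; exact: cl.
Qed.

Let cdisc k (F : R -> 'M[R]_(n, k)) : {within `[0, T], continuous F} ->
  {within `[0, T], continuous (disc F)}.
Proof. by move=> cF; apply: within_Z => //; exact: within_expR. Qed.

Let cddisc k (F F1 : R -> 'M[R]_(n, k)) : {within `[0, T], continuous F} ->
  {within `[0, T], continuous F1} -> {within `[0, T], continuous (ddisc F F1)}.
Proof.
move=> cF cF1; apply: within_Z; first exact: within_expR.
by apply: within_D => //; apply: within_N; exact: cz.
Qed.

Let d_disc k (F F1 : R -> 'M[R]_(n, k)) t : mx_is_derive F t (F1 t) ->
  mx_is_derive (disc F) t (ddisc F F1 t).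
Proof.
move=> dF; apply: mx_is_derive_eq (mx_is_derive_expZ (- rho) dF) _.
by apply/matrixP => i j; rewrite /ddisc /e !mxE; ring.
Qed.

Let PsiM (p : TO) : R := \sum_i (
  dot (ddisc P P1 p.1 *m Mp i p + ddisc K K1 p.1 *m avg (Mp ^~ p)) (delta i p) +
  dot (disc P p.1 *m Mp i p + disc K p.1 *m avg (Mp ^~ p)) (b i p)).

Lemma noise_variation : null_integral PsiM.
Proof.
apply: null_integral_sum => i.
have dPe t : 0 < t < T -> mx_is_derive (disc P) t (ddisc P P1 t).
  by move=> tT; apply: d_disc; exact: dP.
have dKe t : 0 < t < T -> mx_is_derive (disc K) t (ddisc K K1 t).
  by move=> tT; apply: d_disc; exact: dK.
have PeT : disc P T = 0 by rewrite /disc PT scaler0.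
have KeT : disc K T = 0 by rewrite /disc KT scaler0.
have h1 := noise_null i i (cdisc cP) (cddisc cP cP1) dPe PeT.
have h2 j := noise_null i j (cdisc cK) (cddisc cK cK1) dKe KeT.
have := null_integralD h1 (null_integralZ N%:R^-1 (null_integral_sum h2)).
rewrite /null_integral; set g1 := (fun p => _ + _); set g2 := (fun p => _ + _).
suff -> : g1 = g2 by [].
apply/funext => p; rewrite /g1 /g2 !dotDl.
have E (C : 'M[R]_n) (z : 'cV[R]_n) : dot (C *m avg (Mp ^~ p)) z =
    N%:R^-1 * \sum_j dot (C *m Mp j p) z.
  by rewrite /avg -scalemxAr dotZl mulmx_sumr dot_suml.
by rewrite !E big_split/=; ring.
Qed.

(* The costate P x + K x^(N) + s of x = Y + M splits into a part that is
   differentiable in time and a part linear in the noise M. *)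
Let aX i (p : TO) := drift A B G f u x i p.1 p.2.
Let Y i (p : TO) := Xp i p - Mp i p.
Let wY i (p : TO) := disc P p.1 *m Y i p + disc K p.1 *m avg (Y ^~ p) + disc s p.1.
Let cY i (p : TO) := (ddisc P P1 p.1 *m Y i p + disc P p.1 *m aX i p) +
  (ddisc K K1 p.1 *m avg (Y ^~ p) + disc K p.1 *m avg (aX ^~ p)) + ddisc s s1 p.1.
Let PsiY (p : TO) : R := \sum_i (dot (cY i p) (delta i p) + dot (wY i p) (b i p)).

Lemma smooth_variation : {ae Pr, forall w, \int[mu]_(t in `[0, T]) PsiY (t, w) = 0}.
Proof.
have ib : {ae Pr, forall w, forall i, vint T (fun t => b i (t, w))}.
  apply: filter_forall => i; apply: filter_forall => l.
  by have := L2_path (Lb i l); apply: filterS.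
have [_ _ cM] := nM; have [_ _ cx] := nx.
have FF := ae_filter_ringOfSetsType Pr.
have I2 := fun U V => @filterI _ _ FF U V.
apply: (@filterS _ _ FF _ _ _ (I2 _ _ xE (I2 _ _ cM (I2 _ _ cx (I2 _ _ delta_path ib))))) => w [xw [cMw [cxw [dw ibw]]]].
(* Defined as an integral of the drift, [y] is differentiable inside the interval; on [0, T] it
   equals the state without its noise. *)
pose a i t := aX i (t, w); pose y i t : 'cV[R]_n := x0 i w + \col_k (\int[mu]_(v in `[0, t]) a i v k 0).
have cav : {within `[0, T], continuous (fun t => average x t w)}.
  exact: (within_avg (m := fun i t => x i t w)).
have ca i : {within `[0, T], continuous (a i)}.
  rewrite /a /aX /drift /u /feedback /=; apply: within_D; last exact: cf.
  apply: within_D; last by apply: cl.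
  apply: within_D; first by apply: cl.
  apply: within_mulmx; first exact: within_cst.
  apply: within_N; apply: within_mulmx; first exact: within_cst.
  apply: within_D; last exact: cs.
  by apply: within_D; apply: within_mulmx; [exact: cP|exact: cxw|exact: cK|exact: cav].
have cy i : {within `[0, T], continuous (y i)}.
  apply: within_D; first exact: within_cst.
  by have [] := within_primitive_mx T0' (ca i).
have dy i t : 0 < t < T -> mx_is_derive (y i) t (a i t).
  move=> tT; rewrite -[a i t]add0r; apply: mx_is_deriveD; first exact: mx_is_derive_cst.
  by have [_] := within_primitive_mx T0' (ca i); exact.
have yE i t : 0 <= t <= T -> Y i (t, w) = y i t.
  by move=> tT; rewrite /Y /Xp /Mp /= xw// addrK.
have YE t : 0 <= t <= T -> avg (Y ^~ (t, w)) = avg (y ^~ t).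
  by move=> tT; congr (_ *: _); apply: eq_bigr => i _; exact: yE.
pose w1 i t := disc P t *m y i t + disc K t *m avg (y ^~ t) + disc s t.
pose c1 i t := (ddisc P P1 t *m y i t + disc P t *m a i t) +
  (ddisc K K1 t *m avg (y ^~ t) + disc K t *m avg (a ^~ t)) + ddisc s s1 t.
rewrite -[RHS](@costate_parts _ _ T0' _ _ w1 c1 (fun i t => b i (t, w))).
- apply: eq_Rintegral => t; rewrite inE/= in_itv/= => tT; apply: eq_bigr => i _.
  by rewrite /cY /wY /= yE// YE// dw.
- move=> i; apply: within_D; last exact: cdisc.
  apply: within_D; apply: within_mulmx; [exact: cdisc|exact: cy|exact: cdisc|].
  exact: within_avg.
- move=> i; apply: within_D; last exact: cddisc.
  apply: within_D; apply: within_D; apply: within_mulmx.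
  + exact: cddisc.
  + exact: cy.
  + exact: cdisc.
  + exact: ca.
  + exact: cddisc.
  + exact: within_avg.
  + exact: cdisc.
  + exact: within_avg.
- move=> i t tT; apply: mx_is_deriveD; last by apply: d_disc; exact: ds.
  apply: mx_is_deriveD; apply: mx_is_deriveM.
  + by apply: d_disc; exact: dP.
  + exact: dy.
  + by apply: d_disc; exact: dK.
  + by apply: mx_is_derive_avg => j; exact: dy.
- by move=> i; rewrite /w1 /disc PT KT sT !scaler0 !mul0mx !addr0.
- exact: ibw.
Qed.

Let PsiA (p : TO) : R := e p.1 * \sum_i (
  dot (Q *m (x i p.1 p.2 - Gamma *m average x p.1 p.2 - eta))
    (delta i p - Gamma *m avg (delta ^~ p)) +
  dot (Rc *m u i p.1 p.2) (v i p)).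

Lemma variation_split p : p.1 <= T -> PsiA p = - (PsiY p + PsiM p).
Proof.
move=> tT.
have := first_variation_algebra rho hN A B G Gamma Q eta sR (pos_def_unitmx pR) (s p.1) (f p.1)
  (sPi tT) (Xp ^~ p) (delta ^~ p) (v ^~ p).
rewrite /PsiA => ->; rewrite mulrN; congr (- _).
rewrite /PsiY /PsiM -big_split mulr_sumr; apply: eq_bigr => i _ /=.
rewrite [RHS]addrACA -!dotDl mulrDr -!dotZl.
have aY : avg (Y ^~ p) = avg (Xp ^~ p) - avg (Mp ^~ p) by rewrite /Y avg_D avg_N.
have E1 : e p.1 *: adjoint_rhs rho A B G Gamma Q Rc eta (P p.1) (K p.1) (s p.1) (f p.1) (Xp ^~ p) i =
    cY i p + (ddisc P P1 p.1 *m Mp i p + ddisc K K1 p.1 *m avg (Mp ^~ p)).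
  rewrite (_ : adjoint_rhs _ _ _ _ _ _ _ _ _ _ _ _ _ _ =
    P1 p.1 *m Xp i p + P p.1 *m aX i p +
    (K1 p.1 *m avg (Xp ^~ p) + K p.1 *m avg (aX ^~ p)) + s1 p.1 -
    rho *: (P p.1 *m Xp i p + K p.1 *m avg (Xp ^~ p) + s p.1)) //.
  rewrite /cY aY /ddisc /disc /Y.
  move: (P1 p.1) (K1 p.1) (s1 p.1) (e p.1) (P p.1) (K p.1) (s p.1) => P1' K1' s1' e' P' K' s'.
  move: (aX i p) (avg (aX ^~ p)) (avg (Xp ^~ p)) (Xp i p) (avg (Mp ^~ p)) (Mp i p) => a1 a2 a3 a4 a5 a6.
  rewrite !(mulmxDl, mulmxDr, mulmxN, mulNmx, =^~scalemxAl, scalerDr, scalerN).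
  mx_abel.
have E2 : e p.1 *: (P p.1 *m Xp i p + K p.1 *m avg (Xp ^~ p) + s p.1) =
    wY i p + (disc P p.1 *m Mp i p + disc K p.1 *m avg (Mp ^~ p)).
  rewrite /wY aY /disc /Y.
  move: (e p.1) (P p.1) (K p.1) (s p.1) => e' P' K' s'.
  move: (avg (Xp ^~ p)) (Xp i p) (avg (Mp ^~ p)) (Mp i p) => a3 a4 a5 a6.
  rewrite !(mulmxDl, mulmxDr, mulmxN, mulNmx, =^~scalemxAl, scalerDr, scalerN).
  mx_abel.
by rewrite E1 E2.
Qed.

Lemma null_variation : null_integral PsiA.
Proof.
have iA : mP.-integrable D (EFin \o PsiA).
  rewrite (_ : PsiA = fun p => \sum_i (
      e p.1 * dot (Q *m (x i p.1 p.2 - Gamma *m average x p.1 p.2 - eta))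
        (delta i p - Gamma *m avg (delta ^~ p)) +
      e p.1 * dot (Rc *m u i p.1 p.2) (v i p))); last first.
    by apply/funext => p; rewrite /PsiA mulr_sumr; apply: eq_bigr => i _; rewrite mulrDr.
  apply: (integrable_sumr mD) => i; apply: (integrable_addr mD).
    apply: vL2_dot_discount; first by apply: vL2_mulmx; exact: vL2_tracking.
    by apply: vL2_D => //; apply: vL2_N; apply: vL2_mulmx; exact: vL2_avg.
  by apply: vL2_dot_discount => //; apply: vL2_mulmx; exact: admissible_vL2 au.
have [iM0 M0] := noise_variation.
have split p : p \in D -> PsiA p = - (PsiY p + PsiM p).
  by rewrite inE => -[/=]; rewrite in_itv/= => /andP[_ tT] _; exact: variation_split.
(* Integrability is inferred from that of the two other terms of the splitting; it is what allows
   Fubini to turn the pathwise identity into one for the whole integral. *)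
have iY : mP.-integrable D (EFin \o PsiY).
  apply: (eq_integrable mD (EFin \o (fun p => - 1 * PsiA p + - 1 * PsiM p))).
    by move=> p pD /=; rewrite split//; congr EFin; ring.
  by apply: (integrable_addr mD); exact: (integrable_scale mD).
have Y0 : \int[mP]_(p in D) PsiY p = 0.
  have [_ [_ iw -> _ _]] := timespace_fubini iY.
  rewrite (@Rintegral_ae_eq _ _ _ Pr setT _ (fun=> 0)) ?Rintegral_cst ?mul0r//.
    by case/integrableP : iw => /measurable_EFinP.
  by have := smooth_variation; apply: filterS.
split => //; rewrite (@eq_Rintegral _ _ _ mP D (fun p => - 1 * (PsiY p + PsiM p))).
  by rewrite RintegralZl ?(integrable_addr mD)// RintegralD// Y0 M0 addr0 mulr0.
by move=> p pD; rewrite split// mulN1r.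
Qed.

Let Lu i : vL2 Pr T (fun p => u i p.1 p.2).
Proof. exact: admissible_vL2 au. Qed.
Let Lu' i : vL2 Pr T (fun p => u' i p.1 p.2).
Proof. exact: admissible_vL2 au'. Qed.
Let Lx' i : vL2 Pr T (fun p => x' i p.1 p.2).
Proof.
rewrite (_ : (fun p => _) = fun p => x i p.1 p.2 + delta i p); first exact: vL2_D.
by apply/funext => p; rewrite /delta subrKC.
Qed.

Lemma closed_loop_cost_le : (social_cost Pr T rho Gamma Q Rc eta x u <=
  social_cost Pr T rho Gamma Q Rc eta x' u')%E.
Proof.
have pR' := pos_def_psd pR.
rewrite !social_costE// lee_fin; have [iA A0] := null_variation.
have irx : mP.-integrable D (EFin \o (fun p => \sum_i cost_rate rho Gamma Q Rc eta x u i p)).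
  by apply: (integrable_sumr mD) => i; exact: cost_rate_integrable.
have irx' : mP.-integrable D (EFin \o (fun p => \sum_i cost_rate rho Gamma Q Rc eta x' u' i p)).
  by apply: (integrable_sumr mD) => i; exact: cost_rate_integrable.
have i2 := integrable_scale mD 2 iA.
(* Adding 2 [PsiA], whose integral is 0, supplies the linear terms of the tangent inequality, so
   that the costs can be compared pointwise. *)
have <- : \int[mP]_(p in D) (\sum_i cost_rate rho Gamma Q Rc eta x u i p + 2 * PsiA p) =
    \int[mP]_(p in D) \sum_i cost_rate rho Gamma Q Rc eta x u i p.
  by rewrite RintegralD// RintegralZl// A0 mulr0 addr0.
apply: le_Rintegral => //; first exact: (integrable_addr mD).
move=> p _ /=; rewrite /PsiA mulrCA mulr_sumr mulr_sumr -big_split; apply: ler_sum => i _ /=.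
rewrite /cost_rate -mulrDr ler_pM2l ?expR_gt0//.
rewrite mulrDr addrACA; apply: lerD.
  set a := x i _ _ - _ - _.
  have -> : x' i p.1 p.2 - Gamma *m average x' p.1 p.2 - eta =
      a + (delta i p - Gamma *m avg (delta ^~ p)).
    rewrite /delta -avgB mulmxBr /a.
    rewrite -[average x p.1 p.2]/(avg (fun i => x i p.1 p.2)).
    rewrite -[average x' p.1 p.2]/(avg (fun i => x' i p.1 p.2)).
    move: (avg _) (avg _) (x i _ _) (x' i _ _) => c1 c2 c3 c4; mx_abel.
  exact: quad_tangent.
have -> : u' i p.1 p.2 = u i p.1 p.2 + v i p by rewrite /v subrKC.
exact: quad_tangent.
Qed.

End Comparison.

(** Optimality is stated for every state of the feedback control, and these states agree only up to
    a null set. *)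
Lemma social_cost_unique x' : is_state Pr T A B G f sigma x0 W u x' ->
  social_cost Pr T rho Gamma Q Rc eta x' u = social_cost Pr T rho Gamma Q Rc eta x u.
Proof.
move=> sx'; have pR' := pos_def_psd pR; have xx := state_unique T0 hW hWindep hx0meas hx0W hsigma cf au su sx'.
have Lu i : vL2 Pr T (fun p => u i p.1 p.2) by exact: admissible_vL2 au.
have Lx' i : vL2 Pr T (fun p => x' i p.1 p.2).
  have Ld := state_difference_L2 T0 hW hWindep hx0meas hx0W hsigma cf au su au sx' i.
  rewrite (_ : (fun p => _) = fun p => x i p.1 p.2 + (x' i p.1 p.2 - x i p.1 p.2)).
    exact: vL2_D.
  by apply/funext => p; rewrite subrKC.
suff E : \int[mP]_(p in D) \sum_i cost_rate rho Gamma Q Rc eta x' u i p =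
    \int[mP]_(p in D) \sum_i cost_rate rho Gamma Q Rc eta x u i p.
  rewrite (social_costE rho Gamma eta Lx' Lu pQ pR') (social_costE rho Gamma eta Lx Lu pQ pR').
  by rewrite E.
have iS y : (forall i, vL2 Pr T (fun p => y i p.1 p.2)) ->
    mP.-integrable D (EFin \o (fun p => \sum_i cost_rate rho Gamma Q Rc eta y u i p)).
  by move=> Ly; apply: (integrable_sumr mD) => i; exact: cost_rate_integrable.
have [_ [_ i1 -> _ _]] := timespace_fubini (iS _ Lx').
have [_ [_ i2 -> _ _]] := timespace_fubini (iS _ Lx).
apply: Rintegral_ae_eq => //.
- by case/integrableP : i1 => /measurable_EFinP.
- by case/integrableP : i2 => /measurable_EFinP.
apply: filterS xx => w xw _; apply: eq_Rintegral => t; rewrite inE/= in_itv/= => tT.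
have aw : average x' t w = average x t w.
  by congr (_ *: _); apply: eq_bigr => i _; exact: xw.
by apply: eq_bigr => i _; rewrite /cost_rate /= xw// aw.
Qed.

Lemma closed_loop_optimal :
  optimal_control Pr T rho A B G Gamma Q Rc eta f sigma x0 W u.
Proof.
split; [exact: au|by exists x|].
by move=> x1 u' x' sx1 au' sx'; rewrite (social_cost_unique sx1); exact: closed_loop_cost_le.
Qed.

End Optimality.

Theorem mainTheorem2 (R : realType) (d : measure_display)
    (Omega : measurableType d) (Pr : probability Omega R)
    (n r : nat) (T rho : R)
    (A : 'M[R]_n) (B : 'M[R]_(n, r)) (G Gamma Q : 'M[R]_n) (Rc : 'M[R]_r)
    (eta : 'cV[R]_n) (f sigma : R -> 'cV[R]_n) (xbar0 : 'cV[R]_n) (C0 : R)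
    (N : nat) (x0 : 'I_N -> Omega -> 'cV[R]_n) (W : 'I_N -> R -> Omega -> R)
    (hN : (0 < N)%N)
    (hT : 0 < T) (hrho : 0 < rho)
    (hQsym : sym_mx Q) (hRsym : sym_mx Rc) (hRpos : pos_def Rc)
    (hf : {within `[0, +oo[, continuous f})
    (hsigma : {within `[0, +oo[, continuous sigma})
    (hfsigma : (\int[lebesgue_measure]_(t in `[0%R, +oo[)
       (expR (- rho * t) * (sqnorm (f t) + sqnorm (sigma t)))%:E < +oo)%E)
    (hW : forall i, brownian_motion Pr (W i))
    (hWindep : mutually_independent Pr (fun i => sigma_of `[0, +oo[ (W i)))
    (hx0meas : forall i, measurable_vec (x0 i))
    (hx0indep : mutually_independent Pr (fun i => sigma_vec (x0 i)))
    (hx0mean : forall i k, ('E_Pr[fun w => x0 i w k 0%R] = (xbar0 k 0%R)%:E)%E)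
    (hx0C0 : forall i, ('E_Pr[fun w => sqnorm (x0 i w)] < C0%:E)%E)
    (hx0W : independent2 Pr
       <<s \bigcup_(i in [set: 'I_N]) sigma_vec (x0 i) >>
       <<s \bigcup_(i in [set: 'I_N]) sigma_of `[0, +oo[ (W i) >>)
    (hQ : pos_semidef Q) :
  exists (P K : R -> 'M[R]_n) (s : R -> 'cV[R]_n),
    [/\ riccati_system T rho A B G Gamma Q Rc eta f P K s,
        forall P' K' s',
          riccati_system T rho A B G Gamma Q Rc eta f P' K' s' ->
          forall t : R, 0 <= t <= T -> [/\ P' t = P t, K' t = K t & s' t = s t] &
        exists u x,
          [/\ is_state Pr T A B G f sigma x0 W u x,
              forall i (t : R) w, 0 <= t <= T ->
                u i t w = feedback B Rc P K s x i t w &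
              optimal_control Pr T rho A B G Gamma Q Rc eta f sigma x0 W u]].
Proof.
have [P [K [s [PhiP [PsiP [PhiM [PsiM [sys sPi hPhiP hPhiM]]]]]]]] :=
  riccati_system_exists rho A B G Gamma eta hT hf hQsym hRsym hRpos hQ.
exists P, K, s; split => //; first by move=> P' K' s'; exact: riccati_system_unique.
have sub0 (g : R -> 'cV[R]_n) : {within `[0, +oo[, continuous g} -> {within `[0, T], continuous g}.
  by apply: continuous_subspaceW => t /=; rewrite !in_itv/= => /andP[->].
have hf' := sub0 _ hf; have hsigma' := sub0 _ hsigma.
have hx0L2 i k : L2 Pr setT (fun w => x0 i w k 0).
  split; first exact: hx0meas.
  have := hx0C0 i; rewrite unlock => H; apply: le_lt_trans (lt_trans H (ltry _)).
  apply: ge0_le_integral => //.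
  - by move=> w _; rewrite lee_fin sqr_ge0.
  - by apply/measurable_EFinP; apply: measurable_funX; exact: hx0meas.
  - apply/measurable_EFinP; apply: measurable_sum => j; apply: measurable_funX; exact: hx0meas.
  - by move=> w _; rewrite lee_fin sqr_le_sqnorm.
have [/P_equationP[cP PT dP] /K_equationP[cK KT dK] /s_equationP[cs sT ds]] := sys.
have [M [nM iM]] := noises_exist hT hW hWindep hx0meas hx0W hsigma'.
have [x [nx xE]] := closed_loop_exists hN hT hW hx0meas cP cK cs hf' hPhiP hPhiM nM.
exists (feedback B Rc P K s x), x; split; [exact: closed_loop_is_state iM nx xE|by []|].
exact: (closed_loop_optimal hN hT hQsym hQ hRsym hRpos hW hWindep hx0meas hx0W hx0L2 hsigma'
  hf' cP cK cs PT KT sT dP dK ds sPi nM iM nx xE).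
Qed.
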